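(* Let $U\subset\mathbb R^n$ be an open neighborhood of the origin and let $f:U\to\mathbb R$ be a $C^\infty$ function with $f(0)=0$, $\nabla f(0)=0$ and $\Gamma_+(f)\neq\emptyset$, which belongs to $\hat{\mathcal E}(U)$ and is nondegenerate over $\mathbb R$ with respect to $\Gamma_+(f)$. Then there is a neighborhood $V$ of the origin such that for every $C^\infty$ function $\varphi:\mathbb R^n\to\mathbb C$ with support contained in $V$, the oscillatory integral $I(t;\varphi)=\int_{\mathbb R^n}e^{itf(x)}\varphi(x)\,dx$ admits an asymptotic expansion, as $t\to+\infty$, of the form $$I(t;\varphi)\sim\sum_{\alpha}\sum_{k=1}^{n}C_{\alpha k}(\varphi)\,t^{\alpha}(\log t)^{k-1},$$ where the exponents $\alpha$ (which do not depend on $\varphi$) all belong to the set $$\Big\{-\frac{\langle a\rangle+\nu}{l(a)}:\ \nu\in\mathbb Z_+,\ a\in\Sigma^{(1)},\ l(a)>0\Big\}\cup(-\mathbb N).$$ In particular the exponents belong to the same set as for the phase $f_*$ (the principal part of $f$), since $\Gamma_+(f)=\Gamma_+(f_* )$.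
   Context: Notation: $\mathbb Z_+,\mathbb R_+$ denote nonnegative integers/reals; $\langle a,x\rangle$ is the standard inner product, and for $a\in\mathbb R^n$, $\langle a\rangle=a_1+\dots+a_n$. For $(a,l)\in\mathbb R^n\times\mathbb R$, $H(a,l)=\{x:\langle a,x\rangle=l\}$, $H^+(a,l)=\{x:\langle a,x\rangle\ge l\}$. A polyhedron is a finite intersection of sets $H^+(a,l)$ with $(a,l)\in\mathbb Z^n\times\mathbb Z$. A pair $(a,l)\in\mathbb Z^n\times\mathbb Z$ is valid for a polyhedron $P$ if $P\subset H^+(a,l)$; a face of $P$ is a set $P\cap H(a,l)$ with $(a,l)$ valid, and $(a,l)$ is said to define the face $\gamma$ if $P\cap H(a,l)=\gamma$. Newton polyhedron: for a $C^\infty$ function $f$ near $0$ with Taylor series $\sum_\alpha c_\alpha x^\alpha$, $\Gamma_+(f)$ is the convex hull of $\bigcup\{\alpha+\mathbb R_+^n: c_\alpha\ne0\}$. The principal part is $f_*=\sum_{\alpha\in\Gamma(f)\cap\mathbb Z_+^n}c_\alpha x^\alpha$, where $\Gamma(f)$ is the union of compact faces of $\Gamma_+(f)$. $\gamma$-part and classes: let $P\subset\mathbb R_+^n$ be a polyhedron with $P+\mathbb R_+^n\subset P$, $f\in C^\infty(U)$ with $\Gamma_+(f)\subset P$, and $\gamma$ a face of $P$. $f$ admits the $\gamma$-part on $U$ if for every $x\in U$ the limit $\lim_{t\to0^+}f(t^{a_1}x_1,\dots,t^{a_n}x_n)/t^l$ exists for all valid pairs $(a,l)\in\mathbb Z_+^n\times\mathbb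 Z_+$ defining $\gamma$; the (common) value is $f_\gamma(x)$. $\hat{\mathcal E}[P](U)$ ($P\ne\emptyset$) is the set of $f\in C^\infty(U)$ with $\Gamma_+(f)\subset P$ admitting the $\gamma$-part on $U$ for every face $\gamma$ of $P$; $\hat{\mathcal E}(U)=\{f\in C^\infty(U): f\in\hat{\mathcal E}[\Gamma_+(f)](U)\}$. Nondegeneracy: $f$ is nondegenerate over $\mathbb R$ with respect to $\Gamma_+(f)$ if for every compact face $\gamma$ of $\Gamma_+(f)$, the polynomial $f_\gamma=\sum_{\alpha\in\gamma}c_\alpha x^\alpha$ satisfies $\nabla f_\gamma\neq0$ on $U\cap(\mathbb R\setminus\{0\})^n$. Fan: with $P=\Gamma_+(f)$, for $a\in\mathbb R_+^n$ let $l(a)=\min\{\langle a,\alpha\rangle:\alpha\in P\}$. For each face $\gamma$ of $P$ let $\gamma^*=\{a\in\mathbb R_+^n: H(a,l(a))\cap P=\gamma\}$; the closures of the $\gamma^*$ form a fan $\Sigma_0$ with support $\mathbb R_+^n$. Fix a simplicial subdivision $\Sigma$ of $\Sigma_0$: a fan of strongly convex rational polyhedral cones with the same support, each cone contained in a cone of $\Sigma_0$, and such that the primitive integer generators (skeleton) of every cone can be completed to a basis of $\mathbb Z^n$. $\Sigma^{(1)}$ denotes the set of primitive integer generators of the one-dimensional cones of $\Sigma$. *)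

(* Defs.v *)
From HB Require Import structures.
From mathcomp Require Import all_boot all_order all_algebra.
From mathcomp Require Import all_classical all_reals all_analysis.
From mathcomp Require Import complex.

Set Implicit Arguments.
Unset Strict Implicit.
Unset Printing Implicit Defensive.

Import Order.TTheory GRing.Theory Num.Theory.
Import numFieldNormedType.Exports.

Local Open Scope classical_set_scope.
Local Open Scope ring_scope.

Section Defs.
Variables (R : realType) (n : nat).
Implicit Types (x y : 'rV[R]_n) (U A P gam : set 'rV[R]_n).

Definition dotp (a x : 'rV[R]_n) : R := \sum_(i < n) a ord0 i * x ord0 i.
Definition sumz (a : 'rV[int]_n) : int := \sum_(i < n) a ord0 i.
Definition intR (a : 'rV[int]_n) : 'rV[R]_n := \row_i (a ord0 i)%:~R.
Definition natR (a : 'rV[nat]_n) : 'rV[R]_n := \row_i (a ord0 i)%:R.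
Definition evec (j : 'I_n) : 'rV[R]_n := delta_mx 0 j.
Definition orthant : set 'rV[R]_n := [set x | forall i, 0 <= x ord0 i].
Definition hyp (a : 'rV[R]_n) (l : R) := [set x | dotp a x = l].
Definition hyp_plus (a : 'rV[R]_n) (l : R) := [set x | l <= dotp a x].

Definition pd (j : 'I_n) (g : 'rV[R]_n -> R) : 'rV[R]_n -> R :=
  fun x => derive g x (evec j).
Definition iterpd (js : seq 'I_n) (g : 'rV[R]_n -> R) : 'rV[R]_n -> R :=
  foldr pd g js.
Definition smooth_on U (g : 'rV[R]_n -> R) : Prop :=
  forall js : seq 'I_n, forall x, U x ->
    {for x, continuous (iterpd js g)} /\
    forall j, derivable (iterpd js g) x (evec j).
Definition dmulti (al : 'rV[nat]_n) (g : 'rV[R]_n -> R) : 'rV[R]_n -> R :=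
  iterpd (flatten [seq nseq (al ord0 i) i | i <- enum 'I_n]) g.
Definition mfact (al : 'rV[nat]_n) : nat := \prod_(i < n) (al ord0 i)`!.
Definition taylor_coef (g : 'rV[R]_n -> R) (al : 'rV[nat]_n) : R :=
  dmulti al g 0 / (mfact al)%:R.
Definition monom (al : 'rV[nat]_n) (x : 'rV[R]_n) : R :=
  \prod_(i < n) x ord0 i ^+ al ord0 i.

Definition conv_hull A : set 'rV[R]_n :=
  [set x | exists (k : nat) (w : 'I_k -> R) (p : 'I_k -> 'rV[R]_n),
     [/\ forall i, 0 <= w i, \sum_(i < k) w i = 1, forall i, A (p i)
       & x = \sum_(i < k) w i *: p i]].
Definition newton (g : 'rV[R]_n -> R) : set 'rV[R]_n :=
  conv_hull (\bigcup_(al in [set al | taylor_coef g al != 0])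
               [set x | forall i, (al ord0 i)%:R <= x ord0 i]).
Definition valid P (a : 'rV[int]_n) (l : int) : Prop :=
  P `<=` hyp_plus (intR a) l%:~R.
Definition is_face P gam : Prop :=
  exists (a : 'rV[int]_n) (l : int), valid P a l /\ P `&` hyp (intR a) l%:~R = gam.
Definition is_compact_face P gam : Prop :=
  is_face P gam /\ gam !=set0 /\ compact gam.

Definition tscale (a : 'rV[nat]_n) (t : R) x : 'rV[R]_n :=
  \row_i (t ^+ a ord0 i * x ord0 i).
(* g admits the gam-part on U (w.r.t. the polyhedron P): for every x in U and
   every valid pair (a,l) in Z_+^n x Z_+ defining gam, the limit
   lim_{t -> 0+} g(t^a x)/t^l exists (the expression being defined, i.e.
   t^a x in U, for all small t > 0). *)
Definition admits_part P U (g : 'rV[R]_n -> R) gam : Prop :=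
  forall x, U x -> forall (a : 'rV[nat]_n) (l : nat),
    P `<=` hyp_plus (natR a) l%:R -> P `&` hyp (natR a) l%:R = gam ->
    (\forall t \near 0^'+, U (tscale a t x)) /\
    exists v : R, (fun t => g (tscale a t x) / t ^+ l) @ 0^'+ --> v.
Definition hatE_P P U (g : 'rV[R]_n -> R) : Prop :=
  [/\ P !=set0, smooth_on U g, newton g `<=` P &
      forall gam, is_face P gam -> admits_part P U g gam].
Definition hatE U (g : 'rV[R]_n -> R) : Prop := hatE_P (newton g) U g.

Definition gam_part_poly (g : 'rV[R]_n -> R) gam : 'rV[R]_n -> R :=
  fun x => (\sum_(al \in [set al : 'rV[nat]_n | gam (natR al)])
              taylor_coef g al * monom al x)%R.
Definition nondeg_over_R U (g : 'rV[R]_n -> R) : Prop :=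
  forall gam, is_compact_face (newton g) gam ->
    forall x, U x -> (forall i, x ord0 i != 0) ->
      exists j, pd j (gam_part_poly g gam) x != 0.

Definition newton_boundary (g : 'rV[R]_n -> R) : set 'rV[R]_n :=
  \bigcup_(gam in [set gam | is_compact_face (newton g) gam]) gam.
Definition principal_part (g : 'rV[R]_n -> R) : 'rV[R]_n -> R :=
  gam_part_poly g (newton_boundary g).

Definition lmin P (a : 'rV[R]_n) : R := inf [set dotp a al | al in P].
Definition dual_cone P gam : set 'rV[R]_n :=
  [set a | orthant a /\ hyp a (lmin P a) `&` P = gam].
Definition gcone (S : seq 'rV[int]_n) : set 'rV[R]_n :=
  [set x | exists lam : nat -> R, (forall i, 0 <= lam i) /\
     x = \sum_(i < size S) lam i *: intR (nth 0 S i)].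
Definition cone_face (C F : set 'rV[R]_n) : Prop :=
  exists u : 'rV[R]_n, (forall x, C x -> 0 <= dotp u x) /\
    F = C `&` hyp u 0.
(* a fan of strongly convex rational polyhedral cones, each cone given by
   a finite list of integer generators *)
Definition is_fan (Sig : seq (seq 'rV[int]_n)) : Prop :=
  [/\ forall S, S \in Sig -> forall F, cone_face (gcone S) F ->
        exists2 T, T \in Sig & F = gcone T,
      forall S T, S \in Sig -> T \in Sig ->
        cone_face (gcone S) (gcone S `&` gcone T) /\
        cone_face (gcone T) (gcone S `&` gcone T) &
      forall S, S \in Sig ->
        gcone S `&` [set - x | x in gcone S] = [set 0]].
Definition completes_to_basis (S : seq 'rV[int]_n) : Prop :=
  (size S <= n)%N /\
  exists B : 'M[int]_n, B \in unitmx /\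
    forall i : 'I_n, (i < size S)%N -> row i B = nth 0 S i.
(* Sig is a simplicial subdivision of the fan Sigma_0 associated with P,
   with cones given by their skeletons *)
Definition simplicial_subdivision P (Sig : seq (seq 'rV[int]_n)) : Prop :=
  [/\ is_fan Sig,
      \bigcup_(S in [set S | S \in Sig]) gcone S = orthant,
      forall S, S \in Sig -> exists gam, is_face P gam /\
        gcone S `<=` closure (dual_cone P gam) &
      forall S, S \in Sig -> completes_to_basis S].
(* Sigma^(1): primitive generators of the one-dimensional cones *)
Definition skeleton1 (Sig : seq (seq 'rV[int]_n)) : set 'rV[int]_n :=
  [set a | [:: a] \in Sig].
Definition exponent_set P (Sig : seq (seq 'rV[int]_n)) : set R :=
  [set al | (exists (nu : nat) (a : 'rV[int]_n), [/\ skeleton1 Sig a,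
               0 < lmin P (intR a) &
               al = - (((sumz a)%:~R + nu%:R) / lmin P (intR a))])
            \/ (exists m : nat, (0 < m)%N /\ al = - m%:R)].

Fixpoint intn (m : nat) : ('rV[R]_m -> R) -> R :=
  match m return ('rV[R]_m -> R) -> R with
  | 0 => fun g => g 0
  | m'.+1 => fun g => Rintegral lebesgue_measure setT
      (fun s : R => intn (fun y : 'rV[R]_m' =>
         g (\row_(i < m'.+1) match unlift ord0 i with
                             | Some j => y ord0 j | None => s end)))
  end.

End Defs.

Local Open Scope complex_scope.

(* I(t; phi) = int e^{i t f(x)} phi(x) dx, phi : R^n -> C *)
Definition osc_int (R : realType) (n : nat) (f : 'rV[R]_n -> R)
  (phi : 'rV[R]_n -> R[i]) (t : R) : R[i] :=
  (intn (fun x => cos (t * f x) * complex.Re (phi x)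
                  - sin (t * f x) * complex.Im (phi x)))
  +i* (intn (fun x => sin (t * f x) * complex.Re (phi x)
                  + cos (t * f x) * complex.Im (phi x))).

Definition asymp_expansion (R : realType) (n : nat) (I : R -> R[i])
  (A : set R) (C : R -> nat -> R[i]) : Prop :=
  forall N : nat, exists K T : R, forall t : R, T <= t ->
    Normc.normc (I t - (\sum_(al \in A `&` [set al | - N%:R <= al])
        \sum_(1 <= k < n.+1) C al k * (t `^ al * (ln t) ^+ (k.-1))%:C))
    <= K * t `^ (- N%:R).

Definition csupport (R : realType) (n : nat) (phi : 'rV[R]_n -> R[i]) :=
  closure [set x | phi x != 0].

(* Main.v *)
Require Import Defs.
From HB Require Import structures.
From mathcomp Require Import all_boot all_order all_algebra.
From mathcomp Require Import all_classical all_reals all_analysis.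
From mathcomp Require Import measurable_realfun complex ring lra zify.

(** In logarithmic coordinates x_i = ± exp (- u_i) a cone of the subdivision with generators
    a_1, ..., a_n becomes the region where the coordinates s_j of u in the basis (a_j) are
    nonnegative, and x^alpha becomes exp (- <alpha, u>).  Weighted symbol classes replace the toric
    resolution: h has weights nu when h = O(exp (- sum_j nu_j s_j)) on every chart and each operator
    D_{a_j} + nu_j raises the weight at a_j by one.  Admission of the gamma-parts puts the phase F in
    the class of weights l(a); nondegeneracy on the compact faces, by a compactness argument along the
    charts, bounds |grad F|^2 below by the square of its weight.

    Integration by parts against grad F / |grad F|^2 trades a factor t for the loss of the weights l,
    and integration by parts along a generator a shows that
    l(a) t d/dt + <a> + nu_a maps oscillatory integrals of symbols of weights nu to those of symbols
    of weights nu + 1_a.  Starting from a symbol localized near one maximal cone (whose weights away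
    from the generators of that cone are arbitrarily large), finitely many such first order operators
    lead to a remainder O(t^{-M}).  Solving this chain of ordinary differential equations in log t
    gives the expansion; each exponent occurs at most once for each of the n generators, whence at
    most n - 1 logarithms.  Uniqueness of expansions makes the coefficients independent of the
    order. *)

Set Implicit Arguments.
Unset Strict Implicit.
Unset Printing Implicit Defensive.

Import Order.TTheory GRing.Theory Num.Theory.
Import numFieldNormedType.Exports.

Local Open Scope classical_set_scope.
Local Open Scope ring_scope.

(** * Derivatives along lines *)

Section Lines.
Variables (R : realType) (V : normedModType R).
Implicit Types (h : V -> R) (u v : V).

(** The hypothesis on [f] gives only limits along curves, pointwise in x, and [f] need not be
    analytic, so no uniform factorization is available at the start. In the variables y_j = exp (-
    s_j) a symbol of weights nu is y^nu times a function smooth up to y = 0, and Hadamard's lemma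
    turns each pointwise limit into such a factorization. Nondegeneracy concerns compact faces only;
    this suffices because all u_i tend to infinity near the origin, so that the generators escaping
    to infinity have a sum with positive entries, which defines a compact face. The partition of
    unity is not smooth in x, but it is constant along a generator wherever the corresponding
    coordinate is large, and this is all that the symbol estimates see. In the coordinates u
    Lebesgue measure has density exp (- sum u_i), whence the term <a> in the operators. *)

Lemma is_derive_line h u v (r : R) : derivable h (u + r *: v) v ->
  is_derive r 1 (fun r' : R => h (u + r' *: v)) ('D_v h (u + r *: v)).
Proof.
move=> dh.
have E : (fun k : R => k^-1 *: (((fun r' : R => h (u + r' *: v)) \o shift r) (k *: 1)
    - h (u + r *: v))) = (fun k => k^-1 *: ((h \o shift (u + r *: v)) (k *: v)
      - h (u + r *: v))).
  apply/funext => k /=; rewrite [k%:A]mulr1.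
  by do 3 congr (_ _); rewrite scalerDl addrCA.
by split; rewrite /derivable /derive E.
Qed.

Lemma line_MVT h u v (r : R) : 0 <= r ->
  (forall r', 0 <= r' <= r -> derivable h (u + r' *: v) v) ->
  exists2 c, 0 <= c <= r & h (u + r *: v) - h u = 'D_v h (u + c *: v) * r.
Proof.
move=> r0 dh.
have [//| |//|] := @MVT_segment R (fun r' => h (u + r' *: v))
  (fun r' => 'D_v h (u + r' *: v)) 0 r.
- move=> x; rewrite in_itv/= => /andP[x0 xr]; apply: is_derive_line.
  by apply: dh; rewrite !ltW.
- apply: derivable_within_continuous => x; rewrite in_itv/= => xr.
  by have [] := is_derive_line (dh x xr).
- move=> c; rewrite in_itv/= => cr E; exists c => //.
  by move: E; rewrite scale0r addr0 subr0.
Qed.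

End Lines.

Section IsDerive.
Variables (R : realType) (V : normedModType R).
Implicit Types (f g h : V -> R) (x v : V).

(** Rules for functions of one real variable, the chain rule in particular, are transported to
    directional derivatives through this equivalence. *)
Lemma is_derive_lineP h x v b :
  is_derive x v h b <-> is_derive (0 : R) 1 (fun r : R => h (x + r *: v)) b.
Proof.
have E : (fun k : R => k^-1 *: (((fun r' : R => h (x + r' *: v)) \o shift 0) (k *: 1)
    - h (x + 0 *: v))) = (fun k => k^-1 *: ((h \o shift x) (k *: v) - h x)).
  apply/funext => k /=; rewrite [k%:A]mulr1 scale0r !addr0.
  by do 3 congr (_ _); rewrite addrC.
by split=> -[]; rewrite /derivable /derive => A <-; split;
  rewrite /derivable /derive ?E// -E.
Qed.

Lemma isdD f g x v a b : is_derive x v f a -> is_derive x v g b ->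
  is_derive x v (fun y => f y + g y) (a + b).
Proof. by move=> fa gb; exact: is_deriveD. Qed.

Lemma isdN f x v a : is_derive x v f a -> is_derive x v (fun y => - f y) (- a).
Proof. by move=> fa; exact: is_deriveN. Qed.

Lemma isdB f g x v a b : is_derive x v f a -> is_derive x v g b ->
  is_derive x v (fun y => f y - g y) (a - b).
Proof. by move=> fa gb; apply: isdD => //; exact: isdN. Qed.

Lemma isdM f g x v a b : is_derive x v f a -> is_derive x v g b ->
  is_derive x v (fun y => f y * g y) (a * g x + f x * b).
Proof.
move=> [fa <-] [gb <-]; rewrite -[fun y => _]/(f * g).
split. exact: (derivableM fa gb).
rewrite (deriveM fa gb) addrC; congr (_ + _).
exact: mulrC.
Qed.

Lemma isdC c x v : is_derive x v (fun=> c : R) 0.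
Proof. exact: is_derive_cst. Qed.

Lemma isdZ f x v c a : is_derive x v f a -> is_derive x v (fun y => c * f y) (c * a).
Proof.
move=> fa; rewrite (_ : c * a = 0 * f x + c * a); first exact: (isdM (isdC c x v) fa).
by rewrite mul0r add0r.
Qed.

Lemma isdV f x v a : f x != 0 -> is_derive x v f a ->
  is_derive x v (fun y => (f y)^-1) (- a / (f x) ^+ 2).
Proof.
move=> f0 [fa <-]; split; first exact: derivableV.
by rewrite [LHS]deriveV // [_ *: _]mulrC mulrN mulNr.
Qed.

Lemma isd_comp (F : R -> R) h x v a b : is_derive (h x) 1 F a -> is_derive x v h b ->
  is_derive x v (fun y => F (h y)) (a * b).
Proof.
move=> Fa /is_derive_lineP hb; apply/is_derive_lineP.
by apply: (is_derive1_comp (f := F) (g := fun r => h (x + r *: v))); rewrite ?scale0r ?addr0.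
Qed.

Lemma isd_sum (I : eqType) (s : seq I) (f : I -> V -> R) x v (a : I -> R) :
  (forall i, i \in s -> is_derive x v (f i) (a i)) ->
  is_derive x v (fun y => \sum_(i <- s) f i y) (\sum_(i <- s) a i).
Proof.
elim: s => [|i s IH] H.
  rewrite big_nil (_ : (fun _ => _) = fun=> 0); first exact: isdC.
  by apply/funext => y; rewrite big_nil.
rewrite big_cons (_ : (fun _ => _) = fun y => f i y + \sum_(j <- s) f j y); last first.
  by apply/funext => y; rewrite big_cons.
apply: isdD; first by apply: H; rewrite mem_head.
by apply: IH => j js; apply: H; rewrite inE js orbT.
Qed.

End IsDerive.

(** * Estimates for functions of one variable from bounds on the derivative *)

Section OneDim.
Variable R : realType.
Implicit Types (K : R -> R).

Lemma derive_bound_mvt K dK (a b C : R) : a <= b ->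
  (forall r, a <= r <= b -> is_derive r 1 K (dK r)) ->
  (forall r, a <= r <= b -> `|dK r| <= C) -> `|K b - K a| <= C * (b - a).
Proof.
move=> ab dr bd.
have [||c] := @MVT_segment R K dK a b ab.
- by move=> x; rewrite in_itv/= => /andP[x0 xr]; apply: dr; rewrite !ltW.
- apply: derivable_within_continuous => x; rewrite in_itv/= => xr.
  by have [] := dr x xr.
- rewrite in_itv/= => cr ->; rewrite normrM (ger0_norm (_ : 0 <= b - a)) ?subr_ge0//.
  by apply: ler_wpM2r; rewrite ?subr_ge0// bd.
Qed.

Lemma derive_nonneg_le K dK (a b : R) : a <= b ->
  (forall r, a <= r <= b -> is_derive r 1 K (dK r)) ->
  (forall r, a <= r <= b -> 0 <= dK r) -> K a <= K b.
Proof.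
move=> ab dr bd.
have [||c] := @MVT_segment R K dK a b ab.
- by move=> x; rewrite in_itv/= => /andP[x0 xr]; apply: dr; rewrite !ltW.
- apply: derivable_within_continuous => x; rewrite in_itv/= => xr.
  by have [] := dr x xr.
- rewrite in_itv/= => cr E; rewrite -subr_ge0 E mulr_ge0 ?bd// subr_ge0 //.
Qed.

Lemma is_derive_expN (r : R) : is_derive r 1 (fun x => expR (- x)) (- expR (- r)).
Proof.
by rewrite -mulrN1; apply: (isd_comp (F := expR)).
Qed.

Lemma isd_mulc (c r : R) : is_derive r 1 (fun x : R => c * x) c.
Proof. by have H := isdZ c (is_derive_id r 1); exact: (is_derive_eq H (mulr1 c)). Qed.

Lemma is_derive_explin (c r : R) :
  is_derive r 1 (fun x => expR (c * x)) (expR (c * r) * c).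
Proof. by have H := isd_mulc c r; exact: (isd_comp (is_derive_expR (c * r)) H). Qed.

(** The integral of C exp (- s) from 0 is at most [C] whatever the length of the interval; this
    uniformity is what later allows integration to infinity along a generator. *)
Lemma derive_bound_exp K dK (C r : R) : 0 <= r ->
  (forall s, 0 <= s <= r -> is_derive s 1 K (dK s)) ->
  (forall s, 0 <= s <= r -> `|dK s| <= C * expR (- s)) -> `|K r - K 0| <= C.
Proof.
move=> r0 dr bd.
have C0 : 0 <= C.
  have := bd 0; rewrite lexx r0 oppr0 expR0 mulr1 => /(_ isT); exact: le_trans.
(* Both halves of the absolute value come from the monotonicity of [- (e * K s + C * expR (- s))],
   taken at [e] = 1 and [e] = -1. *)
have key (e : R) : `|e| <= 1 -> e * K r + C * expR (- r) <= e * K 0 + C.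
  move=> e1; rewrite -lerN2.
  have {1}-> : C = C * expR (- 0) by rewrite oppr0 expR0 mulr1.
  apply: (derive_nonneg_le (K := fun s => - (e * K s + C * expR (- s)))
    (dK := fun s => - (e * dK s - C * expR (- s)))) => // s sr.
    apply: isdN; rewrite -mulrN.
    by apply: isdD; apply: isdZ; [exact: dr|exact: is_derive_expN].
  rewrite oppr_ge0 subr_le0; apply: le_trans (bd s sr); apply: le_trans (ler_norm _) _.
  by rewrite normrM ler_piMl.
have := key 1; rewrite normr1 lexx !mul1r => /(_ isT) k1.
have := key (-1); rewrite normrN1 lexx !mulN1r => /(_ isT) k2.
have e0 := expR_ge0 (- r).
have : 0 <= C * expR (- r) by rewrite mulr_ge0.
by rewrite ler_norml => ?; apply/andP; split; lra.
Qed.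

End OneDim.

(** * Symmetry of second derivatives *)

Section Schwarz.
Variables (R : realType) (V : normedModType R).
Implicit Types (h : V -> R) (u v w : V).

(** The mean value theorem is used twice: in the direction [v] for the increment along [w], then in
    the direction [w] for the derivative so obtained. *)
Lemma mixed_difference h u v w (r : R) : 0 < r ->
  (forall s t, 0 <= s <= r -> 0 <= t <= r ->
     [/\ derivable h (u + s *: v + t *: w) v & derivable ('D_v h) (u + s *: v + t *: w) w]) ->
  exists s t, [/\ 0 <= s <= r, 0 <= t <= r &
    h (u + r *: v + r *: w) - h (u + r *: v) - (h (u + r *: w) - h u) =
      'D_w ('D_v h) (u + s *: v + t *: w) * r ^+ 2].
Proof.
move=> r0 H.
have r1 : 0 <= r <= r by rewrite lexx ltW.
have z1 : 0 <= (0 : R) <= r by rewrite lexx ltW.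
pose k s := h (u + s *: v + r *: w) - h (u + s *: v).
have [||s] := @MVT_segment R k
    (fun s => 'D_v h (u + s *: v + r *: w) - 'D_v h (u + s *: v)) 0 r (ltW r0).
- move=> s; rewrite in_itv/= => /andP[s0 sr].
  have sr' : 0 <= s <= r by rewrite !ltW.
  apply: isdB; last first.
    by apply: is_derive_line; have [+ _] := H s 0 sr' z1; rewrite scale0r addr0.
  rewrite /= (_ : (fun y => _) = (fun y => h (u + r *: w + y *: v))); last first.
    by apply/funext => y; rewrite addrAC.
  rewrite addrAC; apply: is_derive_line; rewrite addrAC.
  by have [+ _] := H s r sr' r1.
- apply: derivable_within_continuous => s; rewrite in_itv/= => sr.
  apply: derivableB; last first.
    apply: ex_derive; apply: is_derive_line.
    by have [+ _] := H s 0 sr z1; rewrite scale0r addr0.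
  rewrite /= (_ : (fun y => _) = (fun y => h (u + r *: w + y *: v))); last first.
    by apply/funext => y; rewrite addrAC.
  apply: ex_derive; apply: is_derive_line; rewrite addrAC.
  by have [+ _] := H s r sr r1.
- rewrite in_itv/= => sr E.
  have [t' t'r|t tr E'] := @line_MVT R V ('D_v h) (u + s *: v) w r (ltW r0).
    by have [] := H s t' sr t'r.
  exists s, t; split=> //; move: E; rewrite /k !scale0r !addr0 subr0 => ->.
  by rewrite E' expr2 mulrA.
Qed.

(** The mixed difference over a small parallelogram is r^2 times either mixed derivative at some
    point of it; dividing by r^2 and using continuity at [u] identifies the two. *)
Lemma schwarz (O : set V) h v w u : open O -> O u ->
  (forall x, O x -> [/\ derivable h x v, derivable h x w,
     derivable ('D_v h) x w & derivable ('D_w h) x v]) ->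
  {for u, continuous ('D_w ('D_v h))} -> {for u, continuous ('D_v ('D_w h))} ->
  'D_w ('D_v h) u = 'D_v ('D_w h) u.
Proof.
move=> oO Ou H c1 c2.
have sw (a b c d : R) : a - b - (c - d) = a - c - (b - d) by ring.
apply/eqP; rewrite -subr_eq0 -normr_le0; apply/ler_addgt0Pr => e e0.
rewrite add0r.
have e2 : 0 < e / 2 by rewrite divr_gt0.
have := open_nbhs_nbhs (conj oO Ou) => /nbhs_ballP[d0 d0p b0].
move/cvgrPdist_le : (c1) => /(_ _ e2) /nbhs_ballP[d1 d1p b1].
move/cvgrPdist_le : (c2) => /(_ _ e2) /nbhs_ballP[d2 d2p b2].
pose d := Num.min d0 (Num.min d1 d2).
have dp : 0 < d by rewrite !lt_min; apply/and3P; split.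
(* [M] dominates the sum of both directions, so the whole parallelogram of side [r] stays in the
   ball of radius [d]. *)
pose M := `|v| + `|w| + 1.
have Mp : 0 < M by rewrite ltr_wpDl// addr_ge0.
pose r := d / 2 / M.
have rp : 0 < r by rewrite !divr_gt0.
have near s t : 0 <= s <= r -> 0 <= t <= r -> ball u d (u + s *: v + t *: w).
  move=> /andP[s0 sr] /andP[t0 tr]; rewrite -ball_normE/= -addrA opprD addrA subrr sub0r normrN.
  apply: le_lt_trans (ler_normD _ _) _; rewrite !normrZ !ger0_norm//.
  apply: (@le_lt_trans _ _ (r * M)).
    rewrite /M !mulrDr -addrA; apply: lerD; first exact: ler_wpM2r.
    by apply: ler_wpDr; [rewrite mulr1 ltW|exact: ler_wpM2r].
  by rewrite /r divfK ?gt_eqF// ltr_pdivrMr// ltr_pMr// ltr1n.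
have mono x dd : d <= dd -> ball u d x -> ball u dd x by move=> ?; apply: le_ball.
have d0' : d <= d0 by rewrite ge_min lexx.
have d1' : d <= d1 by rewrite !ge_min lexx !orbT.
have d2' : d <= d2 by rewrite !ge_min lexx !orbT.
have [|s1 [t1 [s1r t1r E1]]] := @mixed_difference h u v w r rp.
  move=> s t sr tr; have [] := H (u + s *: v + t *: w) => //.
  by apply: b0; apply: mono (near _ _ sr tr).
have [|s2 [t2 [s2r t2r E2]]] := @mixed_difference h u w v r rp.
  move=> s t sr tr; have [] := H (u + s *: w + t *: v) => //.
  by apply: b0; apply: mono d0' _; rewrite addrAC; apply: near.
have EE : 'D_w ('D_v h) (u + s1 *: v + t1 *: w) = 'D_v ('D_w h) (u + s2 *: w + t2 *: v).
  apply: (@mulIf _ (r ^+ 2)); first by rewrite expf_neq0// gt_eqF.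
  rewrite (addrAC u (r *: w) (r *: v)) in E2.
  exact: (etrans (esym E1) (etrans (sw _ _ _ _) E2)).
have B1 := b1 _ (mono _ _ d1' (near _ _ s1r t1r)).
have B2 : `|'D_v ('D_w h) u - 'D_v ('D_w h) (u + s2 *: w + t2 *: v)| <= e / 2.
  by apply: b2; apply: mono d2' _; rewrite addrAC; apply: near.
rewrite /= in B1; rewrite EE in B1.
rewrite -(subrKA ('D_v ('D_w h) (u + s2 *: w + t2 *: v))).
apply: le_trans (ler_normD _ _) _; rewrite [leRHS](splitr e); apply: lerD; first exact: B1.
rewrite distrC in B2. exact: B2.
Qed.

End Schwarz.

(** * Continuous partial derivatives imply differentiability *)

Section C1.
Variables (R : realType) (n : nat).
Implicit Types (h : 'rV[R]_n -> R) (u v w c : 'rV[R]_n).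

Lemma line_MVT_signed (V : normedModType R) (h : V -> R) (u v : V) (r : R) :
  (forall r', `|r'| <= `|r| -> derivable h (u + r' *: v) v) ->
  exists2 c, `|c| <= `|r| & h (u + r *: v) - h u = 'D_v h (u + c *: v) * r.
Proof.
move=> dh; have [r0|r0] := leP 0 r.
  have [r' /andP[a b]|c /andP[a b] E] := @line_MVT R V h u v r r0.
    by apply: dh; rewrite !ger0_norm.
  by exists c => //; rewrite !ger0_norm.
pose k r' := h (u + r' *: v).
have inr x : r <= x <= 0 -> `|x| <= `|r|.
  by move=> /andP[a b]; rewrite !ler0_norm// ?lerN2// ltW.
have [||x] := @MVT_segment R k (fun s => 'D_v h (u + s *: v)) r 0 (ltW r0).
- move=> s; rewrite in_itv/= => /andP[s0 sr]; apply: is_derive_line.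
  by apply: dh; apply: inr; rewrite !ltW.
- apply: derivable_within_continuous => s; rewrite in_itv/= => sr.
  by apply: ex_derive; apply: is_derive_line; apply: dh; apply: inr.
- rewrite in_itv/= => xr; rewrite /k scale0r addr0 sub0r => E.
  exists x; first exact: inr.
  by rewrite -[LHS]opprB E mulrN opprK.
Qed.

Definition rowdot c : 'rV[R]_n -> R := fun w => \sum_i w ord0 i * c ord0 i.

Lemma rowdot_linear c : linear (rowdot c : 'rV[R]_n -> R).
Proof.
move=> a x y; rewrite -[X in _ = X + _]/(a * rowdot c x) /rowdot mulr_sumr -big_split/=.
by apply: eq_bigr => i _; rewrite !mxE mulrDl mulrA.
Qed.
HB.instance Definition _ c := GRing.isLinear.Build R 'rV[R]_n R *:%R (rowdot c)
  (rowdot_linear c).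

Lemma rowdot_continuous c : continuous (rowdot c).
Proof.
apply: continuous_big => [|i _ x]; first exact: add_continuous.
apply: continuousM; last exact: cst_continuous.
exact: (@coord_continuous R 1 n ord0 i x).
Qed.

Lemma norm_coord u i : `|u ord0 i| <= `|u|.
Proof.
rewrite [leRHS]/Num.norm/= mx_normrE.
exact: (le_bigmax_cond _ (j := (ord0, i)) (fun i : 'I_1 * 'I_n => `|u i.1 i.2|) isT).
Qed.

Lemma norm_row_le u (e : R) : 0 <= e -> (forall i, `|u ord0 i| <= e) -> `|u| <= e.
Proof.
move=> e0 H; rewrite [leLHS]/Num.norm/= mx_normrE.
by apply: bigmax_le => // -[i j] _; rewrite (ord1 i) H.
Qed.

Definition row_prefix w (k : nat) : 'rV[R]_n := \row_i (if (i < k)%N then w ord0 i else 0).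

Lemma row_prefix0 w : row_prefix w 0 = 0.
Proof. by apply/rowP => i; rewrite !mxE. Qed.

Lemma row_prefixn w : row_prefix w n = w.
Proof. by apply/rowP => i; rewrite !mxE ltn_ord. Qed.

Lemma row_prefixS w (i : 'I_n) : row_prefix w i.+1 = row_prefix w i + w ord0 i *: evec R i.
Proof.
apply/rowP => j; rewrite !mxE eqxx/= ltnS leq_eqVlt.
have [->|ji] := eqVneq j i; first by rewrite eqxx ltnn/= mulr1 add0r.
by rewrite (_ : (j == i :> nat) = false)/= ?mulr0 ?addr0//; apply/negbTE.
Qed.

Lemma row_sum_evec w : w = \sum_i w ord0 i *: evec R i.
Proof. by rewrite [LHS]row_sum_delta. Qed.

(** The increment is telescoped by changing one coordinate at a time, and the mean value theorem
    treats each piece. *)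
Lemma C1_differentiable (O : set 'rV[R]_n) h u : open O -> O u ->
  (forall x, O x -> forall i, derivable h x (evec R i)) ->
  (forall i, {for u, continuous ('D_(evec R i) h)}) ->
  differentiable h u.
Proof.
move=> oO Ou dh ch.
pose c : 'rV[R]_n := \row_i 'D_(evec R i) h u.
suff H : h \o shift u = cst (h u) + rowdot c +o_ (0 : 'rV[R]_n) id.
  apply/diff_locallyP; have E := diff_unique (@rowdot_continuous c) H.
  by rewrite E; split=> //; exact: rowdot_continuous.
apply/eqaddoP => _/posnumP[e].
(* There are n telescoped pieces; the divisor n + 1 also covers n = 0. *)
pose e' : R := e%:num / (n.+1)%:R.
have e'0 : 0 < e' by rewrite divr_gt0// ltr0n.
have := open_nbhs_nbhs (conj oO Ou) => /nbhs_ballP[d0 d0p b0].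
have [d [dp bd]] : exists d : R, 0 < d /\ forall x, `|x| < d ->
    O (u + x) /\ forall i, `|'D_(evec R i) h u - 'D_(evec R i) h (u + x)| <= e'.
  have : \forall x \near u, O x /\ forall i, `|'D_(evec R i) h u - 'D_(evec R i) h x| <= e'.
    near=> x; split; first by near: x; exact: open_nbhs_nbhs.
    near: x; apply: filter_forall => i.
    by have /cvgrPdist_le/(_ _ e'0) := ch i.
  move=> /nbhs_ballP[d dp bd]; exists d; split=> // x xd.
  by apply: bd; rewrite -ball_normE/= opprD addrA subrr sub0r normrN.
near=> w => /=.
have wd : `|w| < d.
  near: w; apply/nbhs_ballP; exists d => //= x.
  by rewrite -ball_normE/= sub0r normrN.
have prefix_lt k : `|row_prefix w k| <= `|w|.
  apply: norm_row_le => // i; rewrite mxE; case: ifP => _; last by rewrite normr0.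
  exact: norm_coord.
have step (i : 'I_n) :
    `|h (u + row_prefix w i.+1) - h (u + row_prefix w i) - w ord0 i * c ord0 i| <= e' * `|w|.
  have inb r : `|r| <= `|w ord0 i| -> `|row_prefix w i + r *: evec R i| <= `|w|.
    move=> rw; apply: norm_row_le => // j; rewrite !mxE eqxx/=.
    have [->|ji] := eqVneq j i.
      by rewrite ltnn add0r mulr1 (le_trans rw)// norm_coord.
    by rewrite mulr0 addr0; case: ifP => _; rewrite ?normr0// norm_coord.
  have [r rw|r rw E] := @line_MVT_signed _ h (u + row_prefix w i) (evec R i) (w ord0 i).
    apply: dh; rewrite -addrA; have [|Ox _//] := bd (row_prefix w i + r *: evec R i).
    exact: le_lt_trans (inb _ rw) wd.
  rewrite (row_prefixS w i) addrA E mulrC -mulrBr normrM mulrC; apply: ler_pM => //.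
    rewrite mxE distrC -addrA; have [|_] := bd (row_prefix w i + r *: evec R i).
      exact: le_lt_trans (inb _ rw) wd.
    exact.
  exact: norm_coord.
have tel : h (w + u) - h u = \sum_(i < n) (h (u + row_prefix w i.+1) - h (u + row_prefix w i)).
  rewrite -(big_mkord xpredT (fun i => h (u + row_prefix w i.+1) - h (u + row_prefix w i))).
  by rewrite telescope_sumr// row_prefixn row_prefix0 addr0 (addrC w).
rewrite [X in `|X|](_ : _ = \sum_(i < n)
   (h (u + row_prefix w i.+1) - h (u + row_prefix w i) - w ord0 i * c ord0 i)); last first.
  by rewrite sumrB -tel /= /rowdot !fctE/= opprD addrA.
apply: le_trans (ler_norm_sum _ _ _) _.
apply: le_trans (ler_sum _ (fun i _ => step i)) _.
rewrite sumr_const card_ord -mulr_natl mulrA ler_wpM2r//.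
by rewrite mulrC /e' -mulrA ler_piMr// mulrC ler_pdivrMr// mul1r ler_nat.
Unshelve. all: by end_near. Qed.

End C1.

(** * Weighted symbol classes *)

Section DiffD.
Variables (R : realType) (V : normedModType R).
Implicit Types (h k : V -> R) (u v : V).

Lemma diff_is_derive h u v : differentiable h u -> is_derive u v h ('D_v h u).
Proof. by move=> dh; apply/derivableP/diff_derivable. Qed.

Lemma deriveD_fun h k u v : differentiable h u -> differentiable k u ->
  'D_v (fun x => h x + k x) u = 'D_v h u + 'D_v k u.
Proof. by move=> dh dk; apply: derive_val; apply: isdD; exact: diff_is_derive. Qed.

Lemma deriveM_fun h k u v : differentiable h u -> differentiable k u ->
  'D_v (fun x => h x * k x) u = 'D_v h u * k u + h u * 'D_v k u.
Proof. by move=> dh dk; apply: derive_val; apply: isdM; exact: diff_is_derive. Qed.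

Lemma deriveZ_fun h c u v : differentiable h u ->
  'D_v (fun x => c * h x) u = c * 'D_v h u.
Proof. by move=> dh; apply: derive_val; apply: isdZ; exact: diff_is_derive. Qed.

Lemma deriveV_fun h u v : differentiable h u -> h u != 0 ->
  'D_v (fun x => (h x)^-1) u = - 'D_v h u / (h u) ^+ 2.
Proof. by move=> dh h0; apply: derive_val; apply: isdV => //; exact: diff_is_derive. Qed.

Lemma differentiableD_fun h k u : differentiable h u -> differentiable k u ->
  differentiable (fun x => h x + k x) u.
Proof. exact: differentiableD. Qed.

Lemma differentiableM_fun h k u : differentiable h u -> differentiable k u ->
  differentiable (fun x => h x * k x) u.
Proof. exact: differentiableM. Qed.

Lemma differentiableZ_fun h c u : differentiable h u ->
  differentiable (fun x => c * h x) u.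
Proof. by move=> dh; apply: differentiableM_fun. Qed.

Lemma differentiableV_fun h u : differentiable h u -> h u != 0 ->
  differentiable (fun x => (h x)^-1) u.
Proof. exact: differentiableV. Qed.

Lemma near_eq_differentiable h k u : (\near u, h u = k u) -> differentiable h u ->
  differentiable k u.
Proof.
move=> hk dh.
suff H : k \o shift u = cst (k u) + 'd h u +o_ (0 : V) id.
  apply/diff_locallyP; have E := diff_unique (diff_continuous dh) H.
  by rewrite E; split=> //; exact: diff_continuous.
have := diff_locally dh => /eqaddoP H; apply/eqaddoP => e e0.
have := H e e0; have hk0 := nbhs_singleton hk.
have hk' : \forall x \near (0 : V), h (x + u) = k (x + u).
  by rewrite (near_shift u) /=; near=> x; rewrite /= sub0r subrK; near: x.
move=> H'; near=> x.
have : `|((h \o shift u) \- (cst (h u) + 'd h u)) x| <= e * `|x| by near: x.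
rewrite /= !fctE /= hk0 (_ : h (x + u) = k (x + u))//.
by near: x.
Unshelve. all: by end_near. Qed.

Lemma derive_comb (I : finType) h u (c : I -> R) (w : I -> V) : differentiable h u ->
  'D_(\sum_j c j *: w j) h u = \sum_j c j * 'D_(w j) h u.
Proof.
move=> dh; rewrite deriveE// raddf_sum; apply: eq_bigr => j _.
by rewrite [LHS]linearZZ deriveE.
Qed.

End DiffD.

Section SymbolClass.
Variables (R : realType) (n : nat).
Variables (Om Rg : set 'rV[R]_n) (d : 'I_n -> 'rV[R]_n) (s : 'I_n -> 'rV[R]_n -> R) (g : int).
Hypothesis oOm : open Om.
Hypothesis RgOm : Rg `<=` Om.
Implicit Types (h : 'rV[R]_n -> R) (u v : 'rV[R]_n) (mu nu : 'I_n -> int).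

Definition wt nu u : R := expR (- \sum_k (nu k)%:~R * s k u).
Definition bumpw nu (j : 'I_n) : 'I_n -> int := fun k => nu k + g *+ (k == j).

(** Put y_j = exp (- s_j), where s_j grows at unit speed along d_j. Then (D_j + nu_j) (y^nu k) = -
    y^nu y_j dk/dy_j, so with gain [g] = 1 membership says that h / y^nu has bounded y-derivatives
    up to order [N]. With [g] = 0 only derivatives along the d_j are bounded: this is where cutoffs
    live. Estimates are asked on [Rg], regularity on the open set [Om]. *)
Fixpoint cl (N : nat) nu h : Prop :=
  [/\ (forall u, Om u -> {for u, continuous h}),
      (exists C, forall u, Rg u -> `|h u| <= C * wt nu u)
    & (if N is N'.+1 then (forall u, Om u -> differentiable h u) /\
          forall j, cl N' (bumpw nu j) (fun u => 'D_(d j) h u + (nu j)%:~R * h u)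
       else True)].

Lemma wtD mu nu u : wt (fun k => mu k + nu k) u = wt mu u * wt nu u.
Proof.
rewrite /wt -expRD -opprD -big_split/=; congr (expR (- _)).
by apply: eq_bigr => k _; rewrite rmorphD mulrDl.
Qed.

Lemma wtN nu u : wt (fun k => - nu k) u = (wt nu u)^-1.
Proof.
rewrite /wt -expRN; congr (expR (- _)); rewrite -sumrN.
by apply: eq_bigr => k _; rewrite rmorphN mulNr.
Qed.

Lemma wt0 u : wt (fun=> 0) u = 1.
Proof. by rewrite /wt big1 ?oppr0 ?expR0// => k _; rewrite mul0r. Qed.

Lemma wt_gt0 nu u : 0 < wt nu u.
Proof. exact: expR_gt0. Qed.

Lemma cl_cont N nu h u : cl N nu h -> Om u -> {for u, continuous h}.
Proof. by case: N => [|N] [] c _ _ /c. Qed.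

Lemma cl_bound N nu h : cl N nu h -> exists C, forall u, Rg u -> `|h u| <= C * wt nu u.
Proof. by case: N => [|N] []. Qed.

Lemma cl_bound0 N nu h : cl N nu h ->
  exists C, 0 <= C /\ forall u, Rg u -> `|h u| <= C * wt nu u.
Proof.
move=> /cl_bound[C H]; exists `|C|; split=> // u /H /le_trans; apply.
by rewrite ler_wpM2r ?ler_norm// ltW// wt_gt0.
Qed.

Lemma cl_diff N nu h u : cl N.+1 nu h -> Om u -> differentiable h u.
Proof. by move=> [_ _ [dh _]] /dh. Qed.

Lemma cl_step N nu h j : cl N.+1 nu h ->
  cl N (bumpw nu j) (fun u => 'D_(d j) h u + (nu j)%:~R * h u).
Proof. by move=> [_ _ [_ st]]; exact: st. Qed.

Lemma cl_S N nu h : cl N.+1 nu h -> cl N nu h.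
Proof.
elim: N nu h => [|N IH] nu h [c b [dh st]]; first by split.
by split=> //; split=> // j; apply: IH.
Qed.

Lemma cl_ext N nu h k : (forall u, Om u -> h u = k u) -> cl N nu h -> cl N nu k.
Proof.
have nearO (h' k' : 'rV[R]_n -> R) u : (forall u, Om u -> h' u = k' u) -> Om u -> \near u, h' u = k' u.
  by move=> hk Ou; near=> x; apply: hk; near: x; exact: open_nbhs_nbhs.
have contE (h' k' : 'rV[R]_n -> R) u : (forall u, Om u -> h' u = k' u) -> Om u ->
    {for u, continuous h'} -> {for u, continuous k'}.
  move=> hk Ou ch A; rewrite /= -(hk u Ou) => /ch nA.
  by apply: filterS2 (nearO _ _ _ hk Ou) nA => x /= ->.
elim: N nu h k => [|N IH] nu h k hk [c b st]; split=> //.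
- by move=> u Ou; apply: (contE h) => //; exact: c.
- by case: b => C b; exists C => u Ru; rewrite -hk; [exact: b|exact: RgOm].
- by move=> u Ou; apply: (contE h) => //; exact: c.
- by case: b => C b; exists C => u Ru; rewrite -hk; [exact: b|exact: RgOm].
- case: st => dh st; split=> [u Ou|j].
    by apply: near_eq_differentiable (dh u Ou); apply: nearO.
  apply: IH (st j) => u Ou /=; rewrite hk//; congr (_ + _).
  by apply: near_eq_derive; apply: nearO.
Unshelve. all: by end_near. Qed.

Lemma cl_zero N nu : cl N nu (fun=> 0).
Proof.
elim: N nu => [|N IH] nu; (split; [by move=> u _; exact: cst_continuous
  |by exists 0 => u _; rewrite normr0 mul0r|]) => //.
split=> [u _|j]; first exact: differentiable_cst.
apply: cl_ext (IH _) => u _; rewrite derive_val mulr0 addr0 //.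
Qed.

Lemma cl_add N nu h k : cl N nu h -> cl N nu k -> cl N nu (fun u => h u + k u).
Proof.
have contD (h' k' : 'rV[R]_n -> R) : (forall u, Om u -> {for u, continuous h'}) ->
    (forall u, Om u -> {for u, continuous k'}) ->
    forall u, Om u -> {for u, continuous (fun u => h' u + k' u)}.
  by move=> c1 c2 u Ou; apply: continuousD; [exact: c1|exact: c2].
have boundD (h' k' : 'rV[R]_n -> R) nu' :
    (exists C, forall u, Rg u -> `|h' u| <= C * wt nu' u) ->
    (exists C, forall u, Rg u -> `|k' u| <= C * wt nu' u) ->
    exists C, forall u, Rg u -> `|h' u + k' u| <= C * wt nu' u.
  move=> [C1 b1] [C2 b2]; exists (C1 + C2) => u Ru.
  by apply: le_trans (ler_normD _ _) _; rewrite mulrDl lerD ?b1 ?b2.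
elim: N nu h k => [|N IH] nu h k [c1 b1 st1] [c2 b2 st2];
  (split; [exact: contD|exact: boundD|]) => //.
case: st1 => d1 st1; case: st2 => d2 st2; split=> [u Ou|j].
  by apply: differentiableD_fun; [exact: d1|exact: d2].
apply: cl_ext (IH _ _ _ (st1 j) (st2 j)) => u Ou /=.
rewrite (deriveD_fun _ (d1 u Ou) (d2 u Ou)); ring.
Qed.

Lemma cl_scale N nu h a : cl N nu h -> cl N nu (fun u => a * h u).
Proof.
elim: N nu h => [|N IH] nu h [c b st]; split=> //.
- by move=> u Ou; apply: continuousM; [exact: cst_continuous|exact: c].
- case: b => C b; exists (`|a| * C) => u Ru; rewrite normrM -mulrA ler_wpM2l//; exact: b.
- by move=> u Ou; apply: continuousM; [exact: cst_continuous|exact: c].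
- case: b => C b; exists (`|a| * C) => u Ru; rewrite normrM -mulrA ler_wpM2l//; exact: b.
case: st => dh st; split=> [u Ou|j].
  by apply: differentiableZ_fun; exact: dh.
apply: cl_ext (IH _ _ (st j)) => u Ou /=.
by rewrite (deriveZ_fun _ _ (dh u Ou)); ring.
Qed.

Lemma cl_opp N nu h : cl N nu h -> cl N nu (fun u => - h u).
Proof. by move=> /(cl_scale (-1)); apply: cl_ext => u _; rewrite mulN1r. Qed.

Lemma cl_sub N nu h k : cl N nu h -> cl N nu k -> cl N nu (fun u => h u - k u).
Proof. by move=> ch /cl_opp; apply: cl_add. Qed.

Lemma cl_sum (I : eqType) (r : seq I) N nu (h : I -> 'rV[R]_n -> R) :
  (forall i, i \in r -> cl N nu (h i)) -> cl N nu (fun u => \sum_(i <- r) h i u).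
Proof.
elim: r => [|i r IH] H.
  by apply: cl_ext (cl_zero _ _) => u _; rewrite big_nil.
apply: (@cl_ext _ _ (fun u => h i u + \sum_(j <- r) h j u)).
  by move=> u _; rewrite big_cons.
apply: cl_add; first by apply: H; rewrite mem_head.
by apply: IH => j jr; apply: H; rewrite inE jr orbT.
Qed.

Lemma bumpwDl mu nu j : bumpw (fun k => mu k + nu k) j = (fun k => bumpw mu j k + nu k).
Proof. by apply/funext => k; rewrite /bumpw addrAC. Qed.

Lemma bumpwDr mu nu j : bumpw (fun k => mu k + nu k) j = (fun k => mu k + bumpw nu j k).
Proof. by apply/funext => k; rewrite /bumpw addrA. Qed.

(** By Leibniz, (D_j + mu_j + nu_j) (h k) = ((D_j + mu_j) h) k + h ((D_j + nu_j) k): the shifts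
    distribute over the two factors. *)
Lemma cl_mul N mu nu h k : cl N mu h -> cl N nu k ->
  cl N (fun i => mu i + nu i) (fun u => h u * k u).
Proof.
have contM (h' k' : 'rV[R]_n -> R) : (forall u, Om u -> {for u, continuous h'}) ->
    (forall u, Om u -> {for u, continuous k'}) ->
    forall u, Om u -> {for u, continuous (fun u => h' u * k' u)}.
  by move=> c1 c2 u Ou; apply: continuousM; [exact: c1|exact: c2].
have boundM (h' k' : 'rV[R]_n -> R) mu' nu' :
    (exists C, forall u, Rg u -> `|h' u| <= C * wt mu' u) ->
    (exists C, forall u, Rg u -> `|k' u| <= C * wt nu' u) ->
    exists C, forall u, Rg u -> `|h' u * k' u| <= C * wt (fun i => mu' i + nu' i) u.
  move=> [C1 b1] [C2 b2]; exists (C1 * C2) => u Ru.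
  by rewrite normrM wtD mulrACA ler_pM ?b1 ?b2.
elim: N mu nu h k => [|N IH] mu nu h k [c1 b1 st1] [c2 b2 st2];
  (split; [exact: contM|exact: boundM|]) => //.
have ch : cl N mu h by apply: cl_S; split.
have ck : cl N nu k by apply: cl_S; split.
case: st1 => d1 st1; case: st2 => d2 st2; split=> [u Ou|j].
  by apply: differentiableM_fun; [exact: d1|exact: d2].
have A1 := IH _ _ _ _ (st1 j) ck; have A2 := IH _ _ _ _ ch (st2 j).
rewrite -bumpwDl in A1; rewrite -bumpwDr in A2.
apply: cl_ext (cl_add A1 A2) => u Ou /=.
by rewrite (deriveM_fun _ (d1 u Ou) (d2 u Ou)) rmorphD; ring.
Qed.

(** The induction closes because (D_j - nu_j) h^{-1} = - ((D_j + nu_j) h) h^{-2}, a product of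
    factors whose classes are known at the previous order. *)
Lemma cl_inv N nu h c : 0 < c -> (forall u, Rg u -> c * wt nu u <= `|h u|) ->
  (forall u, Om u -> h u != 0) -> cl N nu h ->
  cl N (fun i => - nu i) (fun u => (h u)^-1).
Proof.
move=> c0 lb h0.
have contV : (forall u, Om u -> {for u, continuous h}) ->
    forall u, Om u -> {for u, continuous (fun u => (h u)^-1)}.
  by move=> c1 u Ou; apply: continuousV; [exact: h0|exact: c1].
have boundV : exists C, forall u, Rg u -> `|(h u)^-1| <= C * wt (fun i => - nu i) u.
  exists c^-1 => u Ru; rewrite normfV wtN -invfM lef_pV2 ?lb// posrE.
    by rewrite normr_gt0 h0//; exact: RgOm.
  by rewrite mulr_gt0// wt_gt0.
elim: N => [|N IH] [c1 b1 st1]; (split; [exact: contV|exact: boundV|]) => //.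
have cV : cl N (fun i => - nu i) (fun u => (h u)^-1) by apply: IH; apply: cl_S; split.
case: st1 => d1 st1; split=> [u Ou|j].
  by apply: differentiableV_fun; [exact: d1|exact: h0].
have A := cl_opp (cl_mul (cl_mul (st1 j) cV) cV).
have -> : bumpw (fun i => - nu i) j = (fun k => bumpw nu j k - nu k - nu k).
  by apply/funext => k; rewrite /bumpw; ring.
apply: cl_ext A => u Ou /=; have hu := h0 u Ou.
by rewrite (deriveV_fun _ (d1 u Ou) hu) rmorphN /=; field.
Qed.

(** For an exact exponential every operator of the definition gives 0, so all orders follow from
    order 0. *)
Lemma cl_exact N nu h : (forall u, Om u -> differentiable h u) ->
  (exists C, forall u, Rg u -> `|h u| <= C * wt nu u) ->
  (forall u j, Om u -> 'D_(d j) h u = - ((nu j)%:~R * h u)) -> cl N nu h.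
Proof.
move=> dh b D; case: N => [|N].
  by split=> // u Ou; apply: differentiable_continuous; exact: dh.
split=> //; first by move=> u Ou; apply: differentiable_continuous; exact: dh.
by split=> // j; apply: cl_ext (cl_zero _ _) => u Ou; rewrite D// addNr.
Qed.

Lemma cl_cst N c : cl N (fun=> 0) (fun=> c).
Proof.
apply: cl_exact.
- by move=> u _; exact: differentiable_cst.
- by exists `|c| => u _; rewrite wt0 mulr1.
- by move=> u j _; rewrite derive_val mul0r oppr0.
Qed.

Section Monotone.
Hypothesis g01 : (g == 0) || (g == 1).
Hypothesis s0 : forall u k, Rg u -> 0 <= s k u.

Lemma wt_mono mu nu u : (forall k, nu k <= mu k) -> Rg u -> wt mu u <= wt nu u.
Proof.
move=> le Ru; rewrite /wt ler_expR lerN2; apply: ler_sum => k _.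
by rewrite ler_wpM2r ?s0// ler_int.
Qed.

(** Changing the shift adds a multiple of h. If nu_j differs from mu_j, the gap between these
    integers is at least the gain, so h itself already has the bumped weight. *)
Lemma cl_mono N mu nu h : (forall k, nu k <= mu k) -> cl N mu h -> cl N nu h.
Proof.
have boundm mu' nu' h' : (forall k, nu' k <= mu' k) ->
   (exists C, forall u, Rg u -> `|h' u| <= C * wt mu' u) ->
   exists C, forall u, Rg u -> `|h' u| <= C * wt nu' u.
  move=> le [C b]; exists `|C| => u Ru; apply: le_trans (b u Ru) _.
  apply: le_trans (ler_norm _) _; rewrite normrM ler_wpM2l//.
  by rewrite ger0_norm ?wt_mono// ltW// wt_gt0.
elim: N mu nu h => [|N IH] mu nu h le [c b st]; (split; [exact: c|exact: boundm b|]) => //.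
have ch : cl N mu h by apply: cl_S; split.
case: st => dh st; split=> // j.
have A : cl N (bumpw nu j) (fun u => 'D_(d j) h u + (mu j)%:~R * h u).
  by apply: IH (st j) => k; rewrite /bumpw lerD2r.
have [e|ne] := eqVneq (mu j) (nu j); first by rewrite -e.
have B : cl N (bumpw nu j) h.
  apply: IH ch => k; rewrite /bumpw; have [->|kj] := eqVneq k j; last by rewrite mulr0n addr0.
  have := le j; rewrite le_eqVlt eq_sym (negbTE ne)/= mulr1n => lt.
  by case/orP: g01 => /eqP ->; lia.
apply: cl_ext (cl_add A (cl_scale ((nu j)%:~R - (mu j)%:~R) B)) => u Ou /=; ring.
Qed.

Lemma cl_deriv N nu h j : cl N.+1 nu h -> cl N nu (fun u => 'D_(d j) h u).
Proof.
move=> ch; have A := cl_scale (- (nu j)%:~R) (cl_S ch).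
have B : cl N nu (fun u => 'D_(d j) h u + (nu j)%:~R * h u).
  apply: cl_mono (cl_step j ch) => k; rewrite /bumpw lerDl.
  by case: (k == j); case/orP: g01 => /eqP ->.
by apply: cl_ext (cl_add B A) => u Ou /=; ring.
Qed.

Lemma cl_dir N nu h (c : 'I_n -> R) v : v = \sum_j c j *: d j -> cl N.+1 nu h ->
  cl N nu (fun u => 'D_v h u).
Proof.
move=> vE ch.
have A : cl N nu (fun u => \sum_(j <- index_enum 'I_n) c j * 'D_(d j) h u).
  by apply: cl_sum => j _; apply: cl_scale; apply: cl_deriv.
apply: cl_ext A => u Ou /=; rewrite vE derive_comb; [by []|exact: cl_diff ch Ou].
Qed.

End Monotone.

End SymbolClass.

Lemma expN_small (R : realType) (C e : R) : 0 < e ->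
  exists r0, forall r, r0 <= r -> 0 <= r -> C * expR (- r) <= e.
Proof.
move=> e0; exists (`|C| / e) => r r0r rp.
have p1 : 0 < 1 + r by rewrite ltr_pwDl.
apply: (@le_trans _ _ (`|C| * expR (- r))); first by rewrite ler_wpM2r ?expR_ge0 ?ler_norm.
apply: (@le_trans _ _ (`|C| / (1 + r))).
  by rewrite ler_wpM2l// expRN lef_pV2 ?posrE ?expR_gt0// expR_ge1Dx.
rewrite ler_pdivrMr// in r0r; rewrite ler_pdivrMr//; lra.
Qed.

(** * Hadamard's lemma in weighted classes *)

Section Hadamard.
Variables (R : realType) (n : nat).
Variables (Om : set 'rV[R]_n) (d : 'I_n -> 'rV[R]_n) (s : 'I_n -> 'rV[R]_n -> R).
Hypothesis oOm : open Om.
Hypothesis Om_up : forall u (r : R) j, Om u -> 0 <= r -> Om (u + r *: d j).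
Hypothesis sd : forall u (r : R) j k, s j (u + r *: d k) = s j u + r *+ (j == k).
Implicit Types (u v : 'rV[R]_n) (mu nu : 'I_n -> int).

Definition chart_region : set 'rV[R]_n := [set u | Om u /\ forall j, 0 <= s j u].
Let Rg := chart_region.
Notation cl := (cl Om chart_region d s 1).

Definition addw mu (j : 'I_n) (k : nat) : 'I_n -> int := fun i => mu i + k%:Z *+ (i == j).

Let RgOm : Rg `<=` Om. Proof. by move=> u []. Qed.
Let g01 : ((1 : int) == 0) || ((1 : int) == 1). Proof. by []. Qed.
Let s0 u k : Rg u -> 0 <= s k u. Proof. by case. Qed.

Lemma chart_region_up u (r : R) j : chart_region u -> 0 <= r -> chart_region (u + r *: d j).
Proof.
move=> [Ou su] r0; split; first exact: Om_up.
by move=> k; rewrite sd addr_ge0// mulrn_wge0.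
Qed.

Lemma wt_shift nu u (r : R) j : wt s nu (u + r *: d j) = wt s nu u * expR (- ((nu j)%:~R * r)).
Proof.
rewrite /wt -expRD -opprD; congr (expR (- _)).
rewrite (eq_bigr (fun k => (nu k)%:~R * s k u + (nu k)%:~R * (r *+ (k == j)))); last first.
  by move=> k _; rewrite sd mulrDr.
rewrite big_split/=; congr (_ + _).
rewrite (bigD1 j)//= eqxx mulr1n big1 ?addr0// => k /negbTE ->.
by rewrite mulr0n mulr0.
Qed.

Lemma cl_commute mu G i j u : cl 3 mu G -> Om u ->
  'D_(d i) ('D_(d j) G) u = 'D_(d j) ('D_(d i) G) u.
Proof.
move=> cG Ou.
have cD i' : cl 2 mu (fun u => 'D_(d i') G u) by exact: (cl_deriv oOm RgOm g01 s0).
have cDD i' j' : cl 1 mu (fun u => 'D_(d i') ('D_(d j') G) u).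
  exact: (cl_deriv oOm RgOm g01 s0 i' (cD j')).
apply: (schwarz oOm Ou).
- move=> x Ox; split; apply: diff_derivable.
  + exact: cl_diff cG Ox.
  + exact: cl_diff cG Ox.
  + exact: cl_diff (cD _) Ox.
  + exact: cl_diff (cD _) Ox.
- exact: cl_cont (cDD _ _) Ou.
- exact: cl_cont (cDD _ _) Ou.
Qed.

(** In the variables y this says that G / y^mu vanishes at y_j = 0, pointwise in the other variables
    and with no rate. *)
Definition flat_along mu (j : 'I_n) (G : 'rV[R]_n -> R) := forall u, chart_region u ->
  forall e, 0 < e -> exists r0, forall r, r0 <= r -> 0 <= r ->
    expR ((mu j)%:~R * r) * `|G (u + r *: d j)| <= e.

Lemma is_derive_exp_line mu j G u (r : R) : Om u -> 0 <= r -> cl 1 mu G ->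
  is_derive r 1 (fun r => expR ((mu j)%:~R * r) * G (u + r *: d j))
    (expR ((mu j)%:~R * r) * ('D_(d j) G (u + r *: d j) + (mu j)%:~R * G (u + r *: d j))).
Proof.
move=> Ou r0 cG.
have E := is_derive_explin (mu j)%:~R r.
have Gd : is_derive r 1 (fun r => G (u + r *: d j)) ('D_(d j) G (u + r *: d j)).
  by apply/is_derive_line/diff_derivable; apply: cl_diff cG _; exact: Om_up.
apply: (is_derive_eq (isdM E Gd)).
by rewrite mulrDr addrC mulrA.
Qed.

(** The function exp (mu_j r) G(u + r d_j) tends to 0, so its value at r = 0 is recovered from the
    integral of its derivative, which carries an extra factor exp (- k r) with k at least 1; the
    constant [C] is therefore preserved. *)
Lemma flat_bound mu j k G u C : (0 < k)%N -> chart_region u -> cl 1 mu G ->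
  flat_along mu j G ->
  (forall u, chart_region u -> `|'D_(d j) G u + (mu j)%:~R * G u| <= C * wt s (addw mu j k) u) ->
  `|G u| <= C * wt s (addw mu j k) u.
Proof.
move=> k0 Ru cG fl b; have [Ou _] := Ru.
have C0 : 0 <= C * wt s (addw mu j k) u by apply: le_trans (b u Ru).
apply/ler_addgt0Pr => e e0; have [r0 H] := fl u Ru e e0.
pose r := Num.max r0 0; have rp : 0 <= r by rewrite le_max lexx orbT.
have := H r; rewrite le_max lexx => /(_ isT rp) Hr.
have B : `|expR ((mu j)%:~R * r) * G (u + r *: d j)
        - expR ((mu j)%:~R * 0) * G (u + 0 *: d j)| <= C * wt s (addw mu j k) u.
  apply: (@derive_bound_exp R (fun r => expR ((mu j)%:~R * r) * G (u + r *: d j))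
    (fun r => expR ((mu j)%:~R * r) * ('D_(d j) G (u + r *: d j)
      + (mu j)%:~R * G (u + r *: d j))) _ r rp).
    by move=> t /andP[t0 _]; exact: is_derive_exp_line.
  move=> t /andP[t0 _]; rewrite normrM ger0_norm ?expR_ge0//.
  have := b _ (chart_region_up j Ru t0); rewrite wt_shift => bt.
  apply: (@le_trans _ _ (expR ((mu j)%:~R * t) * (C * (wt s (addw mu j k) u *
     expR (- ((addw mu j k j)%:~R * t)))))); first by rewrite ler_wpM2l// expR_ge0.
  have -> : expR (- ((addw mu j k j)%:~R * t)) = expR (- ((mu j)%:~R * t)) * expR (- (k%:R * t)).
    by rewrite -expRD -opprD /addw eqxx mulr1n rmorphD/= mulrDl.
  rewrite (_ : expR _ * _ = C * wt s (addw mu j k) u * expR (- (k%:R * t)) *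
     (expR ((mu j)%:~R * t) * expR (- ((mu j)%:~R * t)))); last by ring.
  rewrite expRxMexpNx_1 mulr1 ler_wpM2l// ler_expR lerN2 ler_peMl// ler1n //.
rewrite mulr0 expR0 mul1r scale0r addr0 in B.
set X := expR _ * _ in B.
apply: (@le_trans _ _ (`|X - G u| + `|X|)).
  by have := ler_normB X (X - G u); rewrite subKr addrC.
by apply: lerD => //; rewrite normrM ger0_norm ?expR_ge0.
Qed.

Lemma flat_deriv_self mu j k G : (0 < k)%N -> cl 1 mu G -> flat_along mu j G ->
  cl 0 (addw mu j k) (fun u => 'D_(d j) G u + (mu j)%:~R * G u) ->
  flat_along mu j (fun u => 'D_(d j) G u + (addw mu j k j)%:~R * G u).
Proof.
move=> k0 cG fl /cl_bound0[C [C0 b]] u Ru e e0.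
have e2 : 0 < e / 2 by rewrite divr_gt0.
have k0' : 0 < (k%:R : R) by rewrite ltr0n.
have [r1 H1] := fl u Ru (e / 2 / k%:R) (divr_gt0 e2 k0').
have [r2 H2] := @expN_small R (C * wt s (addw mu j k) u) (e / 2) e2.
exists (Num.max r1 r2) => r; rewrite ge_max => /andP[rr1 rr2] r0.
have b1 := H1 r rr1 r0; have b2 := H2 r rr2 r0.
have b3 := b _ (chart_region_up j Ru r0).
set X := 'D_(d j) G _ in b3 *; set Y := G _ in b1 b3 *.
set E := expR ((mu j)%:~R * r) in b1 *.
have E0 : 0 <= E by exact: expR_ge0.
have -> : (addw mu j k j)%:~R = (mu j)%:~R + k%:R :> R.
  by rewrite /addw eqxx mulr1n rmorphD.
have -> : X + ((mu j)%:~R + k%:R) * Y = (X + (mu j)%:~R * Y) + k%:R * Y by ring.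
apply: (@le_trans _ _ (E * `|X + (mu j)%:~R * Y| + E * `|k%:R * Y|)).
  by rewrite -mulrDr ler_wpM2l// ler_normD.
rewrite (splitr e); apply: lerD; last first.
  by rewrite normrM normr_nat mulrCA mulrC -ler_pdivlMr.
apply: le_trans b2; apply: (@le_trans _ _ (E * (C * wt s (addw mu j k) (u + r *: d j)))).
  by rewrite ler_wpM2l.
rewrite wt_shift; have -> : expR (- ((addw mu j k j)%:~R * r)) = expR (- ((mu j)%:~R * r)) * expR (- (k%:R * r)).
  by rewrite -expRD -opprD /addw eqxx mulr1n rmorphD/= mulrDl.
rewrite (_ : E * _ = C * wt s (addw mu j k) u * expR (- (k%:R * r)) *
     (E * expR (- ((mu j)%:~R * r)))); last by ring.
rewrite expRxMexpNx_1 mulr1; apply: ler_wpM2l; first by rewrite mulr_ge0// ltW// wt_gt0.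
by rewrite ler_expR lerN2 ler_peMl// ler1n.
Qed.

(** Interpolation: a difference quotient of step [p] along [d i] is small because [G] is, and it
    differs from the derivative by at most [p] times a bound for the second derivative. The step is
    fixed first, the distance [r] afterwards. *)
Lemma flat_deriv_other mu i j G : i != j -> cl 3 mu G -> flat_along mu j G ->
  flat_along mu j (fun u => 'D_(d i) G u + (mu i)%:~R * G u).
Proof.
move=> ij cG fl u Ru e e0; have [Ou _] := Ru.
have cD : cl 2 mu (fun u => 'D_(d i) G u) by exact: (cl_deriv oOm RgOm g01 s0).
have [C [C0 b]] := cl_bound0 (cl_deriv oOm RgOm g01 s0 i cD).
(* [W] bounds the rescaled weight along a segment in the direction [d i] of length [p], at most
   1. *)
pose W := wt s mu u * expR `|(mu i)%:~R|.
have W0 : 0 <= W by rewrite mulr_ge0 ?expR_ge0// ltW// wt_gt0.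
have CW : 0 < C * W + 1 by rewrite ltr_wpDl// mulr_ge0.
pose p := Num.min 1 (e / 4 / (C * W + 1)).
have p0 : 0 < p by rewrite lt_min ltr01 !divr_gt0.
have p1 : p <= 1 by rewrite ge_min lexx.
have pe : p * (C * W) <= e / 4.
  apply: (@le_trans _ _ (p * (C * W + 1))); first by rewrite ler_wpM2l ?lerDl// ltW.
  by rewrite -ler_pdivlMr// ge_min lexx orbT.
pose M : R := 1 + `|(mu i)%:~R|.
have M0 : 0 < M by rewrite ltr_pwDl.
have ep : 0 < e * p / 4 / M by rewrite !divr_gt0// mulr_gt0.
have [r1 H1] := fl u Ru _ ep.
have [r2 H2] := fl _ (chart_region_up i Ru (ltW p0)) _ ep.
exists (Num.max r1 r2) => r; rewrite ge_max => /andP[rr1 rr2] r0.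
have b1 := H1 r rr1 r0; have b2 := H2 r rr2 r0.
set E := expR ((mu j)%:~R * r) in b1 b2 *.
have E0 : 0 < E by exact: expR_gt0.
pose v := u + r *: d j.
have Rv : chart_region v by exact: chart_region_up.
have [Ov _] := Rv.
have wv t : 0 <= t <= p -> E * wt s mu (v + t *: d i) <= W.
  move=> /andP[t0 tp]; rewrite wt_shift /v wt_shift.
  have EE : E * expR (- ((mu j)%:~R * r)) = 1 by exact: expRxMexpNx_1.
  rewrite (_ : E * _ = wt s mu u * expR (- ((mu i)%:~R * t)) *
    (E * expR (- ((mu j)%:~R * r)))); last by ring.
  rewrite EE mulr1; apply: ler_wpM2l; first by rewrite ltW// wt_gt0.
  rewrite ler_expR -mulNr.
  apply: le_trans (ler_norm _) _; rewrite normrM normrN ler_piMr// ger0_norm//.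
  exact: le_trans tp p1.
have db t : 0 <= t <= p -> `|'D_(d i) G (v + t *: d i) - 'D_(d i) G v| <= C * W / E * p.
  move=> /andP[t0 tp].
  have := @derive_bound_mvt R (fun t => 'D_(d i) G (v + t *: d i))
    (fun t => 'D_(d i) ('D_(d i) G) (v + t *: d i)) 0 t (C * W / E) t0.
  rewrite scale0r addr0 subr0 => H; apply: le_trans (H _ _) _.
  - move=> t' /andP[t'0 _]; apply/is_derive_line/diff_derivable.
    by apply: cl_diff cD _; exact: Om_up.
  - move=> t' /andP[t'0 t't]; apply: le_trans (b _ (chart_region_up i Rv t'0)) _.
    rewrite -mulrA; apply: ler_wpM2l => //; rewrite ler_pdivlMr// mulrC; apply: wv.
    by rewrite t'0/=; exact: le_trans t't tp.
  - by apply: ler_wpM2l => //; apply: divr_ge0; [exact: mulr_ge0|exact: ltW].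
have mv := @derive_bound_mvt R (fun t => G (v + t *: d i) - t * 'D_(d i) G v)
    (fun t => 'D_(d i) G (v + t *: d i) - 'D_(d i) G v) 0 p (C * W / E * p) (ltW p0).
have {}mv : `|G (v + p *: d i) - p * 'D_(d i) G v - G v| <= C * W / E * p * p.
  move: mv; rewrite scale0r addr0 mul0r subr0 subr0; apply=> // t /andP[t0 tp].
  apply: isdB.
    apply/is_derive_line/diff_derivable; apply: cl_diff cG _; exact: Om_up.
  rewrite -[X in is_derive _ _ _ X]mul1r.
  have := isdM (is_derive_id t 1) (isdC ('D_(d i) G v) t 1).
  by rewrite mulr0 addr0.
have pD : p * (E * `|'D_(d i) G v|) <= E * `|G (v + p *: d i)| + E * `|G v| + C * W * p * p.
  have -> : p * (E * `|'D_(d i) G v|) = E * `|p * 'D_(d i) G v|.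
    by rewrite normrM (ger0_norm (ltW p0)) mulrCA.
  have -> : C * W * p * p = E * (C * W / E * p * p).
    by field; rewrite gt_eqF.
  rewrite -!mulrDr; apply: ler_wpM2l; first exact: ltW.
  set a := G _ in mv *; set c := G v in mv *; set q := p * _ in mv *.
  have -> : q = (a - c) - (a - q - c) by ring.
  by apply: le_trans (ler_normB _ _) _; apply: lerD => //; exact: ler_normB.
have e1 : v + p *: d i = u + p *: d i + r *: d j by rewrite /v addrAC.
rewrite -e1 in b2; rewrite -/v in b1 *.
have n1 : E * `|(mu i)%:~R * G v| <= e / 4.
  rewrite normrM mulrCA.
  apply: (@le_trans _ _ (`|(mu i)%:~R| * (e * p / 4 / M))); first by rewrite ler_wpM2l.
  rewrite mulrA ler_pdivrMr// mulrC.
  have : e * p / 4 <= e / 4 by rewrite ler_pM2r// ?invr_gt0// ler_piMr// ltW.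
  move=> h1; apply: ler_pM => //; first by rewrite !divr_ge0// mulr_ge0// ltW.
  by rewrite /M lerDr.
have hM : e * p / 4 / M <= e * p / 4.
  rewrite ler_pdivrMr//; apply: ler_peMr; last by rewrite /M lerDl.
  by rewrite ltW// divr_gt0// mulr_gt0.
have n2 : E * `|'D_(d i) G v| <= e / 4 + e / 4 + e / 4.
  rewrite -(ler_pM2l p0); apply: le_trans pD _.
  rewrite !mulrDr; apply: lerD; first (apply: lerD).
  - by apply: le_trans b2 _; apply: le_trans hM _; rewrite mulrA [p * e]mulrC.
  - by apply: le_trans b1 _; apply: le_trans hM _; rewrite mulrA [p * e]mulrC.
  - rewrite (_ : C * W * p * p = p * (p * (C * W))); last by ring.
    by apply: ler_wpM2l pe; exact: ltW.
apply: (@le_trans _ _ (E * `|'D_(d i) G v| + E * `|(mu i)%:~R * G v|)).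
  by rewrite -mulrDr ler_wpM2l ?ler_normD// ltW.
by apply: le_trans (lerD n2 n1) _; lra.
Qed.

(** A function smooth up to y_j = 0 and vanishing there is divisible by y_j. Order 0 is
    [flat_bound]. For higher orders the operators commute; the one along [j] raises the gained power
    to k + 1, which is why the induction quantifies over [k], [mu] and [G]. *)
Lemma hadamard j N k mu G : (0 < k)%N -> (forall N, cl N mu G) -> flat_along mu j G ->
  (forall N, cl N (addw mu j k) (fun u => 'D_(d j) G u + (mu j)%:~R * G u)) ->
  cl N (addw mu j k) G.
Proof.
elim: N k mu G => [|N IH] k mu G k0 cG fl cH.
  split=> //; first by move=> u Ou; apply: cl_cont (cG 0%N) Ou.
  have [C b] := cl_bound (cH 0%N).
  by exists C => u Ru; apply: flat_bound (cG 1%N) fl b.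
split=> //.
- by move=> u Ou; apply: cl_cont (cG 0%N) Ou.
- have [C b] := cl_bound (cH 0%N).
  by exists C => u Ru; apply: flat_bound (cG 1%N) fl b.
split=> [u Ou|i]; first exact: cl_diff (cG 1%N) Ou.
have [ij|ij] := eqVneq i j.
  subst i.
  have -> : bumpw 1 (addw mu j k) j = addw mu j k.+1.
    apply/funext => i; rewrite /bumpw /addw -addrA; congr (_ + _).
    by case: (i == j); rewrite ?mulr1n ?mulr0n ?addr0// -addn1 PoszD.
  apply: IH => //.
  - move=> N'; rewrite (_ : (fun u => _) = fun u => ('D_(d j) G u + (mu j)%:~R * G u) + k%:R * G u).
      apply: cl_add => //.
        apply: (cl_mono oOm RgOm g01 s0 _ (cH N')) => i; rewrite /addw lerDl.
        by case: (i == j).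
      exact: cl_scale.
    by apply/funext => u; rewrite /addw eqxx mulr1n rmorphD/= mulrDl addrA.
  - exact: flat_deriv_self.
  - move=> N'; have := cl_step j (cH N'.+1).
    have -> : bumpw 1 (addw mu j k) j = addw mu j k.+1.
      apply/funext => i; rewrite /bumpw /addw -addrA; congr (_ + _).
      by case: (i == j); rewrite ?mulr1n ?mulr0n ?addr0// -addn1 PoszD.
    apply: cl_ext => // u Ou.
    have dG := cl_diff (cG 1%N) Ou.
    have dDG : differentiable (fun u => 'D_(d j) G u) u.
      by apply: cl_diff Ou; exact: (cl_deriv oOm RgOm g01 s0 j (cG 2%N)).
    rewrite !(deriveD_fun _ dDG (differentiableZ_fun _ dG)) !(deriveZ_fun _ _ dG).
    by rewrite /addw eqxx mulr1n rmorphD/=; ring.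
have -> : bumpw 1 (addw mu j k) i = addw (bumpw 1 mu i) j k.
  by apply/funext => i'; rewrite /bumpw /addw addrAC.
have -> : addw mu j k i = mu i by rewrite /addw (negbTE ij) mulr0n addr0.
have Ej : bumpw 1 mu i j = mu j by rewrite /bumpw eq_sym (negbTE ij) mulr0n addr0.
apply: IH => //.
- by move=> N'; exact: cl_step.
- have := flat_deriv_other ij (cG 3%N) fl.
  by rewrite /flat_along Ej.
- move=> N'; have := cl_step i (cH N'.+1).
  have -> : bumpw 1 (addw mu j k) i = addw (bumpw 1 mu i) j k.
    by apply/funext => i'; rewrite /bumpw /addw addrAC.
  have -> : addw mu j k i = mu i by rewrite /addw (negbTE ij) mulr0n addr0.
  apply: cl_ext => // u Ou; rewrite Ej.
  have dG := cl_diff (cG 1%N) Ou.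
  have dDG i' : differentiable (fun u => 'D_(d i') G u) u.
    by apply: cl_diff Ou; exact: (cl_deriv oOm RgOm g01 s0 i' (cG 2%N)).
  rewrite !(deriveD_fun _ (dDG _) (differentiableZ_fun _ dG)) !(deriveZ_fun _ _ dG).
  by rewrite (cl_commute i j (cG 3%N) Ou); ring.
Qed.

End Hadamard.

(** * Expansions of solutions of linear differential equations *)

Section ExpPoly.
Variable R : realType.
Implicit Types (p q : {poly R}) (P Q L : R -> R) (E s : seq R).

(** The degree grows only in the resonant case a = 0; this is one of the two origins of the
    logarithms. *)
Lemma poly_ode (a : R) p :
  exists q, q^`()%R + a *: q = p /\ (size q <= size p + (a == 0)%R)%N.
Proof.
have [->|a0] := eqVneq a 0.
  exists (\poly_(i < (size p).+1) (p`_i.-1 / i%:R)); split; last first.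
    by rewrite addn1 size_poly.
  rewrite scale0r addr0; apply/polyP => i; rewrite coef_deriv coef_poly/= ltnS.
  rewrite -[LHS]mulr_natr; case: ltnP => h; last by rewrite mul0r nth_default.
  by rewrite divfK// pnatr_eq0.
rewrite addn0; move: {2}(size p) (leqnn (size p)) => m.
elim: m p => [|m IH] p sp.
  exists 0; rewrite deriv0 scaler0 addr0; split; last by rewrite size_poly0.
  by apply/esym/eqP; rewrite -size_poly_leq0.
have [->|p0] := eqVneq p 0.
  by exists 0; rewrite deriv0 scaler0 addr0 size_poly0.
have sd := lt_size_deriv p0.
have [q1 [E1 s1]] := IH p^`()%R (leq_trans sd sp).
exists (a^-1 *: (p - q1)); split.
  rewrite derivZ derivB scalerA divff// scale1r.
  by rewrite -E1 addrAC subrr add0r scalerA mulVf// scale1r addrC subrK.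
apply: leq_trans (size_scale_leq _ _) _; apply: leq_trans (size_polyD _ _) _.
by rewrite size_polyN geq_max leqnn/= (leq_trans s1 (ltnW sd)).
Qed.

(** Here x stands for log t: exp (- b x) is t^{-b}, and a polynomial in x is a polynomial in log
    t. *)
Definition expsum E (p : R -> {poly R}) (x : R) := \sum_(b <- E) (p b).[x] * expR (- (b * x)).

Definition has_expansion E (m : R -> nat) P (N : R) := exists p : R -> {poly R},
  [/\ forall b, (size (p b) <= m b)%N &
      exists K T, forall x, T <= x -> 0 <= x -> `|P x - expsum E p x| <= K * expR (- (N * x))].

Lemma is_derive_horner p (x : R) : is_derive x 1 (horner p) (p^`()%R.[x]).
Proof.
apply: DeriveDef; first exact: derivable_horner.
by rewrite -derive1E -derivE.
Qed.

Lemma expsum_ode E (p q : R -> {poly R}) (a x : R) :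
  (forall b, (q b)^`()%R + (a - b) *: q b = p b) ->
  is_derive x 1 (expsum E q) (expsum E p x - a * expsum E q x).
Proof.
move=> H; rewrite /expsum mulr_sumr -sumrB.
apply: isd_sum => b _.
have D := isdM (is_derive_horner (q b) x) (is_derive_explin (- b) x).
rewrite (_ : (fun y => (q b).[y] * expR (- (b * y))) = (fun y => (q b).[y] * expR (- b * y))); last first.
  by apply/funext => y; rewrite mulNr.
by apply: (is_derive_eq D); rewrite -H hornerD hornerZ -!mulNr; ring.
Qed.

(* If (e^{ax} D)' decays then e^{ax} D converges; otherwise it grows at most at the
   rate of its derivative. *)
Lemma ode_remainder (D r : R -> R) (a N N' K T : R) : N' < N -> 0 <= T ->
  (forall x, T <= x -> is_derive x 1 D (r x - a * D x)) ->
  (forall x, T <= x -> `|r x| <= K * expR (- (N * x))) ->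
  exists c K', forall x, T <= x -> `|D x - c * expR (- (a * x))| <= K' * expR (- (N' * x)).
Proof.
move=> NN T0 dD br.
have K0 : 0 <= K.
  have := le_trans (normr_ge0 _) (br T (lexx _)); rewrite pmulr_lge0//; exact: expR_gt0.
pose G x := expR (a * x) * D x.
have dG x : T <= x -> is_derive x 1 G (expR (a * x) * r x).
  move=> Tx; apply: (is_derive_eq (isdM (is_derive_explin a x) (dD x Tx))); ring.
have eD x : D x = expR (- (a * x)) * G x.
  by rewrite /G mulrA [expR (- _) * _]mulrC expRxMexpNx_1 mul1r.
(* comparison of G with an antiderivative of the bound *)
have cmp (b : R) x y : b != 0 -> T <= x -> x <= y ->
   (forall z, T <= z -> `|expR (a * z) * r z| <= K * expR (b * z)) ->
   `|G y - G x| <= K / b * (expR (b * y) - expR (b * x)).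
  move=> b0 Tx xy bd.
  have key (e : R) : `|e| <= 1 -> e * (G y - G x) <= K / b * (expR (b * y) - expR (b * x)).
    move=> e1; rewrite -subr_ge0.
    have := @derive_nonneg_le R (fun z => K / b * expR (b * z) - e * G z)
      (fun z => K / b * (expR (b * z) * b) - e * (expR (a * z) * r z)) x y xy.
    move=> H; have {}H := H _ _.
    have : K / b * expR (b * x) - e * G x <= K / b * expR (b * y) - e * G y.
      apply: H => z /andP[xz zy].
        apply: isdB; first by apply: isdZ; exact: is_derive_explin.
        by apply: isdZ; apply: dG; exact: le_trans xz.
      rewrite (_ : K / b * _ = K * expR (b * z)); last by field.
      rewrite subr_ge0.
      apply: le_trans (ler_norm _) _; rewrite normrM.
      apply: (@le_trans _ _ `|expR (a * z) * r z|); first by rewrite ler_piMl.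
      by apply: bd; exact: le_trans xz.
    by move=> h; rewrite !mulrBr; lra.
  have := key 1; rewrite normr1 lexx mul1r => /(_ isT) k1.
  have := key (-1); rewrite normrN1 lexx mulN1r => /(_ isT) k2.
  by rewrite ler_norml; apply/andP; split; lra.
have bd (M : R) z : M <= N -> T <= z -> `|expR (a * z) * r z| <= K * expR ((a - M) * z).
  move=> MN Tz; rewrite normrM ger0_norm ?expR_ge0//.
  apply: (@le_trans _ _ (expR (a * z) * (K * expR (- (N * z))))).
    by rewrite ler_wpM2l ?expR_ge0// br.
  rewrite mulrCA -expRD ler_wpM2l// ler_expR -mulrBl ler_wpM2r ?lerD2l ?lerN2//.
  exact: le_trans Tz.
have [aN|Na] := ltP a N.
  pose b := a - N; have b0 : b < 0 by rewrite subr_lt0.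
  have b0' : b != 0 by rewrite lt_eqF.
  (* [A] is the tail integral of the bound for the derivative of [G], so the intervals
     [G - A, G + A] are nested and their common point is the limit of [G]. *)
  pose A x := K / (- b) * expR (b * x).
  have A0 x : 0 <= A x by rewrite mulr_ge0 ?expR_ge0// divr_ge0// oppr_ge0 ltW.
  have GA x y : T <= x -> x <= y -> `|G y - G x| <= A x - A y.
    move=> Tx xy; apply: le_trans (cmp b x y b0' Tx xy _) _.
      by move=> z Tz; exact: bd.
    by rewrite /A invrN; lra.
  pose S := [set G x - A x | x in [set x | T <= x]].
  have hS : has_sup S.
    split; first by exists (G T - A T); exists T => //=.
    exists (G T + A T) => _ [x /= Tx <-].
    have := GA T x (lexx _) Tx; rewrite ler_norml => /andP[_ h].
    by have := A0 x; lra.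
  exists (sup S), (K / (- b)) => x Tx.
  have ub : G x - A x <= sup S.
    by apply: ub_le_sup; [exact: hS.2|exists x].
  have lb : sup S <= G x + A x.
    apply: ge_sup; first exact: hS.1.
    move=> _ [y /= Ty <-].
    have [xy|yx] := leP x y.
      have := GA x y Tx xy; rewrite ler_norml => /andP[_ h].
      by have := A0 y; have := A0 x; lra.
    have := GA y x Ty (ltW yx); rewrite ler_norml => /andP[h _].
    by have := A0 y; have := A0 x; lra.
  rewrite eD [_ * expR _]mulrC -mulrBr normrM ger0_norm ?expR_ge0//.
  apply: (@le_trans _ _ (expR (- (a * x)) * A x)).
    rewrite ler_wpM2l ?expR_ge0// ler_norml; apply/andP; split; lra.
  rewrite /A mulrCA -expRD; apply: ler_wpM2l; first by rewrite divr_ge0// oppr_ge0 ltW.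
  rewrite ler_expR /b mulrBl addrA addNr sub0r lerN2; apply: ler_wpM2r; last exact: ltW.
  exact: le_trans Tx.
(* Here [G] may grow. The rate is measured from N' rather than N: at a = N the growth could be
   linear in x, and the loss N' < N absorbs it. *)
pose b := a - N'; have b0 : 0 < b by rewrite subr_gt0 (lt_le_trans NN).
exists 0, (K / b + `|G T|) => x Tx; rewrite mul0r subr0 eD normrM ger0_norm ?expR_ge0//.
have x0 : 0 <= x by exact: le_trans Tx.
have := cmp b T x _ (lexx _) Tx (fun z Tz => bd N' z (ltW NN) Tz); rewrite gt_eqF// => /(_ isT) h.
have GB : `|G x| <= (K / b + `|G T|) * expR (b * x).
  have e1 : 1 <= expR (b * x) by rewrite -[leLHS]expR0 ler_expR mulr_ge0// ltW.
  apply: (@le_trans _ _ (`|G x - G T| + `|G T|)).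
    by have := ler_normD (G x - G T) (G T); rewrite subrK.
  rewrite mulrDl; apply: lerD; last by rewrite ler_peMr.
  apply: le_trans h _; apply: ler_wpM2l; first by rewrite divr_ge0// ltW.
  by rewrite gerBl expR_ge0.
apply: le_trans (ler_wpM2l (expR_ge0 _) GB) _.
by rewrite mulrCA -expRD /b mulrBl addrA addNr sub0r.
Qed.

(** The resonant antiderivative and the constant of integration both sit at the exponent [a];
    together they lengthen the polynomial there by at most one. *)
Lemma expansion_step E (m : R -> nat) P Q (a N N' : R) : uniq E -> a \in E -> N' < N ->
  (forall x : R, 0 <= x -> is_derive x 1 P (Q x - a * P x)) ->
  has_expansion E m Q N -> has_expansion E (fun b => m b + (b == a))%N P N'.
Proof.
move=> uE aE NN dP [p [sp [K [T HT]]]].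
pose q b := projT1 (cid (poly_ode (a - b) (p b))).
have qE b : (q b)^`()%R + (a - b) *: q b = p b by rewrite /q; case: cid => /= ? [].
have qs b : (size (q b) <= size (p b) + (b == a))%N.
  by rewrite /q; case: cid => /= ? [_]; rewrite subr_eq0 eq_sym.
pose T' := Num.max T 0.
have T'0 : 0 <= T' by rewrite le_max lexx orbT.
have T'T x : T' <= x -> T <= x /\ 0 <= x.
  by rewrite ge_max => /andP[].
have dD x : T' <= x -> is_derive x 1 (fun x => P x - expsum E q x)
    ((Q x - expsum E p x) - a * (P x - expsum E q x)).
  move=> Tx; apply: (is_derive_eq (isdB (dP x (T'T x Tx).2) (expsum_ode E x qE))); ring.
have [c [K' H]] := @ode_remainder _ (fun x => Q x - expsum E p x) a N N' K T' NN T'0 dD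
  (fun x Tx => HT x (T'T x Tx).1 (T'T x Tx).2).
exists (fun b => q b + (c *+ (b == a))%:P); split.
  move=> b; apply: leq_trans (size_polyD _ _) _; rewrite geq_max; apply/andP; split.
    by apply: leq_trans (qs b) _; rewrite leq_add2r.
  case: (b == a); last by rewrite mulr0n size_poly0.
  by apply: leq_trans (size_polyC_leq1 _) _; rewrite addn1.
exists K', T' => x Tx x0.
suff -> : expsum E (fun b => q b + (c *+ (b == a))%:P) x = expsum E q x + c * expR (- (a * x)).
  by rewrite opprD addrA; exact: H.
rewrite {1}/expsum (eq_bigr (fun b => (q b).[x] * expR (- (b * x)) +
  (c *+ (b == a)) * expR (- (b * x)))); last first.
  by move=> b _; rewrite hornerD hornerC mulrDl.
rewrite big_split/=; congr (_ + _).
rewrite (bigD1_seq a)//= eqxx mulr1n big1 ?addr0// => b /negbTE ->.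
by rewrite mulr0n mul0r.
Qed.

Fixpoint ode_chain s P L : Prop := match s with
  | [::] => forall x : R, 0 <= x -> P x = L x
  | a :: s' => exists Q, (forall x : R, 0 <= x -> is_derive x 1 P (Q x - a * P x)) /\
      ode_chain s' Q L
  end.

Lemma ode_chain_expansion E s P L (M N : R) : uniq E -> {subset s <= E} -> N < M ->
  (exists K, forall x : R, 0 <= x -> `|L x| <= K * expR (- (M * x))) ->
  ode_chain s P L -> has_expansion E (fun b => count_mem b s) P N.
Proof.
move=> uE + + bL; elim: s P N => [|a s IH] P N sE NM.
  case: bL => K bL PL; exists (fun=> 0); split; first by move=> b; rewrite size_poly0.
  exists K, 0 => x _ x0; rewrite PL// /expsum big1 ?subr0; last first.
    by move=> b _; rewrite horner0 mul0r.
  apply: le_trans (bL x x0) _; rewrite ler_wpM2l//.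
    by have := le_trans (normr_ge0 _) (bL 0 (lexx _)); rewrite pmulr_lge0// expR_gt0.
  by rewrite ler_expR lerN2 ler_wpM2r// ltW.
(* Each equation costs an arbitrarily small amount of decay; half of the remaining gap is spent on
   it. *)
move=> [Q [dP ch]]; pose N' := (N + M) / 2.
have NN' : N < N' by rewrite /N'; lra.
have N'M : N' < M by rewrite /N'; lra.
have := @expansion_step E _ P Q a N' N uE (sE a (mem_head _ _)) NN' dP
  (IH Q N' (fun b bs => sE b (ltac:(by rewrite inE bs orbT))) N'M ch).
rewrite (_ : (fun b => _) = (fun b => count_mem b (a :: s)))//.
by apply/funext => b /=; rewrite addnC eq_sym.
Qed.

End ExpPoly.

(** * Uniqueness of expansions in exponentials with polynomial coefficients *)

Section Uniqueness.
Variable R : realType.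
Implicit Types (F G : R -> R) (E s : seq R).

Definition tends0 F := forall e, 0 < e -> exists T, forall x : R, T <= x -> 0 <= x -> `|F x| <= e.

Lemma tends0_le F G T : (forall x : R, T <= x -> 0 <= x -> `|F x| <= `|G x|) -> tends0 G -> tends0 F.
Proof.
move=> FG t0 e e0; have [T' H] := t0 e e0; exists (Num.max T T') => x.
by rewrite ge_max => /andP[Tx T'x] x0; apply: le_trans (FG _ _ _) (H _ _ _).
Qed.

Lemma tends0_add F G : tends0 F -> tends0 G -> tends0 (fun x => F x + G x).
Proof.
move=> tF tG e e0; have e2 : 0 < e / 2 by rewrite divr_gt0.
have [T1 H1] := tF _ e2; have [T2 H2] := tG _ e2.
exists (Num.max T1 T2) => x; rewrite ge_max => /andP[T1x T2x] x0.
apply: le_trans (ler_normD _ _) _; rewrite (splitr e).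
by apply: lerD; [exact: H1|exact: H2].
Qed.

Lemma tends0_scale F c : tends0 F -> tends0 (fun x => c * F x).
Proof.
move=> tF e e0; have c1 : 0 < `|c| + 1 by rewrite ltr_wpDl.
have [T H] := tF _ (divr_gt0 e0 c1); exists T => x Tx x0; rewrite normrM.
apply: le_trans (ler_wpM2l (normr_ge0 _) (H x Tx x0)) _.
by rewrite mulrCA; apply: ler_piMr; [exact: ltW|rewrite ler_pdivrMr// mul1r lerDl].
Qed.

Lemma tends0_sum E (F : R -> R -> R) : (forall b, b \in E -> tends0 (F b)) ->
  tends0 (fun x => \sum_(b <- E) F b x).
Proof.
elim: E => [|b E IH] H.
  by move=> e e0; exists 0 => x _ _; rewrite big_nil normr0 ltW.
have := tends0_add (H b (mem_head _ _)) (IH (fun c cE => H c (ltac:(by rewrite inE cE orbT)))).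
by apply: (@tends0_le _ _ 0) => x _ _; rewrite big_cons.
Qed.

Lemma tends0_exp (a : R) : 0 < a -> tends0 (fun x => expR (- (a * x))).
Proof.
move=> a0 e e0; exists (e^-1 / a) => x; rewrite ler_pdivrMr// mulrC => h x0.
rewrite ger0_norm ?expR_ge0// expRN -[leRHS]invrK lef_pV2 ?posrE ?expR_gt0 ?invr_gt0//.
by apply: le_trans h _; apply: le_trans (expR_ge1Dx _); rewrite lerDr.
Qed.

Lemma tends0_poly_exp (p : {poly R}) (a : R) : 0 < a ->
  tends0 (fun x => p.[x] * expR (- (a * x))).
Proof.
elim/poly_ind: p a => [|p c IH] a a0.
  by move=> e e0; exists 0 => x _ _; rewrite horner0 mul0r normr0 ltW.
have a2 : 0 < a / 2 by rewrite divr_gt0.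
have := tends0_add (tends0_scale (2 / a) (IH _ a2)) (tends0_scale `|c| (tends0_exp a0)).
move=> H e e0.
have [T1 H1] := tends0_scale (2 / a) (IH _ a2) (divr_gt0 e0 (ltr0n R 2)).
have [T2 H2] := tends0_scale c (tends0_exp a0) (divr_gt0 e0 (ltr0n R 2)).
exists (Num.max T1 T2) => x; rewrite ge_max => /andP[T1x T2x] x0.
have h1 := H1 x T1x x0; have h2 := H2 x T2x x0.
rewrite hornerMXaddC mulrDl [leRHS](splitr e); apply: le_trans (ler_normD _ _) _.
apply: lerD h2; apply: le_trans h1.
have E2 : expR (- (a * x)) = expR (- (a / 2 * x)) * expR (- (a / 2 * x)).
  by rewrite -expRD; congr expR; field.
have hx : x * expR (- (a / 2 * x)) <= 2 / a.
  rewrite expRN ler_pdivrMr ?expR_gt0//.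
  apply: (@le_trans _ _ (2 / a * (a / 2 * x))); first by rewrite (_ : _ * (_ * x) = x)//; field; rewrite gt_eqF.
  apply: ler_wpM2l; first by rewrite divr_ge0// ltW.
  by apply: le_trans (expR_ge1Dx _); rewrite lerDr.
have aa : 0 <= 2 / a by rewrite divr_ge0// ltW.
rewrite E2 [X in `|X| <= _](_ : _ = x * expR (- (a / 2 * x)) * (p.[x] * expR (- (a / 2 * x)))); last by ring.
rewrite normrM [leRHS]normrM; apply: ler_wpM2r => //.
by rewrite !ger0_norm// mulr_ge0// expR_ge0.
Qed.

(** The difference p(x + 1) - p(x) is shorter than p and also tends to 0, so by induction it
    vanishes; p is then 1-periodic, and a periodic function tending to 0 has too many zeros for a
    nonzero polynomial. *)
Lemma poly_tends0_eq0 (p : {poly R}) : tends0 (horner p) -> p = 0.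
Proof.
move: {2}(size p) (leqnn (size p)) => m; elim: m p => [|m IH] p sp t0.
  by apply/eqP; rewrite -size_poly_leq0.
pose q := p \Po ('X + 1%:P) - p.
have qE x : q.[x] = p.[x + 1] - p.[x].
  by rewrite hornerD hornerN horner_comp hornerD hornerX hornerC.
have sX : size ('X + 1%:P : {poly R}) = 2%N by rewrite size_XaddC.
have q0 : q = 0.
  apply: IH; last first.
    move=> e e0; have e2 : 0 < e / 2 by rewrite divr_gt0.
    have [T H] := t0 _ e2; exists T => x Tx x0; rewrite qE.
    apply: le_trans (ler_normB _ _) _; rewrite (splitr e); apply: lerD; apply: H => //.
      by rewrite ler_wpDr.
    by rewrite addr_ge0.
  rewrite /q; have [->|p0] := eqVneq p 0; first by rewrite comp_poly0 subr0 size_poly0.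
  have sc : size (p \Po ('X + 1%:P)) = size p by rewrite size_comp_poly2.
  apply/leq_sizeP => i mi; rewrite coefB.
  have [h|h] := leqP (size p) i; first by rewrite !nth_default ?subr0// sc.
  have ei : i = (size p).-1 by lia.
  have sX1 : (1 < size (('X + 1%:P)%R : {poly R}))%N by rewrite sX.
  have := lead_coef_comp p sX1.
  rewrite lead_coefXaddC expr1n mulr1 /lead_coef sc -ei => ->.
  by rewrite subrr.
have per (k : nat) x : p.[x + k%:R] = p.[x].
  elim: k => [|k IHk]; first by rewrite addr0.
  by rewrite -addn1 natrD addrA -[RHS]IHk; apply/eqP; rewrite -subr_eq0 -qE q0 horner0.
have pz x : 0 <= x -> p.[x] = 0.
  move=> x0; apply/eqP; rewrite -normr_le0; apply/ler_addgt0Pr => e e0; rewrite add0r.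
  have [T H] := t0 e e0; have [k Tk] : exists k : nat, T <= k%:R.
    by exists (Num.bound `|T|); apply: le_trans (ler_norm _) _; rewrite ltW// archi_boundP.
  rewrite -(per k x); apply: H; first by apply: le_trans Tk _; rewrite lerDr.
  by rewrite addr_ge0.
apply/eqP/negP => /negP p0.
have := max_poly_roots (rs := [seq k%:R : R | k <- iota 0 (size p)]) p0.
rewrite size_map size_iota ltnn => H; have //: false; apply: H.
  by apply/allP => _ /mapP[k _ ->]; rewrite /root pz.
by rewrite map_inj_uniq ?iota_uniq// => a b /eqP; rewrite eqr_nat => /eqP.
Qed.

Lemma seq_has_min (s : seq R) : s != [::] -> exists2 b, b \in s & forall c, c \in s -> b <= c.
Proof.
elim: s => [//|a s IH] _; have [->|s0] := eqVneq s [::].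
  by exists a; rewrite ?mem_head// => c; rewrite inE => /eqP ->.
have [b bs bmin] := IH s0; have [ab|ba] := leP a b.
  exists a; rewrite ?mem_head// => c; rewrite inE => /orP[/eqP ->//|/bmin].
  exact: le_trans.
exists b; first by rewrite inE bs orbT.
by move=> c; rewrite inE => /orP[/eqP ->|/bmin//]; exact: ltW.
Qed.

(** Multiply by exp (b0 x), where b0 is the smallest exponent with a nonzero polynomial: all other
    terms tend to 0, hence so does that polynomial. *)
Lemma expsum_unique E (p : R -> {poly R}) (N K T : R) : uniq E ->
  (forall x : R, T <= x -> 0 <= x -> `|expsum E p x| <= K * expR (- (N * x))) ->
  forall b, b \in E -> b < N -> p b = 0.
Proof.
move=> uE H; pose s := [seq b <- E | (b < N) && (p b != 0)].
have [s0|/seq_has_min[b0]] := eqVneq s [::].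
  move=> b bE bN; apply/eqP/negP => /negP pb.
  have : b \in s by rewrite mem_filter bN pb bE.
  by rewrite s0.
rewrite mem_filter => /andP[/andP[b0N pb0] b0E] bmin; exfalso.
move/eqP: pb0; apply; apply: poly_tends0_eq0.
have t1 : tends0 (fun x => K * expR (- ((N - b0) * x))).
  by apply: tends0_scale; apply: tends0_exp; rewrite subr_gt0.
have t2 : tends0 (fun x => \sum_(b <- rem b0 E) (p b).[x] * expR (- ((b - b0) * x))).
  apply: tends0_sum => b; rewrite mem_rem_uniq// inE => /andP[/= bb0 bE].
  have [pb|pb] := eqVneq (p b) 0.
    by move=> e e0; exists 0 => x _ _; rewrite pb horner0 mul0r normr0 ltW.
  apply: tends0_poly_exp; rewrite subr_gt0 lt_neqAle eq_sym bb0/=.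
  have [bN|Nb] := ltP b N; first by apply: bmin; rewrite mem_filter bN pb bE.
  by apply: ltW; apply: lt_le_trans Nb.
have t1' : tends0 (fun x => expR (b0 * x) * expsum E p x).
  apply: (@tends0_le _ _ T) t1 => x Tx x0; rewrite normrM ger0_norm ?expR_ge0//.
  apply: le_trans (ler_norm _).
  apply: le_trans (ler_wpM2l (expR_ge0 _) (H x Tx x0)) _.
  by rewrite mulrCA -expRD mulrBl opprB.
have := tends0_add t1' (tends0_scale (-1) t2); apply: (@tends0_le _ _ 0) => x _ _.
rewrite /expsum (perm_big _ (perm_to_rem b0E)) big_cons/= mulrDr mulrCA -expRD subrr expR0 mulr1.
rewrite mulr_sumr (eq_bigr (fun b => (p b).[x] * expR (- ((b - b0) * x)))).
  by rewrite mulN1r addrK.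
by move=> b _; rewrite mulrCA -expRD mulrBl opprB.
Qed.

(** The data may change with the order [N]; uniqueness forces the coefficient at b to be the same in
    every order beyond b. *)
Lemma consistent_expansion (A : set R) (m : nat) (P : R -> R) :
  (forall N : nat, exists E (p : R -> {poly R}),
     [/\ uniq E, forall b, b \in E -> A b, forall b, (size (p b) <= m)%N &
      exists K T, forall x : R, T <= x -> 0 <= x ->
        `|P x - expsum E p x| <= K * expR (- (N%:R * x))]) ->
  exists p : R -> {poly R}, (forall b, (size (p b) <= m)%N) /\
    forall (N : nat) L, uniq L -> (forall b, b \in L <-> A b /\ b <= N%:R) ->
    exists K T, forall x : R, T <= x -> 0 <= x ->
        `|P x - expsum L p x| <= K * expR (- (N%:R * x)).
Proof.
move=> H.
have H' N : exists Ep : seq R * (R -> {poly R}),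
  [/\ uniq Ep.1, forall b, b \in Ep.1 -> A b, forall b, (size (Ep.2 b) <= m)%N,
     forall b, b \notin Ep.1 -> Ep.2 b = 0 &
      exists K T, forall x : R, T <= x -> 0 <= x ->
        `|P x - expsum Ep.1 Ep.2 x| <= K * expR (- (N%:R * x))].
  have [E [p [uE EA sp [K [T b]]]]] := H N.
  exists (E, fun b => if b \in E then p b else 0); split => //=.
  - by move=> c; case: ifP => // _; rewrite size_poly0.
  - by move=> c /negbTE ->.
  - exists K, T => x Tx x0; have := b x Tx x0; rewrite /expsum.
    by rewrite (eq_big_seq (fun b => (if b \in E then p b else 0).[x] * expR (- (b * x))))//
      => c ->.
pose Ep N := projT1 (cid (H' N)).
have EpP N := projT2 (cid (H' N)); rewrite -/(Ep _) in EpP.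
have agree (N N' : nat) b : b < N%:R -> b < N'%:R -> (Ep N).2 b = (Ep N').2 b.
  move=> bN bN'; have [u1 _ _ z1 [K1 [T1 b1]]] := EpP N.
  have [u2 _ _ z2 [K2 [T2 b2]]] := EpP N'.
  pose E := undup ((Ep N).1 ++ (Ep N').1).
  have ext (F : seq R) (p : R -> {poly R}) x : uniq F -> {subset F <= E} ->
      (forall b, b \notin F -> p b = 0) -> expsum F p x = expsum E p x.
    move=> uF FE pz; rewrite /expsum [RHS](bigID (mem F))/= [X in _ + X]big1 ?addr0; last first.
      by move=> c cF; rewrite pz// horner0 mul0r.
    rewrite -[RHS]big_filter; apply: perm_big; apply: uniq_perm; rewrite ?filter_uniq ?undup_uniq//.
    by move=> c; rewrite mem_filter; case cF : (c \in F) => //=; rewrite (FE c cF).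
  have [bE|bE] := boolP (b \in E); last first.
    move: bE; rewrite mem_undup mem_cat negb_or => /andP[h1 h2].
    by rewrite z1 ?z2.
  pose N0 : R := Num.min N%:R N'%:R.
  have := @expsum_unique E (fun b => (Ep N).2 b - (Ep N').2 b) N0 (`|K1| + `|K2|) (Num.max T1 T2)
    (undup_uniq _) _ b bE.
  rewrite lt_min bN bN' => /(_ _ isT) h; apply/eqP; rewrite -subr_eq0; apply/eqP; apply: h.
  move=> x; rewrite ge_max => /andP[T1x T2x] x0.
  have -> : expsum E (fun b => (Ep N).2 b - (Ep N').2 b) x =
     (P x - expsum (Ep N').1 (Ep N').2 x) - (P x - expsum (Ep N).1 (Ep N).2 x).
    rewrite (ext (Ep N').1)//; last by move=> c cE; rewrite mem_undup mem_cat cE orbT.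
    rewrite (ext (Ep N).1)//; last by move=> c cE; rewrite mem_undup mem_cat cE.
    have sw (x1 x2 x3 : R) : x1 - x2 - (x1 - x3) = x3 - x2 by ring.
    rewrite sw.
    by rewrite /expsum -sumrB; apply: eq_bigr => c _; rewrite hornerD hornerN mulrBl.
  apply: le_trans (ler_normB _ _) _; rewrite addrC mulrDl.
  have mon (K M : R) : N0 <= M -> K * expR (- (M * x)) <= `|K| * expR (- (N0 * x)).
    move=> NM; apply: (@le_trans _ _ (`|K| * expR (- (M * x)))).
      by apply: ler_wpM2r; rewrite ?expR_ge0 ?ler_norm.
    by apply: ler_wpM2l => //; rewrite ler_expR lerN2; apply: ler_wpM2r.
  apply: lerD.
    by apply: le_trans (b1 x T1x x0) _; apply: mon; rewrite ge_min lexx.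
  by apply: le_trans (b2 x T2x x0) _; apply: mon; rewrite ge_min lexx orbT.
(* Any order beyond b can serve to define the coefficient at b. *)
pose M (b : R) := Num.bound `|b|.
have bM b : b < (M b)%:R by apply: le_lt_trans (ler_norm _) _; exact: archi_boundP.
exists (fun b => (Ep (M b)).2 b); split; first by move=> b; have [] := EpP (M b).
(* One order more than requested: exponents equal to [N] must be kept, while uniqueness covers only
   exponents strictly below the order. *)
move=> N L uL LA; have [uE EA _ zE [K [T HT]]] := EpP N.+1.
set E := (Ep N.+1).1 in uE EA zE HT; set p := (Ep N.+1).2 in zE HT.
have tl : tends0 (fun x => \sum_(b <- [seq b <- E | ~~ (b <= N%:R)])
    (p b).[x] * expR (- ((b - N%:R) * x))).
  apply: tends0_sum => b; rewrite mem_filter -ltNge => /andP[Nb _].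
  by apply: tends0_poly_exp; rewrite subr_gt0.
have [T' HT'] := tl 1 ltr01.
exists (`|K| + 1), (Num.max T T') => x; rewrite ge_max => /andP[Tx T'x] x0.
have -> : expsum L (fun b => (Ep (M b)).2 b) x = expsum [seq b <- E | b <= N%:R] p x.
  rewrite /expsum (eq_big_seq (fun b => (p b).[x] * expR (- (b * x)))); last first.
    move=> b /LA[_ bN]; rewrite /p (@agree (M b) N.+1 b)//.
    by apply: le_lt_trans bN _; rewrite ltr_nat.
  rewrite (bigID (mem E))/= [X in _ + X]big1 ?addr0; last first.
    by move=> c cF; rewrite zE// horner0 mul0r.
  rewrite -[LHS]big_filter; apply: perm_big; apply: uniq_perm; rewrite ?filter_uniq//.
  move=> c; rewrite !mem_filter [RHS]andbC; case cE : (c \in E) => //=.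
  apply/idP/idP => [/LA[]//|cN]; apply/LA; split=> //; exact: EA.
have sp : expsum E p x = expsum [seq b <- E | b <= N%:R] p x +
    expR (- (N%:R * x)) * \sum_(b <- [seq b <- E | ~~ (b <= N%:R)])
    (p b).[x] * expR (- ((b - N%:R) * x)).
  rewrite {1}/expsum (bigID (fun b => b <= N%:R))/=.
  rewrite -[X in X + _ = _]big_filter -[X in _ + X = _]big_filter; congr (_ + _).
  rewrite mulr_sumr; apply: eq_bigr => b _.
  by rewrite mulrCA -expRD; congr (_ * expR _); ring.
have sw (x1 x2 x3 : R) : x1 - x2 = (x1 - (x2 + x3)) + x3 by ring.
set Y := expR _ * _ in sp; rewrite (sw _ _ Y) -sp.
apply: le_trans (ler_normD _ _) _; rewrite mulrDl; apply: lerD.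
  apply: le_trans (HT x Tx x0) _; apply: (@le_trans _ _ (`|K| * expR (- (N.+1%:R * x)))).
    by apply: ler_wpM2r; rewrite ?expR_ge0 ?ler_norm.
  apply: ler_wpM2l => //; rewrite ler_expR lerN2; apply: ler_wpM2r => //.
  by rewrite ler_nat.
rewrite normrM ger0_norm ?expR_ge0// mulrC; apply: ler_wpM2r; first exact: expR_ge0.
exact: HT'.
Qed.

End Uniqueness.

(** * Integrals over orthants in logarithmic coordinates *)

Section HalfLine.
Variable R : realType.
Implicit Types (G H k : R -> R) (b : bool).
Local Notation leb := (@lebesgue_measure R).

Lemma bounded_support_integrable k (M p q : R) : measurable_fun setT k ->
  (forall s, `|k s| <= M * \1_`[p, q] s) -> leb.-integrable setT (EFin \o k).
Proof.
move=> mk bk.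
apply: (@le_integrable _ _ _ leb setT measurableT _ (fun s => M%:E * (\1_`[p, q] s)%:E)%E).
- exact/measurable_EFinP.
- move=> s _ /=; rewrite lee_fin; apply: le_trans (bk s) (ler_norm _).
- by apply: integrableZl => //; exact: integrable_indic_itv.
Qed.

Lemma bounded_support_Rintegral k (M p q : R) : p <= q -> measurable_fun setT k ->
  (forall s, `|k s| <= M * \1_`[p, q] s) -> `|Rintegral leb setT k| <= M * (q - p).
Proof.
move=> pq mk bk.
have ik := bounded_support_integrable mk bk.
apply: le_trans (le_normr_Rintegral measurableT ik) _.
have i1 : leb.-integrable setT (EFin \o \1_`[p, q]) by exact: integrable_indic_itv.
have i2 : leb.-integrable setT (EFin \o (fun s => M * \1_`[p, q] s)).
  apply: (@eq_integrable _ _ _ leb setT measurableT (fun s => M%:E * (\1_`[p, q] s)%:E)%E) => //.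
  by apply: integrableZl => //; exact: integrable_indic_itv.
apply: (@le_trans _ _ (Rintegral leb setT (fun s => M * \1_`[p, q] s))).
  apply: le_Rintegral => //; first exact: (integrable_norm ik).
rewrite RintegralZl// /Rintegral integral_indic//= setIT lebesgue_measure_itv/= lte_fin.
case: ifPn => [//|]; rewrite -leNgt => qp.
have -> : q = p by apply/le_anti/andP.
by rewrite subrr /= mulr0.
Qed.

Lemma Rintegral_segment_FTC (F f : R -> R) (p q : R) : p < q ->
  (forall x, p <= x <= q -> is_derive x 1 F (f x)) ->
  (forall x, p <= x <= q -> {for x, continuous f}) ->
  Rintegral leb `[p, q]%classic f = F q - F p.
Proof.
move=> pq dF cf.
rewrite /Rintegral (@continuous_FTC2 R f F p q pq)//.
- apply: continuous_in_subspaceT => x; rewrite inE /= in_itv/=; exact: cf.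
- have cF x : p <= x <= q -> {for x, continuous F}.
    by move=> xpq; apply/differentiable_continuous/derivable1_diffP; apply: ex_derive; exact: dF.
  split.
  + move=> x; rewrite in_itv/= => /andP[a b]; apply: ex_derive; apply: dF; by rewrite !ltW.
  + by apply: cvg_at_right_filter; apply: cF; rewrite lexx ltW.
  + by apply: cvg_at_left_filter; apply: cF; rewrite lexx ltW.
- move=> x; rewrite in_itv/= => /andP[a b]; rewrite derive1E.
  by apply: derive_val; apply: dF; rewrite !ltW.
Qed.

Definition sgb b : R := if b then 1 else -1.
Definition hl b H (s : R) := if 0 < sgb b * s then H (- ln `|s|) else 0.
Definition Shl b H := Rintegral leb setT (hl b H).

(** Vanishing for v < c confines the integrand to |s| <= exp (- c). No decay is asked as v tends to
    infinity, because the measure exp (- v) dv is finite there. *)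
Definition half_adm (c M : R) H := [/\ continuous H, forall v, `|H v| <= M & forall v, v < c -> H v = 0].

Lemma measurable_hl b H : continuous H -> measurable_fun setT (hl b H).
Proof.
move=> cH; apply: measurable_fun_ifT.
- by apply: measurable_fun_ltr => //; apply: measurable_funM.
- apply: (@measurableT_comp _ _ _ _ _ _ H); first exact: continuous_measurable_fun.
  apply: measurableT_comp => //; apply: measurableT_comp => //.
- exact: measurable_cst.
Qed.

Definition hside b (p q : R) : R * R := if b then (p, q) else (- q, - p).

Lemma hside_le b p q : p <= q -> (hside b p q).1 <= (hside b p q).2.
Proof. by case: b => //=; rewrite lerN2. Qed.

Lemma hside_len b p q : (hside b p q).2 - (hside b p q).1 = q - p.
Proof. by case: b => //=; rewrite opprK addrC. Qed.

Lemma hside_mem b p q s : 0 < sgb b * s -> p <= `|s| <= q ->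
  s \in `[(hside b p q).1, (hside b p q).2].
Proof.
rewrite /sgb in_itv/=; case: b; rewrite ?mul1r ?mulN1r ?oppr_gt0 => s0 /=.
  by rewrite gtr0_norm.
by rewrite ltr0_norm// => /andP[h1 h2]; rewrite lerNl h2/= lerNr.
Qed.

Lemma hl_bound b (c M : R) H s : half_adm c M H ->
  `|hl b H s| <= M * \1_`[(hside b 0 (expR (- c))).1, (hside b 0 (expR (- c))).2] s.
Proof.
move=> [cH bH sH]; rewrite /hl.
have M0 : 0 <= M by apply: le_trans (bH 0).
case: ifP => s0; last by rewrite normr0 mulr_ge0// indicE ler0n.
have sn0 : 0 < `|s| by rewrite normr_gt0; apply: contraTneq s0 => ->; rewrite mulr0 ltxx.
have [sc|sc] := leP `|s| (expR (- c)).
  rewrite indicE mem_set ?mulr1//=.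
  by apply: hside_mem => //; rewrite normr_ge0.
rewrite sH ?normr0 ?mulr_ge0// ?indicE ?ler0n//.
by rewrite ltrNl -ltr_expR lnK.
Qed.

Lemma hl_integrable b (c M : R) H : half_adm c M H -> leb.-integrable setT (EFin \o hl b H).
Proof.
move=> aH; apply: bounded_support_integrable (fun s => hl_bound b s aH).
by apply: measurable_hl; case: aH.
Qed.

Lemma Shl_bound b (c M : R) H : half_adm c M H -> `|Shl b H| <= M * expR (- c).
Proof.
move=> aH; have e0 := expR_ge0 (- c).
have := @bounded_support_Rintegral _ _ _ _ (hside_le b e0) _ (fun s => hl_bound b s aH).
by rewrite hside_len subr0; apply; apply: measurable_hl; case: aH.
Qed.

Lemma Shl_lin b (c M1 M2 : R) G H (x y : R) : half_adm c M1 G -> half_adm c M2 H ->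
  Shl b (fun v => x * G v + y * H v) = x * Shl b G + y * Shl b H.
Proof.
move=> aG aH.
have aZ (z M : R) K : half_adm c M K -> half_adm c (`|z| * M) (fun v => z * K v).
  move=> [cK bK sK]; split.
  - by move=> v; apply: continuousM; [exact: cst_continuous|exact: cK].
  - by move=> v; rewrite normrM ler_wpM2l.
  - by move=> v vc; rewrite sK// mulr0.
have E : hl b (fun v => x * G v + y * H v) = (fun s => x * hl b G s + y * hl b H s).
  by apply/funext => s; rewrite /hl; case: ifP => // _; rewrite !mulr0 addr0.
have Ez z K : (fun s => z * hl b K s) = hl b (fun v => z * K v).
  by apply/funext => s; rewrite /hl; case: ifP => // _; rewrite mulr0.
rewrite /Shl E RintegralD//.
- by rewrite RintegralZl ?RintegralZl//; [exact: hl_integrable aH|exact: hl_integrable aG].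
- by rewrite Ez; apply: hl_integrable (aZ x _ _ aG).
- by rewrite Ez; apply: hl_integrable (aZ y _ _ aH).
Qed.

Lemma sgb_norm b s : 0 < sgb b * s -> `|s| = sgb b * s.
Proof.
rewrite /sgb; case: b; rewrite ?mul1r ?mulN1r ?oppr_gt0 => s0; first by rewrite gtr0_norm.
by rewrite ltr0_norm.
Qed.

Lemma ln_norm_derive b s : 0 < sgb b * s -> is_derive s 1 (fun s => - ln (sgb b * s)) (- s^-1).
Proof.
move=> s0; apply: isdN.
have D := isd_comp (is_derive1_ln s0) (isd_mulc (sgb b) s); apply: (is_derive_eq D).
have sn : s != 0 by apply: contraTneq s0 => ->; rewrite mulr0 ltxx.
have bn : sgb b != 0 by rewrite /sgb; case: b {s0 D}; rewrite ?oner_eq0// oppr_eq0 oner_eq0.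
by field; rewrite bn sn.
Qed.

(** The derivative of s G(- ln |s|) is (G - dG)(- ln |s|). It is integrated over eta <= |s| <= B,
    with B beyond the support, and eta then tends to 0. *)
Lemma Shl_IBP b (c M : R) G dG : half_adm c M G -> half_adm c M dG ->
  (forall v : R, is_derive v 1 G (dG v)) -> Shl b dG = Shl b G.
Proof.
move=> aG adG der; have [cG bG sG] := aG; have [cdG bdG sdG] := adG.
have M0 : 0 <= M by apply: le_trans (bG 0).
pose H v := 1 * G v + (-1) * dG v.
suff : Shl b H = 0.
  by rewrite (Shl_lin _ _ _ aG adG) mul1r mulN1r => /eqP; rewrite subr_eq0 => /eqP.
have aH : half_adm c (M + M) H.
  split.
  - move=> v; apply: (@continuousD _ _ _ (fun v => 1 * G v) (fun v => -1 * dG v)).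
      by apply: continuousM; [exact: cst_continuous|exact: cG].
    by apply: continuousM; [exact: cst_continuous|exact: cdG].
  - by move=> v; rewrite /H mul1r mulN1r; apply: le_trans (ler_normB _ _) _; apply: lerD.
  - by move=> v vc; rewrite /H sG// sdG// !mulr0 addr0.
have [cH bH sH] := aH.
apply/eqP; rewrite -normr_le0; apply/ler_addgt0Pr => e e0; rewrite add0r.
pose B := expR (- c) + 1.
have B0 : 0 < B by rewrite ltr_wpDl// expR_ge0.
(* The total error is 3 M eta: M eta from the boundary term at eta, and 2 M eta from the part of the
   half-line closer to 0. *)
pose eta := Num.min (B / 2) (e / (3 * M + 1)).
have M31 : 0 < 3 * M + 1 by rewrite ltr_wpDl// mulr_ge0.
have eta0 : 0 < eta by rewrite lt_min !divr_gt0.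
have etaB : eta < B by rewrite gt_min ltr_pdivrMr// ltr_pMr// ltr1n.
have etae : 3 * M * eta <= e.
  apply: (@le_trans _ _ ((3 * M + 1) * eta)); first by apply: ler_wpM2r; rewrite ?lerDl// ltW.
  by rewrite mulrC -ler_pdivlMr// ge_min lexx orbT.
pose A : set R := `[(hside b eta B).1, (hside b eta B).2]%classic.
have inA s : A s -> 0 < sgb b * s /\ eta <= sgb b * s <= B.
  rewrite /A /= in_itv/= /sgb; case: (b) => /=; rewrite ?mul1r ?mulN1r.
    by move=> /andP[h1 h2]; split; [exact: lt_le_trans h1|rewrite h1 h2].
  move=> /andP[h1 h2]; have h3 : eta <= - s by rewrite lerNr.
  by split; [exact: lt_le_trans h3|rewrite h3/= lerNl].
pose F s := s * G (- ln (sgb b * s)).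
have SA : Rintegral leb A (fun s => H (- ln (sgb b * s))) =
    F (hside b eta B).2 - F (hside b eta B).1.
  apply: Rintegral_segment_FTC.
  - by case: (b) => //=; rewrite ltrN2.
  - move=> s sA; have [s0 _] : 0 < sgb b * s /\ eta <= sgb b * s <= B by apply: inA; rewrite /A /= in_itv.
    have sn : s != 0 by apply: contraTneq s0 => ->; rewrite mulr0 ltxx.
    have D := isdM (is_derive_id s 1) (isd_comp
      (h := fun s => - ln (sgb b * s)) (der (- ln (sgb b * s))) (ln_norm_derive s0)).
    by apply: (is_derive_eq D); rewrite /H; field.
  - move=> s sA; have [s0 _] : 0 < sgb b * s /\ eta <= sgb b * s <= B by apply: inA; rewrite /A /= in_itv.
    apply: (@continuous_comp _ _ _ (fun s => - ln (sgb b * s)) H); last exact: cH.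
    apply/differentiable_continuous/derivable1_diffP; apply: ex_derive; exact: ln_norm_derive.
have FB s : sgb b * s = B -> F s = 0.
  move=> sB; rewrite /F sB sG ?mulr0// ltrNl -ltr_expR lnK ?posrE// /B ltrDl//.
have Fe s : sgb b * s = eta -> `|F s| <= M * eta.
  move=> se; rewrite /F se normrM mulrC; apply: ler_pM => //.
  by rewrite (@sgb_norm b) ?se.
have SAb : `|Rintegral leb A (fun s => H (- ln (sgb b * s)))| <= M * eta.
  rewrite SA; case: (b) (FB) (Fe) => /= FB' Fe'.
    rewrite FB' ?mul1r// sub0r normrN; exact: (Fe' eta (mul1r _)).
  rewrite [F (- B)]FB' ?mulN1r ?opprK// subr0; apply: Fe'; by rewrite mulN1r opprK.
have mA : measurable A by exact: measurable_itv.
have iH := hl_integrable b aH.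
rewrite /Shl -(setUv A) Rintegral_setU//; last 3 first.
- exact: measurableC.
- by rewrite setUv.
- by apply/disj_setPCl.
apply: le_trans (ler_normD _ _) _.
have -> : Rintegral leb A (hl b H) = Rintegral leb A (fun s => H (- ln (sgb b * s))).
  apply: eq_Rintegral => s; rewrite inE => /inA[s0 _].
  by rewrite /hl s0 (@sgb_norm b).
have rest : `|Rintegral leb (~` A) (hl b H)| <= (M + M) * eta.
  rewrite Rintegral_mkcond.
  have := @bounded_support_Rintegral (hl b H \_ (~` A)) (M + M) (hside b 0 eta).1 (hside b 0 eta).2.
  rewrite hside_len subr0; apply; first by apply: hside_le; exact: ltW.
    apply/(measurable_restrictT _ (measurableC mA)).
    by apply: measurable_funTS; exact: measurable_hl.
  move=> s; rewrite /patch; case: ifPn => [|_]; last first.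
    by rewrite normr0 mulr_ge0 ?addr_ge0// indicE ler0n.
  rewrite inE => nA; rewrite /hl; case: ifP => s0; last first.
    by rewrite normr0 mulr_ge0 ?addr_ge0// indicE ler0n.
  have sn0 : 0 < `|s| by rewrite (@sgb_norm b).
  have [se|se] := leP `|s| eta.
    rewrite indicE mem_set ?mulr1//=; apply: hside_mem => //; by rewrite normr_ge0.
  have [sB|sB] := leP `|s| B.
    by exfalso; apply: nA; rewrite /A /=; apply: hside_mem => //; rewrite sB ltW.
  rewrite sH ?normr0 ?mulr_ge0 ?addr_ge0// ?indicE ?ler0n//.
  by rewrite ltrNl -ltr_expR lnK//; apply: lt_trans sB; rewrite ltrDl.
apply: le_trans (lerD SAb rest) _; apply: le_trans etae; lra.
Qed.

End HalfLine.

Section Quadratic.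
Variable R : realType.
Implicit Types K dK : R -> R.

(** Parameter integrals are differentiated through this criterion: a uniform quadratic remainder
    passes through any bounded linear functional, with no limit taken under the integral. *)
Lemma is_derive_quadratic K (v d C : R) :
  (forall r, `|K (v + r) - K v - r * d| <= C * r ^+ 2) -> is_derive v 1 K d.
Proof.
move=> H.
have cv : (fun h : R => h^-1 *: ((K \o shift v) (h *: 1) - K v)) @ 0^' --> d.
  apply/cvgrPdist_le => e e0.
  have K0 : 0 < `|C| + 1 by rewrite ltr_wpDl.
  have : \forall h \near (0 : R)^', (h != 0) /\ `|h| <= e / (`|C| + 1).
    near=> h; split; first by near: h; exact: nbhs_dnbhs_neq.
    by near: h; apply: dnbhs0_le; rewrite divr_gt0.
  apply: filterS => h [h0 he] /=.
  rewrite [h *: 1]mulr1 [h + v]addrC [_ *: _]mulrC distrC.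
  have := H h; set X := K (v + h) - K v => Hh.
  have -> : X / h - d = (X - h * d) / h by field.
  rewrite normrM normfV ler_pdivrMr ?normr_gt0//.
  apply: le_trans Hh _; apply: (@le_trans _ _ ((`|C| + 1) * `|h| * `|h|)).
    rewrite -mulrA -expr2 real_normK ?num_real//; apply: ler_wpM2r; first exact: sqr_ge0.
    by apply: le_trans (ler_norm _) _; rewrite lerDl.
  by apply: ler_wpM2r => //; rewrite mulrC -ler_pdivlMr.
by split; [apply/cvg_ex; exists d|exact: (cvg_lim _ cv)].
Unshelve. all: by end_near. Qed.

Lemma mvt_signed K dK (v r : R) : (forall x : R, is_derive x 1 K (dK x)) ->
  exists2 c, `|c| <= `|r| & K (v + r) - K v = dK (v + c) * r.
Proof.
move=> D; have [|c cr] := @line_MVT_signed R _ K v 1 r.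
  by move=> x _; have [] := D (v + x *: 1).
rewrite [r *: 1]mulr1 [c *: 1]mulr1 => E; exists c => //; rewrite E.
by congr (_ * _); apply: derive_val; exact: D.
Qed.

Lemma quadratic_remainder K dK ddK (v r C : R) :
  (forall x : R, is_derive x 1 K (dK x)) -> (forall x : R, is_derive x 1 dK (ddK x)) ->
  (forall x, `|ddK x| <= C) -> `|K (v + r) - K v - r * dK v| <= C * r ^+ 2.
Proof.
move=> D1 D2 b; have [c cr E] := mvt_signed v r D1; have [c' c'c E'] := mvt_signed v c D2.
rewrite E [r * _]mulrC -mulrBl E' !normrM -mulrA.
apply: ler_pM => //; rewrite -[r ^+ 2]ger0_norm ?sqr_ge0// expr2 normrM.
by apply: ler_wpM2r.
Qed.

End Quadratic.

(** * Iterated integrals and integration by parts in several variables *)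

Section IteratedIntegral.
Variable R : realType.

Definition cons_row (n : nat) (v : R) (y : 'rV[R]_n) : 'rV[R]_n.+1 :=
  \row_(i < n.+1) match unlift ord0 i with Some j => y ord0 j | None => v end.

Lemma cons_row0 n v (y : 'rV[R]_n) : cons_row v y ord0 ord0 = v.
Proof. by rewrite mxE unlift_none. Qed.

Lemma cons_rowS n v (y : 'rV[R]_n) j : cons_row v y ord0 (lift ord0 j) = y ord0 j.
Proof. by rewrite mxE liftK. Qed.

Lemma cons_row_evec0 n v r (y : 'rV[R]_n) :
  cons_row (v + r) y = cons_row v y + r *: evec R ord0.
Proof.
apply/rowP => i; rewrite !mxE eqxx/=; case: unliftP => [j|] -> /=.
  by rewrite mulr0 addr0.
by rewrite mulr1.
Qed.

Lemma cons_row_evecS n v r (y : 'rV[R]_n) j :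
  cons_row v (y + r *: evec R j) = cons_row v y + r *: evec R (lift ord0 j).
Proof.
apply/rowP => i; rewrite !mxE eqxx/=; case: unliftP => [k|] -> /=.
  by rewrite !mxE eqxx/= (inj_eq lift_inj).
by rewrite mulr0 addr0.
Qed.

Lemma cons_row_continuous n v : continuous (fun y : 'rV[R]_n => cons_row v y).
Proof.
move=> y; suff : (fun z => cons_row v z) @ (nbhs y) --> cons_row v y by [].
apply/cvgrPdist_le => e e0; near=> z.
apply: norm_row_le; first exact: ltW.
move=> i; rewrite !mxE; case: unliftP => [j _|_]; last by rewrite subrr normr0 ltW.
have := norm_coord (y - z) j; rewrite !mxE => /le_trans; apply.
by near: z; exact: cvgr_dist_le.
Unshelve. all: by end_near. Qed.

Fixpoint bc (N n : nat) (h : 'rV[R]_n -> R) : Prop :=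
  [/\ continuous h, exists C, forall u, `|h u| <= C &
    if N is N'.+1 then (forall u i, derivable h u (evec R i)) /\
       forall i, bc N' (fun u => 'D_(evec R i) h u)
    else True].

Lemma bc_bound N n (h : 'rV[R]_n -> R) : bc N h -> exists C, forall u, `|h u| <= C.
Proof. by case: N => [|N] []. Qed.

Lemma bc_der N n (h : 'rV[R]_n -> R) u i : bc N.+1 h ->
  is_derive u (evec R i) h ('D_(evec R i) h u).
Proof. by move=> [_ _ [d _]]; apply/derivableP. Qed.

Lemma bc_step N n (h : 'rV[R]_n -> R) i : bc N.+1 h -> bc N (fun u => 'D_(evec R i) h u).
Proof. by move=> [_ _ [_ d]]; exact: d. Qed.

Lemma bc_S N n (h : 'rV[R]_n -> R) : bc N.+1 h -> bc N h.
Proof.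
elim: N h => [|N IH] h [c b [d st]]; first by split.
by split=> //; split=> // i; apply: IH.
Qed.

Definition supp_ge n (c : R) (h : 'rV[R]_n -> R) := forall (u : 'rV[R]_n) i, u ord0 i < c -> h u = 0.

Lemma supp_ge_derive n c (h : 'rV[R]_n -> R) v : supp_ge c h -> supp_ge c (fun u => 'D_v h u).
Proof.
move=> sh u i ui; rewrite (@near_eq_derive _ _ _ h (cst 0)); first by rewrite derive_cst.
near=> x; apply: (sh x i).
near: x; have := @coord_continuous R 1 n ord0 i u => /(_ [set z | z < c]); apply.
by apply: open_nbhs_nbhs; split=> //; exact: open_lt.
Unshelve. all: by end_near. Qed.

Lemma is_derive_slice n (h : 'rV[R]_n.+1 -> R) v y j d :
  is_derive (cons_row v y) (evec R (lift ord0 j)) h d ->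
  is_derive y (evec R j) (fun y => h (cons_row v y)) d.
Proof.
move=> /is_derive_lineP H; apply/is_derive_lineP.
rewrite (_ : (fun r : R => h (cons_row v (y + r *: evec R j)))
   = (fun r => h (cons_row v y + r *: evec R (lift ord0 j))))//.
by apply/funext => r; rewrite cons_row_evecS.
Qed.

Lemma is_derive_head n (h : 'rV[R]_n.+1 -> R) v y d :
  is_derive (cons_row v y) (evec R ord0) h d ->
  is_derive v 1 (fun v => h (cons_row v y)) d.
Proof.
move=> /is_derive_lineP H; apply/is_derive_lineP.
rewrite (_ : (fun r : R => h (cons_row (v + r *: 1) y))
   = (fun r => h (cons_row v y + r *: evec R ord0)))//.
by apply/funext => r; rewrite -cons_row_evec0 [r *: 1]mulr1.
Qed.

Lemma slice_derive N n (h : 'rV[R]_n.+1 -> R) v j : bc N.+1 h ->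
  (fun y => 'D_(evec R j) (fun y => h (cons_row v y)) y) =
  (fun y => 'D_(evec R (lift ord0 j)) h (cons_row v y)).
Proof.
move=> bh; apply/funext => y; apply: derive_val; apply: is_derive_slice; exact: bc_der bh.
Qed.

Lemma bc_slice N n (h : 'rV[R]_n.+1 -> R) v : bc N h -> bc N (fun y => h (cons_row v y)).
Proof.
have cc (k : 'rV[R]_n.+1 -> R) : continuous k -> continuous (fun y => k (cons_row v y)).
  move=> ck y; apply: (@continuous_comp _ _ _ (fun y => cons_row v y) k); last exact: ck.
  exact: cons_row_continuous.
elim: N h => [|N IH] h.
  by move=> [c [C b] _]; split=> //; [exact: (cc h)|exists C => u; exact: b].
move=> bh; have [c [C b] [d st]] := bh; split; [exact: (cc h)|by exists C => u; exact: b|].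
split=> [y j|j].
  by apply: ex_derive; apply: is_derive_slice; exact: bc_der bh.
by rewrite (slice_derive _ _ bh); apply: (IH (fun u => 'D_(evec R (lift ord0 j)) h u)); exact: st.
Qed.

Lemma supp_slice n c (h : 'rV[R]_n.+1 -> R) v : supp_ge c h -> supp_ge c (fun y => h (cons_row v y)).
Proof. by move=> sh u i ui; apply: (sh _ (lift ord0 i)); rewrite cons_rowS. Qed.

Lemma bc_lin N n (h k : 'rV[R]_n -> R) (x y : R) : bc N h -> bc N k ->
  bc N (fun u => x * h u + y * k u).
Proof.
have cl (h' k' : 'rV[R]_n -> R) : continuous h' -> continuous k' ->
    continuous (fun u => x * h' u + y * k' u).
  move=> ch ck u; apply: (@continuousD _ _ _ (fun u => x * h' u) (fun u => y * k' u) u);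
    apply: continuousM.
  - exact: cst_continuous.
  - exact: ch.
  - exact: cst_continuous.
  - exact: ck.
have bl (h' k' : 'rV[R]_n -> R) : (exists C, forall u, `|h' u| <= C) ->
    (exists C, forall u, `|k' u| <= C) -> exists C, forall u, `|x * h' u + y * k' u| <= C.
  move=> [C1 b1] [C2 b2]; exists (`|x| * C1 + `|y| * C2) => u.
  by apply: le_trans (ler_normD _ _) _; rewrite !normrM; apply: lerD; apply: ler_wpM2l.
elim: N h k => [|N IH] h k bh bk; have [c1 b1 s1] := bh; have [c2 b2 s2] := bk.
  by split=> //; [exact: cl|exact: bl].
split; [exact: cl|exact: bl|].
have D u i : is_derive u (evec R i) (fun u => x * h u + y * k u)
    (x * 'D_(evec R i) h u + y * 'D_(evec R i) k u).
  by apply: isdD; apply: isdZ; [exact: bc_der bh|exact: bc_der bk].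
split=> [u i|i]; first by have [] := D u i.
rewrite (_ : (fun u => _) = (fun u => x * 'D_(evec R i) h u + y * 'D_(evec R i) k u)).
  by apply: IH; [exact: bc_step bh|exact: bc_step bk].
by apply/funext => u; apply: derive_val.
Qed.

(** This is the integral over the orthant of signs [e] of h(- ln |x_1|, ..., - ln |x_n|), iterated
    in the same order as [intn]. *)
Fixpoint Int (n : nat) (e : seq bool) : ('rV[R]_n -> R) -> R :=
  match n return ('rV[R]_n -> R) -> R with
  | 0 => fun h => h 0
  | n'.+1 => fun h => Shl (head false e) (fun v => Int (behead e) (fun y => h (cons_row v y)))
  end.

Definition int_adm (N n : nat) (c : R) (h : 'rV[R]_n -> R) := bc N h /\ supp_ge c h.

Lemma supp_ge_lin n c (h k : 'rV[R]_n -> R) (x y : R) : supp_ge c h -> supp_ge c k ->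
  supp_ge c (fun u => x * h u + y * k u).
Proof. by move=> sh sk u i ui; rewrite (sh u i)// (sk u i)// !mulr0 addr0. Qed.

(** One bounded derivative in the outer variable makes the inner integral Lipschitz, which provides
    the continuity, and thus the measurability, needed for the next integration. *)
Lemma slice_half_adm n (I : ('rV[R]_n -> R) -> R) (c : R) :
  (forall (h k : 'rV[R]_n -> R) x y, int_adm 1 c h -> int_adm 1 c k ->
     I (fun u => x * h u + y * k u) = x * I h + y * I k) ->
  (forall (h : 'rV[R]_n -> R) (M : R), int_adm 1 c h -> (forall u, `|h u| <= M) ->
     `|I h| <= M * expR (- c) ^+ n) ->
  forall (h : 'rV[R]_n.+1 -> R) (M : R), int_adm 1 c h -> (forall u, `|h u| <= M) ->
    half_adm c (M * expR (- c) ^+ n) (fun v => I (fun y => h (cons_row v y))).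
Proof.
move=> lin bd h M [bh sh] bM.
have adm v : int_adm 1 c (fun y => h (cons_row v y)).
  by split; [exact: bc_slice|exact: supp_slice].
have [C bC] := bc_bound (bc_step ord0 bh).
have C0 : 0 <= C by apply: le_trans (bC 0).
split=> [v|v|v vc].
- apply/cvgrPdist_le => eps e0.
  pose K := C * expR (- c) ^+ n + 1.
  have K0 : 0 < K by rewrite ltr_wpDl// mulr_ge0// exprn_ge0// expR_ge0.
  near=> w.
  have -> : I (fun y => h (cons_row v y)) - I (fun y => h (cons_row w y))
     = I (fun y => 1 * h (cons_row v y) + (-1) * h (cons_row w y)).
    by rewrite (lin _ _ _ _ (adm v) (adm w)) mul1r mulN1r.
  apply: (@le_trans _ _ (C * `|v - w| * expR (- c) ^+ n)).
    apply: bd; first by split; [apply: bc_lin; exact: bc_slice|apply: supp_ge_lin; exact: supp_slice].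
    move=> y; rewrite mul1r mulN1r.
    have D (z : R) : is_derive z 1 (fun v => h (cons_row v y)) ('D_(evec R ord0) h (cons_row z y)).
      by apply: is_derive_head; exact: bc_der bh.
    have [x _ E] := mvt_signed w (v - w) D; rewrite (addrC w (v - w)) subrK in E.
    by rewrite E normrM; apply: ler_wpM2r.
  have vw : `|v - w| <= eps / K by near: w; apply: cvgr_dist_le; [exact: cvg_id|exact: divr_gt0 e0 K0].
  apply: (@le_trans _ _ (K * `|v - w|)).
    by rewrite mulrAC; apply: ler_wpM2r => //; rewrite /K lerDl.
  by rewrite mulrC -ler_pdivlMr.
- by apply: bd => // y; exact: bM.
- apply/eqP; rewrite -normr_le0; have := bd (fun y => h (cons_row v y)) 0 (adm v).
  rewrite mul0r; apply=> y.
  by rewrite (sh _ ord0) ?normr0// cons_row0.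
Unshelve. all: by end_near. Qed.

(** The two properties need a common induction: linearity in dimension n + 1 requires integrable
    inner integrals, and [slice_half_adm] deduces these from both properties in dimension n. *)
Lemma Int_props n (e : seq bool) (c : R) :
  (forall (h k : 'rV[R]_n -> R) x y, int_adm 1 c h -> int_adm 1 c k ->
     Int e (fun u => x * h u + y * k u) = x * Int e h + y * Int e k) /\
  (forall (h : 'rV[R]_n -> R) (M : R), int_adm 1 c h -> (forall u, `|h u| <= M) ->
     `|Int e h| <= M * expR (- c) ^+ n).
Proof.
elim: n e => [|n IH] e; first by split=> //= h M _ b; rewrite expr0 mulr1.
have [lin bd] := IH (behead e); have Gadm := slice_half_adm lin bd.
split=> [h k x y ah ak|h M ah bM].
  have [C1 b1] := bc_bound ah.1; have [C2 b2] := bc_bound ak.1.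
  rewrite -(Shl_lin _ _ _ (Gadm h _ ah b1) (Gadm k _ ak b2)) /=; congr Shl.
  apply/funext => v; apply: lin.
    by split; [apply: bc_slice; exact: ah.1|apply: supp_slice; exact: ah.2].
  by split; [apply: bc_slice; exact: ak.1|apply: supp_slice; exact: ak.2].
by rewrite exprSr mulrA; apply: Shl_bound; exact: Gadm.
Qed.

Lemma Int_lin n (e : seq bool) (c : R) (h k : 'rV[R]_n -> R) x y : int_adm 1 c h -> int_adm 1 c k ->
  Int e (fun u => x * h u + y * k u) = x * Int e h + y * Int e k.
Proof. exact: (Int_props n e c).1. Qed.

Lemma Int_bound n (e : seq bool) (c : R) (h : 'rV[R]_n -> R) M : int_adm 1 c h ->
  (forall u, `|h u| <= M) -> `|Int e h| <= M * expR (- c) ^+ n.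
Proof. exact: (Int_props n e c).2. Qed.

Lemma Int_half_adm n (e : seq bool) (c : R) (h : 'rV[R]_n.+1 -> R) : int_adm 1 c h ->
  exists M, half_adm c M (fun v => Int e (fun y => h (cons_row v y))).
Proof.
move=> ah; have [M bM] := bc_bound ah.1; exists (M * expR (- c) ^+ n).
by have [lin bd] := Int_props n e c; exact: slice_half_adm lin bd _ _ ah bM.
Qed.

Lemma Int_derive n (e : seq bool) (c : R) (h : 'rV[R]_n.+1 -> R) (v : R) : int_adm 2 c h ->
  is_derive v 1 (fun v => Int e (fun y => h (cons_row v y)))
    (Int e (fun y => 'D_(evec R ord0) h (cons_row v y))).
Proof.
move=> [bh sh].
have [C bC] := bc_bound (bc_step ord0 (bc_step ord0 bh)).
have adm v' : int_adm 1 c (fun y => h (cons_row v' y)).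
  by split; [apply: bc_slice; exact: bc_S|exact: supp_slice].
have adm' v' : int_adm 1 c (fun y => 'D_(evec R ord0) h (cons_row v' y)).
  split; first by apply: (@bc_slice 1 n (fun u => 'D_(evec R ord0) h u)); exact: bc_step.
  by apply: (@supp_slice n c (fun u => 'D_(evec R ord0) h u)); exact: supp_ge_derive.
have admL v1 v2 (x y : R) : int_adm 1 c (fun z => x * h (cons_row v1 z) + y * h (cons_row v2 z)).
  split; [apply: bc_lin; [exact: (adm v1).1|exact: (adm v2).1]|].
  by apply: supp_ge_lin; [exact: (adm v1).2|exact: (adm v2).2].
apply: (@is_derive_quadratic _ _ _ _ (C * expR (- c) ^+ n)) => r.
have -> : Int e (fun y => h (cons_row (v + r) y)) - Int e (fun y => h (cons_row v y)) -
    r * Int e (fun y => 'D_(evec R ord0) h (cons_row v y)) =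
  Int e (fun y => 1 * (1 * h (cons_row (v + r) y) + (-1) * h (cons_row v y)) +
     (- r) * 'D_(evec R ord0) h (cons_row v y)).
  by rewrite (Int_lin _ _ _ (admL _ _ _ _) (adm' v)) (Int_lin _ _ _ (adm _) (adm _)) !mul1r mulN1r mulNr.
rewrite -mulrA [_ * r ^+ 2]mulrC mulrA; apply: (@Int_bound n e c).
  split; [apply: bc_lin; [exact: (admL _ _ _ _).1|exact: (adm' v).1]|].
  by apply: supp_ge_lin; [exact: (admL _ _ _ _).2|exact: (adm' v).2].
move=> y; rewrite !mul1r mulN1r mulNr.
apply: (@quadratic_remainder R (fun v => h (cons_row v y))
  (fun v => 'D_(evec R ord0) h (cons_row v y))
  (fun v => 'D_(evec R ord0) ('D_(evec R ord0) h) (cons_row v y))).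
- by move=> x; apply: is_derive_head; exact: bc_der bh.
- move=> x; apply: (@is_derive_head n (fun u => 'D_(evec R ord0) h u)).
  exact: (bc_der _ _ (bc_step ord0 bh)).
- by move=> x; exact: bC.
Qed.

(** The outermost variable is treated by [Shl_IBP] after differentiation under the inner integral;
    any other variable lies in a slice. The derivative integrates to the function itself because of
    the density exp (- sum u_i). *)
Lemma Int_IBP n (e : seq bool) (c : R) (h : 'rV[R]_n -> R) i : int_adm 3 c h ->
  Int e (fun u => 'D_(evec R i) h u) = Int e h.
Proof.
elim: n e h i => [e h []//|n IH] e h i [bh sh].
have [j ->|->] := unliftP ord0 i => /=.
  congr Shl; apply/funext => v; rewrite -(slice_derive v j bh); apply: IH.
  by split; [exact: bc_slice|exact: supp_slice].
have a2 : int_adm 2 c h by split=> //; exact: bc_S.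
have [M1 A1] := Int_half_adm (behead e) (conj (bc_S (bc_S bh)) sh : int_adm 1 c h).
have a1 : int_adm 1 c (fun u => 'D_(evec R ord0) h u).
  by split; [apply: bc_S; exact: bc_step|exact: supp_ge_derive].
have [M2 A2] := Int_half_adm (behead e) a1.
have mono (M M' : R) H : M <= M' -> half_adm c M H -> half_adm c M' H.
  by move=> MM [cH bH sH]; split=> // v; apply: le_trans (bH v) MM.
apply: (@Shl_IBP R (head false e) c (Num.max M1 M2)).
- by apply: mono A1; rewrite le_max lexx.
- by apply: mono A2; rewrite le_max lexx orbT.
- by move=> v; exact: Int_derive a2.
Qed.

Fixpoint allsigns (n : nat) : seq (seq bool) :=
  if n is n'.+1 then [seq true :: e | e <- allsigns n'] ++ [seq false :: e | e <- allsigns n']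
  else [:: [::]].

Definition signs (n : nat) (x : 'rV[R]_n) : seq bool := [seq 0 < x ord0 i | i <- enum 'I_n].
Definition lnabs (n : nat) (x : 'rV[R]_n) : 'rV[R]_n := \row_i - ln `|x ord0 i|.

Lemma signs_cons n s (y : 'rV[R]_n) : signs (cons_row s y) = (0 < s) :: signs y.
Proof.
rewrite /signs enum_ordSl /= cons_row0; congr cons; rewrite -map_comp.
by apply: eq_map => j /=; rewrite cons_rowS.
Qed.

Lemma lnabs_cons n s (y : 'rV[R]_n) : lnabs (cons_row s y) = cons_row (- ln `|s|) (lnabs y).
Proof.
by apply/rowP => i; rewrite !mxE; case: unliftP => [j|] _ //; rewrite mxE.
Qed.

(** At each stage of the iteration the value s = 0 is discarded as a null set, and the sign of s
    selects one half of the patterns. *)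
Lemma intn_signs n (g : 'rV[R]_n -> R) (h : seq bool -> 'rV[R]_n -> R) (c : R) :
  (forall e, e \in allsigns n -> int_adm 1 c (h e)) ->
  (forall x : 'rV[R]_n, (forall i, x ord0 i != 0) -> g x = h (signs x) (lnabs x)) ->
  intn g = \sum_(e <- allsigns n) Int e (h e).
Proof.
elim: n g h => [|n IH] g h ah gh.
  rewrite /= big_seq1 gh /=; last by case.
  congr (h _ _); last by apply/rowP => -[].
  by rewrite /signs enum_ord0.
rewrite [LHS]/= -[X in Rintegral _ _ X]/(fun s => intn (fun y => g (cons_row s y))).
have slice b e v : e \in allsigns n -> int_adm 1 c (fun y => h (b :: e) (cons_row v y)).
  move=> en; have [] : int_adm 1 c (h (b :: e)).
    by apply: ah; rewrite /= mem_cat; case: b; rewrite map_f ?orbT.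
  by split; [exact: bc_slice|exact: supp_slice].
pose F b e := hl b (fun v => Int e (fun y => h (b :: e) (cons_row v y))).
have iF b e : e \in allsigns n -> lebesgue_measure.-integrable setT (EFin \o F b e).
  move=> en; have [|M A] := @Int_half_adm n e c (h (b :: e)).
    by apply: ah; rewrite /= mem_cat; case: b; rewrite map_f ?orbT.
  exact: hl_integrable A.
pose Ft s := \sum_(e <- allsigns n) F true e s + \sum_(e <- allsigns n) F false e s.
have E s : s != 0 -> intn (fun y => g (cons_row s y)) = Ft s.
  move=> s0; rewrite (IH _ (fun e y => h ((0 < s) :: e) (cons_row (- ln `|s|) y))).
  - rewrite /Ft /F /hl /sgb mul1r mulN1r oppr_gt0; case: (ltgtP 0 s) s0 => // [sp|sn] _.
      by rewrite [X in _ + X]big1 ?addr0.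
    by rewrite [X in X + _]big1 ?add0r.
  - by move=> e en; exact: slice.
  - move=> y y0; rewrite gh ?signs_cons ?lnabs_cons// => i.
    by rewrite mxE; case: unliftP.
have isum b (s : seq (seq bool)) : {subset s <= allsigns n} ->
  lebesgue_measure.-integrable setT (EFin \o (fun x => \sum_(e <- s) F b e x)) /\
  Rintegral lebesgue_measure setT (fun x => \sum_(e <- s) F b e x) =
    \sum_(e <- s) Rintegral lebesgue_measure setT (F b e).
  elim: s => [|e s IHs] ss.
    rewrite big_nil (_ : (fun x => _) = (fun=> 0)); last by apply/funext => x; rewrite big_nil.
    split; first exact: integrable0.
    by rewrite Rintegral_cst// mul0r.
  have [i1 e1] := IHs (fun x xs => ss x (mem_behead (s := e :: s) xs)).
  have ie := iF b e (ss e (mem_head _ _)).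
  rewrite big_cons (_ : (fun x => _) = (fun x => F b e x + \sum_(e <- s) F b e x)); last first.
    by apply/funext => x; rewrite big_cons.
  by split; [exact: (integrableD measurableT ie i1)|rewrite RintegralD// e1].
have [i1 e1] := isum true _ (fun x xs => xs); have [i2 e2] := isum false _ (fun x xs => xs).
have iFt : lebesgue_measure.-integrable setT (EFin \o Ft) by exact: (integrableD measurableT i1 i2).
have -> : Rintegral lebesgue_measure setT (fun s => intn (fun y => g (cons_row s y))) =
   Rintegral lebesgue_measure setT Ft.
  have mD : measurable ([set: R] `\ (0 : R)) by exact: measurableD.
  have mFt : measurable_fun ([set: R] `\ (0 : R)) (EFin \o Ft).
    by apply: measurable_funTS; have /integrableP[] := iFt.
  have eqD x : x \in [set: R] `\ (0 : R) -> intn (fun y => g (cons_row x y)) = Ft x.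
    by rewrite inE => -[_ /eqP x0]; exact: E.
  rewrite /Rintegral -(integral_setD1 mD); last first.
    by apply: eq_measurable_fun mFt => x xD /=; rewrite eqD.
  rewrite -[in RHS](integral_setD1 mD)//; congr fine.
  by apply: eq_integral => x xD; rewrite eqD.
rewrite RintegralD// e1 e2 /= big_cat !big_map /=.
by congr (_ + _).
Qed.

End IteratedIntegral.

(** * Smooth functions in logarithmic coordinates *)

Section Smooth.
Variables (R : realType) (n : nat).
Implicit Types (U : set 'rV[R]_n) (g h : 'rV[R]_n -> R) (x u v : 'rV[R]_n) (e : seq bool).

Lemma smooth_pd U g j : smooth_on U g -> smooth_on U (pd j g).
Proof.
move=> sg js x Ux; have := sg (js ++ [:: j]) x Ux.
by rewrite /iterpd foldr_cat.
Qed.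

Lemma smooth_cont U g x : smooth_on U g -> U x -> {for x, continuous g}.
Proof. by move=> sg Ux; have [] := sg [::] x Ux. Qed.

Lemma smooth_differentiable U g x : open U -> smooth_on U g -> U x -> differentiable g x.
Proof.
move=> oU sg Ux; apply: (C1_differentiable oU Ux).
  by move=> y Uy i; have [_] := sg [::] y Uy; exact.
by move=> i; have [+ _] := sg [:: i] x Ux.
Qed.

Definition ex e u : 'rV[R]_n := \row_i (sgb R (nth false e i) * expR (- u ord0 i)).

Lemma sgb_norm1 (b : bool) : `|sgb R b| = 1.
Proof. by rewrite /sgb; case: b; rewrite ?normrN1 ?normr1. Qed.

Lemma norm_ex e u i : `|ex e u ord0 i| = expR (- u ord0 i).
Proof. by rewrite mxE normrM sgb_norm1 mul1r ger0_norm ?expR_ge0. Qed.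

Lemma ex_neq0 e u i : ex e u ord0 i != 0.
Proof. by rewrite -normr_gt0 norm_ex expR_gt0. Qed.

Lemma ex_lnabs x : (forall i, x ord0 i != 0) -> ex (signs x) (lnabs x) = x.
Proof.
move=> x0; apply/rowP => i; rewrite !mxE opprK lnK ?posrE ?normr_gt0//.
rewrite /signs (nth_map i) ?size_enum_ord// nth_ord_enum /sgb.
case: ltgtP (x0 i) => // [xp _|xn _].
  by rewrite mul1r gtr0_norm.
by rewrite mulN1r ltr0_norm// opprK.
Qed.

Lemma ex_continuous e : continuous (ex e).
Proof.
move=> u; suff : ex e @ nbhs u --> ex e u by [].
apply/cvgrPdist_le => eps e0.
have : \forall v \near nbhs u, forall i, `|ex e u ord0 i - ex e v ord0 i| <= eps.
  apply: filter_forall => i.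
  have c : {for u, continuous (fun v => sgb R (nth false e i) * expR (- v ord0 i))}.
    apply: continuousM; first exact: cst_continuous.
    apply: (@continuous_comp _ _ _ (fun v : 'rV[R]_n => - v ord0 i) expR); last exact: continuous_expR.
    apply: continuousN; exact: (@coord_continuous R 1 n ord0 i u).
  have /cvgrPdist_le/(_ _ e0) := c; apply: filterS => v /=; by rewrite !mxE.
apply: filterS => v H; apply: norm_row_le; first exact: ltW.
by move=> i; have := H i; rewrite !mxE.
Qed.

Definition tilde e g u := g (ex e u).

(** The operator d/du_i becomes - x_i d/dx_i: changing u_i moves x on a line parallel to the i-th
    axis, with parameter w (exp (- r) - 1). *)
Lemma tilde_partial e g u i : differentiable g (ex e u) ->
  is_derive u (evec R i) (tilde e g) (- (ex e u ord0 i * pd i g (ex e u))).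
Proof.
move=> dg; apply/is_derive_lineP.
pose w := ex e u ord0 i.
have E : (fun r : R => tilde e g (u + r *: evec R i)) =
    (fun r => g (ex e u + (w * (expR (- r) - 1)) *: evec R i)).
  apply/funext => r; congr g; apply/rowP => j; rewrite !mxE eqxx/=.
  have [->|ji] := eqVneq j i; last by rewrite !mulr0 !addr0.
  by rewrite !mulr1 opprD expRD /w mxE; ring.
rewrite E.
have D0 : is_derive (0 : R) 1 (fun r : R => w * (expR (- r) - 1)) (- w).
  have H := isdZ w (isdB (is_derive_expN (0 : R)) (isdC (1 : R) (0 : R) (1 : R))).
  by apply: (is_derive_eq H); rewrite oppr0 expR0 addr0 mulrN1.
have Z : w * (expR (- 0) - 1) = 0 by rewrite oppr0 expR0 subrr mulr0.
have D1 : is_derive (w * (expR (- 0) - 1)) 1 (fun r : R => g (ex e u + r *: evec R i))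
    ('D_(evec R i) g (ex e u)).
  have H := @is_derive_line R _ g (ex e u) (evec R i) 0.
  rewrite Z; move: H; rewrite scale0r addr0; apply.
  exact: diff_derivable.
have H := isd_comp (F := fun r : R => g (ex e u + r *: evec R i))
  (h := fun r : R => w * (expR (- r) - 1)) D1 D0.
by apply: (is_derive_eq H); rewrite mulrN mulrC.
Qed.

Definition upbox (c : R) : set 'rV[R]_n := [set u | forall i, c < u ord0 i].

Lemma upbox_open c : open (upbox c).
Proof.
rewrite openE => u Hu; rewrite /interior /=.
have : \forall v \near nbhs (u : 'rV[R]_n), forall i, c < (v : 'rV[R]_n) ord0 i.
  apply: filter_forall => i.
  have := @coord_continuous R 1 n ord0 i u => /(_ [set z | c < z]); apply.
  by apply: open_nbhs_nbhs; split; [exact: open_gt|exact: Hu].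
by [].
Qed.

Definition cube (r : R) : set 'rV[R]_n := [set x | forall i, `|x ord0 i| <= r].

Lemma ex_upbox e c u : upbox c u -> cube (expR (- c)) (ex e u).
Proof. by move=> Hu i; rewrite norm_ex ler_expR lerN2 ltW. Qed.

Lemma cube_compact r : compact (cube r).
Proof.
have -> : cube r = [set x : 'rV[R]_n | forall i, `[- r, r]%classic (x ord0 i)].
  by apply/seteqP; split=> x H i; have := H i; rewrite /= in_itv/= ler_norml.
by apply: (@rV_compact R n (fun=> `[- r, r]%classic)) => i; exact: segment_compact.
Qed.

Lemma smooth_bound U g r : 0 <= r -> cube r `<=` U -> smooth_on U g ->
  exists C, forall x, cube r x -> `|g x| <= C.
Proof.
move=> r0 rU sg.
have [|||c _ cmax] := @compact_EVT_max _ R (fun x => `|g x|) (cube r).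
- by exists 0 => i; rewrite mxE normr0.
- exact: cube_compact.
- apply: continuous_in_subspaceT => x; rewrite inE => xr.
  apply: (@continuous_comp _ _ _ g Num.norm); last exact: norm_continuous.
  by apply: smooth_cont sg _; exact: rU.
by exists `|g c| => x xr; apply: cmax; rewrite inE.
Qed.

End Smooth.

(** * Symbols on a single chart *)

Section Chart.
Variables (R : realType) (n : nat) (A : 'I_n -> 'I_n -> nat).
Local Notation B := (\matrix_(j, i) (A j i)%:R : 'M[R]_n).
Hypothesis uB : B \in unitmx.
Variable c1 : R.
Implicit Types (U : set 'rV[R]_n) (g h : 'rV[R]_n -> R) (x u v : 'rV[R]_n) (e : seq bool).
Implicit Types (mu nu : 'I_n -> int).

Definition cd (j : 'I_n) : 'rV[R]_n := \row_i (A j i)%:R.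
Definition cs (j : 'I_n) (u : 'rV[R]_n) : R := (u *m invmx B) ord0 j.

Lemma cs_zero j : cs j 0 = 0.
Proof. by rewrite /cs mul0mx mxE. Qed.

Lemma cs_shift u (r : R) j k : cs j (u + r *: cd k) = cs j u + r *+ (j == k).
Proof.
have -> : cd k = row k B by apply/rowP => i; rewrite !mxE.
rewrite /cs mulmxDl -scalemxAl -row_mul mulmxV// !mxE eq_sym.
by congr (_ + _); rewrite mulr_natr.
Qed.

Lemma cs_sum u i : u ord0 i = \sum_j cs j u * (A j i)%:R.
Proof.
rewrite -{1}[u](mulmxKV uB) mxE; apply: eq_bigr => j _.
by rewrite /cs !mxE.
Qed.

Lemma cs_expand u : u = \sum_j cs j u *: cd j.
Proof.
apply/rowP => i; rewrite cs_sum summxE; apply: eq_bigr => j _; by rewrite !mxE.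
Qed.

Local Notation Om := (@upbox R n c1).

Lemma upbox_up u (r : R) j : Om u -> 0 <= r -> Om (u + r *: cd j).
Proof. by move=> Ou r0 i; rewrite !mxE; apply: lt_le_trans (Ou i) _; rewrite lerDl mulr_ge0. Qed.

Definition creg := chart_region Om cs.
Notation chcl := (cl Om creg cd cs 1).

Lemma creg_Om : creg `<=` Om. Proof. by move=> u []. Qed.

Let oOm : open Om. Proof. exact: upbox_open. Qed.

Lemma tilde_derive e g u v U : open U -> smooth_on U g -> (forall u, Om u -> U (ex e u)) -> Om u ->
  differentiable (tilde e g) u /\
  'D_v (tilde e g) u = \sum_i v ord0 i * - (ex e u ord0 i * pd i g (ex e u)).
Proof.
move=> oU sg OU Ou.
have dg u' : Om u' -> differentiable g (ex e u').
  by move=> /OU; exact: smooth_differentiable.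
have dt : differentiable (tilde e g) u.
  apply: (C1_differentiable (@upbox_open R n c1) Ou).
    by move=> u' Ou' i; have [] := tilde_partial i (dg _ Ou').
  move=> i.
  pose k u' := - (ex e u' ord0 i * pd i g (ex e u')).
  have ck : {for u, continuous k}.
    apply: continuousN; apply: continuousM.
      apply: (@continuous_comp _ _ _ (ex e) (fun x : 'rV[R]_n => x ord0 i)).
        exact: ex_continuous.
      exact: coord_continuous.
    apply: (@continuous_comp _ _ _ (ex e) (pd i g)); first exact: ex_continuous.
    by apply: smooth_cont (smooth_pd i sg) _; exact: OU.
  have ku : k u = 'D_(evec R i) (tilde e g) u.
    by apply/esym/derive_val; exact: tilde_partial (dg _ Ou).
  move=> S; rewrite /= -ku => /ck kS.
  have nO : nbhs u Om by apply: open_nbhs_nbhs; split=> //; exact: upbox_open.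
  apply: filterS2 nO kS => w Ow /=; rewrite (_ : 'D_(evec R i) (tilde e g) w = k w)//.
  by apply: derive_val; exact: tilde_partial (dg _ Ow).
split=> //.
rewrite {1}(row_sum_evec v) derive_comb//; apply: eq_bigr => i _; congr (_ * _).
by apply: derive_val; exact: tilde_partial (dg _ Ou).
Qed.

(** A coordinate is an exact exponential, decaying along a generator at the rate given by the
    corresponding entry. *)
Lemma coord_class e N i : chcl N (fun j => (A j i)%:Z) (fun u => ex e u ord0 i).
Proof.
have D u v : is_derive u v (fun u => ex e u ord0 i) (- (v ord0 i * ex e u ord0 i)).
  have D0 : is_derive u v (fun u : 'rV[R]_n => u ord0 i) (v ord0 i).
    apply/is_derive_lineP; rewrite (_ : (fun r => _) = (fun r => u ord0 i + r * v ord0 i)).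
      have H := isdD (isdC (u ord0 i) (0 : R) 1) (isdM (is_derive_id (0 : R) 1) (isdC (v ord0 i) (0 : R) 1)).
      by apply: (is_derive_eq H); rewrite add0r mul1r mulr0 addr0.
    by apply/funext => r; rewrite !mxE.
  have H := isdZ (sgb R (nth false e i)) (isd_comp
    (h := fun u : 'rV[R]_n => - u ord0 i) (is_derive_expR (- u ord0 i)) (isdN D0)).
  rewrite (_ : (fun u => _) = (fun u : 'rV[R]_n => sgb R (nth false e i) * expR (- u ord0 i))).
    by apply: (is_derive_eq H); rewrite mxE; ring.
  by apply/funext => w; rewrite mxE.
apply: cl_exact; [exact: upbox_open|exact: creg_Om|..].
- move=> u Ou; apply: (C1_differentiable (@upbox_open R n c1) Ou).
    by move=> x _ k; have [] := D x (evec R k).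
  move=> k; pose kk x := - (evec R k ord0 i * ex e x ord0 i).
  have ck : {for u, continuous kk}.
    apply: continuousN; apply: continuousM; first exact: cst_continuous.
    apply: (@continuous_comp _ _ _ (ex e) (fun x : 'rV[R]_n => x ord0 i)).
      exact: ex_continuous.
    exact: coord_continuous.
  rewrite (_ : 'D_(evec R k) _ = kk)//.
  by apply/funext => x; apply: derive_val.
- exists 1 => u [Ou su]; rewrite norm_ex mul1r /wt ler_expR lerN2 (cs_sum u i).
  by apply: ler_sum => j _; rewrite mulrC.
- by move=> u j Ou; rewrite (derive_val (is_derive := D u (cd j))) mxE.
Qed.

Let g01 : ((1 : int) == 0) || ((1 : int) == 1). Proof. by []. Qed.
Let cs0 u k : creg u -> 0 <= cs k u. Proof. by case. Qed.

(** The derivative along generator j is a combination of the x_i d_i g with coefficients [A j i];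
    when such a coefficient is nonzero, the factor x_i has weight at least 1 at j and supplies the
    gain. *)
Lemma tilde_class e N g U : open U -> cube (expR (- c1)) `<=` U -> smooth_on U g ->
  chcl N (fun=> 0) (tilde e g).
Proof.
move=> oU cU; elim: N g => [|N IH] g sg.
  have OU u : Om u -> U (ex e u) by move=> /ex_upbox/cU.
  split=> //.
    by move=> u Ou; apply: differentiable_continuous; have [] := tilde_derive 0 oU sg OU Ou.
  have [C b] := smooth_bound (expR_ge0 _) cU sg; exists C => u [Ou _]; rewrite wt0 mulr1.
  by apply: b; exact: ex_upbox.
have OU u : Om u -> U (ex e u) by move=> /ex_upbox/cU.
split.
- by move=> u Ou; apply: differentiable_continuous; have [] := tilde_derive 0 oU sg OU Ou.
- have [C b] := smooth_bound (expR_ge0 _) cU sg; exists C => u [Ou _]; rewrite wt0 mulr1.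
  by apply: b; exact: ex_upbox.
split=> [u Ou|j]; first by have [] := tilde_derive 0 oU sg OU Ou.
have S : chcl N (bumpw 1 (fun=> 0) j) (fun u => \sum_(i <- index_enum 'I_n)
    (- (A j i)%:R) * (ex e u ord0 i * tilde e (pd i g) u)).
  apply: (cl_sum oOm creg_Om) => i _.
  have [->|A0] := eqVneq (A j i) 0%N.
    apply: (cl_ext oOm creg_Om _ (cl_zero _ _ _ oOm creg_Om _ _)) => u _.
    by rewrite oppr0 mul0r.
  apply: (cl_scale oOm creg_Om).
  have M := cl_mul oOm creg_Om (coord_class e N i) (IH _ (smooth_pd i sg)).
  apply: (cl_mono oOm creg_Om g01 cs0 _ M) => k.
  rewrite /bumpw addr0 add0r; have [->|kj] := eqVneq k j; last by rewrite mulr0n.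
  by rewrite mulr1n lez_nat lt0n.
apply: (cl_ext oOm creg_Om _ S) => u Ou.
have [_ ->] := tilde_derive (cd j) oU sg OU Ou; rewrite mul0r addr0.
by apply: eq_bigr => i _; rewrite [cd j ord0 i]mxE mulNr mulrN.
Qed.

(** The constants of the decay hypothesis may depend on the point. To raise one weight by one,
    [hadamard] only needs the rescaled function to vanish at infinity along the generator, and it
    returns a uniform bound; the induction counts the missing units. *)
Lemma iterate_hadamard (G : 'rV[R]_n -> R) (L : 'I_n -> nat) :
  (forall N, chcl N (fun=> 0) G) ->
  (forall u j, creg u -> exists C r0, forall r : R, r0 <= r -> 0 <= r ->
     `|G (u + r *: cd j)| <= C * expR (- ((L j)%:R * r))) ->
  forall N, chcl N (fun j => (L j)%:Z) G.
Proof.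
move=> cG dec.
suff H (m : nat) (mu : 'I_n -> nat) : (forall j, mu j <= L j)%N ->
    \sum_j (L j - mu j)%N = m -> (forall N, chcl N (fun j => (mu j)%:Z) G) ->
    forall N, chcl N (fun j => (L j)%:Z) G.
  by apply: (H _ (fun=> 0%N)).
elim: m mu => [|m IH] mu le sm cmu.
  rewrite (_ : (fun j => (L j)%:Z) = (fun j => (mu j)%:Z))//; apply/funext => j.
  have /eqP := sm; rewrite sum_nat_eq0 => /forallP/(_ j)/=; rewrite subn_eq0 => h.
  by congr Posz; apply/eqP; rewrite eqn_leq h le.
have [j jlt] : exists j, (mu j < L j)%N.
  apply: contrapT => no; have : \sum_j (L j - mu j)%N = 0%N.
    rewrite big1// => j _; apply/eqP; rewrite subn_eq0 leqNgt; apply/negP => h.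
    by apply: no; exists j.
  by rewrite sm.
apply: (IH (fun k => mu k + (k == j))%N).
- by move=> k; have [->|_] := eqVneq k j; rewrite ?addn1// addn0.
- have E : \sum_k (L k - (mu k + (k == j)))%N =
      (L j - (mu j).+1 + \sum_(k | k != j) (L k - mu k))%N.
    rewrite (bigD1 j)//= eqxx addn1; congr addn; apply: eq_bigr => k /negbTE ->.
    by rewrite addn0.
  move: sm; rewrite (bigD1 j)//= E; set S := (\sum_(k | k != j) _)%N.
  by move: jlt; clear; lia.
- move=> N; rewrite (_ : (fun k => _) = addw (fun k => (mu k)%:Z) j 1); last first.
    by apply/funext => k; rewrite /addw PoszD; case: (k == j).
  apply: (hadamard oOm upbox_up cs_shift) => //.
    move=> u Ru eps e0; have [C [r0 H]] := dec u j Ru.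
    have [r1 H1] := expN_small C e0.
    exists (Num.max r0 r1) => r; rewrite ge_max => /andP[rr0 rr1] rp.
    apply: le_trans (H1 r rr1 rp).
    have HH := H r rr0 rp.
    have C0 : 0 <= C by have := le_trans (normr_ge0 _) HH; rewrite pmulr_lge0// expR_gt0.
    apply: le_trans (ler_wpM2l (expR_ge0 _) HH) _.
    rewrite mulrCA -expRD; apply: ler_wpM2l => //; rewrite ler_expR -mulrBl.
    rewrite -[leRHS]mulN1r; apply: ler_wpM2r => //.
    rewrite lerBlDr addrC lerBrDr; have : ((mu j)%:R + 1 <= (L j)%:R :> R).
      by rewrite natr1 ler_nat.
    done.
  move=> N'; have := cl_step j (cmu N'.+1).
  by rewrite (_ : bumpw 1 _ j = addw (fun k => (mu k)%:Z) j 1).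
Qed.

End Chart.

(** * Taylor expansions *)

Section Taylor.
Variables (R : realType) (n : nat).
Implicit Types (U : set 'rV[R]_n) (f g h : 'rV[R]_n -> R) (x u v : 'rV[R]_n) (e : seq bool).
Implicit Types (al be : 'rV[nat]_n) (js : seq 'I_n).

Lemma pd_eq_on U g h j x : open U -> (forall y, U y -> g y = h y) -> U x -> pd j g x = pd j h x.
Proof.
move=> oU gh Ux; apply: near_eq_derive; near=> y; apply: gh; near: y.
exact: open_nbhs_nbhs.
Unshelve. all: by end_near. Qed.

Lemma iterpd_eq_on U g h js x : open U -> (forall y, U y -> g y = h y) -> U x ->
  iterpd js g x = iterpd js h x.
Proof.
move=> oU gh; elim: js x => [|j js IH] x Ux; first exact: gh.
by apply: (pd_eq_on _ oU) Ux => y Uy; exact: IH.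
Qed.

Lemma pd_swap U g i j x : open U -> smooth_on U g -> U x -> pd i (pd j g) x = pd j (pd i g) x.
Proof.
move=> oU sg Ux; apply: (schwarz oU Ux).
- move=> y Uy; have [_ d0] := sg [::] y Uy.
  by split; [exact: d0|exact: d0|have [_] := sg [:: j] y Uy; exact|have [_] := sg [:: i] y Uy; exact].
- by have [] := sg [:: i; j] x Ux.
- by have [] := sg [:: j; i] x Ux.
Qed.

Lemma smooth_iterpd U g js : smooth_on U g -> smooth_on U (iterpd js g).
Proof. by move=> sg; elim: js => [|j js IH]; [exact: sg|exact: smooth_pd IH]. Qed.

Lemma iterpd_cons U g j js x : open U -> smooth_on U g -> U x ->
  iterpd (j :: js) g x = iterpd js (pd j g) x.
Proof.
move=> oU sg; elim: js x => [//|k js IH] x Ux.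
have -> : iterpd (j :: k :: js) g x = pd k (iterpd (j :: js) g) x.
  by apply: (pd_swap _ _ oU _ Ux); exact: smooth_iterpd.
by apply: (pd_eq_on _ oU) Ux => y Uy; exact: IH.
Qed.

Lemma iterpd_perm U g js js' x : open U -> smooth_on U g -> perm_eq js js' -> U x ->
  iterpd js g x = iterpd js' g x.
Proof.
move=> oU; elim: js js' g x => [|j js IH] js' g x sg pe Ux.
  by have := perm_size pe; case: js' {pe}.
have jin : j \in js' by rewrite -(perm_mem pe) mem_head.
rewrite (iterpd_cons _ _ oU sg Ux).
case/splitPr: jin pe => p1 p2 pe.
have pe' : perm_eq js (p1 ++ p2).
  by rewrite -(perm_cons j); apply: perm_trans pe _; rewrite -cat1s perm_catCA.
rewrite (IH _ _ _ (smooth_pd j sg) pe' Ux) /iterpd !foldr_cat -/(iterpd p1 _) -/(iterpd p1 _).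
by apply: (iterpd_eq_on _ oU) Ux => y Uy; rewrite -/(iterpd p2 _) -(iterpd_cons _ _ oU sg Uy).
Qed.

Definition cntv js : 'rV[nat]_n := \row_i count_mem i js.

Lemma iterpd_dmulti U g js x : open U -> smooth_on U g -> U x ->
  iterpd js g x = dmulti (cntv js) g x.
Proof.
move=> oU sg Ux; apply: (iterpd_perm oU sg _ Ux); apply/permP => P.
rewrite count_flatten -map_comp.
have E : forall s : seq 'I_n, count P s = (\sum_(i <- enum 'I_n) count_mem i s * P i)%N.
  elim=> [|a s IH] /=; first by rewrite big1.
  rewrite IH [RHS](eq_bigr (fun i => (a == i) * P i + count_mem i s * P i)%N); last first.
    by move=> i _; rewrite /= mulnDl.
  rewrite big_split/=; congr addn; rewrite (bigD1_seq a) ?mem_enum ?enum_uniq//= eqxx mul1n big1 ?addn0//.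
  by move=> i /negbTE; rewrite eq_sym => ->.
rewrite E sumnE big_map; apply: eq_bigr => i _ /=.
by rewrite count_nseq mxE mulnC.
Qed.

Lemma mfact_neq0 al : (mfact al)%:R != 0 :> R.
Proof.
rewrite pnatr_eq0 -lt0n /mfact -[X in (0 < X)%N]/(\prod_(i < n) (al ord0 i)`!)%N.
by apply: prodn_gt0 => i; exact: fact_gt0.
Qed.

Definition mpol (S : seq ('rV[nat]_n)) (c : 'rV[nat]_n -> R) x := \sum_(be <- S) c be * monom be x.

Definition ffactv al (js : seq 'I_n) : nat := (\prod_i (al ord0 i) ^_ (count_mem i js))%N.
Definition subv al (js : seq 'I_n) : 'rV[nat]_n := \row_i (al ord0 i - count_mem i js)%N.

Lemma monom_is_derive al x j : is_derive x (evec R j) (monom al)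
  ((al ord0 j)%:R * monom (\row_i (al ord0 i - (i == j))%N) x).
Proof.
apply/is_derive_lineP.
pose c := \prod_(i | i != j) x ord0 i ^+ al ord0 i.
rewrite (_ : (fun r => _) = (fun r : R => c * (x ord0 j + r) ^+ al ord0 j)); last first.
  apply/funext => r; rewrite /monom (bigD1 j)//= mulrC; congr (_ * _).
    by apply: eq_bigr => i ij; rewrite !mxE eqxx (negbTE ij)/= mulr0 addr0.
  by rewrite !mxE !eqxx mulr1.
have D : is_derive (0 : R) 1 (fun r : R => (x ord0 j + r) ^+ al ord0 j)
   ((al ord0 j)%:R * x ord0 j ^+ (al ord0 j).-1).
  have H1 : is_derive (x ord0 j + 0) 1 (fun z : R => z ^+ al ord0 j)
      ((al ord0 j)%:R * (x ord0 j + 0) ^+ (al ord0 j).-1).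
    apply: DeriveDef; first exact: exprn_derivable.
    by rewrite exp_derive -mulr_natl [_ *: _]mulr1.
  have H := isd_comp (F := fun z : R => z ^+ al ord0 j) (h := fun r => x ord0 j + r) H1
    (isdD (isdC (x ord0 j) (0 : R) 1) (is_derive_id (0 : R) 1)).
  by apply: (is_derive_eq H); rewrite addr0 add0r mulr1.
apply: (is_derive_eq (isdZ c D)); rewrite mulrCA; congr (_ * _).
rewrite /monom (bigD1 j)//= mxE eqxx subn1 mulrC; congr (_ * _).
by apply: eq_bigr => i ij; rewrite mxE (negbTE ij) subn0.
Qed.

Lemma iterpd_mpol S c js : iterpd js (mpol S c) =
  (fun x => \sum_(be <- S) c be * (ffactv be js)%:R * monom (subv be js) x).
Proof.
elim: js => [|j js IH].
  apply/funext => x; apply: eq_bigr => be _; rewrite /ffactv big1 ?mulr1//=; congr (_ * monom _ x).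
  by apply/rowP => i; rewrite mxE subn0.
apply/funext => x; rewrite /= IH; apply: derive_val; apply: isd_sum => be _.
apply: (is_derive_eq (isdZ _ (monom_is_derive _ _ _))).
rewrite -!mulrA; congr (_ * _); rewrite mulrA -natrM; congr (_%:R * monom _ x); last first.
  by apply/rowP => i; rewrite !mxE /= subnDA [(j == i)]eq_sym subnAC.
rewrite /ffactv mxE (bigD1 j)//= [RHS](bigD1 j)//= eqxx add1n ffactnSr mulnAC.
by congr muln; apply: eq_bigr => i /negbTE; rewrite eq_sym => ->.
Qed.

Lemma monom0 al : monom al (0 : 'rV[R]_n) = (al == 0)%:R.
Proof.
rewrite /monom; have [->|] := eqVneq al 0; first by rewrite big1// => i _; rewrite !mxE expr0.
move=> a0; have [i ai] : exists i, al ord0 i != 0%N.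
  apply: contrapT => no; move/eqP: a0; apply; apply/rowP => i; rewrite !mxE.
  by apply: contrapT => h; apply: no; exists i; apply/eqP.
by rewrite (bigD1 i)//= mxE expr0n (negbTE ai) mul0r.
Qed.

Lemma iterpd_mpol0 S c js : uniq S -> iterpd js (mpol S c) 0 =
  if cntv js \in S then c (cntv js) * (mfact (cntv js))%:R else 0.
Proof.
move=> uS; rewrite iterpd_mpol.
have term be : c be * (ffactv be js)%:R * monom (subv be js) 0 =
    if be == cntv js then c (cntv js) * (mfact (cntv js))%:R else 0.
  rewrite monom0; have [->|ne] := eqVneq be (cntv js).
    rewrite (_ : subv _ _ = 0); last by apply/rowP => i; rewrite !mxE subnn.
    rewrite eqxx mulr1; congr (_ * _%:R); rewrite /ffactv /mfact.
    by apply: eq_bigr => i _; rewrite mxE ffactnn.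
  have [E|] := eqVneq (subv be js) 0; last by rewrite mulr0.
  rewrite mulr1; have [i bi] : exists i, (be ord0 i < count_mem i js)%N.
    apply: contrapT => no; move/eqP: ne; apply; apply/rowP => i; rewrite mxE.
    move/rowP: E => /(_ i); rewrite !mxE => /eqP; rewrite subn_eq0 => h.
    apply/eqP; rewrite eqn_leq h /= leqNgt; apply/negP => h'; by apply: no; exists i.
  by rewrite /ffactv (bigD1 i)//= ffact_small// mul0n mulr0.
rewrite (eq_bigr _ (fun be _ => term be)); case: ifPn => [inS|nin].
  by rewrite (bigD1_seq (cntv js))//= eqxx big1 ?addr0// => be /negbTE ->.
rewrite big1_seq// => be /andP[_ beS]; case: eqP => // E; by rewrite -E beS in nin.
Qed.

Lemma taylor_coef_mpol S c al : uniq S -> taylor_coef (mpol S c) al = if al \in S then c al else 0.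
Proof.
move=> uS; rewrite /taylor_coef /dmulti iterpd_mpol0//.
have -> : cntv (flatten [seq nseq (al ord0 i) i | i <- enum 'I_n]) = al.
  apply/rowP => k; rewrite mxE count_flatten -map_comp sumnE big_map.
  rewrite (bigD1_seq k) ?mem_enum ?enum_uniq//= count_nseq/= eqxx mul1n big1 ?addn0//.
  by move=> i /negbTE ik; rewrite count_nseq/= ik.
case: ifP => // _; last by rewrite mul0r.
by rewrite mulfK// mfact_neq0.
Qed.

Lemma iterpd_sub_mpol U f S c js x : open U -> smooth_on U f -> U x ->
  iterpd js (fun y => f y - mpol S c y) x = iterpd js f x - iterpd js (mpol S c) x.
Proof.
move=> oU sf; elim: js x => [//|j js IH] x Ux.
rewrite [LHS](pd_eq_on j oU IH Ux); apply: derive_val; apply: isdB.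
  by apply/derivableP; have [_] := sf js x Ux; exact.
apply/derivableP; rewrite iterpd_mpol; apply: ex_derive; apply: isd_sum => be _.
exact: (isdZ _ (monom_is_derive _ _ _)).
Qed.

Lemma monom_continuous al : continuous (@monom R n al).
Proof.
apply: continuous_big => [|i _ x]; first exact: mul_continuous.
apply: (@continuous_comp _ _ _ (fun x : 'rV[R]_n => x ord0 i) (fun z : R => z ^+ al ord0 i)).
  exact: coord_continuous.
exact: exprn_continuous.
Qed.

Lemma smooth_sub_mpol U f S c : open U -> smooth_on U f ->
  smooth_on U (fun y => f y - mpol S c y).
Proof.
move=> oU sf js x Ux.
have cont_mpol : continuous (iterpd js (mpol S c)).
  rewrite iterpd_mpol; apply: continuous_big => [|be _ y]; first exact: add_continuous.
  have H : {for y, continuous (fun x => c be * (ffactv be js)%:R * monom (subv be js) x)};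
    last exact: H.
  by apply: continuousM; [exact: cst_continuous|exact: monom_continuous].
have [cf df] := sf js x Ux.
have E y : U y -> iterpd js f y - iterpd js (mpol S c) y = iterpd js (fun y => f y - mpol S c y) y.
  by move=> Uy; rewrite (iterpd_sub_mpol _ _ _ oU sf Uy).
have nE : \near x, iterpd js f x - iterpd js (mpol S c) x = iterpd js (fun y => f y - mpol S c y) x.
  by near=> y; apply: E; near: y; exact: open_nbhs_nbhs.
split.
  have cB : {for x, continuous (fun y => iterpd js f y - iterpd js (mpol S c) y)}.
    by apply: continuousB; [exact: cf|exact: cont_mpol].
  move=> A; rewrite /= -E// => /cB nA.
  by apply: filterS2 nE nA => y /= ->.
move=> j; apply: (near_eq_derivable nE); apply: ex_derive; apply: isdB.
  by apply/derivableP; exact: df.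
apply/derivableP; rewrite iterpd_mpol; apply: ex_derive; apply: isd_sum => be _.
exact: (isdZ _ (monom_is_derive _ _ _)).
Unshelve. all: by end_near. Qed.

(** Each use of the mean value theorem on the segment from 0 gains a factor rho and lowers the order
    of vanishing by one. *)
Lemma taylor_remainder U g (r : R) L : 0 <= r -> open U -> cube r `<=` U -> smooth_on U g ->
  (forall w, (size w < L)%N -> iterpd w g 0 = 0) ->
  exists C, 0 <= C /\ forall rho x, 0 <= rho <= r -> cube rho x -> `|g x| <= C * rho ^+ L.
Proof.
move=> r0 oU rU; elim: L g => [|L IH] g sg H.
  have [C b] := smooth_bound r0 rU sg; exists `|C|; split=> // rho x /andP[_ rr] cx.
  rewrite expr0 mulr1; apply: le_trans (b x _) (ler_norm _) => i.
  exact: le_trans (cx i) rr.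
have Hi i : exists C, 0 <= C /\ forall rho x, 0 <= rho <= r -> cube rho x ->
    `|pd i g x| <= C * rho ^+ L.
  apply: IH; first exact: smooth_pd.
  move=> w wL; have := H (rcons w i); rewrite size_rcons => /(_ wL).
  by rewrite /iterpd foldr_rcons.
pose C i := projT1 (cid (Hi i)).
have CP i := projT2 (cid (Hi i)); rewrite -/(C _) in CP.
exists (\sum_i C i); split; first by apply: sumr_ge0 => i _; have [] := CP i.
move=> rho x /andP[rho0 rhor] cx.
have g0 : g 0 = 0 by exact: (H [::]).
have inU (t : R) : 0 <= t <= 1 -> cube rho (t *: x).
  move=> /andP[t0 t1] i; rewrite mxE normrM ger0_norm//.
  by apply: le_trans (cx i); apply: ler_piMl.
have cr y : cube rho y -> U y by move=> cy; apply: rU => i; exact: le_trans (cy i) rhor.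
have dU y : U y -> differentiable g y by exact: smooth_differentiable.
have [|t tr] := @line_MVT R _ g 0 x 1 ler01.
  by move=> t tr; rewrite add0r; apply: diff_derivable; apply: dU; apply: cr; exact: inU.
rewrite !add0r scale1r g0 subr0 mulr1 => ->.
have dt : differentiable g (t *: x) by apply: dU; apply: cr; exact: inU.
rewrite {2}(row_sum_evec x) derive_comb// mulr_suml.
apply: le_trans (ler_norm_sum _ _ _) _; apply: ler_sum => i _.
have [C0 b] := CP i; rewrite normrM exprS mulrCA; apply: ler_pM => //.
by apply: b; [rewrite rho0|exact: inU].
Qed.

Definition degv (a : 'I_n -> nat) be : nat := (\sum_i a i * be ord0 i)%N.
Definition arow (a : 'I_n -> nat) : 'rV[R]_n := \row_i (a i)%:R.

Lemma ex_scale e u (a : 'I_n -> nat) (r : R) i :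
  ex e (u + r *: arow a) ord0 i = ex e u ord0 i * expR (- r) ^+ a i.
Proof. by rewrite !mxE opprD expRD mulrA -expRM_natr mulNr. Qed.

Lemma monom_scale e u (a : 'I_n -> nat) (r : R) be :
  monom be (ex e (u + r *: arow a)) = monom be (ex e u) * expR (- r) ^+ degv a be.
Proof.
rewrite /monom /degv -prodrXr -big_split; apply: eq_bigr => i _ /=.
by rewrite ex_scale exprMn -exprM.
Qed.

Definition small_multi (l : nat) : seq ('rV[nat]_n) :=
  [seq \row_i ((w : {ffun 'I_n -> 'I_l.+1}) i : nat) | w <- enum {ffun 'I_n -> 'I_l.+1}].

Lemma small_multi_uniq l : uniq (small_multi l).
Proof.
rewrite map_inj_uniq ?enum_uniq// => w w' /rowP E; apply/ffunP => i; apply: val_inj.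
by have := E i; rewrite !mxE.
Qed.

Lemma mem_small_multi l be : (be \in small_multi l) = [forall i, be ord0 i <= l]%N.
Proof.
apply/mapP/forallP => [[w _ ->] i|H]; first by rewrite mxE -ltnS.
exists [ffun i => inord (be ord0 i)]; first by rewrite mem_enum.
by apply/rowP => i; rewrite mxE ffunE inordK// ltnS.
Qed.

(** Since all entries of [a] are positive, x shrinks at least like exp (- r), so an ordinary Taylor
    remainder of order l + 1 is smaller than the weighted order l by a factor exp (- r), and so are
    the monomials of weighted degree above l. *)
Lemma taylor_scaling U f (r0 : R) (a : 'I_n -> nat) (l : nat) (S : seq ('rV[nat]_n)) e u :
  0 < r0 -> open U -> cube r0 `<=` U -> smooth_on U f -> (forall i, 0 < a i)%N ->
  (forall be, taylor_coef f be != 0 -> (l <= degv a be)%N) ->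
  uniq S -> (forall be, be \in S <-> taylor_coef f be != 0 /\ degv a be = l) ->
  exists C r1, forall r : R, r1 <= r -> 0 <= r ->
    `|expR (l%:R * r) * f (ex e (u + r *: arow a)) - mpol S (taylor_coef f) (ex e u)|
      <= C * expR (- r).
Proof.
move=> r00 oU rU sf a0 lmin uS SP.
have U0 : U 0 by apply: rU => i; rewrite mxE normr0 ltW.
(* The box contains every multi-index of total degree at most l; its other monomials have vanishing
   derivatives at 0 up to order l. *)
pose T := small_multi l; pose c := taylor_coef f.
pose g y := f y - mpol T c y.
have [|C [C0 Cb]] := @taylor_remainder U g r0 l.+1 (ltW r00) oU rU (smooth_sub_mpol _ _ oU sf).
  move=> w wl; rewrite (iterpd_sub_mpol _ _ _ oU sf U0) iterpd_mpol0 ?small_multi_uniq//.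
  rewrite mem_small_multi (_ : [forall i, _]); last first.
    by apply/forallP => i; rewrite mxE (leq_trans (count_size _ _)).
  by rewrite (iterpd_dmulti _ oU sf U0) /c /taylor_coef divfK ?subrr// mfact_neq0.
pose M := 1 + \sum_i `|ex e u ord0 i|.
have M0 : 0 < M by rewrite ltr_wpDr// sumr_ge0.
have Mi i : `|ex e u ord0 i| <= M.
  rewrite /M (bigD1 i)//= addrCA lerDl addr_ge0// sumr_ge0//.
pose K := C * M ^+ l.+1 + \sum_(be <- T) `|c be * monom be (ex e u)|.
have [r1 H1] := @expN_small R M r0 r00.
exists K, r1 => r rr1 rp.
have er1 : expR (- r) <= 1 by rewrite expR_le1 oppr_le0.
have inc : cube (M * expR (- r)) (ex e (u + r *: arow a)).
  move=> i; rewrite ex_scale normrM [`|_ ^+ _|]ger0_norm ?exprn_ge0 ?expR_ge0//.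
  apply: (ler_pM (normr_ge0 _) (exprn_ge0 _ (expR_ge0 _)) (Mi i)).
  by rewrite -[leRHS]expr1; apply: ler_wiXn2l; rewrite ?expR_ge0// a0.
have gb : `|expR (l%:R * r) * g (ex e (u + r *: arow a))| <= C * M ^+ l.+1 * expR (- r).
  rewrite normrM ger0_norm ?expR_ge0//.
  have := Cb (M * expR (- r)) _ _ inc; rewrite H1// mulr_ge0 ?expR_ge0 ?(ltW M0)// => /(_ isT) gb.
  apply: le_trans (ler_wpM2l (expR_ge0 _) gb) _.
  have E1 : expR (l%:R * r) * expR (- r) ^+ l = 1 by rewrite -expRM_natl mulrN expRxMexpNx_1.
  rewrite exprMn; set Mp := M ^+ l.+1; rewrite exprSr; set Xl := expR (- r) ^+ l in E1 *.
  have sw (x y z w v : R) : x * (y * (z * (w * v))) = x * w * (y * z * v) by ring.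
  by rewrite sw E1 mul1r.
have Tsum : expR (l%:R * r) * mpol T c (ex e (u + r *: arow a)) - mpol S c (ex e u) =
   \sum_(be <- T) (if degv a be == l then 0 else
     c be * monom be (ex e u) * (expR (l%:R * r) * expR (- r) ^+ degv a be)).
  have -> : mpol S c (ex e u) =
      \sum_(be <- T) (if degv a be == l then c be * monom be (ex e u) else 0).
    rewrite -big_mkcond -big_filter [RHS](bigID (mem S))/= [X in _ + X]big1_seq ?addr0.
      rewrite -big_filter; apply: perm_big; apply: uniq_perm => //.
        by rewrite !filter_uniq// small_multi_uniq.
      move=> be; rewrite !mem_filter; case beS : (be \in S) => //=.
      have /SP[cb db] := beS; rewrite db eqxx/= mem_small_multi; apply/esym/forallP => i.
      by rewrite -db /degv (bigD1 i)//= (leq_trans _ (leq_addr _ _))// leq_pmull.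
    move=> be /andP[beS]; rewrite mem_filter => /andP[/eqP db _].
    have [->|cb] := eqVneq (c be) 0; first by rewrite mul0r.
    by case/negP: beS; apply/SP.
  rewrite {1}/mpol mulr_sumr -sumrB; apply: eq_bigr => be _; rewrite monom_scale.
  case: eqP => [->|_]; last by rewrite subr0; ring.
  have E1 : expR (l%:R * r) * expR (- r) ^+ l = 1 by rewrite -expRM_natl mulrN expRxMexpNx_1.
  apply/eqP; rewrite subr_eq0; apply/eqP.
  have sw (x y z w : R) : x * (y * (z * w)) = x * w * (y * z) by ring.
  by rewrite sw E1 mul1r.
rewrite (_ : f _ = g (ex e (u + r *: arow a)) + mpol T c (ex e (u + r *: arow a))); last by rewrite subrK.
rewrite mulrDr -addrA; apply: le_trans (ler_normD _ _) _; rewrite /K mulrDl; apply: lerD => //.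
rewrite Tsum mulr_suml; apply: le_trans (ler_norm_sum _ _ _) _; apply: ler_sum => be _.
case: eqP => [_|/eqP db]; first by rewrite normr0 mulr_ge0// expR_ge0.
have [->|cb] := eqVneq (c be) 0; first by rewrite !mul0r normr0 mulr_ge0// expR_ge0.
rewrite normrM; apply: ler_wpM2l => //.
rewrite ger0_norm ?mulr_ge0 ?exprn_ge0 ?expR_ge0// -expRM_natl -expRD ler_expR mulrN -mulrBl.
rewrite -[leRHS]mulN1r; apply: ler_wpM2r => //.
have := lmin be cb; rewrite leq_eqVlt eq_sym (negbTE db)/= => h.
have : (l%:R + 1 <= (degv a be)%:R :> R) by rewrite natr1 ler_nat.
by lra.
Qed.

End Taylor.

(** * Compactness argument for the gradient bound *)

Section LowerBound.
Variables (R : realType) (n : nat) (A : 'I_n -> 'I_n -> nat).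
Hypothesis uB : (\matrix_(j, i) (A j i)%:R : 'M[R]_n) \in unitmx.
Variables (c1 : R) (F : 'rV[R]_n -> R) (l : 'I_n -> nat).
Local Notation Om := (@upbox R n c1).
Local Notation cd := (cd R A).
Local Notation cs := (@cs R n A).
Local Notation creg := (@creg R n A c1).
Local Notation chcl := (cl Om creg cd cs 1).
Local Notation wtl := (wt cs (fun j => (l j)%:Z)).
Hypothesis cF : forall N, chcl N (fun j => (l j)%:Z) F.

Let oOm : open Om. Proof. exact: upbox_open. Qed.
Let RgOm : creg `<=` Om. Proof. exact: creg_Om. Qed.
Let g01 : ((1 : int) == 0) || ((1 : int) == 1). Proof. by []. Qed.
Let cs0 u k : creg u -> 0 <= cs k u. Proof. by case. Qed.
Let up := @upbox_up R n A c1.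
Let sd := cs_shift uB.

Lemma cs_comb u (s : seq 'I_n) (dl : 'I_n -> R) j : uniq s ->
  cs j (u + \sum_(k <- s) dl k *: cd k) = cs j u + dl j *+ (j \in s).
Proof.
elim: s u => [|k s IH] u us; first by rewrite big_nil addr0 mulr0n addr0.
move: us => /= /andP[ks us]; rewrite big_cons addrA IH// sd -addrA; congr (_ + _).
rewrite inE; have [->|jk] := eqVneq j k; last by rewrite mulr0n add0r.
by rewrite (negbTE ks) mulr0n addr0.
Qed.

Lemma cs_inj u v : (forall j, cs j u = cs j v) -> u = v.
Proof.
move=> H; rewrite (cs_expand uB u) (cs_expand uB v); by apply: eq_bigr => j _; rewrite H.
Qed.

(** In the variables y = exp (- s) these normalized derivatives extend continuously to y = 0; the
    gradient bound expresses that they have no common zero in the limit. *)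
Definition Psi k (u : 'rV[R]_n) := 'D_(cd k) F u / wtl u.

(** This is the Lipschitz property of [Psi] in y_j = exp (- s_j): a move by r changes y_j by at most
    y_j and by at most r, which are the two alternatives. *)
Lemma Psi_step k j : exists C, 0 <= C /\ forall u (r b : R), creg u -> 0 <= r -> 0 <= b ->
  expR (- cs j u) <= b \/ r <= b -> `|Psi k (u + r *: cd j) - Psi k u| <= C * b.
Proof.
have cH N : chcl N (fun j => (l j)%:Z) (fun u => 'D_(cd k) F u).
  exact: (cl_deriv oOm RgOm g01 cs0 k (cF N.+1)).
have [C [C0 bC]] := cl_bound0 (cl_step j (cH 1%N)); exists C; split=> // u r b cu r0 b0 hb.
have [Ou _] := cu.
set H := (fun u => 'D_(cd k) F u) in cH bC.
pose K r := expR ((l j)%:~R * r) * H (u + r *: cd j).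
pose dK r := expR ((l j)%:~R * r) * ('D_(cd j) H (u + r *: cd j) + (l j)%:~R * H (u + r *: cd j)).
have dKP t : 0 <= t <= r -> is_derive t 1 K (dK t).
  by move=> /andP[t0 _]; exact: (is_derive_exp_line up j Ou t0 (cH 1%N)).
have w0 := wt_gt0 cs (fun j => (l j)%:Z) u.
have dKb t : 0 <= t <= r -> `|dK t| <= C * wtl u * expR (- cs j u) * expR (- t).
  move=> /andP[t0 _]; rewrite normrM ger0_norm ?expR_ge0//.
  have := bC _ (chart_region_up up sd j cu t0); rewrite (wt_shift sd) => bt.
  apply: le_trans (ler_wpM2l (expR_ge0 _) bt) _.
  have -> : wt cs (bumpw 1 (fun j => (l j)%:Z) j) u = wtl u * expR (- cs j u).
    rewrite (_ : bumpw _ _ _ = (fun k => (l k)%:Z + (k == j)%:Z)); last first.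
      by apply/funext => k'; rewrite /bumpw; case: (k' == j).
    rewrite wtD; congr (_ * _); rewrite /wt (bigD1 j)//= eqxx mul1r big1 ?addr0//.
    by move=> i /negbTE ->; rewrite mul0r.
  have -> : expR (- ((bumpw 1 (fun j => (l j)%:Z) j j)%:~R * t)) = expR (- ((l j)%:~R * t)) * expR (- t).
    by rewrite -expRD -opprD /bumpw eqxx mulr1n rmorphD/= mulrDl mul1r.
  have E1 : expR ((l j)%:~R * t) * expR (- ((l j)%:~R * t)) = 1 by exact: expRxMexpNx_1.
  have sw (x y z w v s : R) : x * (y * (z * w * (v * s))) = x * v * (y * z * w * s) by ring.
  by rewrite sw E1 mul1r.
have KE t : Psi k (u + t *: cd j) = K t / wtl u.
  rewrite /Psi (wt_shift sd) /K /H.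
  have E : (expR (- ((l j)%:~R * t)))^-1 = expR ((l j)%:~R * t) :> R by rewrite -expRN opprK.
  rewrite invfM E.
  have sw (x y z : R) : x * (y * z) = z * x * y by ring.
  by rewrite sw.
have K0 : Psi k u = K 0 / wtl u by rewrite -KE scale0r addr0.
rewrite KE K0 -mulrBl normrM [`|_^-1|]ger0_norm ?invr_ge0 ?(ltW w0)// ler_pdivrMr//.
case: hb => hb.
  apply: le_trans (derive_bound_exp r0 dKP dKb) _.
  by rewrite mulrAC; apply: ler_wpM2r; [exact: ltW|apply: ler_wpM2l].
apply: (@le_trans _ _ (C * wtl u * (r - 0))).
  apply: (derive_bound_mvt r0 dKP) => t tr; apply: le_trans (dKb t tr) _.
  rewrite -[leRHS]mulr1 -mulrA; apply: ler_wpM2l; first by rewrite mulr_ge0// ltW.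
  rewrite -expRD expR_le1; have := cs0 j cu; case/andP: tr => t0 _ sj0.
  by rewrite -opprD oppr_le0 addr_ge0.
by rewrite subr0 mulrAC; apply: ler_wpM2r; [exact: ltW|apply: ler_wpM2l].
Qed.

Lemma creg_comb u (s : seq 'I_n) (dl : 'I_n -> R) : creg u -> (forall j, 0 <= dl j) ->
  creg (u + \sum_(k <- s) dl k *: cd k).
Proof.
move=> cu d0; elim: s u cu => [|k s IH] u cu; first by rewrite big_nil addr0.
by rewrite big_cons addrA; apply: IH; exact: (chart_region_up up sd).
Qed.

Lemma Psi_up k : exists C, 0 <= C /\ forall u (dl : 'I_n -> R) (b : R), creg u -> 0 <= b ->
  (forall j, 0 <= dl j) -> (forall j, expR (- cs j u) <= b \/ dl j <= b) ->
  `|Psi k (u + \sum_j dl j *: cd j) - Psi k u| <= C * b.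
Proof.
pose C j := projT1 (cid (Psi_step k j)).
have CP j := projT2 (cid (Psi_step k j)); rewrite -/(C _) in CP.
exists (\sum_j C j); split; first by apply: sumr_ge0 => j _; have [] := CP j.
move=> u dl b cu b0 d0 hb.
suff H (s : seq 'I_n) : uniq s ->
    `|Psi k (u + \sum_(j <- s) dl j *: cd j) - Psi k u| <= \sum_(j <- s) C j * b.
  by rewrite mulr_suml; exact: (H (index_enum 'I_n) (index_enum_uniq _)).
elim: s => [|j s IH] us; first by rewrite !big_nil addr0 subrr normr0.
move: us => /= /andP[js us].
rewrite !big_cons [dl j *: _ + _]addrC addrA.
set v := u + _.
have cv : creg v by exact: creg_comb.
rewrite -(subrKA (Psi k v)); apply: le_trans (ler_normD _ _) _; apply: lerD; last exact: IH.
have [_ st] := CP j; apply: st => //.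
by rewrite /v cs_comb// (negbTE js) mulr0n addr0.
Qed.

(** Points violating the bound are compactified by y = exp (- s) in the unit cube. At a cluster
    point, [J] collects the coordinates that escape to infinity; the other coordinates converge to
    those of [ub]. *)
Lemma lower_bound_fail :
  (forall m : nat, exists u, [/\ creg u, forall i, m%:R < u ord0 i &
     forall k, `|Psi k u| <= (m.+1)%:R^-1]) ->
  exists (J : 'I_n -> bool) (ub : 'rV[R]_n),
   [/\ forall i, exists2 j, J j & (0 < A j i)%N, forall j, 0 <= cs j ub &
    forall k e, 0 < e -> exists r1, forall r, r1 <= r ->
      creg (ub + r *: \sum_(j | J j) cd j) /\ `|Psi k (ub + r *: \sum_(j | J j) cd j)| <= e].
Proof.
move=> H.
pose u m := projT1 (cid (H m)); have uP m := projT2 (cid (H m)); rewrite -/(u _) in uP.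
pose y m : 'rV[R]_n := \row_j expR (- cs j (u m)).
have y1 m : cube 1 (y m).
  move=> j; rewrite mxE ger0_norm ?expR_ge0// expR_le1 oppr_le0; apply: cs0.
  by have [] := uP m.
have [yb [cyb cl_yb]] := @cube_compact R n 1 (y @ \oo) _ (filterE _ y1).
have freq (Q : set 'rV[R]_n) M : nbhs yb Q -> exists2 m, (M <= m)%N & Q (y m).
  move=> nQ; have h : (y @ \oo) [set y m | m in [set m | (M <= m)%N]].
    by exists M => // m Mm; exists m.
  by have [z [[m Mm <-] Qm]] := cl_yb _ _ h nQ; exists m.
have yb0 j : 0 <= yb ord0 j.
  rewrite leNgt; apply/negP => yj.
  have [|m _] := freq [set z | z ord0 j < 0] 0%N.
    have := @coord_continuous R 1 n ord0 j yb => /(_ [set z | z < 0]); apply.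
    by apply: open_nbhs_nbhs; split=> //; exact: open_lt.
  by rewrite /= mxE ltNge expR_ge0.
pose J j := yb ord0 j == 0.
pose sb j := if J j then 0 else - ln (yb ord0 j).
have ybp j : ~~ J j -> 0 < yb ord0 j by move=> nJ; rewrite lt_neqAle eq_sym nJ yb0.
have sb0 j : 0 <= sb j.
  rewrite /sb; case: ifP => // nJ; rewrite oppr_ge0 ln_le0//.
  by apply: le_trans (ler_norm _) (cyb j).
have sm0 m j : 0 <= cs j (u m) by apply: cs0; have [] := uP m.
have good (eta : R) M : 0 < eta -> exists2 m, (M <= m)%N & forall j,
    (J j -> expR (- cs j (u m)) <= eta) /\ (~~ J j -> `|cs j (u m) - sb j| <= eta).
  move=> e0.
  have [|m Mm Qm] := freq [set z | forall j, (J j -> z ord0 j <= eta) /\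
      (~~ J j -> `|ln (yb ord0 j) - ln (z ord0 j)| <= eta)] M.
    suff h j : nbhs yb [set z : 'rV[R]_n | (J j -> z ord0 j <= eta) /\
      (~~ J j -> `|ln (yb ord0 j) - ln (z ord0 j)| <= eta)] by exact: filter_forall h.
    have [Jj|nJ] := boolP (J j).
      have : nbhs yb [set z | z ord0 j < eta].
        have := @coord_continuous R 1 n ord0 j yb => /(_ [set z | z < eta]); apply.
        by apply: open_nbhs_nbhs; split; [exact: open_lt|rewrite /= (eqP Jj)].
      by apply: filterS => z /= /ltW.
    have c : {for yb, continuous (fun z : 'rV[R]_n => ln (z ord0 j))}.
      apply: (@continuous_comp _ _ _ (fun z : 'rV[R]_n => z ord0 j) (@ln R)).
        exact: coord_continuous.
      exact: continuous_ln (ybp j nJ).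
    by have /cvgrPdist_le/(_ _ e0) := c; apply: filterS => z h; split.
  exists m => // j; have [h1 h2] := Qm j; split=> [/h1|nJ]; first by rewrite mxE.
  have := h2 nJ; rewrite mxE expRK /sb (negbTE nJ) opprK.
  by congr (`|_| <= _); rewrite opprK addrC.
pose ub := 0 + \sum_(j <- index_enum 'I_n) sb j *: cd j.
have csub j : cs j ub = sb j.
  rewrite /ub cs_comb ?index_enum_uniq// mem_index_enum mulr1n.
  by rewrite cs_zero add0r.
(* If no escaping generator had a positive entry at i, the coordinate u_i would remain below [Bd],
   whereas it exceeds m at the m-th point. *)
have HJ i : exists2 j, J j & (0 < A j i)%N.
  apply: contrapT => no.
  pose Bd : R := \sum_j (sb j + 1) * (A j i)%:R.
  have [M MB] : exists M : nat, Bd <= M%:R.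
    by exists (Num.bound `|Bd|); apply: le_trans (ler_norm _) _; rewrite ltW// archi_boundP.
  have [m Mm gm] := good 1 M ltr01; have [_ um _] := uP m.
  have := um i; rewrite ltNge => /negP; apply; rewrite (cs_sum uB (u m) i).
  apply: le_trans (le_trans MB _); last by rewrite ler_nat.
  apply: ler_sum => j _; have [Jj|nJ] := boolP (J j).
    have -> : A j i = 0%N by apply/eqP; rewrite -leqn0 leqNgt; apply/negP => h; apply: no; exists j.
    by rewrite !mulr0.
  apply: ler_wpM2r => //; have [_ /(_ nJ)] := gm j.
  by rewrite ler_distl => /andP[_].
exists J, ub; split=> // [j|k e e0]; first by rewrite csub.
have [C [C0 Cup]] := Psi_up k.
(* Chosen so that eta + 2 C eta, the sum of the three errors below, is at most [e]. *)
pose eta := e / (2 * C + 1 + 1).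
have K0 : 0 < 2 * C + 1 + 1 by rewrite !ltr_wpDl// addr_ge0// mulr_ge0.
have eta0 : 0 < eta by rewrite divr_gt0.
have [M MB] : exists M : nat, eta^-1 <= M%:R.
  by exists (Num.bound `|eta^-1|); apply: le_trans (ler_norm _) _; rewrite ltW// archi_boundP.
have [m Mm gm] := good eta M eta0; have [cum um Psm] := uP m.
exists (Num.max (`|c1| + 1) (\sum_j cs j (u m))) => r; rewrite ge_max => /andP[rc rs].
have r0 : 0 <= r by apply: le_trans rc; rewrite addr_ge0.
have rsj j : cs j (u m) <= r.
  by apply: le_trans rs; rewrite (bigD1 j)//= lerDl sumr_ge0.
set p := ub + r *: _.
have csp j : cs j p = sb j + (if J j then r else 0).
  have -> : p = ub + \sum_(j <- index_enum 'I_n) (if J j then r else 0) *: cd j.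
    rewrite /p scaler_sumr big_mkcond/=; congr (_ + _); apply: eq_bigr => i _.
    by case: (J i); rewrite ?scale0r.
  by rewrite cs_comb ?index_enum_uniq// mem_index_enum mulr1n csub.
have csp0 j : 0 <= cs j p by rewrite csp addr_ge0//; case: (J j).
have cp : creg p.
  split=> // i; rewrite (cs_sum uB p i); have [j Jj Aji] := HJ i.
  rewrite (bigD1 j)//=; apply: (@lt_le_trans _ _ r).
    by apply: lt_le_trans rc; apply: le_lt_trans (ler_norm _) _; rewrite ltrDl.
  apply: ler_wpDr; first by apply: sumr_ge0 => k' _; rewrite mulr_ge0.
  apply: (@le_trans _ _ (cs j p)); first by rewrite csp Jj lerDr.
  by apply: ler_peMr => //; rewrite ler1n.
split=> //.
(* Only upward moves stay in the region, so [u m] and [p] are compared through a common point above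
   both, with coordinates [sg]. *)
pose sg j := if J j then r else Num.max (cs j (u m)) (sb j).
pose d1 j := sg j - cs j (u m); pose d2 j := sg j - cs j p.
have d10 j : 0 <= d1 j.
  by rewrite subr_ge0 /sg; case: ifP => _; rewrite ?rsj// le_max lexx.
have d20 j : 0 <= d2 j.
  rewrite subr_ge0 csp /sg /sb; case: ifP => _; first by rewrite add0r.
  by rewrite addr0 le_max lexx orbT.
have w12 : u m + \sum_j d1 j *: cd j = p + \sum_j d2 j *: cd j.
  apply: cs_inj => j; rewrite !cs_comb ?index_enum_uniq// !mem_index_enum !mulr1n.
  by rewrite /d1 /d2 !(addrC (cs j _)) !subrK.
have h1 := Cup (u m) d1 eta cum (ltW eta0) d10.
have h2 := Cup p d2 eta cp (ltW eta0) d20.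
have {}h1 : `|Psi k (u m + \sum_j d1 j *: cd j) - Psi k (u m)| <= C * eta.
  apply: h1 => j; have [g1 g2] := gm j; have [Jj|nJ] := boolP (J j); first by left; exact: g1.
  right; rewrite /d1 /sg (negbTE nJ); have := g2 nJ; rewrite ler_distl => /andP[q1 q2].
  by rewrite lerBlDr ge_max addrC; apply/andP; split; lra.
have {}h2 : `|Psi k (p + \sum_j d2 j *: cd j) - Psi k p| <= C * eta.
  apply: h2 => j; have [g1 g2] := gm j; right; rewrite /d2 csp /sg.
  have [Jj|nJ] := boolP (J j); first by rewrite /sb Jj add0r subrr ltW.
  have := g2 nJ; rewrite addr0 ler_distl => /andP[q1 q2].
  by rewrite lerBlDr ge_max addrC; apply/andP; split; lra.
have h3 : `|Psi k (u m)| <= eta.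
  apply: le_trans (Psm k) _; rewrite -[leRHS]invrK lef_pV2 ?posrE ?invr_gt0// ?ltr0n//.
  by apply: le_trans MB _; rewrite ler_nat ltnW.
rewrite w12 in h1; set q := Psi k (p + _) in h1 h2.
have -> : Psi k p = (Psi k (u m) + (q - Psi k (u m))) - (q - Psi k p).
  have sw (v1 v2 v3 : R) : v3 = (v1 + (v2 - v1)) - (v2 - v3) by ring.
  exact: sw.
apply: le_trans (ler_normB _ _) _.
apply: le_trans (lerD (ler_normD _ _) (lexx _)) _.
apply: le_trans (lerD (lerD h3 h1) h2) _.
have H5 : (2 * C + 1 + 1) * eta = e by rewrite mulrC divfK// gt_eqF.
have sw : eta + C * eta + C * eta = (2 * C + 1 + 1) * eta - eta by ring.
by rewrite sw H5 gerBl ltW.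
Qed.

End LowerBound.

(** * Cones of the subdivision *)

Section Farkas.
Variables (R : realType) (n : nat).
Implicit Types (a b g h x y z : 'rV[R]_n) (s : seq 'rV[R]_n).

Lemma dotpC a x : dotp a x = dotp x a.
Proof. by apply: eq_bigr => i _; rewrite mulrC. Qed.

Lemma dotpDr a x y : dotp a (x + y) = dotp a x + dotp a y.
Proof. by rewrite /dotp -big_split; apply: eq_bigr => i _; rewrite mxE mulrDr. Qed.

Lemma dotpZr a (c : R) x : dotp a (c *: x) = c * dotp a x.
Proof. by rewrite /dotp mulr_sumr; apply: eq_bigr => i _; rewrite mxE mulrCA. Qed.

Lemma dotpDl a b x : dotp (a + b) x = dotp a x + dotp b x.
Proof. by rewrite dotpC dotpDr !(dotpC x). Qed.

Lemma dotpZl (c : R) a x : dotp (c *: a) x = c * dotp a x.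
Proof. by rewrite dotpC dotpZr (dotpC x). Qed.

Lemma dotp0r a : dotp a 0 = 0.
Proof. by rewrite -(scale0r 0) dotpZr mul0r. Qed.

Lemma dotpNr a x : dotp a (- x) = - dotp a x.
Proof. by rewrite -scaleN1r dotpZr mulN1r. Qed.

Lemma dotpNl a x : dotp (- a) x = - dotp a x.
Proof. by rewrite dotpC dotpNr dotpC. Qed.

Lemma dotp_sumr a (I : Type) (r : seq I) (P : pred I) (F : I -> 'rV[R]_n) :
  dotp a (\sum_(i <- r | P i) F i) = \sum_(i <- r | P i) dotp a (F i).
Proof.
elim/big_rec2: _ => [|i y1 y2 _ <-]; first exact: dotp0r.
by rewrite dotpDr.
Qed.

Lemma dotp_evec (j : 'I_n) x : dotp (evec R j) x = x ord0 j.
Proof.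
rewrite /dotp (bigD1 j)//= big1 ?addr0; first by rewrite /evec mxE !eqxx mul1r.
by move=> i /negbTE ij; rewrite /evec mxE ij andbF mul0r.
Qed.

Fixpoint incone s b : Prop := match s with
  | [::] => b = 0
  | g :: s' => exists c, 0 <= c /\ incone s' (b - c *: g)
  end.

Lemma incone_shift s (c : 'rV[R]_n -> R) h b : (forall g, g \in s -> 0 <= c g) ->
  incone [seq g + c g *: h | g <- s] b -> exists d, 0 <= d /\ incone s (b - d *: h).
Proof.
elim: s b => [|g s IH] b c0 /=.
  by move=> ->; exists 0; rewrite scale0r subr0.
move=> [lam [l0 /IH[|d [d0 H]]]]; first by move=> g' g's; apply: c0; rewrite inE g's orbT.
exists (lam * c g + d); split.
  by rewrite addr_ge0// mulr_ge0// c0// mem_head.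
exists lam; split=> //; congr (incone s _): H.
rewrite scalerDr scalerA scalerDl; have sw (x1 x2 x3 x4 : 'rV[R]_n) : x1 - (x2 + x3) - x4 = x1 - (x3 + x4) - x2.
  by apply/rowP => i; rewrite !mxE; ring.
exact: sw.
Qed.

(** Induction on the number of generators. If y separates b from all generators except h, and h . y
    < 0, every vector is projected along h to the hyperplane orthogonal to y. A combination of the
    projections lifts back to the original vectors; a separator of the projections is corrected by a
    multiple of y to become orthogonal to h. *)
Lemma farkas s b : incone s b \/
  exists y, (forall g, g \in s -> 0 <= dotp g y) /\ dotp b y < 0.
Proof.
move: {2}(size s) (erefl (size s)) => m; elim: m s b => [|m IH] s b.
  move/eqP; rewrite size_eq0 => /eqP ->; have [->|b0] := eqVneq b 0; first by left.
  right; exists (- b); split=> //; rewrite dotpNr oppr_lt0 /dotp lt_neqAle.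
  rewrite sumr_ge0 ?andbT; last by move=> i _; rewrite -expr2 sqr_ge0.
  apply: contra b0; rewrite eq_sym psumr_eq0; last by move=> i _; rewrite -expr2 sqr_ge0.
  move/allP => H; apply/eqP/rowP => i; rewrite mxE; apply/eqP.
  by have := H i (mem_index_enum i); rewrite -expr2 sqrf_eq0.
case: s => [//|h s] /= [sm].
have [inc|[y [y0 by0]]] := IH s b sm.
  by left; exists 0; rewrite scale0r subr0.
have [hy|hy] := leP 0 (dotp h y).
  by right; exists y; split=> // g; rewrite inE => /predU1P[->//|]; exact: y0.
have hy0 : dotp h y != 0 by rewrite lt_eqF.
pose c g := - (dotp g y / dotp h y).
have [|inc|[y' [y'0 by']]] := IH [seq g + c g *: h | g <- s] (b + c b *: h).
- by rewrite size_map.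
- left; have [|d [d0 H]] := incone_shift _ inc.
    by move=> g /y0 gy; rewrite /c -mulrN mulr_ge0// oppr_ge0 invr_le0 ltW.
  exists (d - c b); split.
    rewrite subr_ge0 (le_trans _ d0)// /c oppr_le0 mulr_le0// ?invr_le0; exact: ltW.
  congr (incone s _): H; rewrite scalerBl; apply/rowP => i; rewrite !mxE; ring.
right; pose z := y' - (dotp h y' / dotp h y) *: y; exists z.
have hz : dotp h z = 0 by rewrite dotpDr dotpNr dotpZr divfK// subrr.
have gz g : dotp g z = dotp (g + c g *: h) y'.
  by rewrite dotpDl dotpZl dotpDr dotpNr dotpZr /c; field.
split=> [g|]; last by rewrite gz.
rewrite inE => /predU1P[->|gs]; first by rewrite hz.
by rewrite gz; apply: y'0; apply: map_f.
Qed.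

(** A nonnegative combination drops by at most the sum of its coefficients when each generator is
    allowed to reach the value -1. *)
Lemma incone_bound s b : incone s b -> exists K, 0 <= K /\ forall u,
  (forall g, g \in s -> - 1 <= dotp g u) -> - K <= dotp b u.
Proof.
elim: s b => [|g s IH] b /=.
  by move=> ->; exists 0; split=> // u _; rewrite dotpC dotp0r oppr0.
move=> [c [c0 /IH[K [K0 HK]]]]; exists (K + c); split; first exact: addr_ge0.
move=> u Hu; have : - K <= dotp (b - c *: g) u.
  by apply: HK => g' g's; apply: Hu; rewrite inE g's orbT.
rewrite dotpDl dotpNl dotpZl => h1.
have : c * - 1 <= c * dotp g u by apply: ler_wpM2l => //; apply: Hu; rewrite mem_head.
by move: h1; rewrite mulrN1; set v := c * _; lra.
Qed.

End Farkas.

Section Primitive.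
Variables (R : realType) (n : nat).
Implicit Types (a b w : 'rV[int]_n).

(** Coprimality of the entries in Bezout form; for a member of a basis of Z^n a column of the
    inverse matrix is a witness. *)
Definition primitive a := exists w : 'rV[int]_n, \sum_i a ord0 i * w ord0 i = 1.

Lemma int_mul_eq1 (x y : int) : 0 < x -> x * y = 1 -> x = 1.
Proof.
move=> x0 xy; have y0 : 0 < y by nia.
nia. Qed.

(** Pairing with the two Bezout witnesses shows that both c and 1/c are integers. *)
Lemma primitive_eq a b (c : R) : primitive a -> primitive b -> 0 < c ->
  intR R b = c *: intR R a -> b = a.
Proof.
move=> [w aw] [w' bw'] c0 E.
have Ei i : ((b ord0 i)%:~R : R) = c * (a ord0 i)%:~R by have /rowP/(_ i) := E; rewrite !mxE.
have S (v : 'rV[int]_n) : ((\sum_i b ord0 i * v ord0 i)%:~R : R) = c * (\sum_i a ord0 i * v ord0 i)%:~R.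
  by rewrite !rmorph_sum/= mulr_sumr; apply: eq_bigr => i _; rewrite !rmorphM/= Ei mulrA.
have := S w; have := S w'; rewrite aw bw' mulr1.
set za := \sum_i a ord0 i * w' ord0 i; set zb := \sum_i b ord0 i * w ord0 i => h1 h2.
have zb0 : 0 < zb by rewrite -(ltr0z R) h2.
have zz : zb * za = 1.
  by apply/eqP; rewrite -(eqr_int R) rmorphM/= h2 -h1.
have zb1 : zb = 1 by apply: int_mul_eq1 zz.
have c1 : c = 1 by rewrite -h2 zb1.
by apply/rowP => i; apply/eqP; rewrite -(eqr_int R) Ei c1 mul1r.
Qed.

Lemma basis_primitive (S : seq 'rV[int]_n) i : completes_to_basis S -> (i < size S)%N ->
  primitive (nth 0 S i).
Proof.
move=> [sn [B [uB rB]]] iS; have iN : (i < n)%N := leq_trans iS sn.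
exists (\row_k (invmx B) k (Ordinal iN)).
have := mulmxV uB => /matrixP/(_ (Ordinal iN) (Ordinal iN)).
rewrite !mxE eqxx => E; rewrite -[RHS]E; apply: eq_bigr => k _.
by rewrite -(rB (Ordinal iN) iS) !mxE.
Qed.

Lemma primitive_neq0 a : primitive a -> intR R a != 0.
Proof.
move=> [w aw]; apply/eqP => a0; have : (1 : int) = 0; last by [].
rewrite -[LHS]aw big1// => i _; have /rowP/(_ i) := a0; rewrite !mxE => /eqP.
by rewrite intr_eq0 => /eqP ->; rewrite mul0r.
Qed.

Lemma gcone_gen (S : seq 'rV[int]_n) i : (i < size S)%N -> gcone S (intR R (nth 0 S i)).
Proof.
move=> iS; exists (fun k => (k == i)%:R); split=> //.
rewrite (bigD1 (Ordinal iS))//= eqxx scale1r big1 ?addr0// => k.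
by rewrite -val_eqE/= => /negbTE ->; rewrite scale0r.
Qed.

End Primitive.

Section Cones.
Variables (R : realType) (n : nat) (P : set 'rV[R]_n) (Sig : seq (seq 'rV[int]_n)).
Hypothesis ss : simplicial_subdivision P Sig.
Implicit Types (S T : seq 'rV[int]_n) (u : 'rV[R]_n).

Definition chart S := (S \in Sig) && (size S == n).
(** The absolute values are harmless: the cones lie in the orthant, so their generators have
    nonnegative entries. *)
Definition gens S (j i : 'I_n) : nat := `|(nth 0%R S j) ord0 i|%N.

Let fan : is_fan R Sig. Proof. by have [] := ss. Qed.
Let basis S : S \in Sig -> completes_to_basis S. Proof. by have [_ _ _] := ss; exact. Qed.

Lemma gens_nonneg S k i : S \in Sig -> (k < size S)%N -> nth 0 S k ord0 i = `|(nth 0%R S k) ord0 i|%N.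
Proof.
move=> SS kS; have [_ + _ _] := ss => /seteqP[H _].
have /H/(_ i) : (\bigcup_(S in [set S | S \in Sig]) @gcone R n S) (intR R (nth 0 S k)).
  by exists S => //; exact: gcone_gen.
by rewrite mxE ler0z => h; rewrite gez0_abs.
Qed.

Lemma chart_cd S (j : 'I_n) : chart S -> cd R (gens S) j = intR R (nth 0 S j).
Proof.
move=> /andP[SS /eqP sz]; apply/rowP => i; rewrite !mxE /gens.
by rewrite [in RHS]gens_nonneg ?sz.
Qed.

Lemma chart_unit S : chart S -> (\matrix_(j, i) (gens S j i)%:R : 'M[R]_n) \in unitmx.
Proof.
move=> cS; have /andP[SS /eqP sz] := cS; have [_ [B [uB rB]]] := basis SS.
have -> : (\matrix_(j, i) (gens S j i)%:R : 'M[R]_n) = map_mx intr B.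
  apply/matrixP => j i; rewrite !mxE; have := chart_cd j cS => /rowP/(_ i); rewrite !mxE => ->.
  by rewrite -(rB j) ?sz// mxE.
rewrite unitmxE det_map_mx; move: uB; rewrite unitmxE => h; exact: rmorph_unit h.
Qed.

(** The basis dual to the generators; it presents the coordinates as linear functionals, to which
    Farkas' lemma applies. *)
Definition csv S (j : 'I_n) : 'rV[R]_n :=
  \row_i invmx (\matrix_(j, i) (gens S j i)%:R : 'M[R]_n) i j.

Lemma csE S j u : cs (gens S) j u = dotp (csv S j) u.
Proof. by rewrite /cs mxE; apply: eq_bigr => i _; rewrite !mxE mulrC. Qed.

Lemma cs_gen S (j k : 'I_n) : chart S -> cs (gens S) j (intR R (nth 0 S k)) = (j == k)%:R.
Proof.
move=> cS; rewrite -chart_cd//; have := cs_comb (chart_unit cS) (0 : 'rV[R]_n) (s := [:: k]) (fun=> 1) j isT.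
rewrite big_seq1 scale1r add0r => ->.
by rewrite /cs mul0mx mxE add0r inE.
Qed.

Lemma gconeE S u : chart S -> gcone S u <-> forall j, 0 <= cs (gens S) j u.
Proof.
move=> cS; have /andP[SS /eqP sz] := cS; split.
  move=> [lam [l0 ->]] j; rewrite csE dotp_sumr; apply: sumr_ge0 => k _.
  rewrite dotpZr mulr_ge0//; have kn : (k < n)%N := leq_trans (ltn_ord k) (eq_leq sz).
  by rewrite -csE -[nat_of_ord k]/(nat_of_ord (Ordinal kn)) cs_gen.
move=> H; exists (fun i => if insub i is Some j then cs (gens S) j u else 0); split.
  by move=> i; case: insubP.
rewrite {1}(cs_expand (chart_unit cS) u).
rewrite -(big_mkord xpredT (fun i => (if insub i is Some j then cs (gens S) j u else 0) *:
  intR R (nth 0 S i))) sz big_mkord; apply: eq_bigr => j _.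
by rewrite valK chart_cd.
Qed.

Lemma gcone_cs S u (j : 'I_n) : chart S -> gcone S u -> 0 <= cs (gens S) j u.
Proof. by move=> cS /(gconeE _ cS). Qed.

Lemma gcone_pick S u : S \in Sig -> gcone S u -> u != 0 ->
  exists lam : nat -> R, [/\ forall i, 0 <= lam i, u = \sum_(i < size S) lam i *: intR R (nth 0 S i) &
    exists2 i, (i < size S)%N & 0 < lam i].
Proof.
move=> SS [lam [l0 E]] u0; exists lam; split=> //; apply: contrapT => no.
move/eqP: u0; apply; rewrite E big1// => i _.
suff -> : lam i = 0 by rewrite scale0r.
apply/eqP; rewrite eq_le l0 andbT leNgt; apply/negP => li; apply: no; exists i => //.
Qed.

(* The ray spanned by a generator is the face cut out by the sum of the other coordinates. *)
Lemma gens_skeleton1 S (j : 'I_n) : chart S -> skeleton1 Sig (nth 0 S j).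
Proof.
move=> cS; have /andP[SS /eqP sz] := cS.
pose w := \sum_(i | i != j) csv S i.
have wE x : dotp w x = \sum_(i | i != j) cs (gens S) i x.
  by rewrite dotpC dotp_sumr; apply: eq_bigr => i _; rewrite csE dotpC.
have [face _ _] := fan; have [|T TS FE] := face S SS (gcone S `&` hyp w 0).
  exists w; split=> // x /(gconeE _ cS) h; rewrite wE; exact: sumr_ge0.
have ray x : gcone T x <-> exists2 c : R, 0 <= c & x = c *: intR R (nth 0 S j).
  rewrite -FE; split=> [[/(gconeE _ cS) h] |[c c0 ->]].
    rewrite /hyp/= wE => /eqP; rewrite psumr_eq0 => [/allP z|i _]; last exact: h.
    exists (cs (gens S) j x); first exact: h.
    rewrite {1}(cs_expand (chart_unit cS) x) (bigD1 j)//= chart_cd// big1 ?addr0// => i ij.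
    have := z i (mem_index_enum i); rewrite ij => /eqP ->; exact: scale0r.
  have csc i : cs (gens S) i (c *: intR R (nth 0 S j)) = c * (i == j)%:R.
    by rewrite csE dotpZr -csE cs_gen.
  split; first by apply/(gconeE _ cS) => i; rewrite csc mulr_ge0.
  by rewrite /hyp/= wE big1// => i /negbTE ij; rewrite csc ij mulr0.
have pj : primitive (nth 0 S j) by apply: basis_primitive; [exact: basis|rewrite sz].
have genT i : (i < size T)%N -> nth 0 T i = nth 0 S j.
  move=> iT; have pi := basis_primitive (basis TS) iT.
  have /ray[c c0 E] := @gcone_gen R n T i iT.
  apply: (@primitive_eq R _ _ _ c) => //; rewrite lt_neqAle c0 andbT eq_sym.
  by apply/eqP => cz; have := primitive_neq0 R pi; rewrite E cz scale0r eqxx.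
have : gcone T (intR R (nth 0 S j)) by apply/ray; exists 1; rewrite ?scale1r.
move=> inT; have [lam [_ _ [i iT _]]] := gcone_pick TS inT (primitive_neq0 R pj).
have sT : size T = 1%N.
  apply/eqP; rewrite eqn_leq (leq_ltn_trans _ iT)// andbT leqNgt; apply/negP => s2.
  have [sn [B [uB rB]]] := basis TS.
  have n0 : (0 < n)%N by apply: leq_trans sn; apply: leq_trans s2.
  have n1 : (1 < n)%N by apply: leq_trans sn.
  have := mulmxV uB => /matrixP E.
  have E0 := E (Ordinal n0) (Ordinal n0); have E1 := E (Ordinal n1) (Ordinal n0).
  have BB k : B (Ordinal n1) k = B (Ordinal n0) k.
    have := rB (Ordinal n1) s2; have := rB (Ordinal n0) (ltnW s2).
    rewrite (genT (Ordinal n1) s2) (genT (Ordinal n0) (ltnW s2)).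
    by move=> /rowP/(_ k); rewrite !mxE => -> /rowP/(_ k); rewrite !mxE.
  move: E1; rewrite !mxE -val_eqE/= (eq_bigr (fun k => B (Ordinal n0) k * (invmx B) k (Ordinal n0))).
    by move: E0; rewrite !mxE eqxx => ->.
  by move=> k _; rewrite BB.
have := genT 0%N; rewrite sT => /(_ isT) <-.
by rewrite /skeleton1/= -[[:: _]](_ : T = _)//; case: T sT {ray inT FE TS genT iT} => [//|x []].
Qed.

(** A functional supporting the common face vanishes at [u], hence at every generator of S with
    positive coefficient in it, so the k-th one lies in T. The same argument from the side of T
    yields a generator of T on the same ray, and primitivity makes the two equal. *)
Lemma shared_gen S T u (k : 'I_n) : chart S -> chart T -> gcone S u -> gcone T u ->
  0 < cs (gens S) k u -> exists j : 'I_n, nth 0 S k = nth 0 T j.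
Proof.
move=> cS cT Su Tu ku; have /andP[SS /eqP szS] := cS; have /andP[TS /eqP szT] := cT.
have [_ /(_ S T SS TS)[[w [w0 wE]] [w' [w'0 w'E]]] _] := fan.
have pk : primitive (nth 0 S k) by apply: basis_primitive; [exact: basis|rewrite szS].
have akT : gcone T (intR R (nth 0 S k)).
  have : (gcone S `&` gcone T) u by split.
  rewrite wE => -[_]; rewrite /hyp/= {1}(cs_expand (chart_unit cS) u) dotp_sumr => /eqP.
  have t0 i : 0 <= dotp w (cs (gens S) i u *: cd R (gens S) i).
    rewrite dotpZr mulr_ge0//; first exact: gcone_cs.
    by rewrite chart_cd//; apply: w0; apply: gcone_gen; rewrite szS.
  rewrite psumr_eq0// => /allP/(_ k (mem_index_enum k))/=.
  rewrite dotpZr mulf_eq0 gt_eqF//= => /eqP wk.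
  suff : (gcone S `&` gcone T) (intR R (nth 0 S k)) by case.
  by rewrite wE; split; [apply: gcone_gen; rewrite szS|rewrite /hyp/= -chart_cd].
have [j tj] : exists j, 0 < cs (gens T) j (intR R (nth 0 S k)).
  apply: contrapT => no; have := primitive_neq0 R pk; move/eqP; apply.
  rewrite (cs_expand (chart_unit cT) (intR R (nth 0 S k))) big1// => j _.
  suff -> : cs (gens T) j (intR R (nth 0 S k)) = 0 by rewrite scale0r.
  apply/eqP; rewrite eq_le (gcone_cs j cT akT) andbT leNgt.
  by apply/negP => h; apply: no; exists j.
exists j.
have tS i : 0 < cs (gens T) i (intR R (nth 0 S k)) -> gcone S (intR R (nth 0 T i)).
  move=> ti; have : (gcone S `&` gcone T) (intR R (nth 0 S k)).
    by split=> //; apply: gcone_gen; rewrite szS.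
  rewrite w'E => -[_]; rewrite /hyp/= {1}(cs_expand (chart_unit cT) (intR R (nth 0 S k))) dotp_sumr.
  move=> /eqP; have t0 i' : 0 <= dotp w' (cs (gens T) i' (intR R (nth 0 S k)) *: cd R (gens T) i').
    rewrite dotpZr mulr_ge0//; first exact: gcone_cs.
    by rewrite chart_cd//; apply: w'0; apply: gcone_gen; rewrite szT.
  rewrite psumr_eq0// => /allP/(_ i (mem_index_enum i))/=.
  rewrite dotpZr mulf_eq0 gt_eqF//= => /eqP wi.
  suff : (gcone S `&` gcone T) (intR R (nth 0 T i)) by case.
  by rewrite w'E; split; [apply: gcone_gen; rewrite szT|rewrite /hyp/= -chart_cd].
have pj : primitive (nth 0 T j) by apply: basis_primitive; [exact: basis|rewrite szT].
have z i : i != k -> cs (gens S) i (intR R (nth 0 T j)) = 0.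
  move=> ik; have : cs (gens S) i (intR R (nth 0 S k)) = 0 by rewrite cs_gen// (negbTE ik).
  rewrite {1}(cs_expand (chart_unit cT) (intR R (nth 0 S k))) csE dotp_sumr => /eqP.
  rewrite psumr_eq0 => [/allP/(_ j (mem_index_enum j))/=|l _].
    by rewrite dotpZr mulf_eq0 gt_eqF//= chart_cd// -csE => /eqP.
  rewrite dotpZr; have [h|h] := ltP 0 (cs (gens T) l (intR R (nth 0 S k))).
    apply: mulr_ge0; first exact: ltW.
    by rewrite chart_cd// -csE; apply: gcone_cs (tS l h).
  have -> : cs (gens T) l (intR R (nth 0 S k)) = 0.
    by apply/eqP; rewrite eq_le h (gcone_cs l cT akT).
  by rewrite mul0r.
have E : intR R (nth 0 T j) = cs (gens S) k (intR R (nth 0 T j)) *: intR R (nth 0 S k).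
  rewrite {1}(cs_expand (chart_unit cS) (intR R (nth 0 T j))) (bigD1 k)//= chart_cd//.
  by rewrite big1 ?addr0// => i /z ->; rewrite scale0r.
symmetry; apply: (@primitive_eq R _ _ _ (cs (gens S) k (intR R (nth 0 T j)))) => //.
rewrite lt_neqAle (gcone_cs k cS (tS j tj)) andbT eq_sym.
by apply/eqP => cz; have := primitive_neq0 R pj; rewrite E cz scale0r eqxx.
Qed.

(** The generators of S that occur in [u] with positive coefficient are shared, so the expansion of
    [u] in S is also its expansion in T. *)
Lemma shared_coord S T u (k j : 'I_n) : chart S -> chart T -> gcone S u -> gcone T u ->
  nth 0 S k = nth 0 T j -> cs (gens S) k u = cs (gens T) j u.
Proof.
move=> cS cT Su Tu E; rewrite [in RHS](cs_expand (chart_unit cS) u) [RHS]csE dotp_sumr.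
have term i : dotp (csv T j) (cs (gens S) i u *: cd R (gens S) i) =
    if i == k then cs (gens S) k u else 0.
  rewrite dotpZr chart_cd// -csE; case: eqVneq => [->|ik].
    by rewrite E cs_gen// eqxx mulr1.
  have [h|h] := ltP 0 (cs (gens S) i u); last first.
    suff -> : cs (gens S) i u = 0 by rewrite mul0r.
    by apply/eqP; rewrite eq_le h (gcone_cs i cS Su).
  have [j' E'] := shared_gen cS cT Su Tu h.
  rewrite E' cs_gen//; have [jj|] := eqVneq j j'; last by rewrite mulr0.
  have := cs_gen i k cS; rewrite E jj -E' cs_gen// eqxx (negbTE ik) => /eqP.
  by rewrite oner_eq0.
by rewrite (eq_bigr _ (fun i _ => term i)) -big_mkcond big_pred1_eq.
Qed.

(** By Farkas' lemma the functional is minus a nonnegative combination of the coordinates of both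
    cones; relaxing each constraint from 0 to -1 then changes it by a bounded amount. *)
Lemma cone_functional_bound S T (b : 'rV[R]_n) : chart S -> chart T ->
  (forall u, gcone S u -> gcone T u -> dotp b u <= 0) ->
  exists K, 0 <= K /\ forall u, (forall j, - 1 <= cs (gens S) j u) ->
    (forall j, - 1 <= cs (gens T) j u) -> dotp b u <= K.
Proof.
move=> cS cT H; pose s := [seq csv S j | j <- enum 'I_n] ++ [seq csv T j | j <- enum 'I_n].
have [inc|[y [y0 yb]]] := farkas s (- b).
  have [K [K0 HK]] := incone_bound inc; exists K; split=> // u hS hT.
  rewrite -lerN2 -dotpNl; apply: HK => g; rewrite mem_cat => /orP[] /mapP[j _ ->].
    by rewrite -csE.
  by rewrite -csE.
exfalso; move: yb; rewrite dotpNl oppr_lt0 ltNge => /negP; apply; apply: H.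
  by apply/(gconeE _ cS) => j; rewrite csE; apply: y0; rewrite mem_cat map_f ?mem_enum.
by apply/(gconeE _ cT) => j; rewrite csE; apply: y0; rewrite mem_cat map_f ?mem_enum ?orbT.
Qed.

Lemma at_rightW (Q : set R) : nbhs (0 : R) Q -> \forall r \near (0 : R)^'+, Q r.
Proof. by move=> h; exact: cvg_within h. Qed.

Lemma poly_near0 (p : {poly R}) : p != 0 -> \forall r \near (0 : R)^'+, p.[r] != 0.
Proof.
elim/poly_ind: p => [|p c IH]; first by rewrite eqxx.
have [->|c0] := eqVneq c 0; last first.
  move=> _; set q := p * 'X + c%:P.
  have H := @continuous_horner R q 0 [set z | z != 0].
  apply: at_rightW; apply: H; rewrite [q.[0]]hornerMXaddC mulr0 add0r.
  by apply: open_nbhs_nbhs; split=> //; exact: open_neq.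
rewrite addr0 mulf_eq0 polyX_eq0 orbF => /IH H.
near=> r; rewrite hornerMX mulf_neq0//; by near: r.
Unshelve. all: by end_near. Qed.

(** Suppose no maximal cone contains [u] and perturb it by (r, r^2, ..., r^n) with small r > 0.
    Maximal cones, being closed, still miss it, and a lower-dimensional cone lies in a hyperplane
    that the curve leaves at once; so no cone at all contains the perturbed point. *)
Lemma charts_cover u : (forall i, 0 < u ord0 i) -> exists2 S, chart S & gcone S u.
Proof.
move=> u0; apply: contrapT => no.
pose ur (r : R) : 'rV[R]_n := \row_i (u ord0 i + r ^+ i.+1).
(* The polynomial r -> w . u(r); its coefficients of positive degree are the entries of w, so it is
   nonzero as soon as w is. *)
pose pu (w : 'rV[R]_n) : {poly R} := (dotp w u)%:P + \poly_(k < n.+1)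
   (if k is k'.+1 then (if insub k' is Some i then w ord0 i else 0) else 0).
have puE w r : (pu w).[r] = dotp w (ur r).
  rewrite hornerD hornerC horner_poly big_ord_recl/= mul0r add0r /dotp -big_split/=.
  by apply: eq_bigr => i _; rewrite mxE mulrDr /bump/= valK.
have pu0 w : w != 0 -> pu w != 0.
  move=> w0; apply/eqP => pz; move/eqP: w0; apply; apply/rowP => i; rewrite mxE.
  have := congr1 (fun p : {poly R} => p`_i.+1) pz; rewrite coef0 coefD coefC/= coef_poly add0r.
  by rewrite ltnS ltn_ord valK.
have good S : S \in Sig -> \forall r \near (0 : R)^'+, ~ gcone S (ur r).
  move=> SS; have [sn [B [uB rB]]] := basis SS.
  have [sz|sz] := eqVneq (size S) n.
    have cS : chart S by rewrite /chart SS sz eqxx.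
    have [j hj] : exists j, cs (gens S) j u < 0.
      apply: contrapT => no'; apply: no; exists S => //; apply/(gconeE _ cS) => j.
      by rewrite leNgt; apply/negP => h; apply: no'; exists j.
    have : {for 0, continuous (horner (pu (csv S j)))} by exact: continuous_horner.
    rewrite /continuous_at => /(_ [set z | z < 0]) H.
    have : nbhs (0 : R) [set r | (pu (csv S j)).[r] < 0].
      apply: H; apply: open_nbhs_nbhs; split; first exact: open_lt.
      rewrite /= puE; rewrite (_ : ur 0 = u) -?csE//.
      by apply/rowP => i; rewrite mxE expr0n addr0.
    move/at_rightW; apply: filterS => r /=; rewrite puE -csE => lt0 /(gconeE _ cS)/(_ j).
    by rewrite leNgt lt0.
  have sn' : (size S < n)%N by rewrite ltn_neqAle sz.
  (* The column of the inverse basis matrix just beyond the generators of S is a normal vector to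
     their span. *)
  pose w : 'rV[R]_n := \row_k ((invmx B) k (Ordinal sn'))%:~R.
  have w0 : w != 0.
    apply/eqP => wz; have := mulmxV uB => /matrixP/(_ (Ordinal sn') (Ordinal sn')).
    rewrite !mxE eqxx big1// => k _; have /rowP/(_ k) := wz; rewrite !mxE => /eqP.
    by rewrite intr_eq0 => /eqP ->; rewrite mulr0.
  have := poly_near0 (pu0 w w0); apply: filterS => r /eqP; rewrite puE => wr [lam [_ E]].
  apply: wr; rewrite E dotp_sumr big1// => i _; rewrite dotpZr.
  suff -> : dotp w (intR R (nth 0 S i)) = 0 by rewrite mulr0.
  have iN : (i < n)%N := ltn_trans (ltn_ord i) sn'.
  have := mulmxV uB => /matrixP/(_ (Ordinal iN) (Ordinal sn')).
  rewrite !mxE -val_eqE/= (ltn_eqF (ltn_ord i)) => /(congr1 (fun z : int => z%:~R : R)).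
  rewrite rmorph_sum/= => h; rewrite -[RHS]h; apply: eq_bigr => k _.
  by rewrite rmorphM/= !mxE mulrC -(rB (Ordinal iN))//= mxE.
have allgood (s : seq (seq 'rV[int]_n)) : {subset s <= Sig} ->
    \forall r \near (0 : R)^'+, forall S, S \in s -> ~ gcone S (ur r).
  elim: s => [|S s IH] sS; first by near=> r.
  have h1 := good S (sS _ (mem_head _ _)).
  have h2 : \forall r \near (0 : R)^'+, forall S, S \in s -> ~ gcone S (ur r).
    by apply: IH => T Ts; apply: sS; rewrite inE Ts orbT.
  apply: filterS2 h1 h2 => r r1 r2 T; rewrite inE => /predU1P[->//|]; exact: r2.
have {}allgood := allgood Sig (fun S SS => SS).
have : \forall r \near (0 : R)^'+, False; last first.
  by move=> h; have [? []] := filter_ex h.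
near=> r.
have r0 : 0 < r by [].
have [_ /seteqP[_ cov] _ _] := ss.
have [S SS Su] : (\bigcup_(S in [set S | S \in Sig]) @gcone R n S) (ur r).
  by apply: cov => i; rewrite mxE addr_ge0 ?exprn_ge0// ltW.
by move: S SS Su; near: r.
Unshelve. all: by end_near. Qed.

End Cones.

(** * Newton polyhedra *)

Section Dickson.
Variables (X I : eqType) (c : I -> X -> nat).

(** Let K be the largest [c j] on a finite dominating set for the remaining indices. Elements with
    [c j] at least K are dominated by that set; below K there are finitely many values, and each
    slice is handled by the induction hypothesis. *)
Lemma dickson (js : seq I) (T : set X) : exists M : seq X, (forall m, m \in M -> T m) /\
  forall x, T x -> exists m, m \in M /\ forall j, j \in js -> (c j m <= c j x)%N.
Proof.
elim: js T => [|j js IH] T.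
  have [[x Tx]|no] := pselect (exists x, T x); last first.
    by exists [::]; split=> // x Tx; case: no; exists x.
  exists [:: x]; split=> [m|y _]; first by rewrite inE => /eqP ->.
  by exists x; rewrite mem_head.
have [M0 [M0T M0P]] := IH T.
pose K := \max_(m <- M0) c j m.
have mK m : m \in M0 -> (c j m <= K)%N.
  rewrite /K; elim: (M0) => [//|x s IHs]; rewrite inE => /predU1P[->|/IHs h]; rewrite big_cons leq_max ?leqnn//.
  by rewrite h orbT.
have [M1 [M1T M1P]] : exists M : seq X, (forall m, m \in M -> T m) /\
   forall x, T x -> (c j x < K)%N ->
     exists m, m \in M /\ forall k, k \in j :: js -> (c k m <= c k x)%N.
  elim: (K) => [|k [M [MT MP]]]; first by exists [::].
  have [M' [M'T M'P]] := IH [set x | T x /\ c j x = k].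
  exists (M ++ M'); split=> [m|x Tx].
    by rewrite mem_cat => /orP[/MT//|/M'T[]].
  rewrite ltnS leq_eqVlt => /orP[/eqP xk|xk].
    have [m [mM' H]] := M'P x (conj Tx xk); exists m; split; first by rewrite mem_cat mM' orbT.
    move=> i; rewrite inE => /predU1P[->|/H//]; have [_ ->] := M'T m mM'; by rewrite xk.
  by have [m [mM H]] := MP x Tx xk; exists m; split=> //; rewrite mem_cat mM.
exists (M0 ++ M1); split=> [m|x Tx].
  by rewrite mem_cat => /orP[/M0T|/M1T].
have [xK|xK] := ltnP (c j x) K.
  by have [m [mM H]] := M1P x Tx xK; exists m; split=> //; rewrite mem_cat mM orbT.
have [m [mM H]] := M0P x Tx; exists m; split; first by rewrite mem_cat mM.
by move=> i; rewrite inE => /predU1P[->|/H//]; apply: leq_trans (mK m mM) xK.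
Qed.

End Dickson.

Section Newton.
Variables (R : realType) (n : nat).
Implicit Types (g : 'rV[R]_n -> R) (a x y : 'rV[R]_n) (al be m : 'rV[nat]_n).

Lemma dickson_supp g : exists M : seq 'rV[nat]_n, (forall m, m \in M -> taylor_coef g m != 0) /\
  forall al, taylor_coef g al != 0 -> exists2 m, m \in M & forall i, (m ord0 i <= al ord0 i)%N.
Proof.
have [M [MT MP]] := @dickson _ _ (fun (i : 'I_n) al => al ord0 i) (enum 'I_n)
   [set al | taylor_coef g al != 0].
exists M; split=> [m /MT//|al /MP[m [mM H]]]; exists m => // i.
by apply: H; rewrite mem_enum.
Qed.

Lemma dotp_mono a x y : orthant a -> (forall i, x ord0 i <= y ord0 i) -> dotp a x <= dotp a y.
Proof. by move=> a0 xy; apply: ler_sum => i _; apply: ler_wpM2l. Qed.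

Lemma newton_supp g al x : taylor_coef g al != 0 -> (forall i, (al ord0 i)%:R <= x ord0 i) ->
  newton g x.
Proof.
move=> Tal h; exists 1%N, (fun=> 1), (fun=> x); split=> //; first by rewrite big_ord1.
  by move=> _; exists al.
by rewrite big_ord1 scale1r.
Qed.

Lemma newton_valid g a (L : R) : orthant a ->
  (forall al, taylor_coef g al != 0 -> L <= dotp a (natR R al)) -> newton g `<=` hyp_plus a L.
Proof.
move=> a0 H x [k [w [p [w0 w1 pA ->]]]]; rewrite /hyp_plus/= dotp_sumr.
rewrite -[L]mul1r -w1 mulr_suml; apply: ler_sum => i _; rewrite dotpZr; apply: ler_wpM2l => //.
have [al Tal h] := pA i; apply: le_trans (H al Tal) _; apply: dotp_mono => // j.
by rewrite mxE.
Qed.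

Lemma newton_orthant g : newton g `<=` @orthant R n.
Proof.
move=> x gx i; rewrite -(dotp_evec i x).
apply: (newton_valid (L := 0) _ _ gx).
  by move=> k; rewrite mxE; case: (_ && _).
by move=> al _; rewrite dotp_evec mxE.
Qed.

Lemma cons_rowB k (t s c : R) (x y : 'rV[R]_k) :
  cons_row t x - c *: cons_row s y = cons_row (t - c * s) (x - c *: y).
Proof. by apply/rowP => i; rewrite !mxE; case: unliftP => [j _|_]; rewrite ?mxE. Qed.

Lemma dotp_cons k (t : R) (x : 'rV[R]_k) (y : 'rV[R]_k.+1) :
  dotp (cons_row t x) y = t * y ord0 ord0 + dotp x (\row_j y ord0 (lift ord0 j)).
Proof.
rewrite /dotp big_ord_recl cons_row0; congr (_ + _).
by apply: eq_bigr => j _; rewrite cons_rowS mxE.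
Qed.

Lemma incone_evec (s : seq 'I_n) (t : R) x :
  incone [seq cons_row 0 (evec R i) | i <- s] (cons_row t x) -> t = 0 /\ orthant x.
Proof.
elim: s x => [|i s IH] x /=.
  move=> /rowP H; split; first by have := H ord0; rewrite cons_row0 mxE.
  by move=> j; have := H (lift ord0 j); rewrite cons_rowS mxE => ->.
move=> [c [c0]]; rewrite cons_rowB mulr0 subr0 => /IH[-> h]; split=> // j.
have := h j; rewrite !mxE subr_ge0; apply: le_trans; by rewrite mulr_ge0.
Qed.

Lemma incone_hull (M : seq 'rV[nat]_n) (t : R) x :
  incone ([seq cons_row 1 (natR R m) | m <- M] ++ [seq cons_row 0 (evec R i) | i <- enum 'I_n])
    (cons_row t x) ->
  exists (k : nat) (w : 'I_k -> R) (p : 'I_k -> 'rV[R]_n) y,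
   [/\ forall i, 0 <= w i, \sum_(i < k) w i = t, forall i, exists2 m, m \in M & p i = natR R m,
     orthant y & x = \sum_(i < k) w i *: p i + y].
Proof.
elim: M t x => [|m M IH] t x /=.
  move=> /incone_evec[-> x0]; exists 0%N, (fun=> 0), (fun=> 0), x; split=> //.
  - by rewrite big_ord0.
  - by case.
  - by rewrite big_ord0 add0r.
move=> [c [c0]]; rewrite cons_rowB mulr1 => /IH[k [w [p [y [w0 w1 pM y0 xE]]]]].
exists k.+1, (fun i => if unlift ord0 i is Some j then w j else c),
  (fun i => if unlift ord0 i is Some j then p j else natR R m), y; split=> //.
- by move=> i; case: unliftP.
- rewrite big_ord_recl unlift_none (eq_bigr w) => [|i _]; last by rewrite liftK.
  by rewrite w1 addrC subrK.
- move=> i; case: unliftP => [j _|_]; last by exists m; rewrite ?mem_head.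
  by have [m' m'M ->] := pM j; exists m'; rewrite // inE m'M orbT.
- rewrite big_ord_recl unlift_none (eq_bigr (fun i => w i *: p i)) => [|i _]; last by rewrite liftK.
  by rewrite -addrA -xE addrC subrK.
Qed.

(** After homogenization, with minimal exponents m written as (1, m) and recession directions as (0,
    e_i), this is an instance of Farkas' lemma; Dickson's lemma makes the list of generators
    finite. *)
Lemma newton_dual g x : newton g x <-> forall a (L : R), orthant a ->
  (forall al, taylor_coef g al != 0 -> L <= dotp a (natR R al)) -> L <= dotp a x.
Proof.
split=> [gx a L a0 H|H]; first exact: newton_valid gx.
have [M [MT MP]] := dickson_supp g.
have [inc|[y [y0 yx]]] := farkas ([seq cons_row 1 (natR R m) | m <- M] ++
   [seq cons_row 0 (evec R i) | i <- enum 'I_n]) (cons_row 1 x); last first.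
  exfalso; move: yx; rewrite dotp_cons mul1r ltNge => /negP; apply.
  set a := \row_j _; rewrite dotpC -lerBlDl sub0r.
  have a0 : orthant a.
    move=> i; have : 0 <= dotp (cons_row 0 (evec R i)) y.
      apply: y0; rewrite mem_cat; apply/orP; right.
      by apply: (map_f (fun i => cons_row 0 (evec R i))); rewrite mem_enum.
    by rewrite dotp_cons mul0r add0r dotp_evec.
  apply: H => // al /MP[m mM mal].
  have : 0 <= dotp (cons_row 1 (natR R m)) y.
    by apply: y0; rewrite mem_cat (map_f (fun m => cons_row 1 (natR R m))).
  rewrite dotp_cons mul1r dotpC -lerBlDl sub0r => /le_trans; apply.
  by apply: dotp_mono => // i; rewrite !mxE ler_nat.
have [k [w [p [y [w0 w1 pM y0 xE]]]]] := incone_hull inc.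
exists k, w, (fun i => p i + y); split=> //.
  move=> i; have [m mM ->] := pM i; exists m; first exact: MT.
  by move=> j; rewrite !mxE lerDl.
have -> : \sum_(i < k) w i *: (p i + y) = \sum_(i < k) w i *: p i + y.
  rewrite (eq_bigr (fun i => w i *: p i + w i *: y)) => [|i _]; last by rewrite scalerDr.
  by rewrite big_split/= -scaler_suml w1 scale1r.
exact: xE.
Qed.

Lemma dotp_continuous a : continuous (fun x => dotp a x).
Proof.
have -> : (fun x => dotp a x) = rowdot a by apply/funext => x; rewrite dotpC.
exact: rowdot_continuous.
Qed.

Lemma newton_closed g : closed (newton g).
Proof.
have -> : newton g = \bigcap_(q in [set q : 'rV[R]_n * R | orthant q.1 /\
   forall al, taylor_coef g al != 0 -> q.2 <= dotp q.1 (natR R al)]) [set x | q.2 <= dotp q.1 x].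
  apply/seteqP; split=> x.
    by move=> /newton_dual H [a L] /= [a0 Hal]; exact: H.
  by move=> H; apply/newton_dual => a L a0 Hal; exact: (H (a, L)).
apply: closed_bigI => -[a L] _ /=.
apply: (@closed_comp _ _ (fun x => dotp a x) [set z | L <= z]); last exact: closed_ge.
by move=> x _; exact: dotp_continuous.
Qed.

Lemma seq_argmin (X : eqType) (s : seq X) (F : X -> R) : s != [::] ->
  exists2 b, b \in s & forall c, c \in s -> F b <= F c.
Proof.
elim: s => [//|a s IH] _; have [->|s0] := eqVneq s [::].
  by exists a; rewrite ?mem_head// => c; rewrite inE => /eqP ->.
have [b bs bmin] := IH s0; have [ab|ba] := leP (F a) (F b).
  exists a; rewrite ?mem_head// => c; rewrite inE => /predU1P[->//|/bmin].
  exact: le_trans.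
exists b; first by rewrite inE bs orbT.
by move=> c; rewrite inE => /predU1P[->|/bmin//]; exact: ltW.
Qed.

Lemma newton_min g a : orthant a -> newton g !=set0 -> exists2 al, taylor_coef g al != 0 &
  forall be, taylor_coef g be != 0 -> dotp a (natR R al) <= dotp a (natR R be).
Proof.
move=> a0 [x gx]; have [M [MT MP]] := dickson_supp g.
have [k [w [p [w0 w1 pA _]]]] := gx.
have M0 : M != [::].
  case: k w p w0 w1 pA => [|k] w p w0 w1 pA.
    by move: w1; rewrite big_ord0 => /eqP; rewrite eq_sym oner_eq0.
  have [al /MP[m mM _] _] := pA ord0; by case: (M) mM.
have [b bM bmin] := seq_argmin (fun m => dotp a (natR R m)) M0.
exists b; first exact: MT.
move=> be /MP[m mM mbe]; apply: le_trans (bmin m mM) _; apply: dotp_mono => // i.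
by rewrite !mxE ler_nat.
Qed.

Lemma lmin_attained g a al : orthant a -> taylor_coef g al != 0 ->
  (forall be, taylor_coef g be != 0 -> dotp a (natR R al) <= dotp a (natR R be)) ->
  lmin (newton g) a = dotp a (natR R al).
Proof.
move=> a0 Tal H.
have gal : newton g (natR R al) by apply: newton_supp Tal _ => i; rewrite mxE.
have lb : lbound [set dotp a z | z in newton g] (dotp a (natR R al)).
  by move=> _ [z gz <-]; exact: newton_valid gz.
apply/eqP; rewrite eq_le; apply/andP; split.
  by apply: ge_inf; [exists (dotp a (natR R al))|exists (natR R al)].
by apply: lb_le_inf => //; exists (dotp a (natR R al)), (natR R al).
Qed.

(** An exponent minimizing for one vector of the dual cone lies on [gam], so it minimizes for every
    vector of that dual cone, and the inequalities pass to the closure. One exponent thus serves the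
    whole cone of the subdivision. *)
Lemma cone_minimizer g gam (S : seq 'rV[int]_n) : newton g !=set0 ->
  gcone S `<=` closure (dual_cone (newton g) gam) ->
  exists2 al, taylor_coef g al != 0 & forall u, gcone S u ->
    forall be, taylor_coef g be != 0 -> dotp u (natR R al) <= dotp u (natR R be).
Proof.
move=> g0 H.
have S0 : gcone S (0 : 'rV[R]_n).
  by exists (fun=> 0); split=> //; rewrite big1// => i _; rewrite scale0r.
(* The origin belongs to the cone, so the dual cone, in whose closure it lies, is nonempty. *)
have [a [[a0 aE] _]] := H _ S0 setT filterT.
have [al Tal amin] := newton_min a0 g0; exists al => //.
have gal : newton g (natR R al) by apply: newton_supp Tal _ => i; rewrite mxE.
have galm : gam (natR R al) by rewrite -aE; split=> //; rewrite /hyp/= (lmin_attained a0 Tal amin).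
move=> u /H cu be Tbe; rewrite leNgt; apply/negP => lt.
have : nbhs u [set v | dotp v (natR R be) < dotp v (natR R al)].
  have c : continuous (fun v : 'rV[R]_n => dotp (natR R be - natR R al) v) by exact: dotp_continuous.
  have : nbhs u [set v | dotp (natR R be - natR R al) v < 0].
    apply: (c u [set z | z < 0]); apply: open_nbhs_nbhs; split; first exact: open_lt.
    by rewrite /= dotpDl dotpNl subr_lt0 !(dotpC _ u).
  by apply: filterS => v /=; rewrite dotpDl dotpNl subr_lt0 !(dotpC _ v).
move=> /cu[b [[b0 bE] /= bl]].
have : gam (natR R al) by []; rewrite -bE /hyp/= => -[bal _].
have [al' Tal' bmin] := newton_min b0 g0.
move: bal; rewrite (lmin_attained b0 Tal' bmin) => bal.
by have := bmin be Tbe; rewrite -bal leNgt bl.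
Qed.

Definition natv (a : 'I_n -> nat) : 'rV[int]_n := \row_i (a i)%:Z.

Lemma intR_natv (a : 'I_n -> nat) : intR R (natv a) = arow R a.
Proof. by apply/rowP => i; rewrite !mxE. Qed.

Lemma dotp_degv (a : 'I_n -> nat) be : dotp (arow R a) (natR R be) = (degv a be)%:R.
Proof. by rewrite /degv natr_sum; apply: eq_bigr => i _; rewrite !mxE natrM. Qed.

Lemma arow_orthant (a : 'I_n -> nat) : orthant (arow R a).
Proof. by move=> i; rewrite mxE. Qed.

Definition mindeg g (a : 'I_n -> nat) (l : nat) :=
  (exists2 al, taylor_coef g al != 0 & degv a al = l) /\
  forall be, taylor_coef g be != 0 -> (l <= degv a be)%N.

Lemma mindeg_ex g (a : 'I_n -> nat) : newton g !=set0 -> exists l, mindeg g a l.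
Proof.
move=> g0; have [al Tal H] := newton_min (arow_orthant a) g0.
exists (degv a al); split; first by exists al.
by move=> be /H; rewrite !dotp_degv ler_nat.
Qed.

Lemma mindeg_lmin g (a : 'I_n -> nat) l : mindeg g a l -> lmin (newton g) (arow R a) = l%:R.
Proof.
move=> [[al Tal <-] H]; rewrite (lmin_attained (arow_orthant a) Tal) ?dotp_degv// => be Tbe.
by rewrite !dotp_degv ler_nat H.
Qed.

Lemma mindeg_valid g (a : 'I_n -> nat) l : mindeg g a l -> newton g `<=` hyp_plus (arow R a) l%:R.
Proof.
move=> [_ H]; apply: newton_valid; first exact: arow_orthant.
by move=> al Tal; rewrite dotp_degv ler_nat H.
Qed.

Lemma mindeg_face g (a : 'I_n -> nat) l : mindeg g a l ->
  is_face (newton g) (newton g `&` hyp (arow R a) l%:R).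
Proof.
move=> ml; exists (natv a), l%:Z; rewrite /valid intR_natv; split=> //; exact: mindeg_valid.
Qed.

(** Positive natural weights bound every coordinate on the face by l. *)
Lemma mindeg_compact g (a : 'I_n -> nat) l : (forall i, 0 < a i)%N -> mindeg g a l ->
  is_compact_face (newton g) (newton g `&` hyp (arow R a) l%:R).
Proof.
move=> a0 ml; split; first exact: mindeg_face.
have [[al Tal dl] _] := ml; split.
  exists (natR R al); split; first by apply: newton_supp Tal _ => i; rewrite mxE.
  by rewrite /hyp/= dotp_degv dl.
apply: (@subclosed_compact _ _ (cube l%:R)).
- apply: closedI; first exact: newton_closed.
  have cl1 : closed [set z : R | z = l%:R] by exact: closed_eq.
  apply: (@closed_comp _ _ (fun x => dotp (arow R a) x) [set z | z = l%:R]) cl1.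
  by move=> x _; exact: dotp_continuous.
- exact: cube_compact.
- move=> x [/newton_orthant x0 xl] i; rewrite ger0_norm// -xl /dotp (bigD1 i)//=.
  apply: ler_wpDr; first by apply: sumr_ge0 => k _; rewrite mulr_ge0// mxE.
  by apply: ler_peMl => //; rewrite mxE ler1n.
Qed.

(** A compact face contains no half-line parallel to an axis, so all entries of a defining normal
    are strictly positive, and a smaller exponent of the support would violate validity. Exponents
    on compact faces are therefore finite in number. *)
Lemma compact_face_minimal g al be : newton_boundary g (natR R al) -> taylor_coef g al != 0 ->
  taylor_coef g be != 0 -> (forall i, be ord0 i <= al ord0 i)%N -> be = al.
Proof.
move=> [gam [[a [l [va aE]]] [_ cg]] gal] Tal Tbe beal.
have lal : dotp (intR R a) (natR R al) = l%:~R by move: gal; rewrite -aE => -[].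
have gup i (t : R) : 0 <= t -> newton g (natR R al + t *: evec R i).
  move=> t0; apply: newton_supp Tal _ => j; by rewrite !mxE lerDl mulr_ge0.
have dup i (t : R) : dotp (intR R a) (natR R al + t *: evec R i) = l%:~R + t * (a ord0 i)%:~R.
  by rewrite dotpDr lal dotpZr [dotp _ (evec R i)]dotpC dotp_evec mxE.
have apos i : (0 : R) < (a ord0 i)%:~R.
  rewrite lt_neqAle; apply/andP; split; last first.
    by have := va _ (gup i 1 ler01); rewrite /hyp_plus/= dup mul1r lerDl.
  apply/eqP => a0.
  have up (t : R) : 0 <= t -> gam (natR R al + t *: evec R i).
    by move=> t0; rewrite -aE; split; [exact: gup|rewrite /hyp/= dup -a0 mulr0 addr0].
  have [|||c _ cmax] := @compact_EVT_max _ R (fun x : 'rV[R]_n => x ord0 i) gam.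
  - by exists (natR R al).
  - exact: cg.
  - by apply: continuous_subspaceT => x; exact: coord_continuous.
  have c0 : 0 <= c ord0 i by apply: le_trans (cmax _ (mem_set gal)); rewrite mxE.
  have := cmax _ (mem_set (up (c ord0 i + 1) (addr_ge0 c0 ler01))).
  rewrite !mxE !eqxx mulr1 leNgt => /negP; apply.
  by apply: (@lt_le_trans _ _ (c ord0 i + 1)); rewrite ?ltrDl// lerDr.
have : dotp (intR R a) (natR R al) <= dotp (intR R a) (natR R be).
  by rewrite lal; apply: va; apply: newton_supp Tbe _ => i; rewrite mxE.
rewrite -subr_ge0 -dotpNr -dotpDr -oppr_le0 -dotpNr opprB => le0.
have tp i : 0 <= intR R a ord0 i * (natR R al - natR R be) ord0 i.
  by rewrite mulr_ge0 ?mxE ?(ltW (apos i))// subr_ge0 ler_nat.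
have : dotp (intR R a) (natR R al - natR R be) == 0.
  by rewrite eq_le le0 /dotp sumr_ge0.
rewrite /dotp psumr_eq0// => /allP z; apply/rowP => i.
have := z i (mem_index_enum i); rewrite /= mulf_eq0 !mxE gt_eqF//= subr_eq0 eqr_nat => /eqP ->.
by [].
Qed.

(* Real weights are approximated by positive integer ones, for which the minimizing face is compact. *)
Lemma boundary_dominates g (M : seq 'rV[nat]_n) : newton g !=set0 ->
  (forall al, taylor_coef g al != 0 -> newton_boundary g (natR R al) -> al \in M) ->
  forall a (L : R), orthant a -> (forall m, m \in M -> L <= dotp a (natR R m)) ->
  forall be, taylor_coef g be != 0 -> L <= dotp a (natR R be).
Proof.
move=> g0 HM a L a0 LM be Tbe; rewrite leNgt; apply/negP => lt.
have {LM lt} lt m : m \in M -> 0 < dotp a (natR R m - natR R be).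
  by move=> mM; rewrite dotpDr dotpNr subr_gt0; apply: lt_le_trans lt (LM m mM).
pose ai (N : nat) i : nat := (Num.truncn (N%:R * a ord0 i)).+1.
have aiP N i : N%:R * a ord0 i <= (ai N i)%:R <= N%:R * a ord0 i + 1.
  have /truncn_itv/andP[h1 h2] : 0 <= N%:R * a ord0 i by rewrite mulr_ge0.
  by rewrite (ltW h2)/= /ai -natr1 lerD2r.
have [N HN] : exists N : nat, forall m, m \in M -> (degv (ai N) be < degv (ai N) m)%N.
  have [N0 H] : exists N0 : nat, forall N, (N0 <= N)%N -> forall m, m \in M ->
      (degv (ai N) be < degv (ai N) m)%N; last by exists N0; exact: H.
  elim: M lt {HM} => [|m M IH] lt; first by exists 0%N.
  have [|N1 H1] := IH; first by move=> m' m'M; apply: lt; rewrite inE m'M orbT.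
  have dm := lt m (mem_head _ _).
  pose D : R := \sum_i `|(natR R m - natR R be) ord0 i|.
  pose N2 := Num.bound (D / dotp a (natR R m - natR R be)).
  have D0 : 0 <= D by apply: sumr_ge0.
  exists (maxn N1 N2) => N; rewrite geq_max => /andP[N1N N2N] m'.
  rewrite inE => /predU1P[->|]; last exact: H1.
  rewrite -(ltr_nat R) -!dotp_degv -subr_gt0 -dotpNr -dotpDr.
  apply: (@lt_le_trans _ _ (N%:R * dotp a (natR R m - natR R be) - D)).
    rewrite subr_gt0 -ltr_pdivrMr//; apply: (@lt_le_trans _ _ N2%:R); last by rewrite ler_nat.
    by apply: archi_boundP; rewrite divr_ge0// ltW.
  rewrite /dotp mulr_sumr /D -sumrB; apply: ler_sum => i _.
  pose v := (natR R m - natR R be) ord0 i; rewrite -/v.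
  have -> : arow R (ai N) ord0 i = (ai N i)%:R by rewrite mxE.
  rewrite mulrA.
  have /andP[h1 h2] := aiP N i.
  have : `|((ai N i)%:R - N%:R * a ord0 i) * v| <= `|v|.
    rewrite normrM; apply: ler_piMl => //; rewrite ger0_norm ?subr_ge0//.
    by rewrite lerBlDl.
  by rewrite mulrBl => /ler_normlP[h _]; move: h; lra.
have [l ml] := mindeg_ex (ai N) g0.
have [[al Tal dl] lb] := ml.
have alM : al \in M.
  apply: HM => //; exists (newton g `&` hyp (arow R (ai N)) l%:R); first exact: mindeg_compact.
  split; first by apply: newton_supp Tal _ => i; rewrite mxE.
  by rewrite /hyp/= dotp_degv dl.
by have := HN al alM; rewrite dl ltnNge lb.
Qed.

(** Finiteness of the exponents on compact faces turns [principal_part] into a polynomial whose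
    Taylor coefficients can be read off; the two polyhedra are then compared through the half-spaces
    of [newton_dual]. *)
Lemma newton_principal g : newton g !=set0 -> newton (principal_part g) = newton g.
Proof.
move=> g0; have [M0 [MT MP]] := dickson_supp g.
pose M := undup [seq al <- M0 | `[< newton_boundary g (natR R al) >]].
have inM al : taylor_coef g al != 0 -> newton_boundary g (natR R al) -> al \in M.
  move=> Tal bal; have [m mM0 mal] := MP al Tal.
  have <- := compact_face_minimal bal Tal (MT m mM0) mal.
  rewrite mem_undup mem_filter mM0 andbT; apply/asboolP.
  by rewrite (compact_face_minimal bal Tal (MT m mM0) mal).
have MB al : al \in M -> newton_boundary g (natR R al) /\ taylor_coef g al != 0.
  by rewrite mem_undup mem_filter => /andP[/asboolP h /MT].
have pE : principal_part g = mpol M (taylor_coef g).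
  apply/funext => x; rewrite /principal_part /gam_part_poly /mpol [RHS]fsbig_seq ?undup_uniq//.
  symmetry; apply: fsbig_widen; first by move=> al /= /MB[].
  move=> al [/= bal alM]; apply/eqP; rewrite mulf_eq0; apply/orP; left.
  by apply/negPn/negP => Tal; apply: alM; exact: inM.
have TE al : taylor_coef (principal_part g) al != 0 <-> al \in M.
  rewrite pE taylor_coef_mpol ?undup_uniq//; case: ifP => [/MB[_ ->]|_]; first by [].
  by rewrite eqxx.
apply/seteqP; split=> x /newton_dual H; apply/newton_dual => a L a0 HL; apply: H => // al.
  by move=> /TE/MB[_]; exact: HL.
by move=> Tal; apply: (boundary_dominates g0 inM a0 _ Tal) => m /TE; exact: HL.
Qed.

End Newton.

(** * Lower bound for the gradient *)

Section ChartAnalysis.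
Variables (R : realType) (n : nat) (A : 'I_n -> 'I_n -> nat).
Hypothesis uB : (\matrix_(j, i) (A j i)%:R : 'M[R]_n) \in unitmx.
Variables (c1 : R) (U : set 'rV[R]_n) (f : 'rV[R]_n -> R) (l : 'I_n -> nat).
Hypothesis (oU : open U) (cU : cube (expR (- c1)) `<=` U) (sf : smooth_on U f).
Hypothesis ml : forall j, mindeg f (A j) (l j).
Local Notation Om := (@upbox R n c1).
Local Notation cd := (cd R A).
Local Notation cs := (@cs R n A).
Local Notation creg := (@creg R n A c1).
Local Notation chcl := (cl Om creg cd cs 1).
Local Notation wtl := (wt cs (fun j => (l j)%:Z)).

(** With t = exp (- r), scaling x by t^a is translation by r along the generator a. Existence of the
    limit that defines the part of the face cut out by this generator gives exactly the decay,
    pointwise in u, needed by [iterate_hadamard]. *)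
Lemma tilde_flat_class e : hatE U f -> forall N, chcl N (fun j => (l j)%:Z) (tilde e f).
Proof.
move=> [_ _ _ hat]; apply: (iterate_hadamard uB).
  by move=> N; exact: (tilde_class uB e N oU cU sf).
move=> u j [Ou _]; pose a : 'rV[nat]_n := \row_i A j i.
have aE : natR R a = arow R (A j) by apply/rowP => i; rewrite !mxE.
have Ux : U (ex e u) by apply: cU; exact: ex_upbox.
have := hat _ (mindeg_face (ml j)) _ Ux a (l j); rewrite aE.
move=> /(_ (mindeg_valid (ml j)) erefl) [_ [v /cvgrPdist_le/(_ 1 ltr01)]].
move=> [d /= d0 H]; exists (`|v| + 1), (- ln d + 1) => r rd r0.
have t0 : 0 < expR (- r) := expR_gt0 _.
have td : expR (- r) < d.
  by rewrite -[ltRHS]lnK ?posrE// ltr_expR; move: rd; lra.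
have := H (expR (- r)); rewrite /ball/= sub0r normrN gtr0_norm// => /(_ td t0).
have -> : tscale a (expR (- r)) (ex e u) = ex e (u + r *: cd j).
  apply/rowP => i; have ai : a ord0 i = A j i by rewrite mxE.
  rewrite [LHS]mxE ai mulrC; exact/esym/ex_scale.
have E : expR (- r) ^+ l j = expR (- ((l j)%:R * r)) by rewrite -expRM_natl mulrN.
rewrite E => h; have w0 : 0 < expR (- ((l j)%:R * r)) := expR_gt0 _.
have h2 : `|tilde e f (u + r *: cd j) / expR (- ((l j)%:R * r))| <= `|v| + 1.
  rewrite -[X in `|X|](subKr v); apply: le_trans (ler_normB _ _) _; by rewrite lerD2l.
by move: h2; rewrite normrM normfV [`|expR _|]gtr0_norm// ler_pdivrMr.
Qed.

Lemma smooth_mpol S0 (c : 'rV[nat]_n -> R) : smooth_on setT (mpol S0 c).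
Proof.
move=> js x _; rewrite iterpd_mpol; split.
  apply: continuous_big => [|be _ y]; first exact: add_continuous.
  have H : {for y, continuous (fun x => c be * (ffactv be js)%:R * monom (subv be js) x)}; last exact: H.
  by apply: continuousM; [exact: cst_continuous|exact: monom_continuous].
move=> j; apply: ex_derive; apply: isd_sum => be _.
exact: isdZ (monom_is_derive (subv be js) x j).
Qed.

(** One-sided in h, because the region is stable only under nonnegative multiples of the
    generators. *)
Lemma quadratic_derive0 (K : R -> R) (C d : R) : is_derive (0 : R) 1 K d ->
  (forall h : R, 0 <= h <= 1 -> `|K h - K 0| <= C * h ^+ 2) -> d = 0.
Proof.
move=> dK H; apply/eqP; rewrite -normr_le0; apply/ler_addgt0Pr => eps e0; rewrite add0r.
have C0 : 0 <= C by have := H 1; rewrite lexx ler01 expr1n mulr1 => /(_ isT); apply: le_trans.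
have e2 : 0 < eps / 2 by rewrite divr_gt0.
have : h^-1 *: ((K \o shift 0) (h *: 1) - K 0) @[h --> 0^'] --> d.
  by case: dK => D <-; exact: D.
move=> /cvgrPdist_le/(_ _ e2)[del /= del0 Hd].
pose h := Num.min (del / 2) (Num.min 1 (eps / (2 * (C + 1)))).
have C1 : 0 < 2 * (C + 1) by rewrite mulr_gt0// ltr_wpDl.
have h0 : 0 < h by rewrite !lt_min !divr_gt0// ltr01.
have hd : h < del by rewrite gt_min ltr_pdivrMr// ltr_pMr// ltr1n.
have h1 : h <= 1 by rewrite !ge_min lexx orbT.
have hC : C * h <= eps / 2.
  apply: (@le_trans _ _ ((C + 1) * (eps / (2 * (C + 1))))).
    apply: ler_pM => //; [exact: ltW|by rewrite lerDl|by rewrite !ge_min lexx !orbT].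
  by rewrite le_eqVlt; apply/orP; left; apply/eqP; field; rewrite gt_eqF// ltr_wpDl.
have := Hd h; rewrite /ball_/= sub0r normrN gtr0_norm// => /(_ hd (lt0r_neq0 h0)).
rewrite /= [h *: 1]mulr1 addr0 => q1.
have := H h; rewrite h1 ltW// => /(_ isT) q2.
have q3 : `|h^-1 *: (K h - K 0)| <= eps / 2.
  apply: le_trans hC; have -> : h^-1 *: (K h - K 0) = (K h - K 0) / h by rewrite mulrC.
  by rewrite normrM normfV [`|h|]gtr0_norm// ler_pdivrMr// -mulrA -expr2.
rewrite -[d](subrK (h^-1 *: (K h - K 0))); apply: le_trans (ler_normD _ _) _.
by rewrite (splitr eps) lerD.
Qed.

Lemma gam_part_mpol (a : 'I_n -> nat) (l0 : nat) S0 : uniq S0 ->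
  (forall be, be \in S0 <-> taylor_coef f be != 0 /\ degv a be = l0) ->
  gam_part_poly f (newton f `&` hyp (arow R a) l0%:R) = mpol S0 (taylor_coef f).
Proof.
move=> uS SP; apply/funext => x; rewrite /gam_part_poly /mpol [RHS]fsbig_seq//.
symmetry; apply: fsbig_widen.
  move=> be /= /SP[Tbe dl]; split; first by apply: newton_supp Tbe _ => i; rewrite mxE.
  by rewrite /hyp/= dotp_degv dl.
move=> be [/= [_ hbe] nS]; apply/eqP; rewrite mulf_eq0; apply/orP; left.
apply/negPn/negP => Tbe; apply: nS; apply/SP; split=> //.
by move: hbe; rewrite /hyp/= dotp_degv => /eqP; rewrite eqr_nat => /eqP.
Qed.

Variables (e : seq bool) (al0 : 'rV[nat]_n).
Hypothesis (Tal0 : taylor_coef f al0 != 0) (dal0 : forall j, degv (A j) al0 = l j).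
Hypothesis cF : forall N, chcl N (fun j => (l j)%:Z) (tilde e f).

Let oOm : open Om. Proof. exact: upbox_open. Qed.
Let RgOm : creg `<=` Om. Proof. exact: creg_Om. Qed.
Let g01 : ((1 : int) == 0) || ((1 : int) == 1). Proof. by []. Qed.
Let cs0 u k : creg u -> 0 <= cs k u. Proof. by case. Qed.
Let up := @upbox_up R n A c1.
Let sd := cs_shift uB.

(** If the bound failed, the normalized derivatives would tend to 0 along the ray of
    [lower_bound_fail]. Along it the rescaled f converges to the polynomial of the compact face
    defined by the sum of the escaping generators, whose gradient would vanish at a point of [U] off
    the coordinate hyperplanes. *)
Lemma chart_lower_bound : (0 < n)%N -> nondeg_over_R U f -> exists (m : nat) (c : R), 0 < c /\
  forall u, creg u -> (forall i, m%:R < u ord0 i) ->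
    c * wtl u ^+ 2 <= \sum_k ('D_(cd k) (tilde e f) u) ^+ 2.
Proof.
move=> n0 nd; apply: contrapT => no.
have [|J [ub0 [HJ _ HP]]] := lower_bound_fail uB cF.
  move=> m; apply: contrapT => nou; apply: no.
  exists m, ((m.+1)%:R^-1 ^+ 2); split; first by rewrite exprn_gt0// invr_gt0 ltr0n.
  move=> u cu um; rewrite leNgt; apply/negP => lt; apply: nou; exists u; split=> // k.
  have w0 := wt_gt0 cs (fun j => (l j)%:Z) u.
  rewrite /Psi normrM [`|_^-1|]gtr0_norm ?invr_gt0// ler_pdivrMr//.
  rewrite -(@ler_pXn2r _ 2)// ?nnegrE ?mulr_ge0 ?(ltW w0) ?invr_ge0//.
  rewrite exprMn real_normK ?num_real//; apply: ltW; apply: le_lt_trans lt.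
  by rewrite (bigD1 k)//= lerDl; apply: sumr_ge0 => i _; rewrite sqr_ge0.
pose av := \sum_(j | J j) cd j.
pose a i := (\sum_(j | J j) A j i)%N; pose l0 := (\sum_(j | J j) l j)%N.
have avE : av = arow R a by apply/rowP => i; rewrite summxE mxE natr_sum; apply: eq_bigr => j _; rewrite mxE.
have a0 i : (0 < a i)%N.
  by have [j Jj Aji] := HJ i; rewrite /a (bigD1 j)//= ltn_addr.
have degE be : degv a be = (\sum_(j | J j) degv (A j) be)%N.
  by rewrite /degv exchange_big/=; apply: eq_bigr => i _; rewrite /a big_distrl.
(* The exponent [al0], minimal for all generators at once, shows that the minimum for the sum [a] is
   the sum of the minima. *)
have ma : mindeg f a l0.
  split; first by exists al0 => //; rewrite degE; apply: eq_bigr => j _; rewrite dal0.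
  by move=> be Tbe; rewrite degE; apply: leq_sum => j _; have [_] := ml j; exact.
pose S0 := [seq be <- small_multi n l0 | (taylor_coef f be != 0) && (degv a be == l0)].
have uS : uniq S0 by rewrite filter_uniq// small_multi_uniq.
have SP be : be \in S0 <-> taylor_coef f be != 0 /\ degv a be = l0.
  rewrite mem_filter; split=> [/andP[/andP[-> /eqP ->]]//|[-> dl]].
  rewrite dl eqxx/= mem_small_multi; apply/forallP => i; rewrite -dl /degv (bigD1 i)//=.
  by rewrite (leq_trans (leq_pmull _ (a0 i)))// leq_addr.
have [r1 Hr1] := HP (Ordinal n0) 1 ltr01.
pose r1' := Num.max r1 0; have r10 : 0 <= r1' by rewrite le_max lexx orbT.
pose ub := ub0 + r1' *: av.
have cub : creg ub by have [] := Hr1 r1' (ltac:(by rewrite le_max lexx)).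
have {}HP k (eps : R) : 0 < eps -> exists r2, forall r : R, r2 <= r -> 0 <= r ->
    creg (ub + r *: av) /\ `|Psi A (tilde e f) l k (ub + r *: av)| <= eps.
  move=> e0; have [r2 H2] := HP k eps e0; exists r2 => r rr r0.
  have -> : ub + r *: av = ub0 + (r1' + r) *: av by rewrite scalerDl addrA.
  by apply: H2; apply: le_trans rr _; rewrite lerDr.
have Oub : Om ub by case: cub.
have Ux : U (ex e ub) by apply: cU; exact: ex_upbox.
pose gp := mpol S0 (taylor_coef f).
have wsh (r : R) : wtl (ub + r *: av) = wtl ub * expR (- (l0%:R * r)).
  rewrite /wt -expRD; congr expR; rewrite -opprD; congr (- _).
  have -> : ub + r *: av = ub + \sum_(j <- index_enum 'I_n) (if J j then r else 0) *: cd j.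
    rewrite /av scaler_sumr big_mkcond/=; congr (_ + _); apply: eq_bigr => i _.
    by case: (J i); rewrite ?scale0r.
  have -> : l0%:R * r = \sum_j (l j)%:R * (if J j then r else 0).
    rewrite natr_sum mulr_suml big_mkcond/=; apply: eq_bigr => j _.
    by case: (J j); rewrite ?mulr0.
  rewrite -big_split/=; apply: eq_bigr => j _.
  by rewrite (cs_comb uB) ?index_enum_uniq// mem_index_enum mulr1n mulrDr.
have W0 : 0 < wtl ub := wt_gt0 _ _ _.
(* The convergence concerns values, not derivatives. The rescaled increment of f over h is bounded
   by eps / 3 plus a multiple of h^2, and letting eps tend to 0 leaves a quadratic bound for the
   limit polynomial. *)
have key k : 'D_(cd k) (tilde e gp) ub = 0.
  have [dk _] : differentiable (tilde e gp) ub /\ _ :=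
    tilde_derive (cd k) openT (smooth_mpol S0 (taylor_coef f)) (fun _ _ => I) Oub.
  have [C [C0 HC]] := Psi_step uB cF k k.
  have dd := (is_derive_lineP _ _ _ _).1 (diff_is_derive (cd k) dk).
  apply: (quadratic_derive0 (C := C * wtl ub) dd) => h /andP[h0 h1]; rewrite scale0r addr0; apply/ler_addgt0Pr => eps e0.
  have e3 : 0 < eps / 3 by rewrite divr_gt0.
  have rU : 0 < expR (- c1) := expR_gt0 _.
  have [C1 [s1 H1]] := taylor_scaling e (ub + h *: cd k) rU oU cU sf a0 ma.2 uS SP.
  have [C2 [s2 H2]] := taylor_scaling e ub rU oU cU sf a0 ma.2 uS SP.
  have [s3 H3] := expN_small C1 e3; have [s4 H4] := expN_small C2 e3.
  pose ep := eps / 3 / wtl ub; have ep0 : 0 < ep by rewrite divr_gt0.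
  have [s5 H5] := HP k ep ep0.
  pose r := Num.max 0 (Num.max s1 (Num.max s2 (Num.max s3 (Num.max s4 s5)))).
  have r0 : 0 <= r by rewrite le_max lexx.
  have [t1 t2 t3 t4 t5] : [/\ s1 <= r, s2 <= r, s3 <= r, s4 <= r & s5 <= r].
    by split; rewrite /r !le_max lexx ?orbT.
  have b1 := le_trans (H1 r t1 r0) (H3 r t3 r0); have b2 := le_trans (H2 r t2 r0) (H4 r t4 r0).
  have [cp Pp] := H5 r t5 r0.
  pose p := ub + r *: av; rewrite -avE in b1 b2; rewrite -/p in cp Pp b2.
  have pE : ub + h *: cd k + r *: av = p + h *: cd k by rewrite addrAC.
  rewrite pE in b1.
  have E1 : expR (l0%:R * r) * expR (- (l0%:R * r)) = 1 by exact: expRxMexpNx_1.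
  pose K (s : R) := tilde e f (p + s *: cd k).
  pose dK (s : R) := 'D_(cd k) (tilde e f) (p + s *: cd k).
  have hK s : 0 <= s <= h -> is_derive s 1 K (dK s).
    move=> /andP[s0 sh]; have Ops : Om (p + s *: cd k) by apply: up => //; case: cp.
    have dfp := cl_diff (cF 1%N) Ops.
    exact: (is_derive_line (diff_derivable dfp)).
  have bK s : 0 <= s <= h -> `|dK s| <= (ep + C * h) * wtl p.
    move=> /andP[s0 sh]; rewrite /dK.
    have cps : creg (p + s *: cd k) by exact: (chart_region_up up sd).
    have ws0 := wt_gt0 cs (fun j => (l j)%:Z) (p + s *: cd k).
    have -> : 'D_(cd k) (tilde e f) (p + s *: cd k) =
      Psi A (tilde e f) l k (p + s *: cd k) * wtl (p + s *: cd k) by rewrite /Psi divfK// gt_eqF.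
    rewrite normrM (gtr0_norm ws0); apply: ler_pM; [by []|exact: ltW| |].
      rewrite -[Psi _ _ _ _ _](subrK (Psi A (tilde e f) l k p)).
      apply: le_trans (ler_normD _ _) _; rewrite addrC; apply: lerD => //.
      apply: le_trans (HC p s s cp s0 s0 _) _; first by right.
      by apply: ler_wpM2l.
    rewrite (wt_shift sd); apply: ler_piMr; first exact: ltW (wt_gt0 _ _ _).
    by rewrite expR_le1 oppr_le0 mulr_ge0.
  have b3 := derive_bound_mvt h0 hK bK.
  have K0 : K 0 = tilde e f p by rewrite /K scale0r addr0.
  rewrite subr0 K0 /p wsh -/p in b3.
  have b4 : `|expR (l0%:R * r) * f (ex e (p + h *: cd k)) - expR (l0%:R * r) * f (ex e p)| <=
     eps / 3 + C * wtl ub * h ^+ 2.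
    rewrite -mulrBr normrM ger0_norm ?expR_ge0//.
    apply: le_trans (ler_wpM2l (expR_ge0 _) b3) _.
    have sw (x1 x2 x3 x4 x5 : R) : x1 * (x2 * (x3 * x4) * x5) = (x1 * x4) * (x2 * x3 * x5) by ring.
    rewrite sw E1 mul1r !mulrDl.
    apply: lerD; first by rewrite /ep divfK ?gt_eqF//; apply: ler_piMr => //; exact: ltW.
    by rewrite le_eqVlt; apply/orP; left; apply/eqP; ring.
  move: b1 b2 b4; rewrite -/gp.
  set x1 := expR _ * f (ex e (p + _)); set x2 := expR _ * f (ex e p) => b1 b2 b4.
  have -> : tilde e gp (ub + h *: cd k) - tilde e gp ub =
     - (x1 - gp (ex e (ub + h *: cd k))) + (x1 - x2) + (x2 - gp (ex e ub)).
    by rewrite /tilde; set y1 := gp _; set y2 := gp _; ring.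
  apply: le_trans (ler_normD _ _) _; apply: le_trans (lerD (ler_normD _ _) (lexx _)) _.
  rewrite normrN; apply: le_trans (lerD (lerD b1 b4) b2) _.
  have sw (y1 y2 : R) : y1 / 3 + (y1 / 3 + y2) + y1 / 3 = y2 + y1 by field.
  by rewrite sw.
(* The derivatives along all generators vanish; since the generators form a basis, every x_i d_i gp
   vanishes as well. *)
pose v : 'cV[R]_n := \col_i (ex e ub ord0 i * pd i gp (ex e ub)).
have Bv : (\matrix_(j, i) (A j i)%:R : 'M[R]_n) *m v = 0.
  apply/matrixP => k z; rewrite !mxE.
  have [_ E] : differentiable (tilde e gp) ub /\ _ :=
    tilde_derive (cd k) openT (smooth_mpol S0 (taylor_coef f)) (fun _ _ => I) Oub.
  have := key k; rewrite E => /eqP; rewrite -oppr_eq0 -sumrN => /eqP h.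
  rewrite -[RHS]h; apply: eq_bigr => i _; by rewrite !mxE mulrN opprK.
have v0 : v = 0 by rewrite -[v](mulKmx uB) Bv mulmx0.
have [j] := nd _ (mindeg_compact a0 ma) _ Ux (fun i => ex_neq0 e ub i).
rewrite (gam_part_mpol uS SP) => /eqP; apply.
have : v j ord0 = 0 by rewrite v0 mxE.
have -> : v j ord0 = ex e ub ord0 j * pd j gp (ex e ub) by rewrite mxE.
by move=> /eqP; rewrite mulf_eq0 (negbTE (ex_neq0 e ub j)) => /eqP.
Qed.

End ChartAnalysis.

(** * Partition of unity *)

Section FlatExp.
Variable R : realType.

(* All derivatives of [exp (- 1 / x)] extended by [0] are combinations of these functions. *)
Definition flatexp (k : nat) (x : R) : R := if 0 < x then x^-1 ^+ k * expR (- x^-1) else 0.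

Lemma flatexp_ge0 k x : 0 <= flatexp k x.
Proof.
rewrite /flatexp; case: ifP => // x0; rewrite mulr_ge0 ?expR_ge0// exprn_ge0//.
by rewrite invr_ge0 ltW.
Qed.

(** With y = 1/x this is (y / (k+1))^k <= exp (y / (k+1))^{k+1} = exp y. *)
Lemma flatexp_le k x : flatexp k x <= k.+1%:R ^+ k.
Proof.
rewrite /flatexp; case: ifP => x0; last by rewrite exprn_ge0.
set y := x^-1; have y0 : 0 <= y by rewrite invr_ge0 ltW.
have K0 : 0 < k.+1%:R :> R by rewrite ltr0n.
rewrite expRN ler_pdivrMr ?expR_gt0//.
have -> : y ^+ k = k.+1%:R ^+ k * (y / k.+1%:R) ^+ k.
  by rewrite exprMn mulrCA -exprMn divff ?gt_eqF// expr1n mulr1.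
apply: ler_wpM2l; first exact: exprn_ge0.
have z0 : 0 <= y / k.+1%:R by rewrite divr_ge0.
apply: (@le_trans _ _ (expR (y / k.+1%:R) ^+ k)).
  by apply: lerXn2r; rewrite ?nnegrE ?expR_ge0//; apply: le_trans (expR_ge1Dx _); rewrite lerDr.
apply: (@le_trans _ _ (expR (y / k.+1%:R) ^+ k.+1)).
  by rewrite exprS; apply: ler_peMl; [exact/exprn_ge0/expR_ge0|apply: le_trans (expR_ge1Dx _); rewrite lerDl].
by rewrite -expRM_natl mulrC divfK// gt_eqF.
Qed.

Lemma flatexp_norm k x : `|flatexp k x| <= k.+1%:R ^+ k.
Proof. by rewrite ger0_norm ?flatexp_ge0// flatexp_le. Qed.

Lemma flatexp_derive k (x : R) :
  is_derive x 1 (flatexp k) (flatexp k.+2 x - k%:R * flatexp k.+1 x).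
Proof.
have [x0|x0|x0] := ltgtP x 0.
- have E j : flatexp j x = 0 by rewrite /flatexp ltNge (ltW x0).
  rewrite !E mulr0 subr0; have D := isdC (0 : R) x 1.
  apply: (near_eq_is_derive _ D); near=> y; rewrite /flatexp ltNge ltW//.
  by near: y; exact: lt_nbhsl.
- have xn : x != 0 by rewrite gt_eqF.
  have Di := isdV xn (is_derive_id x 1).
  have De : is_derive x 1 (fun y => expR (- y^-1)) (expR (- x^-1) * - (- 1 / x ^+ 2)).
    exact: (isd_comp (F := expR) (h := fun y : R => - y^-1) (is_derive_expR _) (isdN Di)).
  have Dp : is_derive x 1 (fun y : R => y^-1 ^+ k) (k%:R * x^-1 ^+ k.-1 * (- 1 / x ^+ 2)).
    have Dx : is_derive (x^-1 : R) 1 (fun z : R => z ^+ k) (k%:R * x^-1 ^+ k.-1).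
      have H := is_derive_horner ('X^k : {poly R}) x^-1; rewrite derivXn hornerMn hornerXn in H.
      rewrite mulr_natl (_ : (fun z : R => z ^+ k) = horner 'X^k)//.
      by apply/funext => z; rewrite hornerXn.
    exact: (isd_comp (F := fun z : R => z ^+ k) (h := fun y : R => y^-1) Dx Di).
  have D := isdM Dp De.
  have E j : flatexp j x = x^-1 ^+ j * expR (- x^-1) by rewrite /flatexp x0.
  rewrite !E; have {}D : is_derive x 1 (fun y : R => y^-1 ^+ k * expR (- y^-1))
     (x^-1 ^+ k.+2 * expR (- x^-1) - k%:R * (x^-1 ^+ k.+1 * expR (- x^-1))).
    apply: (is_derive_eq D); set y := x^-1; set ee := expR _.
    have -> : - 1 / x ^+ 2 = - (y * y) by rewrite /y mulN1r expr2 invfM.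
    case: (k) => [|m]; first by rewrite mul0r !mul0r add0r subr0 !exprS expr0; ring.
    by rewrite [m.+1.-1]/= !exprS; ring.
  apply: (near_eq_is_derive _ D); near=> y; rewrite /flatexp ifT//.
  by near: y; exact: lt_nbhsr.
(* At the gluing point, [flatexp k r] is r^2 times the bounded value [flatexp k.+2 r], whence a
   quadratic remainder and derivative 0. *)
rewrite x0; have E j : flatexp j 0 = 0 by rewrite /flatexp ltxx.
rewrite !E mulr0 subr0; apply: (@is_derive_quadratic R _ _ _ (k.+3%:R ^+ k.+2)) => r.
rewrite add0r E subr0 mulr0 subr0; have [r0|r0] := ltP 0 r; last first.
  by rewrite /flatexp ltNge r0/= normr0; apply: mulr_ge0; [exact: exprn_ge0|exact: sqr_ge0].
have -> : flatexp k r = flatexp k.+2 r * r ^+ 2.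
  rewrite /flatexp r0 !exprS expr0; have rn : r != 0 by rewrite gt_eqF.
  by set ee := expR _; set y := _ ^+ k; field.
rewrite normrM [`|r ^+ 2|]ger0_norm ?sqr_ge0//; apply: ler_wpM2r; first exact: sqr_ge0.
exact: flatexp_norm.
Unshelve. all: by end_near. Qed.

Definition smoothstep (x : R) : R := flatexp 0 (x + 1) * (flatexp 0 (x + 1) + flatexp 0 (- x))^-1.

(** Of x + 1 and - x, whose sum is 1, one is at least 1/2. *)
Lemma smoothstep_den x : expR (- 2) <= flatexp 0 (x + 1) + flatexp 0 (- x).
Proof.
have H (y : R) : 2^-1 <= y -> expR (- 2) <= flatexp 0 y.
  move=> hy; have y0 : 0 < y by apply: lt_le_trans hy; rewrite invr_gt0.
  rewrite /flatexp y0 expr0 mul1r ler_expR lerN2 -[leRHS]invrK lef_pV2// posrE invr_gt0//.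
have [h|h] := leP (- 2^-1) x.
  apply: ler_wpDr; first exact: flatexp_ge0.
  by apply: H; rewrite -lerBlDr; apply: le_trans h; rewrite le_eqVlt; apply/orP; left; apply/eqP; field.
apply: ler_wpDl; first exact: flatexp_ge0.
by apply: H; rewrite lerNr ltW.
Qed.

Lemma smoothstep_ge0 x : 0 <= smoothstep x.
Proof. by rewrite mulr_ge0 ?flatexp_ge0// invr_ge0 addr_ge0// flatexp_ge0. Qed.

Lemma smoothstep1 x : 0 <= x -> smoothstep x = 1.
Proof.
move=> x0; have := smoothstep_den x; rewrite /smoothstep.
have -> : flatexp 0 (- x) = 0 by rewrite /flatexp ltNge oppr_le0 x0.
rewrite addr0 => h; rewrite divff// gt_eqF//; apply: lt_le_trans h; exact: expR_gt0.
Qed.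

Lemma smoothstep0 x : x <= - 1 -> smoothstep x = 0.
Proof.
by move=> x0; rewrite /smoothstep {1}/flatexp ltNge -lerBrDr sub0r x0/= mul0r.
Qed.

End FlatExp.

(** * Symbol classes of cutoffs and of oscillating factors *)

Section MoreClasses.
Variables (R : realType) (n : nat) (Om Rg : set 'rV[R]_n).
Variables (d : 'I_n -> 'rV[R]_n) (s : 'I_n -> 'rV[R]_n -> R).
Hypothesis (oOm : open Om) (RgOm : Rg `<=` Om).
Local Notation cl0 := (cl Om Rg d s 0).
Local Notation cl1 := (cl Om Rg d s 1).

Lemma cl_eqw g N (mu nu : 'I_n -> int) (h : 'rV[R]_n -> R) : (forall k, mu k = nu k) ->
  cl Om Rg d s g N mu h -> cl Om Rg d s g N nu h.
Proof. by move=> /funext ->. Qed.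

Lemma wt0E u : wt s (fun=> 0) u = 1.
Proof. by rewrite /wt big1 ?oppr0 ?expR0// => k _; rewrite mul0r. Qed.

Lemma flatexp_class N k v (c : R) : cl0 N (fun=> 0) (fun u => flatexp k (dotp v u + c)).
Proof.
have D k' u w : is_derive u w (fun u => flatexp k' (dotp v u + c))
    ((flatexp k'.+2 (dotp v u + c) - k'%:R * flatexp k'.+1 (dotp v u + c)) * dotp v w).
  have D0 : is_derive u w (fun u => dotp v u + c) (dotp v w).
    apply/is_derive_lineP; rewrite (_ : (fun r => _) = (fun r : R => dotp v u + c + r * dotp v w)).
      have H := isdD (isdC (dotp v u + c) (0 : R) 1) (isdM (is_derive_id (0 : R) 1) (isdC (dotp v w) (0 : R) 1)).
      by apply: (is_derive_eq H); ring.
    by apply/funext => r; rewrite dotpDr dotpZr addrAC.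
  exact: (isd_comp (F := flatexp k') (h := fun u => dotp v u + c) (flatexp_derive _ _) D0).
have dif k' u : differentiable (fun u => flatexp k' (dotp v u + c)) u.
  have h1 : differentiable (flatexp k' : R -> R) (dotp v u + c).
    by apply/derivable1_diffP; have [] := flatexp_derive k' (dotp v u + c).
  have h2 : differentiable (fun u : 'rV[R]_n => dotp v u + c) u.
    have -> : (fun u : 'rV[R]_n => dotp v u + c) = (fun u => rowdot v u + cst c u).
      by apply/funext => u'; rewrite dotpC.
    apply: differentiableD; last exact: differentiable_cst.
    exact: linear_differentiable (@rowdot_continuous R n v).
  exact: (differentiable_comp h2 h1).
elim: N k => [|N IH] k.
  split=> // [u _|]; first exact: differentiable_continuous (dif k u).
  by exists (k.+1%:R ^+ k) => u _; rewrite wt0E mulr1 flatexp_norm.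
split.
- by move=> u _; exact: differentiable_continuous (dif k u).
- by exists (k.+1%:R ^+ k) => u _; rewrite wt0E mulr1 flatexp_norm.
split=> [u _|j]; first exact: dif.
apply: (@cl_eqw _ _ (fun=> 0)); first by move=> i; rewrite /bumpw mul0rn addr0.
apply: (cl_ext oOm RgOm (h := fun u => dotp v (d j) *
  (flatexp k.+2 (dotp v u + c) - k%:R * flatexp k.+1 (dotp v u + c)))).
  by move=> u Ou; rewrite mul0r addr0 mulrC; apply/esym/derive_val.
apply: (cl_scale oOm RgOm); apply: (cl_sub oOm RgOm); first exact: IH.
by apply: (cl_scale oOm RgOm); exact: IH.
Qed.

Lemma smoothstep_class N v : cl0 N (fun=> 0) (fun u => smoothstep (dotp v u)).
Proof.
have c1 := flatexp_class N 0 v 1.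
have c2 : cl0 N (fun=> 0) (fun u => flatexp 0 (- dotp v u)).
  apply: (cl_ext oOm RgOm) (flatexp_class N 0 (- v) 0) => u _.
  by rewrite dotpNl addr0.
have c3 := cl_add oOm RgOm c1 c2.
have c4 := cl_inv oOm RgOm (expR_gt0 (- 2 : R)) _ _ c3.
apply: (@cl_eqw _ _ (fun k => 0 + - 0)); first by move=> k; rewrite oppr0 addr0.
apply: (cl_mul oOm RgOm c1); apply: c4 => u _.
  rewrite wt0E mulr1; apply: le_trans (smoothstep_den _) (ler_norm _).
by rewrite gt_eqF//; apply: lt_le_trans (smoothstep_den _); exact: expR_gt0.
Qed.

Lemma cl_prod0 N (I : eqType) (r : seq I) (h : I -> 'rV[R]_n -> R) :
  (forall i, i \in r -> cl0 N (fun=> 0) (h i)) -> cl0 N (fun=> 0) (fun u => \prod_(i <- r) h i u).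
Proof.
elim: r => [|i r IH] H.
  by apply: (cl_ext oOm RgOm) (cl_cst d s 0 oOm RgOm N 1) => u _; rewrite big_nil.
apply: (cl_ext oOm RgOm (h := fun u => h i u * \prod_(i <- r) h i u)).
  by move=> u _; rewrite big_cons.
apply: (@cl_eqw _ _ (fun k => 0 + 0)) => //; apply: (cl_mul oOm RgOm).
  by apply: H; rewrite mem_head.
by apply: IH => k kr; apply: H; rewrite inE kr orbT.
Qed.

(** The constants depend on t. These bounds serve regularity and integrability at fixed t; uniform
    estimates in t will use only that the phase is bounded by 1. *)
Lemma trig_class (F : 'rV[R]_n -> R) (t : R) : (forall N, cl1 N (fun=> 0) F) -> forall N,
  cl1 N (fun=> 0) (fun u => cos (t * F u)) /\ cl1 N (fun=> 0) (fun u => sin (t * F u)).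
Proof.
move=> cF.
have dF u : Om u -> differentiable F u := cl_diff (cF 1%N).
have Dt u w : Om u -> is_derive u w (fun u => t * F u) (t * 'D_w F u).
  by move=> Ou; exact: isdZ (diff_is_derive w (dF u Ou)).
have Dc u w : Om u -> is_derive u w (fun u => cos (t * F u)) (- sin (t * F u) * (t * 'D_w F u)).
  by move=> Ou; exact: (isd_comp (F := cos) (h := fun u => t * F u) (is_derive_cos _) (Dt u w Ou)).
have Ds u w : Om u -> is_derive u w (fun u => sin (t * F u)) (cos (t * F u) * (t * 'D_w F u)).
  by move=> Ou; exact: (isd_comp (F := sin) (h := fun u => t * F u) (is_derive_sin _) (Dt u w Ou)).
have dt u : Om u -> differentiable (fun u => t * F u) u.
  by move=> Ou; exact: differentiableZ_fun (dF u Ou).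
have dc u : Om u -> differentiable (fun u => cos (t * F u)) u.
  move=> Ou; apply: (differentiable_comp (dt u Ou)).
  by apply/derivable1_diffP; have [] := is_derive_cos (t * F u).
have ds u : Om u -> differentiable (fun u => sin (t * F u)) u.
  move=> Ou; apply: (differentiable_comp (dt u Ou)).
  by apply/derivable1_diffP; have [] := is_derive_sin (t * F u).
have bcos : exists C, forall u, Rg u -> `|cos (t * F u)| <= C * wt s (fun=> 0) u.
  exists 1 => u _; rewrite wt0E mulr1 ler_norml; apply/andP; split; [exact: cos_geN1|exact: cos_le1].
have bsin : exists C, forall u, Rg u -> `|sin (t * F u)| <= C * wt s (fun=> 0) u.
  exists 1 => u _; rewrite wt0E mulr1 ler_norml; apply/andP; split; [exact: sin_geN1|exact: sin_le1].
elim=> [|N [IHc IHs]].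
  by split; split=> // u Ou; apply: differentiable_continuous; [exact: dc|exact: ds].
have st j : cl1 N (bumpw 1 (fun=> 0) j) (fun u => 'D_(d j) F u).
  apply: (cl_ext oOm RgOm) (cl_step j (cF N.+1)) => u _.
  by rewrite mul0r addr0.
split; split=> //.
- by move=> u Ou; apply: differentiable_continuous; exact: dc.
- split=> // j; apply: (cl_ext oOm RgOm (h := fun u => - t * (sin (t * F u) * 'D_(d j) F u))).
    move=> u Ou; rewrite mul0r addr0; have E := @derive_val _ _ _ _ _ _ _ (Dc u (d j) Ou); apply: (etrans _ (esym E)).
    by set x1 := sin _; set x2 := 'D_ _ _ _; ring.
  apply: (cl_scale oOm RgOm).
  apply: (@cl_eqw _ _ (fun k => 0 + bumpw 1 (fun=> 0) j k)); first by move=> k; rewrite add0r.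
  exact: (cl_mul oOm RgOm IHs (st j)).
- by move=> u Ou; apply: differentiable_continuous; exact: ds.
- split=> // j; apply: (cl_ext oOm RgOm (h := fun u => t * (cos (t * F u) * 'D_(d j) F u))).
    move=> u Ou; rewrite mul0r addr0; have E := @derive_val _ _ _ _ _ _ _ (Ds u (d j) Ou); apply: (etrans _ (esym E)).
    by set x1 := cos _; set x2 := 'D_ _ _ _; ring.
  apply: (cl_scale oOm RgOm).
  apply: (@cl_eqw _ _ (fun k => 0 + bumpw 1 (fun=> 0) j k)); first by move=> k; rewrite add0r.
  exact: (cl_mul oOm RgOm IHc (st j)).
Qed.

Variable O : set 'rV[R]_n.
Hypothesis (oO : open O) (RgO : Rg `<=` O) (OOm : O `<=` Om).
Hypothesis s0 : forall u k, Rg u -> 0 <= s k u.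
Hypothesis scont : forall k, continuous (s k).

Lemma derive_open_zero (W : set 'rV[R]_n) (h : 'rV[R]_n -> R) v u : open W -> W u ->
  (forall x, W x -> h x = 0) -> 'D_v h u = 0.
Proof.
move=> oW Wu H; rewrite (@near_eq_derive _ _ _ h (cst 0)); first by rewrite derive_cst.
near=> x; apply: H; near: x; exact: open_nbhs_nbhs.
Unshelve. all: by end_near. Qed.

(* Where the coordinate [s k] is large the function is constant along [d k]; on the rest of the
   region every weight supported on [Kz] is bounded below. *)
Lemma locally_constant_class (ka : R) N : 0 <= ka ->
  forall (Kz : pred 'I_n) (h : 'rV[R]_n -> R) (nu : 'I_n -> int),
  (forall N, cl0 N (fun=> 0) h) ->
  (forall u k, O u -> Kz k -> ka < s k u -> h u = 0) ->
  (forall u k, O u -> ka < s k u -> 'D_(d k) h u = 0) ->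
  (forall k, ~~ Kz k -> nu k = 0) -> (forall k, 0 <= nu k) -> cl1 N nu h.
Proof.
move=> ka0.
have oW k : open (O `&` [set u | ka < s k u]).
  apply: openI => //; apply: (@open_comp _ _ (s k) [set z | ka < z]); last exact: open_gt.
  by move=> x _; exact: scont.
have bd (Kz : pred 'I_n) (h : 'rV[R]_n -> R) (nu : 'I_n -> int) : (forall N, cl0 N (fun=> 0) h) ->
    (forall u k, O u -> Kz k -> ka < s k u -> h u = 0) ->
    (forall k, ~~ Kz k -> nu k = 0) -> (forall k, 0 <= nu k) ->
    exists C, forall u, Rg u -> `|h u| <= C * wt s nu u.
  move=> ch hz nz n0; have [C [C0 hC]] := cl_bound0 (ch 0%N).
  (* Where h is nonzero, each s_k with nu_k nonzero is at most [ka], so this factor compensates for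
     the weight. *)
  exists (C * expR (\sum_k (nu k)%:~R * ka)) => u Ru.
  have [[k /andP[Kk sk]]|no] := pselect (exists k, Kz k && (ka < s k u)).
    rewrite (hz u k) ?normr0 ?mulr_ge0 ?expR_ge0//; last exact: RgO.
  have := hC u Ru; rewrite wt0E mulr1 => /le_trans; apply; rewrite -mulrA; apply: ler_peMr => //.
  rewrite /wt -expRD; apply: le_trans (expR_ge1Dx _); rewrite lerDl subr_ge0; apply: ler_sum => k _.
  have [Kk|nK] := boolP (Kz k); last by rewrite nz// !mul0r.
  apply: ler_wpM2l; first by rewrite ler0z.
  by rewrite leNgt; apply/negP => sk; apply: no; exists k; rewrite Kk sk.
elim: N => [|N IH] Kz h nu ch hz hd nz n0.
  split=> //; first by move=> u; exact: cl_cont (ch 0%N).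
  exact: bd nz n0.
split; first by move=> u; exact: cl_cont (ch 0%N).
  exact: bd nz n0.
split=> [u Ou|j]; first exact: cl_diff (ch 1%N) Ou.
have g00 : ((0 : int) == 0) || ((0 : int) == 1) by [].
have cd' i N' : cl0 N' (fun=> 0) (fun u => 'D_(d i) h u).
  exact: (cl_deriv oOm RgOm g00 s0 i (ch N'.+1)).
have com i k u : Om u -> 'D_(d i) ('D_(d k) h) u = 'D_(d k) ('D_(d i) h) u.
  move=> Ou; have cDD i' j' : cl0 1 (fun=> 0) (fun u => 'D_(d i') ('D_(d j') h) u).
    exact: (cl_deriv oOm RgOm g00 s0 i' (cd' j' 2%N)).
  apply: (schwarz oOm Ou).
  - move=> x Ox; split; apply: diff_derivable.
    + exact: cl_diff (ch 1%N) Ox.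
    + exact: cl_diff (ch 1%N) Ox.
    + exact: cl_diff (cd' _ 1%N) Ox.
    + exact: cl_diff (cd' _ 1%N) Ox.
  - exact: cl_cont (cDD _ _) Ou.
  - exact: cl_cont (cDD _ _) Ou.
have hd' u k : O u -> ka < s k u -> 'D_(d k) ('D_(d j) h) u = 0.
  move=> Ou sk; rewrite com; last exact: OOm.
  by apply: (derive_open_zero _ (oW k)) => // x [Ox sx]; exact: hd.
have hz' u k : O u -> Kz k -> ka < s k u -> 'D_(d j) h u = 0.
  move=> Ou Kk sk; apply: (derive_open_zero _ (oW k)) => // x [Ox sx]; exact: hz sx.
have nb k : 0 <= bumpw 1 nu j k by rewrite /bumpw addr_ge0// mulrn_wge0.
have [Kj|nKj] := boolP (Kz j).
  have zb k : ~~ Kz k -> bumpw 1 nu j k = 0.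
    move=> nK; rewrite /bumpw nz// (_ : k == j = false) ?add0r//.
    by apply/negbTE; apply: contra nK => /eqP ->.
  apply: (cl_add oOm RgOm).
    exact: (IH Kz (fun u => 'D_(d j) h u) _ (cd' j) hz' hd' zb nb).
  by apply: (cl_scale oOm RgOm); exact: (IH Kz h _ ch hz hd zb nb).
apply: (cl_ext oOm RgOm (h := fun u => 'D_(d j) h u)).
  by move=> u _; rewrite nz// mul0r addr0.
(* After differentiation along j, a large coordinate s_j makes the function vanish rather than
   merely constant, so j joins the set [Kz] and may carry weight. *)
apply: (IH [pred k | Kz k || (k == j)] (fun u => 'D_(d j) h u) _ (cd' j) _ hd' _ nb).
  move=> u k Ou /= /orP[Kk|/eqP ->]; [exact: hz'|exact: hd].
by move=> k /=; rewrite negb_or => /andP[nK /negbTE kj]; rewrite /bumpw nz// kj addr0.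
Qed.

End MoreClasses.

(** * The partition attached to the maximal cones *)

Section Partition.
Variables (R : realType) (n : nat) (P : set 'rV[R]_n) (Sig : seq (seq 'rV[int]_n)).
Hypothesis ss : simplicial_subdivision P Sig.
Variable c1 : R.
Hypothesis c10 : 0 <= c1.
Implicit Types (S T : seq 'rV[int]_n) (u : 'rV[R]_n).
Local Notation Om := (@upbox R n c1).
Local Notation chart := (chart Sig).
Local Notation cs S := (@cs R n (gens S)).
Local Notation creg S := (@creg R n (gens S) c1).

Definition charts := [seq S <- Sig | size S == n].

Lemma mem_charts S : (S \in charts) = chart S.
Proof. by rewrite mem_filter andbC. Qed.

(** Equal to 1 on the cone of S and to 0 as soon as one coordinate is at most -1. *)
Definition chi S u := \prod_(j <- index_enum 'I_n) smoothstep (cs S j u).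
Definition chitot u := \sum_(S <- charts) chi S u.
Definition zeta S u := chi S u * (chitot u)^-1.

Lemma chi_ge0 S u : 0 <= chi S u.
Proof. by apply: prodr_ge0 => j _; exact: smoothstep_ge0. Qed.

Lemma chi_eq0 S u j : cs S j u <= - 1 -> chi S u = 0.
Proof.
by move=> h; rewrite /chi (bigD1_seq j) ?mem_index_enum ?index_enum_uniq//= smoothstep0// mul0r.
Qed.

Lemma upbox_chart u : Om u -> exists2 S, chart S & creg S u.
Proof.
move=> Ou; have [|S cS Su] := charts_cover ss (u := u).
  by move=> i; apply: le_lt_trans c10 (Ou i).
by exists S => //; split=> // j; exact: (gcone_cs ss).
Qed.

Lemma chitot_ge1 u : Om u -> 1 <= chitot u.
Proof.
move=> /upbox_chart[S cS [Ou Su]]; rewrite /chitot.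
have SC : S \in charts by rewrite mem_charts.
rewrite (perm_big _ (perm_to_rem SC)) big_cons/=; apply: ler_wpDr.
  by apply: sumr_ge0 => T _; exact: chi_ge0.
by rewrite /chi big1_seq// => j _; rewrite smoothstep1.
Qed.

Lemma zeta_sum u : Om u -> \sum_(S <- charts) zeta S u = 1.
Proof.
move=> Ou; rewrite /zeta -mulr_suml divff// gt_eqF//.
exact: lt_le_trans ltr01 (chitot_ge1 Ou).
Qed.

Lemma mem_gens T (a : 'rV[int]_n) : chart T -> a \in T -> exists i : 'I_n, a = nth 0 T i.
Proof.
move=> /andP[_ /eqP sz] /(nthP 0)[i iT <-].
have iN : (i < n)%N := leq_trans iT (eq_leq sz).
by exists (Ordinal iN).
Qed.

Lemma gens_mem T (i : 'I_n) : chart T -> nth 0 T i \in T.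
Proof. by move=> /andP[_ /eqP sz]; apply: mem_nth; rewrite sz. Qed.

Lemma gens_inj T (i j : 'I_n) : chart T -> nth 0 T i = nth 0 T j -> i = j.
Proof.
move=> cT E; have := cs_gen ss i j cT; rewrite -E (cs_gen ss)// eqxx.
by case: eqVneq => // _ /eqP; rewrite oner_eq0.
Qed.

(** On the intersection of the two cones the coordinate is 0, or equals that of the shared
    generator; [cone_functional_bound] extends this, up to a constant, to the enlarged cones on
    which the cutoffs live. *)
Lemma separation S T (k : 'I_n) : chart S -> chart T -> exists K : R, 0 <= K /\ forall u,
  (forall j, - 1 <= cs S j u) -> (forall j, - 1 <= cs T j u) ->
  (nth 0 S k \notin T -> cs S k u <= K) /\
  (forall i : 'I_n, nth 0 S k = nth 0 T i -> cs S k u - cs T i u <= K).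
Proof.
move=> cS cT; have [kT|kT] := boolP (nth 0 S k \in T).
  have [i E] := mem_gens cT kT.
  have [|K [K0 H]] := cone_functional_bound ss (b := csv R S k - csv R T i) cS cT.
    move=> u Su Tu; rewrite dotpDl dotpNl -!csE subr_le0.
    by rewrite (shared_coord ss cS cT Su Tu E).
  exists K; split=> // u hS hT; split=> // i' E'.
  have <- : i = i' by apply: (gens_inj cT); rewrite -E -E'.
  by have := H u hS hT; rewrite dotpDl dotpNl -!csE.
have [|K [K0 H]] := cone_functional_bound ss (b := csv R S k) cS cT.
  move=> u Su Tu; rewrite -csE leNgt; apply/negP => h.
  have [j E] := shared_gen ss cS cT Su Tu h.
  by move: kT; rewrite E gens_mem.
exists K; split=> // u hS hT; split=> [_|i E]; first by have := H u hS hT; rewrite -csE.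
by move: kT; rewrite E gens_mem.
Qed.

Let oOm : open Om. Proof. exact: upbox_open. Qed.

Lemma cs_continuous S k : continuous (cs S k).
Proof.
have -> : cs S k = (fun u => dotp (csv R S k) u) by apply/funext => u; rewrite csE.
exact: dotp_continuous.
Qed.

(** Far out along a generator of S, the cutoff of a chart lacking that generator vanishes. The
    cutoff of a chart containing it is constant along it: the coordinate there is large too, so its
    [smoothstep] is 1, and the other coordinates do not move. Hence [zeta] is locally constant along
    the generator, and 0 when the generator is not in T. *)
Lemma zeta_class S T N (nu : 'I_n -> int) : chart S -> chart T ->
  (forall k : 'I_n, nth 0 S k \in T -> nu k = 0) -> (forall k, 0 <= nu k) ->
  cl Om (creg S) (cd R (gens S)) (cs S) 1 N nu (zeta T).
Proof.
move=> cS cT nz n0.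
pose K X (k : 'I_n) := if pselect (chart X) is left h then projT1 (cid (separation k cS h)) else 0.
have KP X (k : 'I_n) : chart X -> 0 <= K X k /\ forall u,
    (forall j, - 1 <= cs S j u) -> (forall j, - 1 <= cs X j u) ->
    (nth 0 S k \notin X -> cs S k u <= K X k) /\
    (forall i : 'I_n, nth 0 S k = nth 0 X i -> cs S k u - cs X i u <= K X k).
  by move=> cX; rewrite /K; case: pselect => // h; case: cid.
pose ka := \sum_(X <- charts) \sum_k K X k.
have K0 X (k : 'I_n) : X \in charts -> 0 <= K X k.
  by rewrite mem_charts => cX; have [] := KP X k cX.
have Kka X k : X \in charts -> K X k <= ka.
  move=> XC; rewrite /ka (perm_big _ (perm_to_rem XC)) big_cons/= (bigD1 k)//= -addrA lerDl.
  rewrite addr_ge0//; first by apply: sumr_ge0 => i _; exact: K0.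
  rewrite big_seq; apply: sumr_ge0 => Y /mem_rem YC; apply: sumr_ge0 => i _; exact: K0.
have ka0 : 0 <= ka.
  by rewrite /ka big_seq; apply: sumr_ge0 => Y YC; apply: sumr_ge0 => i _; exact: K0.
pose O := Om `&` [set u | forall k, - 1 < cs S k u].
have oO : open O.
  apply: openI => //; rewrite openE => u Hu; rewrite /interior/=.
  have h k : nbhs u [set v | - 1 < cs S k v].
    apply: (@cs_continuous S k u [set z | - 1 < z]).
    by apply: open_nbhs_nbhs; split; [exact: open_gt|exact: Hu].
  exact: filter_forall h.
have RgO : creg S `<=` O.
  by move=> u [Ou su]; split=> // k; apply: lt_le_trans (su k); rewrite oppr_lt0.
have RgOm : creg S `<=` Om by exact: creg_Om.
have OOm : O `<=` Om by move=> u [].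
have s0 u k : creg S u -> 0 <= cs S k u by case.
have chi_cl N' X : cl Om (creg S) (cd R (gens S)) (cs S) 0 N' (fun=> 0) (chi X).
  apply: (cl_prod0 oOm RgOm) => j _.
  by apply: (cl_ext oOm RgOm) (smoothstep_class _ _ oOm RgOm N' (csv R X j)) => u _; rewrite csE.
have zcl N' : cl Om (creg S) (cd R (gens S)) (cs S) 0 N' (fun=> 0) (zeta T).
  apply: (@cl_eqw _ _ _ _ _ _ _ _ (fun k => 0 + - 0)); first by move=> k; rewrite oppr0 addr0.
  apply: (cl_mul oOm RgOm (chi_cl N' T)); apply: (cl_inv oOm RgOm ltr01).
  - move=> u [Ou _]; rewrite wt0E mul1r; apply: le_trans (ler_norm _); exact: chitot_ge1.
  - by move=> u Ou; rewrite gt_eqF//; apply: lt_le_trans ltr01 (chitot_ge1 Ou).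
  - by apply: (cl_sum oOm RgOm) => X _; exact: chi_cl.
have sep0 X u (k : 'I_n) : X \in charts -> (forall j, - 1 < cs S j u) -> ka < cs S k u ->
    nth 0 S k \notin X -> chi X u = 0.
  move=> XC Su ku kX; have [H|] := pselect (forall j, - 1 <= cs X j u); last first.
    by move=> /asboolPn/existsp_asboolPn[j /negP]; rewrite -ltNge => /ltW; exact: chi_eq0.
  have cX : chart X by rewrite -mem_charts.
  have [_ /(_ u _ H)[|/(_ kX) h _]] := KP X k cX; first by move=> j; exact: ltW.
  by have := lt_le_trans ku (le_trans h (Kka X k XC)); rewrite ltxx.
have hz u (k : 'I_n) : O u -> nth 0 S k \notin T -> ka < cs S k u -> zeta T u = 0.
  by move=> [_ Su] kT ku; rewrite /zeta (sep0 T u k)// ?mul0r// mem_charts.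
have hn (k : 'I_n) : ~~ (nth 0 S k \notin T) -> nu k = 0 by rewrite negbK; exact: nz.
have hd u (k : 'I_n) : O u -> ka < cs S k u -> 'D_(cd R (gens S) k) (zeta T) u = 0.
  move=> [_ Su] ku.
  have shS (r : R) j : cs S j (u + r *: cd R (gens S) k) = cs S j u + r *+ (j == k).
    exact: (cs_shift (chart_unit ss cS)).
  have near_gt (x y : R) : x < y -> \forall r \near (0 : R), x < y + r.
    move=> xy; have := @nbhs0_lt R R (y - x); rewrite subr_gt0 => /(_ xy); apply: filterS => r.
    by rewrite /= ltr_norml opprB ltrBlDl => /andP[].
  have near_lt (x y : R) : x < y -> \forall r \near (0 : R), x + r < y.
    move=> xy; have := @nbhs0_lt R R (y - x); rewrite subr_gt0 => /(_ xy); apply: filterS => r.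
    by rewrite /= ltr_norml ltrBrDl => /andP[].
  have nS : \forall r \near (0 : R), (forall j, - 1 < cs S j (u + r *: cd R (gens S) k)) /\
      ka < cs S k (u + r *: cd R (gens S) k).
    have h j : \forall r \near (0 : R), - 1 < cs S j (u + r *: cd R (gens S) k).
      case: (eqVneq j k) => [->|jk].
        by apply: filterS (near_gt _ _ (Su k)) => r; rewrite shS eqxx.
      by apply: filterE => r; rewrite shS (negbTE jk) addr0; exact: Su.
    have h' : \forall r \near (0 : R), forall j, - 1 < cs S j (u + r *: cd R (gens S) k).
      exact: filter_forall h.
    apply: filterS2 h' (near_gt _ _ ku) => r h1 h2; split=> //.
    by rewrite shS eqxx.
  have cst X : X \in charts -> \forall r \near (0 : R), chi X (u + r *: cd R (gens S) k) = chi X u.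
    move=> XC; have cX : chart X by rewrite -mem_charts.
    have [kX|kX] := boolP (nth 0 S k \in X); last first.
      apply: filterS nS => r [r1 r2]; rewrite (sep0 X u k)//; exact: sep0 r1 r2 kX.
    have [i E] := mem_gens cX kX.
    have shX (r : R) j : cs X j (u + r *: cd R (gens S) k) = cs X j u + r *+ (j == i).
      rewrite (chart_cd ss)// E -(chart_cd ss)//; exact: (cs_shift (chart_unit ss cX)).
    have [[j /andP[ji hj]]|no] := pselect (exists j, (j != i) && (cs X j u <= - 1)).
      apply: filterE => r; rewrite (chi_eq0 hj) (chi_eq0 (j := j))// shX (negbTE ji) addr0//.
    have [hi|hi] := ltP (cs X i u) (- 1).
      apply: filterS (near_lt _ _ hi) => r hr; rewrite (chi_eq0 (ltW hi)) (chi_eq0 (j := i))//.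
      by rewrite shX eqxx mulr1n ltW.
    have HX j : - 1 <= cs X j u.
      case: (eqVneq j i) => [->//|ji]; rewrite leNgt; apply/negP => h; apply: no.
      by exists j; rewrite ji ltW.
    have [_ /(_ u _ HX)[|_ /(_ i E) h]] := KP X k cX; first by move=> j; exact: ltW.
    have i0 : 0 < cs X i u by have := Kka X k XC; move: ku h; lra.
    apply: filterS (near_gt _ _ i0) => r hr; apply: eq_bigr => j _; rewrite shX.
    case: (eqVneq j i) => [->|_]; last by rewrite addr0.
    by rewrite !smoothstep1// ltW.
  have zc : \forall r \near (0 : R), zeta T (u + r *: cd R (gens S) k) = zeta T u.
    have all_c (s : seq (seq 'rV[int]_n)) : {subset s <= charts} ->
        \forall r \near (0 : R), forall X, X \in s -> chi X (u + r *: cd R (gens S) k) = chi X u.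
      elim: s => [|X s IH] sC; first by apply: filterE.
      have h1 := cst X (sC _ (mem_head _ _)).
      have h2 := IH (fun Y Ys => sC Y (ltac:(by rewrite inE Ys orbT))).
      by apply: filterS2 h1 h2 => r r1 r2 Y; rewrite inE => /predU1P[->//|]; exact: r2.
    apply: filterS (all_c charts (fun _ h => h)) => r hr; rewrite /zeta hr ?mem_charts//.
    by congr (_ * _^-1); apply: eq_big_seq => X; exact: hr.
  have D0 : is_derive (0 : R) 1 (fun r : R => zeta T (u + r *: cd R (gens S) k)) 0.
    apply: (near_eq_is_derive _ (isdC (zeta T u) (0 : R) 1)).
    by apply: filterS zc => r.
  exact: (@derive_val _ _ _ _ _ _ _ ((is_derive_lineP _ _ _ _).2 D0)).
exact: (locally_constant_class oOm RgOm oO RgO OOm s0 (@cs_continuous S) N ka0 zcl hz hd hn n0).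
Qed.

End Partition.

(** * Oscillatory integrals *)

Section GlobalClass.
Variables (R : realType) (n : nat) (P : set 'rV[R]_n) (Sig : seq (seq 'rV[int]_n)).
Hypothesis ss : simplicial_subdivision P Sig.
Variables (c1 c0 : R).
Hypothesis (c10 : 0 <= c1) (c01 : c1 < c0).
Implicit Types (S T : seq 'rV[int]_n) (u v : 'rV[R]_n) (h k : 'rV[R]_n -> R) (a b : 'rV[int]_n).
Implicit Types (mu nu : 'rV[int]_n -> int).
Local Notation Om := (@upbox R n c1).
Local Notation chart := (chart Sig).
Local Notation cs S := (@cs R n (gens S)).
Local Notation cd S := (@cd R n (gens S)).
Local Notation creg S := (@creg R n (gens S) c1).
Local Notation chcl S := (cl Om (creg S) (cd S) (cs S) 1).

(** Weights are indexed by the vectors themselves, so charts sharing a generator share its weight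
    and an operator D_a + nu_a acts on all charts at once. *)
Definition gcl nu h := forall S, chart S -> forall N, chcl S N (fun j : 'I_n => nu (nth 0 S j)) h.

Let oOm : open Om. Proof. exact: upbox_open. Qed.
Let RgOm S : creg S `<=` Om. Proof. exact: creg_Om. Qed.
Let g01 : ((1 : int) == 0) || ((1 : int) == 1). Proof. by []. Qed.
Let cs0 S u (k : 'I_n) : creg S u -> 0 <= cs S k u. Proof. by case. Qed.

Lemma gcl_ext nu h k : (forall u, Om u -> h u = k u) -> gcl nu h -> gcl nu k.
Proof. by move=> E ch S cS N; apply: (cl_ext oOm (@RgOm S) E); exact: ch. Qed.

Lemma gcl_eqw mu nu h : (forall a, mu a = nu a) -> gcl mu h -> gcl nu h.
Proof. by move=> /funext ->. Qed.

Lemma gcl_mono mu nu h : (forall a, nu a <= mu a) -> gcl mu h -> gcl nu h.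
Proof. by move=> le ch S cS N; apply: (cl_mono oOm (@RgOm S) g01 (@cs0 S)) (ch S cS N). Qed.

Lemma gcl_add nu h k : gcl nu h -> gcl nu k -> gcl nu (fun u => h u + k u).
Proof. by move=> ch ck S cS N; apply: (cl_add oOm (@RgOm S)); [exact: ch|exact: ck]. Qed.

Lemma gcl_sub nu h k : gcl nu h -> gcl nu k -> gcl nu (fun u => h u - k u).
Proof. by move=> ch ck S cS N; apply: (cl_sub oOm (@RgOm S)); [exact: ch|exact: ck]. Qed.

Lemma gcl_scale nu h (c : R) : gcl nu h -> gcl nu (fun u => c * h u).
Proof. by move=> ch S cS N; apply: (cl_scale oOm (@RgOm S)); exact: ch. Qed.

Lemma gcl_mul mu nu h k : gcl mu h -> gcl nu k -> gcl (fun a => mu a + nu a) (fun u => h u * k u).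
Proof. by move=> ch ck S cS N; apply: (cl_mul oOm (@RgOm S)); [exact: ch|exact: ck]. Qed.

Lemma gcl_sum (I : eqType) (r : seq I) nu (h : I -> 'rV[R]_n -> R) :
  (forall i, i \in r -> gcl nu (h i)) -> gcl nu (fun u => \sum_(i <- r) h i u).
Proof.
by move=> ch S cS N; apply: (cl_sum oOm (@RgOm S)) => i ir; exact: ch.
Qed.

Lemma gcl_diff nu h u : gcl nu h -> Om u -> differentiable h u.
Proof. by move=> ch Ou; have [S cS _] := upbox_chart ss c10 Ou; exact: cl_diff (ch S cS 1%N) Ou. Qed.

Lemma gcl_dir nu h v : gcl nu h -> gcl nu (fun u => 'D_v h u).
Proof.
move=> ch S cS N.
exact: (cl_dir oOm (@RgOm S) g01 (@cs0 S) (cs_expand (chart_unit ss cS) v) (ch S cS N.+1)).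
Qed.

(** On a chart without [a] no weight has to be raised, and a derivative in any direction preserves
    the class. *)
Lemma gcl_gen nu h a : gcl nu h ->
  gcl (fun b => nu b + (b == a)%:Z) (fun u => 'D_(intR R a) h u + (nu a)%:~R * h u).
Proof.
move=> ch S cS N; have [aS|aS] := boolP (a \in S).
  have [j ->] := mem_gens cS aS; rewrite -(chart_cd ss)//.
  apply: (cl_eqw _ (cl_step j (ch S cS N.+1))) => k; rewrite /bumpw; congr (_ + _).
  have -> : (nth 0 S k == nth 0 S j) = (k == j); last by case: (k == j).
  by apply/eqP/eqP => [/(gens_inj ss cS)|->].
apply: (@cl_eqw _ _ _ _ _ _ _ _ (fun j : 'I_n => nu (nth 0 S j))).
  move=> k; rewrite (_ : nth 0 S k == a = false) ?addr0//; apply/negbTE.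
  by apply: contra aS => /eqP <-; exact: (gens_mem _ cS).
apply: (cl_add oOm (@RgOm S)); first exact: gcl_dir.
by apply: (cl_scale oOm (@RgOm S)); exact: ch.
Qed.

Lemma gcl_bound h : gcl (fun=> 0) h -> exists C, forall u, Om u -> `|h u| <= C.
Proof.
move=> ch; pose K S := if pselect (chart S) is left cS then projT1 (cid (cl_bound0 (ch S cS 0%N))) else 0.
have KP S : chart S -> 0 <= K S /\ forall u, creg S u -> `|h u| <= K S.
  move=> cS; rewrite /K; case: pselect => // cS'; case: cid => C /= [C0 H]; split=> // u.
  by move=> /H; rewrite wt0E mulr1.
exists (\sum_(S <- charts Sig) K S) => u /(upbox_chart ss c10)[S cS Su].
have SC : S \in charts Sig by rewrite mem_charts.
rewrite (perm_big _ (perm_to_rem SC)) big_cons/=; apply: ler_wpDr; last by have [_] := KP S cS; exact.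
rewrite big_seq; apply: sumr_ge0 => T /mem_rem; rewrite mem_charts => cT.
by have [] := KP T cT.
Qed.

(** The gap between c1 and c0 makes the open box and the zero set overlap, so functions controlled
    on the box are smooth everywhere. *)
Lemma supp_or_upbox h u : supp_ge c0 h -> Om u \/ exists i, u ord0 i < c0.
Proof.
move=> sh; have [|no] := pselect (Om u); first by left.
right; apply: contrapT => H; apply: no => i; apply: lt_le_trans c01 _.
by rewrite leNgt; apply/negP => ui; apply: H; exists i.
Qed.

Lemma supp_near0 h u i : supp_ge c0 h -> u ord0 i < c0 -> \forall x \near u, h x = 0.
Proof.
move=> sh ui; have : nbhs u [set x : 'rV[R]_n | x ord0 i < c0].
  have := @coord_continuous R 1 n ord0 i u => /(_ [set z | z < c0]); apply.
  by apply: open_nbhs_nbhs; split=> //; exact: open_lt.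
by apply: filterS => x; exact: sh.
Qed.

Lemma supp_diff nu h u : gcl nu h -> supp_ge c0 h -> differentiable h u.
Proof.
move=> ch sh; have [Ou|[i ui]] := supp_or_upbox u sh; first exact: gcl_diff ch Ou.
apply: (near_eq_differentiable (h := cst 0)); last exact: differentiable_cst.
by apply: filterS (supp_near0 sh ui) => x ->.
Qed.

Lemma gcl_bc N h : gcl (fun=> 0) h -> supp_ge c0 h -> bc N h.
Proof.
have ct k : gcl (fun=> 0) k -> supp_ge c0 k -> continuous k.
  by move=> ck sk u; apply: differentiable_continuous; exact: supp_diff ck sk.
have bd k : gcl (fun=> 0) k -> supp_ge c0 k -> exists C, forall u, `|k u| <= C.
  move=> ck sk; have [C HC] := gcl_bound ck; exists `|C| => u.
  have [Ou|[i ui]] := supp_or_upbox u sk; first exact: le_trans (HC u Ou) (ler_norm _).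
  by rewrite (sk u i)// normr0.
elim: N h => [|N IH] h ch sh; split=> //; [exact: ct|exact: bd|exact: ct|exact: bd|].
split=> [u i|i]; last by apply: IH; [exact: gcl_dir|exact: supp_ge_derive].
by apply: diff_derivable; exact: supp_diff ch sh.
Qed.

Definition admissible nu h := gcl nu h /\ supp_ge c0 h.

Lemma admissible_int N nu h : (forall a, 0 <= nu a) -> admissible nu h -> int_adm N c0 h.
Proof.
move=> n0 [ch sh]; split=> //; apply: gcl_bc => //; exact: gcl_mono ch.
Qed.

Lemma supp_mul h k : supp_ge c0 h -> supp_ge c0 (fun u => k u * h u).
Proof. by move=> sh u i ui; rewrite (sh u i)// mulr0. Qed.

Lemma admissible_mul mu nu h k : gcl mu k -> admissible nu h ->
  admissible (fun a => mu a + nu a) (fun u => k u * h u).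
Proof. by move=> ck [ch sh]; split; [exact: gcl_mul|exact: supp_mul]. Qed.

Lemma admissible_dir nu h v : admissible nu h -> admissible nu (fun u => 'D_v h u).
Proof. by move=> [ch sh]; split; [exact: gcl_dir|exact: supp_ge_derive]. Qed.

Lemma admissible_mono mu nu h : (forall a, nu a <= mu a) -> admissible mu h -> admissible nu h.
Proof. by move=> le [ch sh]; split=> //; exact: gcl_mono ch. Qed.

Lemma admissible_lin nu h k (x y : R) : admissible nu h -> admissible nu k ->
  admissible nu (fun u => x * h u + y * k u).
Proof.
move=> [ch sh] [ck sk]; split; last exact: supp_ge_lin.
by apply: gcl_add; apply: gcl_scale.
Qed.

Lemma admissible_sum (I : eqType) (r : seq I) nu (h : I -> 'rV[R]_n -> R) :
  (forall i, i \in r -> admissible nu (h i)) -> admissible nu (fun u => \sum_(i <- r) h i u).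
Proof.
move=> H; split; first by apply: gcl_sum => i ir; have [] := H i ir.
by move=> u i ui; rewrite big1_seq// => k kr; have [_ sh] := H k kr; exact: sh ui.
Qed.

Lemma Int_sum e (I : eqType) (r : seq I) (h : I -> 'rV[R]_n -> R) :
  (forall i, i \in r -> admissible (fun=> 0) (h i)) ->
  Int e (fun u => \sum_(i <- r) h i u) = \sum_(i <- r) Int e (h i).
Proof.
have adm0 k : admissible (fun=> 0) k -> int_adm 1 c0 k by exact: admissible_int.
elim: r => [|i r IH] H.
  rewrite big_nil; have z : int_adm 1 c0 (fun _ : 'rV[R]_n => 0 : R).
    apply: adm0; split=> // S cS N; exact: (cl_zero _ _ _ oOm (@RgOm S)).
  have E : Int e (fun u : 'rV[R]_n => 0 * 0 + 0 * 0) = 0 :> R.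
    by rewrite (Int_lin e 0 0 z z) !mul0r addr0.
  rewrite -[RHS]E; congr Int; apply/funext => u.
  by rewrite big_nil !mul0r addr0.
have Hr (k : I) : k \in r -> admissible (fun=> 0) (h k) by move=> kr; apply: H; rewrite inE kr orbT.
rewrite big_cons -IH//; have a1 := adm0 _ (H i (mem_head _ _)).
have a2 := adm0 _ (admissible_sum Hr).
have E := Int_lin e 1 1 a1 a2; rewrite !mul1r in E.
rewrite -[RHS]E; congr Int; apply/funext => u.
by rewrite big_cons !mul1r.
Qed.

End GlobalClass.

(** * Integration by parts and differential equations in log t *)

Section Oscillatory.
Variables (R : realType) (n : nat) (P : set 'rV[R]_n) (Sig : seq (seq 'rV[int]_n)).
Hypothesis ss : simplicial_subdivision P Sig.
Variables (c1 c0 : R).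
Hypothesis (c10 : 0 <= c1) (c01 : c1 < c0).
Implicit Types (S T : seq 'rV[int]_n) (u v : 'rV[R]_n) (h k : 'rV[R]_n -> R) (a b : 'rV[int]_n).
Implicit Types (mu nu : 'rV[int]_n -> int).
Local Notation Om := (@upbox R n c1).
Local Notation chart := (chart Sig).
Local Notation cs S := (@cs R n (gens S)).
Local Notation creg S := (@creg R n (gens S) c1).
Local Notation gcl := (gcl (R := R) Sig c1).
Local Notation adm := (admissible (R := R) Sig c1 c0).

Variables (F : 'rV[R]_n -> R) (lw : 'rV[int]_n -> nat) (e : seq bool).
Local Notation lz := (fun b => (lw b)%:Z).
Local Notation pd i h := (fun u => 'D_(evec R i) h u).
Local Notation en := (index_enum 'I_n).

Definition gradsq u := \sum_(i <- en) 'D_(evec R i) F u * 'D_(evec R i) F u.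

Hypothesis cF : gcl lz F.
Hypothesis lbd : forall S, chart S -> exists c : R, 0 < c /\ forall u, creg S u ->
  c * wt (cs S) (fun j : 'I_n => lz (nth 0 S j)) u ^+ 2 <= gradsq u.

Let oOm : open Om. Proof. exact: upbox_open. Qed.

Lemma gradsq_gt0 u : Om u -> 0 < gradsq u.
Proof.
move=> /(upbox_chart ss c10)[S cS Su]; have [c [cp H]] := lbd cS.
by apply: lt_le_trans (H u Su); rewrite mulr_gt0// exprn_gt0// wt_gt0.
Qed.

Lemma gradsq_inv : gcl (fun b => - (lz b + lz b)) (fun u => (gradsq u)^-1).
Proof.
move=> S cS N; have [c [cp H]] := lbd cS; have RgOm : creg S `<=` Om by exact: creg_Om.
apply: (cl_inv oOm RgOm cp).
- move=> u Su; rewrite wtD -expr2; apply: le_trans (ler_norm _); exact: H.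
- by move=> u Ou; rewrite gt_eqF// gradsq_gt0.
- have cT : gcl (fun b => lz b + lz b) gradsq.
    by apply: gcl_sum => i _; apply: gcl_mul; exact: (gcl_dir ss).
  exact: (cT S cS N).
Qed.

Definition cvec i u := 'D_(evec R i) F u * (gradsq u)^-1.

Lemma cvec_class i : gcl (fun b => - lz b) (cvec i).
Proof.
apply: (gcl_eqw (mu := fun b => lz b + - (lz b + lz b))).
  by move=> b; rewrite opprD addrA subrr add0r.
by apply: gcl_mul; [exact: (gcl_dir ss)|exact: gradsq_inv].
Qed.

Lemma cvec_sum u : Om u -> \sum_(i <- en) 'D_(evec R i) F u * cvec i u = 1.
Proof.
move=> Ou; rewrite /cvec (eq_bigr (fun i => 'D_(evec R i) F u * 'D_(evec R i) F u * (gradsq u)^-1)).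
  by rewrite -mulr_suml divff// gt_eqF// gradsq_gt0.
by move=> i _; rewrite mulrA.
Qed.

(** The angle [psi] handles cosine and sine together: a derivative of the phase shifts it by pi /
    2. *)
Definition phase (t psi : R) u := cos (t * F u + psi).

Lemma phase_class t psi : gcl (fun=> 0) (phase t psi).
Proof.
have cF0 : gcl (fun=> 0) F by exact: gcl_mono cF.
have tc S : chart S -> forall N, _ := fun cS => trig_class oOm (@creg_Om R n (gens S) c1) t (fun N => cF0 S cS N).
apply: (gcl_ext (h := fun u => cos psi * cos (t * F u) - sin psi * sin (t * F u))).
  by move=> u _; rewrite /phase cosD mulrC [sin psi * _]mulrC.
apply: gcl_sub; apply: gcl_scale => S cS N; by have [] := tc S cS N.
Qed.

Lemma phase_derive t psi u v : Om u ->
  is_derive u v (phase t psi) (phase t (psi + pi / 2) u * (t * 'D_v F u)).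
Proof.
move=> Ou; have dF := gcl_diff ss c10 cF Ou.
have D1 : is_derive u v (fun u => t * F u + psi) (t * 'D_v F u).
  have H := isdD (isdZ t (diff_is_derive v dF)) (isdC psi u v).
  by apply: (is_derive_eq H); rewrite addr0.
have D := isd_comp (F := cos) (h := fun u => t * F u + psi) (is_derive_cos _) D1.
by apply: (is_derive_eq D); rewrite /phase addrA cosDpihalf.
Qed.

Lemma phase_bound t psi u : `|phase t psi u| <= 1.
Proof. by rewrite /phase ler_norml cos_geN1 cos_le1. Qed.

Lemma phase_adm t psi nu h : adm nu h -> adm nu (fun u => phase t psi u * h u).
Proof.
move=> ah; have [g s] := admissible_mul (phase_class t psi) ah; split=> //.
by apply: gcl_eqw g => a; rewrite add0r.
Qed.

Definition Tint (psi t : R) h := Int e (fun u => phase t psi u * h u).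

Lemma adm0 N nu h : (forall a, 0 <= nu a) -> adm nu h -> int_adm N c0 h.
Proof. exact: (admissible_int ss). Qed.

Lemma Tint_lin psi t nu h k (x y : R) : (forall a, 0 <= nu a) -> adm nu h -> adm nu k ->
  Tint psi t (fun u => x * h u + y * k u) = x * Tint psi t h + y * Tint psi t k.
Proof.
move=> n0 ah ak; rewrite /Tint -(Int_lin e (c := c0)).
- congr Int; apply/funext => u; rewrite mulrDr; congr (_ + _); exact: mulrCA.
- by apply: (adm0 1 n0); exact: phase_adm.
- by apply: (adm0 1 n0); exact: phase_adm.
Qed.

Lemma Tint_bound psi nu h : (forall a, 0 <= nu a) -> adm nu h ->
  exists M, forall t, `|Tint psi t h| <= M.
Proof.
move=> n0 ah; have [[_ [C bC] _] _] := adm0 0 n0 ah.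
exists (C * expR (- c0) ^+ n) => t; apply: (Int_bound e (c := c0)).
  by apply: (adm0 1 n0); exact: phase_adm.
move=> u; rewrite normrM; apply: le_trans (bC u); apply: ler_piMl => //; exact: phase_bound.
Qed.

(** The formal adjoint of the field grad F / |grad F|^2 for the density exp (- sum u_i), which
    produces the term without derivative. The explicit coefficients match [admissible_lin]. *)
Definition Lop h u := \sum_(i <- en) (1 * (cvec i u * h u) + (-1) * 'D_(evec R i) (fun x => cvec i x * h x) u).

Lemma Lop_adm nu h : adm nu h -> adm (fun b => nu b - lz b) (Lop h).
Proof.
move=> ah; apply: admissible_sum => i _.
have am : adm (fun b => nu b - lz b) (fun x => cvec i x * h x).
  have [g s] := admissible_mul (cvec_class i) ah; split=> //.
  by apply: gcl_eqw g => a; rewrite addrC.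
by apply: admissible_lin => //; exact: (admissible_dir ss).
Qed.

Lemma adm_out nu h u i : adm nu h -> u ord0 i < c0 -> h u = 0.
Proof. by move=> [_ sh]; exact: sh. Qed.

Lemma Int_pd nu h i : (forall a, 0 <= nu a) -> adm nu h -> Int e (pd i h) = Int e h.
Proof. by move=> n0 ah; exact: (Int_IBP e i (adm0 3 n0 ah)). Qed.

(* Integration by parts against the field [grad F / |grad F|^2]. *)
Lemma Tint_Lop psi t nu h : (forall a, lz a <= nu a) -> adm nu h ->
  t * Tint (psi + pi / 2) t h = Tint psi t (Lop h).
Proof.
move=> ln ah.
have n0 a : 0 <= nu a by apply: le_trans (ln a).
have n1 a : 0 <= nu a - lz a by rewrite subr_ge0.
have ag i : adm (fun b => nu b - lz b) (fun x => cvec i x * h x).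
  have [g s] := admissible_mul (cvec_class i) ah; split=> //.
  by apply: gcl_eqw g => a; rewrite addrC.
pose w i u := phase t psi u * (cvec i u * h u).
have aw i : adm (fun b => nu b - lz b) (w i) by exact: phase_adm.
have awd i : adm (fun b => nu b - lz b) (fun u => 1 * w i u + (-1) * 'D_(evec R i) (w i) u).
  by apply: admissible_lin => //; exact: (admissible_dir ss).
have pt u : phase t psi u * Lop h u = t * (phase t (psi + pi / 2) u * h u) +
    1 * \sum_(i <- en) (1 * w i u + (-1) * 'D_(evec R i) (w i) u).
  have [Ou|[i ui]] := supp_or_upbox c01 u ah.2; last first.
    rewrite (adm_out (Lop_adm ah) ui) (adm_out ah ui) !mulr0 big1 ?mulr0 ?addr0// => j _.
    exact: (adm_out (awd j) ui).
  rewrite mul1r /Lop mulr_sumr.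
  have E i : 1 * w i u + (-1) * 'D_(evec R i) (w i) u =
     phase t psi u * (1 * (cvec i u * h u) + (-1) * 'D_(evec R i) (fun x => cvec i x * h x) u) -
     'D_(evec R i) F u * cvec i u * (t * (phase t (psi + pi / 2) u * h u)).
    have dg : differentiable (fun x => cvec i x * h x) u by exact: (gcl_diff ss c10 (ag i).1 Ou).
    have D := isdM (phase_derive t psi (evec R i) Ou) (diff_is_derive (evec R i) dg).
    have -> : 'D_(evec R i) (w i) u = _ := @derive_val _ _ _ _ _ _ _ D.
    rewrite /w; set x1 := phase _ _ _; set x2 := phase _ _ _; set x3 := 'D_ _ F u.
    by set x4 := 'D_ _ _ u; set x5 := cvec i u; set x6 := h u; ring.
  rewrite (eq_bigr _ (fun i _ => E i)) sumrB -mulr_suml cvec_sum// mul1r.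
  by rewrite addrC subrK.
have z : Int e (fun u => \sum_(i <- en) (1 * w i u + (-1) * 'D_(evec R i) (w i) u)) = 0.
  rewrite (Int_sum ss c10 c01) => [|i _]; last exact: admissible_mono (awd i).
  apply: big1 => i _.
  have := Int_lin e 1 (-1) (adm0 1 n1 (aw i)) (adm0 1 n1 (admissible_dir ss (evec R i) (aw i))).
  by move=> ->; rewrite (Int_pd i n1 (aw i)) mul1r mulN1r subrr.
rewrite /Tint; have a1 := adm0 1 n0 (phase_adm t (psi + pi / 2) ah).
have a2 := adm0 1 n1 (admissible_sum (r := en) (fun i _ => awd i)).
have L := Int_lin e t 1 a1 a2; rewrite z mulr0 addr0 in L.
by rewrite -L; congr Int; apply/funext => u; rewrite pt.
Qed.

(** Integration by parts along each coordinate direction: the density contributes the sum of the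
    entries of [a], the phase the factor t. *)
Lemma Tint_dir psi t nu h a : (forall b, 0 <= nu b) -> adm nu h ->
  (sumz a)%:~R * Tint psi t h =
  t * Tint (psi + pi / 2) t (fun u => 'D_(intR R a) F u * h u) + Tint psi t (fun u => 'D_(intR R a) h u).
Proof.
move=> n0 ah; pose w u := phase t psi u * h u.
have aw : adm nu w by exact: phase_adm.
have E1 : Int e (fun u => 'D_(intR R a) w u) = (sumz a)%:~R * Int e w.
  have -> : (fun u => 'D_(intR R a) w u) =
      (fun u => \sum_(i <- en) ((a ord0 i)%:~R * 'D_(evec R i) w u + 0 * w u)).
    apply/funext => u; have dw : differentiable w u by exact: (supp_diff ss c10 c01 _ aw.1 aw.2).
    have -> : 'D_(intR R a) w u = \sum_i intR R a ord0 i * 'D_(evec R i) w u.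
      by rewrite -(derive_comb _ _ dw) -row_sum_evec.
    apply: eq_bigr => i _.
    by rewrite mul0r addr0 mxE.
  have al i : adm nu (fun u => (a ord0 i)%:~R * 'D_(evec R i) w u + 0 * w u).
    by apply: admissible_lin => //; exact: (admissible_dir ss).
  rewrite (Int_sum ss c10 c01) => [|i _]; last exact: admissible_mono (al i).
  rewrite /sumz rmorph_sum/= mulr_suml; apply: eq_bigr => i _.
  have := Int_lin e (a ord0 i)%:~R 0 (adm0 1 n0 (admissible_dir ss (evec R i) aw)) (adm0 1 n0 aw).
  by move=> ->; rewrite (Int_pd i n0 aw) mul0r addr0.
have aF : adm nu (fun u => 'D_(intR R a) F u * h u).
  apply: (admissible_mono (mu := fun b => lz b + nu b)); first by move=> b; rewrite lerDr.
  by apply: admissible_mul => //; exact: (gcl_dir ss).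
have aD : adm nu (fun u => 'D_(intR R a) h u) by exact: (admissible_dir ss).
rewrite -[Tint psi t h]/(Int e w) -E1 /Tint -[X in _ + X]mul1r.
rewrite -(Int_lin e t 1 (adm0 1 n0 (phase_adm t (psi + pi / 2) aF)) (adm0 1 n0 (phase_adm t psi aD))).
congr Int; apply/funext => u; have [Ou|[i ui]] := supp_or_upbox c01 u ah.2; last first.
  rewrite (adm_out (admissible_dir ss (intR R a) aw) ui) (adm_out aF ui) (adm_out aD ui).
  by rewrite !mulr0 addr0.
have dh := gcl_diff ss c10 ah.1 Ou.
have D := isdM (phase_derive t psi (intR R a) Ou) (diff_is_derive (intR R a) dh).
have -> : 'D_(intR R a) w u = _ := @derive_val _ _ _ _ _ _ _ D.
set x1 := phase _ _ _; set x2 := phase _ _ _; set x3 := 'D_ _ F u.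
by set x4 := 'D_ _ _ u; set x6 := h u; ring.
Qed.

Lemma cos_taylor (x psi v r : R) :
  `|cos ((v + r) * x + psi) - cos (v * x + psi) - r * (cos (v * x + (psi + pi / 2)) * x)|
    <= x ^+ 2 * r ^+ 2.
Proof.
have D0 (y : R) : is_derive y 1 (fun y : R => y * x + psi) x.
  have H := isdD (isdM (is_derive_id y 1) (isdC x y 1)) (isdC psi y 1).
  by apply: (is_derive_eq H); rewrite mulr0 !addr0 mul1r.
have D1 (y : R) : is_derive y 1 (fun y : R => cos (y * x + psi)) (cos (y * x + (psi + pi / 2)) * x).
  have H := isd_comp (F := cos) (h := fun y : R => y * x + psi) (is_derive_cos _) (D0 y).
  by apply: (is_derive_eq H); rewrite addrA cosDpihalf.
have D2 (y : R) : is_derive y 1 (fun y : R => cos (y * x + (psi + pi / 2)) * x)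
    (- (cos (y * x + psi) * x * x)).
  have H := isdM (isd_comp (F := sin) (h := fun y : R => y * x + psi) (is_derive_sin _) (D0 y)) (isdC (- x) y 1).
  rewrite (_ : (fun y : R => cos (y * x + (psi + pi / 2)) * x) = (fun y : R => sin (y * x + psi) * - x)).
    by apply: (is_derive_eq H); rewrite mulr0 addr0 mulrN.
  by apply/funext => z; rewrite addrA cosDpihalf mulrN mulNr.
apply: (quadratic_remainder v r D1 D2) => y; rewrite normrN -mulrA normrM -expr2.
rewrite [`|x ^+ 2|]ger0_norm ?sqr_ge0//; apply: ler_piMl; first exact: sqr_ge0.
by rewrite ler_norml cos_geN1 cos_le1.
Qed.

Lemma Tint_derive (psi t : R) nu h : (forall b, 0 <= nu b) -> adm nu h ->
  is_derive t 1 (fun t : R => Tint psi t h) (Tint (psi + pi / 2) t (fun u => F u * h u)).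
Proof.
move=> n0 ah.
have cF0 : gcl (fun=> 0) F by exact: gcl_mono cF.
have aF k : adm nu k -> adm nu (fun u => F u * k u).
  move=> ak; have [g s] := admissible_mul cF0 ak; split=> //.
  by apply: gcl_eqw g => b; rewrite add0r.
have aFF := aF _ (aF _ ah); have [[_ [C bC] _] _] := adm0 0 n0 aFF.
apply: (@is_derive_quadratic _ _ _ _ (C * expR (- c0) ^+ n)) => r.
have a1 := phase_adm (t + r) psi ah; have a2 := phase_adm t psi ah.
have a3 := phase_adm t (psi + pi / 2) (aF _ ah).
have a12 := admissible_lin 1 (-1) a1 a2.
have E : Tint psi (t + r) h - Tint psi t h - r * Tint (psi + pi / 2) t (fun u => F u * h u) =
  Int e (fun u => 1 * (1 * (phase (t + r) psi u * h u) + (-1) * (phase t psi u * h u)) +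
    (- r) * (phase t (psi + pi / 2) u * (F u * h u))).
  rewrite (Int_lin e 1 (- r) (adm0 1 n0 a12) (adm0 1 n0 a3)).
  rewrite (Int_lin e 1 (-1) (adm0 1 n0 a1) (adm0 1 n0 a2)).
  by rewrite !mul1r mulN1r mulNr.
rewrite E mulrAC; have a123 := admissible_lin 1 (- r) a12 a3.
apply: (Int_bound e (adm0 1 n0 a123)) => u.
have := cos_taylor (F u) psi t r; rewrite /phase.
have -> : 1 * (1 * (cos ((t + r) * F u + psi) * h u) + -1 * (cos (t * F u + psi) * h u)) +
   - r * (cos (t * F u + (psi + pi / 2)) * (F u * h u)) =
   (cos ((t + r) * F u + psi) - cos (t * F u + psi) - r * (cos (t * F u + (psi + pi / 2)) * F u)) * h u.
  by set x1 := cos _; set x2 := cos _; set x3 := cos _; ring.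
move=> H; rewrite normrM; apply: le_trans (ler_wpM2r (normr_ge0 _) H) _.
rewrite mulrAC; apply: ler_wpM2r; first exact: sqr_ge0.
apply: le_trans (bC u); rewrite mulrA -expr2 normrM.
by rewrite [`|F u ^+ 2|]ger0_norm// sqr_ge0.
Qed.

(** The leading part of F along [a] is homogeneous of degree l(a); the Euler operator removes it, so
    by [gcl_gen] the weights become l + 1_a. *)
Definition qgen a u := 'D_(intR R a) F u + (lz a)%:~R * F u.

(* The coefficients [1] and [0] give [step] the shape expected by [Tint_lin]. *)
Definition step a (x : R) h u :=
  (lw a)%:R^-1 * (1 * (1 * 'D_(intR R a) h u + x * h u) + 1 * Lop (fun y => qgen a y * h y) u)
  + 0 * h u.

Lemma qgen_adm a nu h : adm nu h -> adm (fun b => lz b + (b == a)%:Z + nu b) (fun y => qgen a y * h y).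
Proof. by move=> ah; apply: admissible_mul => //; exact: (gcl_gen ss). Qed.

Lemma step_adm a (nn : 'rV[int]_n -> nat) h : adm (fun b => (nn b)%:Z) h ->
  adm (fun b => (nn b)%:Z + (b == a)%:Z) (fun u => 1 * 'D_(intR R a) h u + (nn a)%:R * h u) /\
  adm (fun b => (nn b)%:Z + (b == a)%:Z) (Lop (fun y => qgen a y * h y)).
Proof.
move=> ah; split.
  have [g s] := ah; split; last by apply: supp_ge_lin => //; exact: supp_ge_derive.
  apply: gcl_ext (gcl_gen ss a g) => u _; by rewrite mul1r.
have := Lop_adm (qgen_adm a ah); apply: admissible_mono => b.
by rewrite le_eqVlt; apply/orP; left; apply/eqP; ring.
Qed.

(** Substitute l(a) F = [qgen] - D_a F in the derivative. The term with D_a F is integrated by parts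
    along [a], which yields <a>; the term with [qgen] is integrated along the gradient, which costs
    the weights l but keeps the unit gained at [a]. *)
Lemma Tint_ode (psi : R) a (nn : 'rV[int]_n -> nat) h (tau : R) : (0 < lw a)%N ->
  adm (fun b => (nn b)%:Z) h ->
  adm (fun b => (nn b + (b == a))%N%:Z) (step a (nn a)%:R h) /\
  is_derive tau 1 (fun tau : R => Tint psi (expR tau) h)
   (Tint psi (expR tau) (step a (nn a)%:R h) -
    ((sumz a)%:~R + (nn a)%:R) / (lw a)%:R * Tint psi (expR tau) h).
Proof.
move=> la ah; have [a1 a2] := step_adm a ah.
have aw : forall b, (nn b)%:Z <= (nn b)%:Z + (b == a)%:Z by move=> b; rewrite lerDl.
have a3 := admissible_lin 1 1 a1 a2.
split.
  have h0 := admissible_lin (lw a)%:R^-1 0 a3 a3.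
  have [g s] := h0; split; last first.
    by move=> u i ui; rewrite /step (a3.2 u i)// (ah.2 u i)// !mulr0 addr0.
  apply: (gcl_eqw (mu := fun b => (nn b)%:Z + (b == a)%:Z)); first by move=> b; rewrite PoszD.
  by apply: gcl_ext g => u _; rewrite /step !mul0r.
have n0 b : 0 <= (nn b)%:Z by [].
set t := expR tau; have lR : (lw a)%:R != 0 :> R by rewrite pnatr_eq0 -lt0n.
have D := isd_comp (F := fun t : R => Tint psi t h) (h := expR) (Tint_derive psi (expR tau) n0 ah) (is_derive_expR tau).
apply: (is_derive_eq D); rewrite -/t.
have ad k : adm (fun b => (nn b)%:Z + (b == a)%:Z) k -> adm (fun b => (nn b)%:Z) k.
  exact: admissible_mono.
have aF : adm (fun b => (nn b)%:Z) (fun u => F u * h u).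
  have cF0 : gcl (fun=> 0) F by exact: gcl_mono cF.
  have [g s] := admissible_mul cF0 ah; split=> //; by apply: gcl_eqw g => b; rewrite add0r.
have aq : adm (fun b => (nn b)%:Z) (fun y => qgen a y * h y).
  by apply: admissible_mono (qgen_adm a ah) => b; rewrite lerDr addr_ge0.
have aDh : adm (fun b => (nn b)%:Z) (fun u => 'D_(intR R a) h u) by exact: (admissible_dir ss).
have Es : Tint psi t (step a (nn a)%:R h) = (lw a)%:R^-1 *
   (Tint psi t (fun u => 'D_(intR R a) h u) + (nn a)%:R * Tint psi t h +
    t * Tint (psi + pi / 2) t (fun y => qgen a y * h y)).
  rewrite (Tint_lin psi t (lw a)%:R^-1 0 n0 (ad _ a3) ah) mul0r addr0; congr (_ * _).
  rewrite (Tint_lin psi t 1 1 n0 (ad _ a1) (ad _ a2)) !mul1r.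
  rewrite (Tint_lin psi t 1 (nn a)%:R n0 aDh ah) mul1r; congr (_ + _).
  apply/esym; apply: (Tint_Lop psi t _ (qgen_adm a ah)) => b.
  by rewrite -addrA lerDl addr_ge0.
have Eq : Tint (psi + pi / 2) t (fun u => 'D_(intR R a) F u * h u) =
   Tint (psi + pi / 2) t (fun y => qgen a y * h y) -
   (lw a)%:R * Tint (psi + pi / 2) t (fun u => F u * h u).
  have := Tint_lin (psi + pi / 2) t 1 (- (lw a)%:R) n0 aq aF; rewrite mul1r mulNr => <-.
  congr Int; apply/funext => u; rewrite /qgen; congr (_ * _).
  rewrite -[(lz a)%:~R]/((lw a)%:R : R).
  by set x1 := 'D_ _ _ _; set x2 := F u; set x3 := h u; ring.
have I2 := Tint_dir psi t a n0 ah; rewrite Eq in I2.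
rewrite Es mulrC.
set x1 := Tint _ _ (fun u => F u * _) in I2 *; set x2 := Tint _ _ (fun u => 'D_ _ h u) in I2 *.
set x3 := Tint _ _ (fun y => qgen a y * _) in I2 *; set x4 := Tint psi t h in I2 *.
have sw (y z : R) : (lw a)%:R * (y / (lw a)%:R * z) = y * z by field.
apply: (mulfI lR); rewrite mulrBr sw [X in X - _]mulrA mulfV// mul1r mulrDl I2; ring.
Qed.

Fixpoint exps (nn : 'rV[int]_n -> nat) (s : seq 'rV[int]_n) : seq R := match s with
  | [::] => [::]
  | a :: s' => ((sumz a)%:~R + (nn a)%:R) / (lw a)%:R :: exps (fun b => nn b + (b == a))%N s'
  end.

Lemma Tint_chain (psi : R) (s : seq 'rV[int]_n) nn h : (forall a, a \in s -> 0 < lw a)%N ->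
  adm (fun b => (nn b)%:Z) h ->
  exists2 h', adm (fun b => (nn b + count_mem b s)%N%:Z) h' &
    ode_chain (exps nn s) (fun tau => Tint psi (expR tau) h) (fun tau => Tint psi (expR tau) h').
Proof.
elim: s nn h => [|a s IH] nn h ls ah.
  by exists h => //; apply: admissible_mono ah => b; rewrite addn0.
have la := ls a (mem_head _ _).
have [a1 _] := Tint_ode psi 0 la ah.
have [h' ah' ch'] := IH _ _ (fun b bs => ls b (ltac:(by rewrite inE bs orbT))) a1.
exists h'; first by apply: admissible_mono ah' => b /=; rewrite [a == b]eq_sym addnA.
exists (fun tau => Tint psi (expR tau) (step a (nn a)%:R h)); split=> // tau _.
by have [_] := Tint_ode psi tau la ah.
Qed.

(** Each factor t^{-1} is paid for by one [Lop], which lowers the weights by l; the angle is shifted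
    back by pi / 2 beforehand to compensate for the shift it causes. *)
Lemma Tint_decay (psi : R) (M : nat) h : adm (fun b => (M * lw b)%N%:Z) h ->
  exists K, forall tau : R, 0 <= tau -> `|Tint psi (expR tau) h| <= K * expR (- (M%:R * tau)).
Proof.
elim: M psi h => [|M IH] psi h ah.
  have [K HK] := Tint_bound psi (fun _ => le0z_nat _) ah; exists K => tau _.
  by rewrite mul0r oppr0 expR0 mulr1.
have ln b : lz b <= (M.+1 * lw b)%N%:Z by rewrite lez_nat mulSn leq_addr.
have aL : adm (fun b => (M * lw b)%N%:Z) (Lop h).
  apply: admissible_mono (Lop_adm ah) => b; by rewrite mulSn PoszD addrAC subrr add0r.
have [K HK] := IH (psi - pi / 2) _ aL; exists K => tau t0.
have := Tint_Lop (psi - pi / 2) (expR tau) ln ah; rewrite subrK => E.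
have := HK tau t0; rewrite -E normrM [`|expR tau|]ger0_norm ?expR_ge0//.
rewrite -ler_pdivlMl ?expR_gt0// -expRN => /le_trans; apply.
by rewrite mulrCA -expRD -natr1 mulrDl mul1r opprD addrC.
Qed.

Lemma exps_cat nn s1 s2 : exps nn (s1 ++ s2) =
  exps nn s1 ++ exps (fun b => nn b + count_mem b s1)%N s2.
Proof.
elim: s1 nn => [|a s1 IH] nn /=.
  by congr exps; apply/funext => b; rewrite addn0.
rewrite IH; congr (_ :: _ ++ exps _ _); apply/funext => b.
by rewrite [a == b]eq_sym addnA.
Qed.

(** Every use of [a] raises its weight by one, so the exponents increase strictly and none is
    repeated. *)
Lemma exps_nseq nn a m : (0 < lw a)%N -> uniq (exps nn (nseq m a)) /\
  forall x, x \in exps nn (nseq m a) -> exists2 k, (nn a <= k)%N & x = ((sumz a)%:~R + k%:R) / (lw a)%:R.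
Proof.
move=> la; have lR : (lw a)%:R != 0 :> R by rewrite pnatr_eq0 -lt0n.
elim: m nn => [|m IH] nn //=; have [um Hm] := IH (fun b => nn b + (b == a))%N.
split.
  rewrite um andbT; apply/negP => /Hm[k]; rewrite eqxx addn1 => lt /(divIf lR)/addrI/eqP.
  by rewrite eqr_nat => /eqP nk; move: lt; rewrite nk ltnn.
move=> x; rewrite inE => /predU1P[->|/Hm[k nk ->]]; first by exists (nn a).
by exists k => //; apply: leq_trans nk; rewrite leq_addr.
Qed.

Lemma exps_count (M : nat) nn (s : seq 'rV[int]_n) x :
  (count_mem x (exps nn (flatten [seq nseq (M * lw a) a | a <- s])) <= size s)%N.
Proof.
elim: s nn => [//|a s IH] nn /=; rewrite exps_cat count_cat -[(size s).+1]add1n leq_add//.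
have [l0|la] := posnP (lw a); first by rewrite l0 muln0.
have [u _] := exps_nseq nn (M * lw a) la; by rewrite count_uniq_mem// leq_b1.
Qed.

Lemma exps_mem (M : nat) nn (s : seq 'rV[int]_n) x :
  x \in exps nn (flatten [seq nseq (M * lw a) a | a <- s]) ->
  exists a (k : nat), [/\ a \in s, (0 < lw a)%N & x = ((sumz a)%:~R + k%:R) / (lw a)%:R].
Proof.
elim: s nn => [//|a s IH] nn /=; rewrite exps_cat mem_cat => /orP[|/IH[b [k [bs lb ->]]]]; last first.
  by exists b, k; split=> //; rewrite inE bs orbT.
have [l0|la] := posnP (lw a); first by rewrite l0 muln0.
have [_ H] := exps_nseq nn (M * lw a) la; move=> /H[k _ ->].
by exists a, k; split=> //; rewrite mem_head.
Qed.

Definition expansion_exponents : set R :=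
  [set x | exists a (k : nat), [/\ skeleton1 Sig a, (0 < lw a)%N & x = ((sumz a)%:~R + k%:R) / (lw a)%:R]].

Definition expandable (Q : R -> R) := forall N : nat, exists E (p : R -> {poly R}),
  [/\ uniq E, forall x, x \in E -> expansion_exponents x, forall x, (size (p x) <= n)%N &
   exists K T0 : R, forall x : R, T0 <= x -> 0 <= x ->
     `|Q x - expsum E p x| <= K * expR (- (N%:R * x))].

(** Off S the weights are already as large as desired. Each generator of S is used M l(a) times,
    hence not at all if l(a) = 0, which lifts all weights to at least M l. *)
Lemma Tint_expandable psi S h : chart S ->
  (forall M : nat, adm (fun b => (if b \in S then 0 else M * lw b)%N%:Z) h) ->
  expandable (fun tau => Tint psi (expR tau) h).
Proof.
(* The extra order N + 1 is the strict margin consumed in solving the equations. *)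
move=> cS ah N; pose M := N.+1; pose sc := flatten [seq nseq (M * lw a) a | a <- S].
have lsc a : a \in sc -> (0 < lw a)%N.
  by move=> /flattenP[_ /mapP[b bS ->]]; rewrite mem_nseq => /andP[+ /eqP ->]; rewrite muln_gt0 => /andP[].
have [h' ah' ch'] := Tint_chain psi lsc (ah M).
have {}ah' : adm (fun b => (M * lw b)%N%:Z) h'.
  apply: admissible_mono ah' => b; rewrite lez_nat; case: ifP => bS; last exact: leq_addr.
  rewrite add0n /sc; elim: (S) bS => [//|a s IH]; rewrite inE /= count_cat => /predU1P[->|/IH].
    by rewrite count_nseq/= eqxx mul1n leq_addr.
  by move=> /leq_trans; apply; rewrite leq_addl.
pose E := undup (exps (fun b => if b \in S then 0 else M * lw b)%N sc).
have [p [sp bp]] : has_expansion E (fun x : R => count_mem x (exps (fun b => if b \in S then 0 else M * lw b)%N sc))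
    (fun tau => Tint psi (expR tau) h) N%:R.
  apply: (ode_chain_expansion (M := M%:R) (undup_uniq _) _ _ (Tint_decay psi ah') ch').
    by move=> x; rewrite mem_undup.
  by rewrite ltr_nat.
exists E, p; split=> //; first exact: undup_uniq.
  move=> x; rewrite mem_undup => /exps_mem[a [k [aS la ->]]]; exists a, k; split=> //.
  by have [j ->] := mem_gens cS aS; exact: (gens_skeleton1 ss).
move=> x; apply: leq_trans (sp x) _; apply: leq_trans (exps_count _ _ _ _) _.
by have /andP[_ /eqP ->] := cS.
Qed.

Lemma expandable_add Q1 Q2 : expandable Q1 -> expandable Q2 -> expandable (fun x => Q1 x + Q2 x).
Proof.
move=> e1 e2 N; have [E1 [p1 [u1 A1 s1 [K1 [T1 b1]]]]] := e1 N.
have [E2 [p2 [u2 A2 s2 [K2 [T2 b2]]]]] := e2 N.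
pose p x := (if x \in E1 then p1 x else 0) + (if x \in E2 then p2 x else 0).
exists (undup (E1 ++ E2)), p; split; first exact: undup_uniq.
- by move=> x; rewrite mem_undup mem_cat => /orP[/A1|/A2].
- move=> x; apply: leq_trans (size_polyD _ _) _; rewrite geq_max.
  by apply/andP; split; case: ifP => // _; rewrite size_poly0.
exists (K1 + K2), (Num.max T1 T2) => x; rewrite ge_max => /andP[x1 x2] x0.
have ext (E G : seq R) (q : R -> {poly R}) : uniq E -> uniq G -> {subset E <= G} ->
    \sum_(b <- G) (if b \in E then q b else 0).[x] * expR (- (b * x)) = expsum E q x.
  move=> uE uG EG; rewrite (bigID (mem E))/= [X in _ + X]big1 ?addr0; last first.
    by move=> b /negbTE ->; rewrite horner0 mul0r.
  rewrite -big_filter /expsum (perm_big E)/=; last first.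
    apply: uniq_perm => //; first exact: filter_uniq.
    by move=> b; rewrite mem_filter; case bE : (b \in E) => //=; rewrite (EG b bE).
  by apply: eq_big_seq => b ->.
have -> : expsum (undup (E1 ++ E2)) p x = expsum E1 p1 x + expsum E2 p2 x.
  rewrite -(ext E1 (undup (E1 ++ E2)))// ?undup_uniq//; last first.
    by move=> b bE; rewrite mem_undup mem_cat bE.
  rewrite -(ext E2 (undup (E1 ++ E2)))// ?undup_uniq//; last first.
    by move=> b bE; rewrite mem_undup mem_cat bE orbT.
  by rewrite -big_split; apply: eq_bigr => b _; rewrite /p hornerD mulrDl.
rewrite opprD addrACA mulrDl; apply: le_trans (ler_normD _ _) _.
by apply: lerD; [exact: b1|exact: b2].
Qed.

Lemma expandable_sum (I : eqType) (r : seq I) (Q : I -> R -> R) :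
  (forall i, i \in r -> expandable (Q i)) -> expandable (fun x => \sum_(i <- r) Q i x).
Proof.
elim: r => [|i r IH] H.
  move=> N; exists [::], (fun=> 0); split=> // [x|]; first by rewrite size_poly0.
  by exists 0, 0 => x _ _; rewrite /expsum !big_nil subr0 normr0 mul0r.
have h1 := H i (mem_head _ _).
have h2 : expandable (fun x => \sum_(i <- r) Q i x).
  by apply: IH => k kr; apply: H; rewrite inE kr orbT.
have := expandable_add h1 h2; rewrite (_ : (fun x => _) = (fun x => \sum_(k <- i :: r) Q k x))//.
by apply/funext => x; rewrite big_cons.
Qed.

End Oscillatory.

(** * The asymptotic expansion *)

Lemma common_bound (X : eqType) (s : seq X) (Q : X -> nat -> Prop) :
  (forall x m m', (m <= m')%N -> Q x m -> Q x m') ->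
  (forall x, x \in s -> exists m, Q x m) -> exists m, forall x, x \in s -> Q x m.
Proof.
move=> mono; elim: s => [|x s IH] H; first by exists 0%N.
have [m1 q1] := H x (mem_head _ _).
have [m2 q2] := IH (fun y ys => H y (ltac:(by rewrite inE ys orbT))).
exists (maxn m1 m2) => y; rewrite inE => /predU1P[->|ys].
  exact: mono (leq_maxl _ _) q1.
exact: mono (leq_maxr _ _) (q2 y ys).
Qed.

Section ComplexSum.
Local Open Scope complex_scope.
Variable R : realType.

Lemma complex_sum (I : Type) (s : seq I) (x y : I -> R) :
  \sum_(i <- s) (x i +i* y i) = (\sum_(i <- s) x i) +i* (\sum_(i <- s) y i).
Proof.
elim: s => [|i s IH]; first by rewrite !big_nil.
by rewrite !big_cons IH.
Qed.

Lemma normc_le (x y : R) : Normc.normc (x +i* y) <= `|x| + `|y|.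
Proof.
rewrite /Normc.normc -[leRHS]ger0_norm ?addr_ge0// -sqrtr_sqr ler_wsqrtr//.
rewrite sqrrD !real_normK ?num_real// -addrA lerD2l lerDr mulrn_wge0// mulr_ge0//.
Qed.

End ComplexSum.

Section Expansion.
Variables (R : realType) (n : nat) (Sig : seq (seq 'rV[int]_n)) (lw : 'rV[int]_n -> nat).
Local Notation expo := (expansion_exponents (R := R) Sig lw).
Local Open Scope complex_scope.

(** As <a> is nonnegative, an exponent at most [N] has k at most N l(a), so finitely many candidates
    remain. *)
Lemma exponents_list (N : nat) : (forall a, skeleton1 Sig a -> (0 <= sumz a)) ->
  exists2 L : seq R, uniq L & forall x, x \in L <-> expo x /\ x <= N%:R.
Proof.
move=> s0; exists (undup [seq x <- flatten [seq [seq ((sumz a)%:~R + k%:R) / (lw a)%:R | k <- iota 0 (N * lw a).+1]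
   | a <- [seq head 0 T | T <- Sig]] | `[< expo x /\ x <= N%:R >]]); first exact: undup_uniq.
move=> x; rewrite mem_undup mem_filter; split=> [/andP[/asboolP//]|[ex xN]].
apply/andP; split; first exact/asboolP.
have [a [k [sa la xE]]] := ex; apply/flattenP.
exists [seq ((sumz a)%:~R + k%:R) / (lw a)%:R | k <- iota 0 (N * lw a).+1].
  by apply/mapP; exists a => //; apply/mapP; exists [:: a].
rewrite xE; apply: (map_f (fun k : nat => ((sumz a)%:~R + k%:R) / (lw a)%:R)).
rewrite mem_iota/= add0n ltnS.
suff : (k%:R : R) <= (N * lw a)%N%:R by rewrite ler_nat.
rewrite natrM.
have lp : 0 < (lw a)%:R :> R by rewrite ltr0n.
move: xN; rewrite xE ler_pdivrMr//; apply: le_trans.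
by rewrite lerDr ler0z s0.
Qed.

Lemma expandable_asymp (I : R -> R[i]) : (forall a, skeleton1 Sig a -> (0 <= sumz a)) ->
  expandable Sig lw (fun tau : R => complex.Re (I (expR tau))) ->
  expandable Sig lw (fun tau : R => complex.Im (I (expR tau))) ->
  exists C : R -> nat -> R[i], asymp_expansion n I [set al | expo (- al)] C.
Proof.
move=> s0 eR eI.
have [pR [sR HR]] := consistent_expansion eR; have [pI [sI HI]] := consistent_expansion eI.
exists (fun al k => (pR (- al))`_k.-1 +i* (pI (- al))`_k.-1) => N.
have [L uL LP] := exponents_list N s0.
have [KR [TR bR]] := HR N L uL LP; have [KI [TI bI]] := HI N L uL LP.
(* The 0 in the maximum guarantees log t >= 0, as the bounds in tau require. *)
exists (KR + KI), (expR (Num.max 0 (Num.max TR TI))) => t Tt.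
have t0 : 0 < t by apply: lt_le_trans Tt; exact: expR_gt0.
pose tau := ln t; have tE : expR tau = t by rewrite lnK// posrE.
have : Num.max 0 (Num.max TR TI) <= tau by rewrite -ler_expR tE.
rewrite !ge_max => /and3P[tau0 tR tI].
have pw (al : R) : t `^ al = expR (al * tau) by rewrite /powR gt_eqF.
have termE (q : {poly R}) (x : R) : (size q <= n)%N ->
    \sum_(1 <= k < n.+1) q`_k.-1 * (t `^ (- x) * ln t ^+ k.-1) = q.[tau] * expR (- (x * tau)).
  move=> sq; rewrite (horner_coef_wide _ sq) mulr_suml big_add1 big_mkord.
  by apply: eq_bigr => k _; rewrite pw mulNr -mulrA [_ * expR _]mulrC.
set sm := \sum_(al \in _) _.
have smE : sm = expsum L pR tau +i* expsum L pI tau.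
  have -> : sm = \sum_(al <- [seq - x | x <- L]) \sum_(1 <= k < n.+1)
      ((pR (- al))`_k.-1 +i* (pI (- al))`_k.-1) * (t `^ al * ln t ^+ k.-1)%:C.
    rewrite /sm [RHS]fsbig_seq; last by rewrite map_inj_uniq//; exact: oppr_inj.
    apply: eq_fsbigl; apply/seteqP; split=> al /=.
      move=> [ea Na]; apply/mapP; exists (- al); rewrite ?opprK//.
      by apply/LP; split=> //; rewrite lerNl.
    by move=> /mapP[x /LP[ex xN] ->]; rewrite opprK lerN2.
  rewrite big_map -complex_sum; apply: eq_bigr => x _; rewrite opprK -!termE// -complex_sum.
  apply: eq_bigr => k _; set q := _ * _ ^+ _.
  by apply/eqP; rewrite eq_complex/= !mulr0 subr0 ?addr0 ?add0r !eqxx.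
rewrite smE; have -> : I t - (expsum L pR tau +i* expsum L pI tau) =
    (complex.Re (I t) - expsum L pR tau) +i* (complex.Im (I t) - expsum L pI tau).
  by case: (I t).
apply: le_trans (normc_le _ _) _; rewrite pw mulNr mulrDl -tE; apply: lerD.
  exact: bR.
exact: bI.
Qed.

End Expansion.

(** In dimension 0 the only Taylor coefficient is the value at 0. *)
Lemma newton_dim_gt0 (R : realType) (n : nat) (f : 'rV[R]_n -> R) :
  f 0 = 0 -> newton f !=set0 -> (0 < n)%N.
Proof.
case: n f => // f f0 g0.
have a0 : @orthant R 0 0 by case.
have [al] := newton_min a0 g0; rewrite /taylor_coef /dmulti.
have -> : enum 'I_0 = [::] by apply: size0nil; rewrite -cardE card_ord.
by rewrite /= f0 mul0r eqxx.
Qed.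

Lemma open_cube (R : realType) (n : nat) (U : set 'rV[R]_n) : open U -> U 0 ->
  exists c : R, 0 <= c /\ cube (expR (- c)) `<=` U.
Proof.
move=> oU U0; have /nbhs_ballP[d /= d0 H] : nbhs (0 : 'rV[R]_n) U by exact: open_nbhs_nbhs.
exists (Num.max 0 (- ln (d / 2))); split; first by rewrite le_max lexx.
move=> x cx; apply: H; rewrite -ball_normE /ball_/= sub0r normrN.
have d2 : 0 < d / 2 by rewrite divr_gt0.
apply: (@le_lt_trans _ _ (d / 2)); last by rewrite ltr_pdivrMr// ltr_pMr// ltr1n.
apply: norm_row_le; first exact: ltW.
move=> i; apply: le_trans (cx i) _; rewrite -[leRHS]lnK ?posrE// ler_expR lerNl.
by rewrite le_max lexx orbT.
Qed.

Lemma open_cube_nbhs (R : realType) (n : nat) (r : R) : 0 < r ->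
  nbhs (0 : 'rV[R]_n) [set x : 'rV[R]_n | forall i, `|x ord0 i| < r].
Proof.
move=> r0; have h i : nbhs (0 : 'rV[R]_n) [set x : 'rV[R]_n | `|x ord0 i| < r].
  have c : {for (0 : 'rV[R]_n), continuous (fun x : 'rV[R]_n => `|x ord0 i|)}.
    apply: (@continuous_comp _ _ _ (fun x : 'rV[R]_n => x ord0 i) Num.norm).
      exact: coord_continuous.
    exact: norm_continuous.
  apply: (c [set z | z < r]); apply: open_nbhs_nbhs; split; first exact: open_lt.
  by rewrite /= mxE normr0.
exact: filter_forall h.
Qed.

(** * Application to the phase f *)

Section Main.
Variables (R : realType) (n : nat) (U : set 'rV[R]_n) (f : 'rV[R]_n -> R).
Hypothesis (oU : open U) (U0 : U 0) (sf : smooth_on U f) (f0 : f 0 = 0).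
Hypothesis (g0 : newton f !=set0) (hf : hatE U f) (nd : nondeg_over_R U f).
Variable Sig : seq (seq 'rV[int]_n).
Hypothesis ss : simplicial_subdivision (newton f) Sig.

(** A total function on integer vectors, with natural values; on the generators, whose entries are
    nonnegative, it is l(a). *)
Definition lmult (a : 'rV[int]_n) : nat :=
  projT1 (cid (mindeg_ex (fun i => `|a ord0 i|%N) g0)).

Lemma lmult_mindeg (a : 'rV[int]_n) : mindeg f (fun i => `|a ord0 i|%N) (lmult a).
Proof. exact: projT2 (cid (mindeg_ex (fun i => `|a ord0 i|%N) g0)). Qed.

Let ml (S : seq 'rV[int]_n) (j : 'I_n) : mindeg f (gens S j) (lmult (nth 0 S j)). Proof. exact: lmult_mindeg. Qed.

Lemma chart_minimizer S : chart Sig S -> exists2 al, taylor_coef f al != 0 &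
  forall j : 'I_n, degv (gens S j) al = lmult (nth 0 S j).
Proof.
move=> cS; have /andP[SS /eqP sz] := cS; have [_ _ /(_ S SS)[gam [_ H]] _] := ss.
have [al Tal amin] := cone_minimizer g0 H; exists al => // j.
have [[al' Tal' E] lb] := ml S j; apply/eqP; rewrite eqn_leq lb// andbT -E.
have jS : (j < size S)%N by rewrite sz.
have := amin (intR R (nth 0 S j)) (gcone_gen R jS) al' Tal'.
by rewrite -(chart_cd ss)// -[cd R _ j]/(arow R (gens S j)) !dotp_degv ler_nat.
Qed.

(** The derivative along a generator is at most the sum of its entries times the Euclidean norm of
    the gradient; this converts the bound of [chart_lower_bound] into one for [gradsq]. *)
Lemma gradsq_lower (c : R) S e : chart Sig S -> cube (expR (- c)) `<=` U ->
  exists m : nat, exists2 d : R, 0 < d & forall u, creg (gens S) c u -> (forall i, m%:R < u ord0 i) ->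
    d * wt (@cs R n (gens S)) (fun j : 'I_n => (lmult (nth 0 S j))%:Z) u ^+ 2 <= gradsq (tilde e f) u.
Proof.
move=> cS cU; have uB := chart_unit ss cS.
have cF := tilde_flat_class uB oU cU sf (ml S) e hf.
have [al Tal dal] := chart_minimizer cS.
have [m [d [d0 H]]] := chart_lower_bound uB oU cU sf (ml S) Tal dal cF (newton_dim_gt0 f0 g0) nd.
pose K : R := \sum_k (\sum_i (gens S k i)%:R) ^+ 2 + 1.
have K0 : 0 < K by rewrite ltr_wpDl//; apply: sumr_ge0 => k _; exact: sqr_ge0.
exists m, (d / K); first by rewrite divr_gt0.
move=> u cu um; rewrite mulrAC ler_pdivrMr//; apply: le_trans (H u cu um) _.
set th := gradsq _ _; have th0 : 0 <= th by apply: sumr_ge0 => i _; rewrite -expr2 sqr_ge0.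
rewrite /K mulrDr mulr1; apply: ler_wpDr => //; rewrite mulr_sumr; apply: ler_sum => k _.
have df : differentiable (tilde e f) u by apply: (cl_diff (cF 1%N)); case: cu.
have -> : 'D_(cd R (gens S) k) (tilde e f) u = \sum_i (gens S k i)%:R * 'D_(evec R i) (tilde e f) u.
  rewrite (eq_bigr (fun i => cd R (gens S) k ord0 i * 'D_(evec R i) (tilde e f) u)).
    by rewrite -(derive_comb _ _ df) -row_sum_evec.
  by move=> i _; rewrite mxE.
have bi i : `|'D_(evec R i) (tilde e f) u| <= Num.sqrt th.
  rewrite -sqrtr_sqr ler_wsqrtr// expr2 /th /gradsq (bigD1_seq i) ?mem_index_enum ?index_enum_uniq//=.
  by rewrite lerDl; apply: sumr_ge0 => j _; rewrite -expr2 sqr_ge0.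
rewrite -real_normK ?num_real// -[X in _ <= X * _](sqr_sqrtr th0) -exprMn.
apply: lerXn2r; rewrite ?nnegrE ?mulr_ge0 ?sqrtr_ge0 ?sumr_ge0//.
apply: le_trans (ler_norm_sum _ _ _) _; rewrite mulr_sumr; apply: ler_sum => i _.
by rewrite normrM ger0_norm// mulrC; apply: ler_wpM2r.
Qed.

(** There are finitely many sign patterns and charts, so one threshold serves them all; absorbing it
    into c1 makes the bounds valid on whole chart regions. *)
Lemma uniform_lower : exists c1 : R, [/\ 0 <= c1, cube (expR (- c1)) `<=` U &
  forall e S, e \in allsigns n -> chart Sig S -> exists d : R, 0 < d /\
    forall u, creg (gens S) c1 u ->
    d * wt (@cs R n (gens S)) (fun j : 'I_n => (lmult (nth 0 S j))%:Z) u ^+ 2 <= gradsq (tilde e f) u].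
Proof.
have [c [c0 cU]] := open_cube oU U0.
pose Q (eS : seq bool * seq 'rV[int]_n) (m : nat) := exists2 d : R, 0 < d &
  forall u, creg (gens eS.2) c u -> (forall i, m%:R < u ord0 i) ->
    d * wt (@cs R n (gens eS.2)) (fun j : 'I_n => (lmult (nth 0 eS.2 j))%:Z) u ^+ 2 <=
    gradsq (tilde eS.1 f) u.
have [|eS|m Hm] := @common_bound _ [seq (e, T) | e <- allsigns n, T <- charts Sig] Q.
- move=> eS m m' mm [d d0 H]; exists d => // u cu um; apply: H => // i.
  by apply: le_lt_trans (um i); rewrite ler_nat.
- case/allpairsP => -[e S] /= [_ SC ->].
  by apply: gradsq_lower => //; rewrite -mem_charts.
exists (Num.max c m%:R); split; first by rewrite le_max c0.
  move=> x cx; apply: cU => i; apply: le_trans (cx i) _.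
  by rewrite ler_expR lerN2 le_max lexx.
move=> e S eS cS; have [|d d0 H] := Hm (e, S).
  by apply/allpairsP; exists (e, S); split=> //; rewrite mem_charts.
exists d; split=> // u [Ou su]; apply: H.
  by split=> // i; apply: le_lt_trans (Ou i); rewrite le_max lexx.
by move=> i; apply: le_lt_trans (Ou i); rewrite le_max lexx orbT.
Qed.

Lemma skeleton1_nonneg (a : 'rV[int]_n) i : skeleton1 Sig a -> a ord0 i = `|a ord0 i|%N.
Proof. by move=> sa; exact: (gens_nonneg ss (S := [:: a]) (k := 0) i sa). Qed.

Lemma exponents_sub :
  [set al : R | expansion_exponents Sig lmult (- al)] `<=` exponent_set (newton f) Sig.
Proof.
move=> al [a [k [sa la E]]]; left; exists k, a.
have aE : intR R a = arow R (fun i => `|a ord0 i|%N).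
  by apply/rowP => i; rewrite !mxE [in LHS](skeleton1_nonneg i sa).
rewrite aE (mindeg_lmin (lmult_mindeg a)); split=> //; first by rewrite ltr0n.
by rewrite -E opprK.
Qed.

Variable c1 : R.
Hypothesis (c10 : 0 <= c1) (cU : cube (expR (- c1)) `<=` U).
Hypothesis lbd : forall e S, e \in allsigns n -> chart Sig S -> exists d : R, 0 < d /\
    forall u, creg (gens S) c1 u ->
    d * wt (@cs R n (gens S)) (fun j : 'I_n => (lmult (nth 0 S j))%:Z) u ^+ 2 <= gradsq (tilde e f) u.
Local Notation c0 := (c1 + 1).
Let c01 : c1 < c0. Proof. by rewrite ltrDl. Qed.
Local Notation adm := (admissible (R := R) Sig c1 c0).

Lemma tilde_gcl e : gcl Sig c1 (fun b => (lmult b)%:Z) (tilde e f).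
Proof. by move=> S cS; exact: (tilde_flat_class (chart_unit ss cS) oU cU sf (ml S) e hf). Qed.

Definition smallcube := [set x : 'rV[R]_n | forall i, `|x ord0 i| < expR (- c0)].

Variable g : 'rV[R]_n -> R.
Hypothesis (sg : smooth_on setT g) (gV : forall x, ~ smallcube x -> g x = 0).

Lemma tilde_supp e : supp_ge c0 (tilde e g).
Proof.
move=> u i ui; apply: gV => /(_ i); rewrite norm_ex ltr_expR ltrN2 => h.
by have := lt_trans ui h; rewrite ltxx.
Qed.

Lemma tilde_adm e : adm (fun=> 0) (tilde e g).
Proof.
split; last exact: tilde_supp.
by move=> S cS N; exact: (tilde_class (chart_unit ss cS) e N openT (fun _ _ => I) sg).
Qed.

Lemma piece_adm e S (nu : 'rV[int]_n -> int) : chart Sig S -> (forall b, b \in S -> nu b = 0) ->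
  (forall b, 0 <= nu b) -> adm nu (fun u => zeta Sig S u * tilde e g u).
Proof.
move=> cS nS n0; apply: (admissible_mono (mu := fun b => nu b + 0)); first by move=> b; rewrite addr0.
apply: admissible_mul; last exact: tilde_adm.
by move=> T cT N; apply: (zeta_class ss c10) => // k; exact: nS.
Qed.

(** On the box containing the support the functions [zeta] add up to 1, so the amplitude splits into
    pieces, each with free weights off one chart. *)
Lemma Tint_tilde_expandable psi e : e \in allsigns n ->
  expandable Sig lmult (fun tau => Tint (tilde e f) e psi (expR tau) (tilde e g)).
Proof.
move=> eA; have cF := @tilde_gcl e; have lb S := @lbd e S eA.
have pc S : chart Sig S -> adm (fun=> 0) (fun u => zeta Sig S u * tilde e g u).
  by move=> cS; exact: piece_adm.
have E t : Tint (tilde e f) e psi t (tilde e g) =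
    \sum_(S <- charts Sig) Tint (tilde e f) e psi t (fun u => zeta Sig S u * tilde e g u).
  rewrite /Tint -(Int_sum ss c10 c01) => [|S]; last first.
    by rewrite mem_charts => cS; apply: (phase_adm cF); exact: pc.
  congr Int; apply/funext => u; rewrite -mulr_sumr; congr (_ * _).
  have [Ou|[i ui]] := supp_or_upbox c01 u (@tilde_supp e).
    by rewrite -mulr_suml (zeta_sum ss c10 Ou) mul1r.
  by rewrite (@tilde_supp e u i ui) big1// => S _; rewrite mulr0.
have -> : (fun tau => Tint (tilde e f) e psi (expR tau) (tilde e g)) = (fun tau =>
    \sum_(S <- charts Sig) Tint (tilde e f) e psi (expR tau) (fun u => zeta Sig S u * tilde e g u)).
  by apply/funext => tau; exact: E.
apply: expandable_sum => S; rewrite mem_charts => cS.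
apply: (Tint_expandable ss c10 c01 e cF lb psi cS) => M.
by apply: piece_adm => // b ->.
Qed.

Lemma Tint_adm e psi t : e \in allsigns n ->
  int_adm 1 c0 (fun u => phase (tilde e f) t psi u * tilde e g u).
Proof.
move=> eA; apply: (admissible_int ss c10 c01 1 (nu := fun=> 0)) => //.
by apply: (phase_adm (@tilde_gcl e)); exact: tilde_adm.
Qed.

End Main.

Lemma intn_phases (R : realType) (n : nat) (f g k F : 'rV[R]_n -> R) (t p q c0 : R) :
  (forall e, e \in allsigns n -> int_adm 1 c0 (fun u => phase (tilde e f) t p u * tilde e g u)) ->
  (forall e, e \in allsigns n -> int_adm 1 c0 (fun u => phase (tilde e f) t q u * tilde e k u)) ->
  (forall x, F x = cos (t * f x + p) * g x + cos (t * f x + q) * k x) ->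
  intn F = \sum_(e <- allsigns n)
    (Tint (tilde e f) e p t (tilde e g) + Tint (tilde e f) e q t (tilde e k)).
Proof.
move=> ag ak FE.
have H := @intn_signs R n F (fun e u => 1 * (phase (tilde e f) t p u * tilde e g u) +
  1 * (phase (tilde e f) t q u * tilde e k u)) c0.
rewrite H; first last.
- by move=> x x0; rewrite /phase /tilde ex_lnabs// !mul1r.
- move=> e eA; have [b1 s1] := ag e eA; have [b2 s2] := ak e eA.
  by split; [exact: bc_lin|exact: supp_ge_lin].
apply: eq_big_seq => e eA; rewrite /Tint.
by rewrite (Int_lin e 1 1 (ag e eA) (ak e eA)) !mul1r.
Qed.

Theorem theorem3p3 (R : realType) (n : nat) (U : set 'rV[R]_n)
    (f : 'rV[R]_n -> R) :
  open U -> U 0 -> smooth_on U f ->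
  f 0 = 0 -> (forall j : 'I_n, pd j f 0 = 0) ->
  newton f !=set0 -> hatE U f -> nondeg_over_R U f ->
  forall Sig : seq (seq 'rV[int]_n),
  simplicial_subdivision (newton f) Sig ->
  exists V : set 'rV[R]_n,
    [/\ nbhs (0 : 'rV[R]_n) V, V `<=` U &
     exists A : set R, A `<=` exponent_set (newton f) Sig /\
     forall phi : 'rV[R]_n -> R[i],
       smooth_on setT (fun x => complex.Re (phi x)) ->
       smooth_on setT (fun x => complex.Im (phi x)) ->
       csupport phi `<=` V ->
       exists C : R -> nat -> R[i],
         asymp_expansion n (osc_int f phi) A C]
  /\ newton (principal_part f) = newton f.
Proof.
move=> oU U0 sf f0 _ g0 hf nd Sig ss.
have [c1 [c10 cU lbd]] := uniform_lower oU U0 sf f0 g0 hf nd ss.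
(* In logarithmic coordinates this cube is u_i > c1 + 1, which leaves the margin 1 inside the box
   u_i > c1. *)
exists (@smallcube R n c1); split; last exact: newton_principal.
split.
- by apply: open_cube_nbhs; exact: expR_gt0.
- move=> x Vx; apply: cU => i; apply: le_trans (ltW (Vx i)) _.
  by rewrite ler_expR lerN2 lerDl.
exists [set al | expansion_exponents Sig (lmult g0) (- al)]; split; first exact: exponents_sub.
move=> phi sR sI sV.
have out x : ~ @smallcube R n c1 x -> phi x = 0.
  move=> nV; apply/eqP/negPn/negP => px; apply: nV; apply: sV.
  by apply: subset_closure.
have oR x : ~ @smallcube R n c1 x -> complex.Re (phi x) = 0 by move=> /out ->.
have oI x : ~ @smallcube R n c1 x -> complex.Im (phi x) = 0 by move=> /out ->.
have eR psi e : e \in allsigns n -> _ :=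
  Tint_tilde_expandable oU sf hf ss c10 cU lbd sR oR psi (e := e).
have eI psi e : e \in allsigns n -> _ :=
  Tint_tilde_expandable oU sf hf ss c10 cU lbd sI oI psi (e := e).
have aR e psi t : e \in allsigns n -> int_adm 1 (c1 + 1)
    (fun u => phase (tilde e f) t psi u * tilde e (fun x => complex.Re (phi x)) u).
  by move=> eA; exact: (Tint_adm oU sf g0 hf ss c10 cU sR oR psi t eA).
have aI e psi t : e \in allsigns n -> int_adm 1 (c1 + 1)
    (fun u => phase (tilde e f) t psi u * tilde e (fun x => complex.Im (phi x)) u).
  by move=> eA; exact: (Tint_adm oU sf g0 hf ss c10 cU sI oI psi t eA).
apply: expandable_asymp.
- move=> a sa; apply: sumr_ge0 => i _; by rewrite (skeleton1_nonneg ss i sa).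
(* The real part uses - sin = cos shifted by pi / 2, so that both terms are phases. *)
- have -> : (fun tau => complex.Re (osc_int f phi (expR tau))) = (fun tau => \sum_(e <- allsigns n)
     (Tint (tilde e f) e 0 (expR tau) (tilde e (fun x => complex.Re (phi x))) +
      Tint (tilde e f) e (pi / 2) (expR tau) (tilde e (fun x => complex.Im (phi x))))).
    apply/funext => tau; apply: (intn_phases (c0 := c1 + 1)) => [e eA|e eA|x]; [exact: aR|exact: aI|].
    by rewrite addr0 cosDpihalf mulNr.
  by apply: expandable_sum => e eA; apply: expandable_add; [exact: eR|exact: eI].
(* Likewise sin is the phase of angle - pi / 2. *)
have -> : (fun tau => complex.Im (osc_int f phi (expR tau))) = (fun tau => \sum_(e <- allsigns n)
     (Tint (tilde e f) e (- (pi / 2)) (expR tau) (tilde e (fun x => complex.Re (phi x))) +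
      Tint (tilde e f) e 0 (expR tau) (tilde e (fun x => complex.Im (phi x))))).
  apply/funext => tau; apply: (intn_phases (c0 := c1 + 1)) => [e eA|e eA|x]; [exact: aR|exact: aI|].
  by rewrite addr0 cosB cos_pihalf sin_pihalf mulr0 add0r mulr1.
by apply: expandable_sum => e eA; apply: expandable_add; [exact: eR|exact: eI].
Qed.
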